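(* Assume the following. (i) For each $p\in\mathbf P$ there are a random function $f_p:\{-1,1\}\to\mathbb R$, i.i.d. copies $f_{p,1},\dots,f_{p,p}$ of $f_p$, and random variables $a_p,b_p$ independent of $f_{p,1},\dots,f_{p,p}$, such that for all $\sigma_1,\dots,\sigma_p\in\{-1,1\}$ $$\exp\theta_p(\sigma_1,\dots,\sigma_p)=a_p\bigl(1+b_pf_{p,1}(\sigma_1)\cdots f_{p,p}(\sigma_p)\bigr),\qquad |b_pf_{p,1}(\sigma_1)\cdots f_{p,p}(\sigma_p)|<1\ \text{a.s.},$$ and $\mathbb E[(-b_p)^n]\ge 0$ for all $n\ge1$. (ii) There is a constant $\kappa>0$ such that $|\theta_p|\le\kappa$ for all $p\in\mathbf P$ and $|h|\le\kappa$, almost surely. (iii) For every $p\in\mathbf P$, $p$ is even or $f_p\ge0$ a.s. (iv) For every $N$, $d^N=(d_i^N)_{1\le i\le N}\in\mathbb N^N$ and $E^N=(E^N_p)_{p\in\mathbf P}\in\mathbb N^{\mathbf P}$ satisfy $\sum_{i=1}^Nd_i^N=\sum_{p\in\mathbf P}pE_p^N$. With $\mu_N(k)=\frac1N\sum_{i=1}^N\mathbf 1(d_i^N=k)$ and $\nu_N(p)=E_p^N/\sum_{q\in\mathbf P}E_q^N$, there are probability measures $\mu$ on $\mathbb N$ and $\nu$ on $\mathbf P$ with $$\lim_{N\to\infty}\sum_{k\in\mathbb N}k|\mu_N(k)-\mu(k)|=0,\qquad \lim_{N\to\infty}\sum_{p\in\mathbf P}p|\nu_N(p)-\nu(p)|=0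 .$$ (v) $\sup_{N\ge1}\frac1N\sum_{i=1}^N(d_i^N)^2<\infty$, $\sum_{n}n^2\mu(n)<\infty$ and $\sum_{n}n\nu(n)<\infty$. Then for any $m\in(0,1)$ and any $\zeta^{(2)}\in\mathcal L_2$ (a probability measure on the set of probability measures on $\mathbb R$), $$F_N\le\frac1m\mathbb E\left[\log\mathbb E'\left[\left(\sum_{\sigma=\pm1}\exp\Bigl(\sum_{i=1}^dU_{p_i,i}(\sigma;\zeta^{(2)})+h(\sigma)\Bigr)\right)^m\right]\right]-\frac{\mathbb E[d]}{m}\mathbb E\left[\frac{p_1-1}{p_1}\log\mathbb E'\bigl(\langle\mathcal E_{p_1}\rangle_x\bigr)^m\right]+o_N(1),$$ where $o_N(1)\to 0$ as $N\to\infty$, $\mathbb E'$ is the expectation with respect to the real variables $(x_\ell)$ and $(x^p_{i,\ell})$ for fixed $(\zeta^{(1)}_\ell)$ and $(\zeta^{p,(1)}_{i,\ell})$ (and all other randomness fixed), and $\mathbb E$ is the expectation with respect to $(\zeta^{(1)}_\ell)$, $(\zeta^{p,(1)}_{i,\ell})$, $d$ with law $\mu$, the i.i.d. sequence $(p_i)_{i\ge1}$ with law $\rho(p)=p\nu(p)/\sum_{q\in\mathbf P}q\nu(q)$, and the random functions $h$, $(\theta_{p,i})$ (and $\theta_p$ in $\mathcal E_p$).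
   Context: $\mathbf P$ is a set of integers $\ge2$. $(\theta_p)_{p\in\mathbf P}$ are independent random functions $\theta_p:\{-1,1\}^p\to\mathbb R$, and $h:\{-1,1\}\to\mathbb R$ is a random function. Graph. Given degrees $(d_i)_{1\le i\le N}$ and numbers $(E_p)_{p\in\mathbf P}$ with $\sum_id_i=\sum_ppE_p$, $\mathbb G(d,E)$ is the random multi-hypergraph on vertex set $\mathbf V=\{1,\dots,N\}$ given by the configuration model: vertex $i$ carries $d_i$ half-edges, there are $E_p$ $p$-edges each carrying $p$ ordered half-edges, and a uniformly random perfect matching between vertex half-edges and edge half-edges is chosen. A $p$-edge $e$ thus contains $p$ (not necessarily distinct) vertices $\partial e=(e(1),\dots,e(p))$, and vertex $i$ has degree $d_i$. $\mathbf E_p$ is the set of $p$-edges. Put $G^N=\mathbb G(d^N,E^N)$. Hamiltonian. For $\sigma\in\Sigma_N=\{-1,1\}^{\mathbf V}$, $$-H_{G}(\sigma)=\sum_{p\in\mathbf P}\sum_{e\in\mathbf E_p}\theta_{p,e}(\sigma_{\partial e})+\sum_{i\in\mathbf V}h_i(\sigma_i),\qquad \sigma_{\partial e}=(\sigma_{e(1)},\dots,\sigma_{e(p)}),$$ where the $\theta_{p,e}$ are i.i.d. copies of $\theta_p$ (independent for different $p$), and $(h_i)$ are i.i.d. copies of $h$; all independent of each other and of the graph. The free energy is $F_N=\frac1N\mathbb E\log\sum_{\sigma\in\Sigma_N}\exp(-H_{G^N}(\sigma))$, the expectation being over the graph and the Hamiltonian. Cavity functions. Let $\mathcal E_p(\epsilon_1,\dots,\epsilon_p)=\exp\theta_p(\epsilon_1,\dots,\epsilon_p)$.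 For $f:\{-1,1\}^p\to\mathbb R$, a real vector $x$ and $\sigma\in\{\pm1\}$, $$\langle f\rangle_x^-(\sigma)=\frac{\sum_{\epsilon_1,\dots,\epsilon_{p-1}=\pm1}f(\epsilon_1,\dots,\epsilon_{p-1},\sigma)\exp\sum_{\ell=1}^{p-1}x_\ell\epsilon_\ell}{\sum_{\epsilon_1,\dots,\epsilon_{p-1}=\pm1}\exp\sum_{\ell=1}^{p-1}x_\ell\epsilon_\ell},\qquad \langle f\rangle_x=\frac{\sum_{\epsilon_1,\dots,\epsilon_p=\pm1}f(\epsilon_1,\dots,\epsilon_p)\exp\sum_{\ell=1}^px_\ell\epsilon_\ell}{\sum_{\epsilon_1,\dots,\epsilon_p=\pm1}\exp\sum_{\ell=1}^px_\ell\epsilon_\ell}.$$ Let $U_p(\theta_p,x_1,\dots,x_{p-1},\sigma)=\log\langle\mathcal E_p\rangle_x^-(\sigma)$. Two-level randomness. $\mathcal L_1$ is the set of probability measures on $\mathbb R$ and $\mathcal L_2$ the set of probability measures on $\mathcal L_1$. Given $\zeta^{(2)}\in\mathcal L_2$, consider a pair $(\zeta^{(1)},x)$ where $\zeta^{(1)}\in\mathcal L_1$ is random with law $\zeta^{(2)}$ and, conditionally on $\zeta^{(1)}$, $x$ is a real random variable with law $\zeta^{(1)}$. Let $(\zeta^{p,(1)}_{i,\ell},x^p_{i,\ell})$ ($p,i,\ell$) and $(\zeta^{(1)}_\ell,x_\ell)_{\ell}$ be i.i.d. copies of $(\zeta^{(1)},x)$, let $(\theta_{p,i})_{i\ge1}$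 be i.i.d. copies of $\theta_p$, and set $$U_{p,i}(\sigma;\zeta^{(2)})=U_p(\theta_{p,i},x^p_{i,1},\dots,x^p_{i,p-1},\sigma).$$ In $\langle\mathcal E_{p_1}\rangle_x$, $x=(x_1,x_2,\dots)$. The families $d$, $(p_i)$, $h$, $(\theta_{p,i})$ and the pairs $(\zeta^{(1)},x)$ are independent. *)

(* Defs.v *)
From HB Require Import structures.
From mathcomp Require Import all_boot all_order all_algebra.
From mathcomp Require Import all_classical all_reals all_analysis.

Set Implicit Arguments.
Unset Strict Implicit.
Unset Printing Implicit Defensive.

Import Order.TTheory GRing.Theory Num.Theory.
Import numFieldNormedType.Exports.

Local Open Scope classical_set_scope.
Local Open Scope ring_scope.

(* The space of functions S -> R with the sigma-algebra generated by the
   evaluations; a random function is a random variable with values in it. *)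
Definition evaluation_sets (R : realType) (S : Type) : set (set (S -> R)) :=
  [set A | exists (s : S) (B : set (measurableTypeR R)),
      measurable B /\ A = [set g | B (g s)]].

Definition funspace (R : realType) (S : Type) :=
  g_sigma_algebraType (@evaluation_sets R S).

(* Laws are only compared on measurable sets: outside of the sigma-algebra the
   value of a measure is meaningless. *)
Definition has_law (R : realType) (d d' : measure_display)
    (Omega : measurableType d) (T : measurableType d')
    (P : probability Omega R) (X : {RV P >-> T}) (mu : probability T R) :=
  forall A : set T, measurable A -> distribution P X A = mu A.

Definition same_law (R : realType) (d d' : measure_display)
    (Omega : measurableType d) (T : measurableType d')
    (P : probability Omega R) (X Y : {RV P >-> T}) :=
  forall A : set T, measurable A -> distribution P X A = distribution P Y A.

Definition mutually_independent (R : realType) (d : measure_display)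
    (Omega : measurableType d) (P : probability Omega R)
    (I : Type) (D : set I) (F : I -> set (set Omega)) :=
  forall (n : nat) (j : 'I_n -> I), injective j -> (forall k, D (j k)) ->
  forall A : 'I_n -> set Omega, (forall k, F (j k) (A k)) ->
  P (\bigcap_(k in [set: 'I_n]) A k) = (\prod_(k < n) P (A k))%E.

(* The spin space {-1,1} is encoded by bool, with false |-> 1, true |-> -1. *)
Definition spin : Type := bool.

Definition spin_val (R : realType) (s : spin) : R := (-1) ^+ s.

Definition config (p : nat) := {ffun 'I_p -> bool}.

(* (eps_1, ..., eps_(p-1), s), meaningful for p >= 1. *)
Definition rcons_config (p : nat) (eps : config p.-1) (s : spin) : config p :=
  [ffun l : 'I_p => if insub (val l) is Some k then eps k else s].

Definition field_weight (R : realType) (n : nat) (x : 'I_n -> R)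
    (eps : config n) : R := expR (\sum_(l < n) x l * spin_val R (eps l)).

Definition gibbs_avg (R : realType) (p : nat) (f : config p -> R)
    (x : 'I_p -> R) : R :=
  (\sum_(eps : config p) f eps * field_weight x eps)
  / (\sum_(eps : config p) field_weight x eps).

Definition cavity_avg (R : realType) (p : nat) (f : config p -> R)
    (x : 'I_p.-1 -> R) (s : spin) : R :=
  (\sum_(eps : config p.-1) f (rcons_config eps s) * field_weight x eps)
  / (\sum_(eps : config p.-1) field_weight x eps).

Definition exp_theta (R : realType) (p : nat) (theta : config p -> R)
    (eps : config p) : R := expR (theta eps).

Definition U (R : realType) (p : nat) (theta : config p -> R)
    (x : 'I_p.-1 -> R) (s : spin) : R := ln (cavity_avg (exp_theta theta) x s).

(* Probability measures on R, with the sigma-algebra generated by the maps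
   z |-> z B, B Borel. *)
Definition L1 (R : realType) := pprobability (measurableTypeR R) R.

Definition L2 (R : realType) := probability (L1 R) R.

Section cons_tuple.
Context (d : measure_display) (T : measurableType d) (n : nat).

Definition cons_pair (u : T * n.-tuple T) : n.+1.-tuple T :=
  [tuple of u.1 :: u.2].

Lemma measurable_cons_pair : measurable_fun [set: T * n.-tuple T] cons_pair.
Proof. exact: measurable_cons. Qed.

HB.instance Definition _ :=
  isMeasurableFun.Build _ _ _ _ cons_pair measurable_cons_pair.

End cons_tuple.

(* Product measure z_0 (x) ... (x) z_(n-1). *)
Fixpoint product_law (R : realType) (n : nat) :
    ('I_n -> L1 R) -> probability (n.-tuple (measurableTypeR R)) R :=
  match n return ('I_n -> L1 R) ->
                 probability (n.-tuple (measurableTypeR R)) R with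
  | 0 => fun _ => \d_([tuple])
  | n'.+1 => fun z =>
      distribution
        ((z ord0 : probability (measurableTypeR R) R)
           \x product_law (fun k => z (lift ord0 k)))%E
        (@cons_pair _ (measurableTypeR R) n')
  end.

(* The expectation of G in the independent real variables (x_i), x_i having law
   z_i, the probability measures z_i being fixed. *)
Definition Eprime (R : realType) (I : finType) (z : I -> L1 R)
    (G : (I -> R) -> R) : R :=
  \int[product_law (fun k : 'I_#|I| => z (enum_val k))]_t
    G (fun i => tnth t (enum_rank i)).

Section configuration_model.
Variables (N : nat) (deg : 'I_N -> nat) (E : nat -> nat).

Definition total_degree : nat := (\sum_(i < N) deg i)%N.

Definition vertex_half_edge := {i : 'I_N & 'I_(deg i)}.

(* An edge is a pair (p, j) with j < E p. Bounding p by the sum of the degrees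
   only serves to have a finite type: no edge is discarded when
   sum_i deg i = sum_p p * E p. *)
Definition edge := {p : 'I_total_degree.+1 & 'I_(E p)}.

Definition edge_size (e : edge) : nat := tag e.

Definition edge_half_edge := {e : edge & 'I_(edge_size e)}.

Definition half_edge_map := {ffun edge_half_edge -> vertex_half_edge}.

Definition perfect_matchings : {set half_edge_map} :=
  [set M : half_edge_map | injectiveb M & [forall v, exists x, M x == v]].

(* The vertex e(l) of the hypergraph given by M. *)
Definition endpoint (M : half_edge_map) (e : edge) (l : 'I_(edge_size e)) :
  'I_N := tag (M (Tagged (fun e : edge => 'I_(edge_size e)) l)).

Variable R : realType.

(* Expectation over the uniformly random perfect matching. *)
Definition graph_mean (X : half_edge_map -> R) : R :=
  (\sum_(M in perfect_matchings) X M) / #|perfect_matchings|%:R.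

(* - H, for realisations (theta p j) of the functions attached to the p-edges
   and (h i) of the external fields. *)
Definition minus_H (M : half_edge_map)
    (theta : forall p : nat, nat -> config p -> R) (h : nat -> spin -> R)
    (sigma : config N) : R :=
  \sum_(e : edge) theta (edge_size e) (tagged e)
                    [ffun l => sigma (endpoint M l)]
  + \sum_(i < N) h i (sigma i).

Definition partition_function (M : half_edge_map)
    (theta : forall p : nat, nat -> config p -> R) (h : nat -> spin -> R) : R :=
  \sum_(sigma : config N) expR (minus_H M theta h sigma).

Definition free_energy (d : measure_display) (Omega : measurableType d)
    (P : probability Omega R)
    (theta : forall p : nat, nat -> {RV P >-> funspace R (config p)})
    (h : nat -> {RV P >-> funspace R spin}) : \bar R :=
  ((N%:R^-1)%:E *
   'E_P[fun w => graph_mean (fun M =>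
          ln (partition_function M (fun p j => theta p j w)
                                   (fun i => h i w)))])%E.

End configuration_model.

Definition degree_freq (R : realType) (N : nat) (deg : 'I_N -> nat) (k : nat)
  : R := N%:R^-1 * \sum_(i < N) (deg i == k)%:R.

Definition edge_freq (R : realType) (PP : set nat) (E : nat -> nat) (p : nat)
  : R :=
  (E p)%:R / fine (\sum_(0 <= q <oo | q \in PP) (E q)%:R%:E)%E.

Definition size_biased (R : realType) (PP : set nat) (nu : probability nat R)
    (p : nat) : R :=
  p%:R * fine (nu [set p])
  / fine (\sum_(0 <= q <oo | q \in PP) q%:R%:E * nu [set q])%E.

(* theta_p itself, the copies theta_(p,i), h itself, the copies h_i, d, p_i,
   zeta^(p,(1))_(i,l) and zeta^((1))_l. *)
Inductive source : Type :=
  | SrcTheta of nat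
  | SrcThetaCopy of nat & nat
  | SrcH
  | SrcHCopy of nat
  | SrcDegree
  | SrcEdgeSize of nat
  | SrcZetaEdge of nat & nat & nat
  | SrcZeta of nat.

Definition source_dom (PP : set nat) : set source := fun s =>
  match s with
  | SrcTheta p | SrcThetaCopy p _ | SrcZetaEdge p _ _ => PP p
  | _ => True
  end.

Section cavity.
Context (R : realType) (dd : measure_display) (Omega : measurableType dd)
  (P : probability Omega R).
Variables (theta : forall p : nat, {RV P >-> funspace R (config p)})
  (thetac : forall p : nat, nat -> {RV P >-> funspace R (config p)})
  (h : {RV P >-> funspace R spin}) (hc : nat -> {RV P >-> funspace R spin})
  (dg : {RV P >-> nat}) (pp : nat -> {RV P >-> nat})
  (zetae : nat -> nat -> nat -> {RV P >-> L1 R})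
  (zeta : nat -> {RV P >-> L1 R}).

Definition source_sigma (s : source) : set (set Omega) :=
  match s with
  | SrcTheta p => g_sigma_algebra_preimage (theta p)
  | SrcThetaCopy p i => g_sigma_algebra_preimage (thetac p i)
  | SrcH => g_sigma_algebra_preimage h
  | SrcHCopy i => g_sigma_algebra_preimage (hc i)
  | SrcDegree => g_sigma_algebra_preimage dg
  | SrcEdgeSize i => g_sigma_algebra_preimage (pp i)
  | SrcZetaEdge p i l => g_sigma_algebra_preimage (zetae p i l)
  | SrcZeta l => g_sigma_algebra_preimage (zeta l)
  end.

(* Indices (i,l), counted from 0, of the variables x^(p_i)_(i,l), i <= d and
   l <= p_i - 1, which are the only ones that U_(p_i,i), i <= d, depend on. *)
Definition cavity_index (w : Omega) := {i : 'I_(dg w) & 'I_(pp i w).-1}.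

Definition cavity_zeta (w : Omega) (u : cavity_index w) : L1 R :=
  zetae (pp (tag u) w) (tag u) (tagged u) w.

Definition vertex_weight (w : Omega) (x : cavity_index w -> R) : R :=
  \sum_(s : bool)
    expR (\sum_(i < dg w)
            U (thetac (pp i w) i w)
              (fun l => x (Tagged (fun i : 'I_(dg w) => 'I_(pp i w).-1) l)) s
          + h w s).

Definition vertex_term (m : R) : \bar R :=
  ((m^-1)%:E *
   'E_P[fun w => ln (Eprime (@cavity_zeta w)
                       (fun x => vertex_weight x `^ m))%R])%E.

(* p_1 is pp 0. *)
Definition edge_weight (w : Omega) (x : 'I_(pp 0%N w) -> R) : R :=
  gibbs_avg (exp_theta (theta (pp 0%N w) w)) x.

Definition edge_term (m : R) : \bar R :=
  ('E_P[fun w => (dg w)%:R%R] * (m^-1)%:E *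
   'E_P[fun w => (((pp 0%N w)%:R - 1) / (pp 0%N w)%:R *
                  ln (Eprime (fun l : 'I_(pp 0%N w) => zeta l w)
                        (fun x => edge_weight x `^ m)))%R])%E.

End cavity.

(* Main.v *)
Require Import Defs.
From HB Require Import structures.
From mathcomp Require Import all_boot all_order all_algebra.
From mathcomp Require Import all_classical all_reals all_analysis.
From mathcomp Require Import measurable_realfun.
From mathcomp Require Import ring lra zify.

(** The half-edges of the vertices can be saturated in two ways. With the edges of
    the graph one gets the free energy (edges_only). With one independent cavity
    field per half-edge, of type p with probability rho(p) = p q(p), the vertices
    decouple and one gets the first term of the bound (fields_only). Objects of
    both kinds are attached to half-edges drawn uniformly without replacement, so
    that the order in which they are added is irrelevant, and the proof trades
    fields for edges one at a time. The state of the system is an ensemble, a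
    finite list of weighted Gibbs weights, whose value is m^-1 log E' Z^m.

    One move removes a cavity field and, with probability q(p), puts a p-edge in
    its place. Up to the difference between drawing with and without replacement,
    the value decreases by at least the mean of (p-1) c(p), where c(p) is the value
    of a p-edge placed on cavity variables only (step_le); these numbers add up to
    the second term of the bound. Indeed one edge compares with p fields, all
    placed on the same system (edge_vs_cavity_fields, edge_step), by
      value(+ p-edge) - p value(+ field) + (p-1) value + (p-1) c(p) <= 0.
    The reason is the product form of exp theta. The series of 1 - (1-x)^m and of
    - log(1-y) have nonnegative coefficients, so that minus the logarithm of the
    edge functional is a power series in -b whose coefficients are nonnegative
    combinations of products over the p positions of the edge, a position on a
    vertex contributing a replica factor X and one on a cavity variable a factor
    Y (edge_log_poly). In the mean, by independence, a term of degree n becomes a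
    nonnegative multiple of E[(-b)^n] (X^p - p X Y^(p-1) + (p-1) Y^p), which is
    nonnegative because p is even or the factors are (monomial_comb_ge0,
    pow_comparison). The logarithm is singular where b times the product
    approaches -1; exp theta is therefore first mixed with a little of the
    constant a, which keeps its product form.

    The numbers of edges produced by the moves are random while those of the graph
    are prescribed. A potential, quadratic in the deviations, bounds the cost of
    the discrepancy; it does not increase in the mean along the walk
    (potential_step), and the deviations are of the order of the square root of
    the number of moves. A small fraction of the half-edges is left out, so that
    edges which do not fit any more mean a deviation so large that the bound holds
    trivially (potential_big).

    The interpolation only involves finitely many values. Reals, random measures
    and random functions are rounded to finitely many codes, expectations over
    independent sources are computed by decision trees (mean_tree), and the
    expectation E' by a finite sum (Eprime_between). The free energy is at most
    the value of the rounded system (free_energy_le), the first term of the bound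
    is at least the rounded one (vertex_term_ge), the second at most the rounded
    one (edge_term_le), up to errors that vanish with the mesh. The convergence of
    the frequencies of degrees and sizes then turns the sums over the graph into
    expectations under mu and nu. *)

Set Implicit Arguments.
Unset Strict Implicit.
Unset Printing Implicit Defensive.

Import Order.TTheory GRing.Theory Num.Theory.
Import numFieldNormedType.Exports.

Local Open Scope classical_set_scope.
Local Open Scope ring_scope.

(** * Ensembles of unnormalised Gibbs weights *)

Section ensembles.
Variable R : realType.

(** The weights are those of the cavity variables, whose expectation E' is
    taken inside the logarithm; they are kept apart from the remaining
    randomness, which is averaged outside. *)
Definition ens (T : Type) : Type := seq (R * (T -> R)).

Definition esum (T : Type) (e : ens T) (F : (T -> R) -> R) : R :=
  \sum_(x <- e) x.1 * F x.2.

Definition addfac (T : Type) (e : ens T) (A : T -> R) : ens T :=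
  [seq (x.1, fun t => x.2 t * A t) | x <- e].

(** The field acts on the spin s t of the configuration t, and its own weights
    multiply those of the ensemble because its cavity variables are fresh. *)
Definition addfield (T : Type) (e : ens T) (y : ens bool) (s : T -> bool)
  : ens T :=
  [seq (x.1 * u.1, fun t => x.2 t * u.2 (s t)) | x <- e, u <- y].

Definition trivial_ens (T : Type) : ens T := [:: (1, fun=> 1)].

Definition pos_ens (T : Type) (e : ens T) : Prop :=
  \sum_(x <- e) x.1 = 1 /\
  forall x, x \in e -> 0 <= x.1 /\ forall t, 0 < x.2 t.

Lemma esum_addfac T (e : ens T) A F :
  esum (addfac e A) F = esum e (fun g => F (fun t => g t * A t)).
Proof. by rewrite /esum /addfac big_map. Qed.

Lemma esum_addfield T (e : ens T) y s F :
  esum (addfield e y s) F =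
  esum e (fun g => esum y (fun W => F (fun t => g t * W (s t)))).
Proof.
rewrite /esum /addfield big_allpairs_dep; apply: eq_bigr => x _.
by rewrite big_distrr; apply: eq_bigr => u _ /=; rewrite mulrA.
Qed.

Lemma eq_esum T (e : ens T) F G : F =1 G -> esum e F = esum e G.
Proof. by move=> FG; apply: eq_bigr => x _; rewrite FG. Qed.

Lemma esum1 T (g : T -> R) F : esum [:: (1, g)] F = F g.
Proof. by rewrite /esum big_seq1 mul1r. Qed.

Lemma esumZ T (e : ens T) c F : esum e (fun g => c * F g) = c * esum e F.
Proof. by rewrite /esum big_distrr; apply: eq_bigr => x _; rewrite mulrCA. Qed.

Lemma esumZr T (e : ens T) c F : esum e (fun g => F g * c) = esum e F * c.
Proof. by rewrite mulrC -esumZ; apply: eq_esum => g; rewrite mulrC. Qed.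

Lemma esumC T S (e : ens T) (y : ens S) F :
  esum e (fun g => esum y (F g)) = esum y (fun W => esum e (F^~ W)).
Proof.
rewrite /esum; under eq_bigr do rewrite big_distrr.
rewrite exchange_big; apply: eq_bigr => u _ /=; rewrite big_distrr.
by apply: eq_bigr => x _; rewrite /= mulrCA.
Qed.

Lemma addfac_addfield T (e : ens T) A y s :
  addfac (addfield e y s) A = addfield (addfac e A) y s.
Proof.
rewrite /addfac /addfield map_allpairs allpairs_mapl.
by apply: eq_allpairs => x u; congr pair; apply/funext => t; rewrite mulrAC.
Qed.

Lemma addfacC T (e : ens T) A B : addfac (addfac e A) B = addfac (addfac e B) A.
Proof.
rewrite /addfac -!map_comp; apply: eq_map => x /=; congr pair.
by apply/funext => t; rewrite mulrAC.
Qed.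

Lemma addfac1 T (e : ens T) : addfac e (fun=> 1) = e.
Proof.
rewrite /addfac -[RHS]map_id; apply: eq_map => -[q g] /=; congr pair.
by apply/funext => t; rewrite mulr1.
Qed.

Lemma addfield_trivial T (e : ens T) s : addfield e (trivial_ens bool) s = e.
Proof.
rewrite /addfield /trivial_ens allpairs1r -[RHS]map_id.
apply: eq_map => -[q g] /=; congr pair; first exact: mulr1.
by apply/funext => t; rewrite mulr1.
Qed.

Lemma pos_ens_addfac T (e : ens T) A :
  pos_ens e -> (forall t, 0 < A t) -> pos_ens (addfac e A).
Proof.
move=> [e1 epos] Apos; split; first by rewrite big_map.
move=> _ /mapP[x xe ->]; have [x0 xpos] := epos x xe; split=> // t.
exact: mulr_gt0.
Qed.

Lemma pos_ens_addfield T (e : ens T) y s :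
  pos_ens e -> pos_ens y -> pos_ens (addfield e y s).
Proof.
move=> [e1 epos] [y1 ypos]; split.
  have : esum (addfield e y s) (fun=> 1) = 1.
    rewrite esum_addfield /esum -[RHS]e1; apply: eq_bigr => x _.
    by under eq_bigr do rewrite mulr1; rewrite y1 mulr1.
  by move=> <-; apply: eq_bigr => x _; rewrite mulr1.
move=> _ /allpairsP[[x u] /= [xe uy ->]].
have [x0 xpos] := epos x xe; have [u0 upos] := ypos u uy.
by split=> [|t]; [exact: mulr_ge0|exact: mulr_gt0].
Qed.

Lemma pos_ens_trivial T : pos_ens (trivial_ens T).
Proof.
split; first by rewrite big_seq1.
by move=> x; rewrite inE => /eqP -> /=; split=> [|t]; rewrite ?ler01 ?ltr01.
Qed.

Lemma pos_ens1 T (g : T -> R) : (forall t, 0 < g t) -> pos_ens [:: (1, g)].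
Proof.
move=> gpos; split; first by rewrite big_seq1.
by move=> x; rewrite inE => /eqP -> /=; split=> //; rewrite ler01.
Qed.

Variable m : R.
Hypothesis m_gt0 : 0 < m.

(** Functionals of the Gibbs weight that behave like the m-th power of a
    partition function. Every comparison of free energies below only uses
    these two properties. *)
Definition mpower_like (T : Type) (F : (T -> R) -> R) : Prop :=
  (forall g, (forall t, 0 < g t) -> 0 <= F g) /\
  (forall c g g', (forall t, 0 < g t) -> (forall t, 0 < g' t) ->
     (forall t, g t <= expR c * g' t) -> F g <= expR (m * c) * F g').

(** Comparing all the functionals at once, rather than the values alone, makes
    the relation stable under the addition of edges and fields. *)
Definition dominated (T : Type) (c : R) (e e' : ens T) : Prop :=
  forall F, mpower_like F -> esum e F <= expR (m * c) * esum e' F.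

Lemma mpower_like_fac T (F : (T -> R) -> R) A : mpower_like F ->
  (forall t, 0 < A t) -> mpower_like (fun g => F (fun t => g t * A t)).
Proof.
move=> [F0 Fm] Apos; split=> [g gpos|c g g' gpos g'pos gg'].
  by apply: F0 => t; exact: mulr_gt0.
apply: Fm => t; rewrite ?mulr_gt0// mulrA.
by rewrite ler_wpM2r// ltW.
Qed.

Lemma mpower_like_pull T (F : (T -> R) -> R) g s : mpower_like F ->
  (forall t, 0 < g t) ->
  mpower_like (fun W : bool -> R => F (fun t => g t * W (s t))).
Proof.
move=> [F0 Fm] gpos; split=> [W Wpos|c W W' Wpos W'pos WW'].
  by apply: F0 => t; exact: mulr_gt0.
apply: Fm => t; rewrite ?mulr_gt0// mulrCA.
by rewrite ler_wpM2l// ltW.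
Qed.

Lemma ler_esum T (e : ens T) F G : (forall x, x \in e -> 0 <= x.1) ->
  (forall x, x \in e -> F x.2 <= G x.2) -> esum e F <= esum e G.
Proof.
move=> e0 FG; rewrite /esum big_seq [leRHS]big_seq; apply: ler_sum => x xe.
by rewrite ler_wpM2l ?e0 ?FG.
Qed.

Lemma esum_ge0 T (e : ens T) F : (forall x, x \in e -> 0 <= x.1) ->
  (forall x, x \in e -> 0 <= F x.2) -> 0 <= esum e F.
Proof.
move=> e0 F0; rewrite /esum big_seq; apply: sumr_ge0 => x xe.
by rewrite mulr_ge0 ?e0 ?F0.
Qed.

Lemma esum_const T (e : ens T) c : pos_ens e -> esum e (fun=> c) = c.
Proof. by move=> [e1 _]; rewrite /esum -big_distrl /= e1 mul1r. Qed.

Lemma mpower_like_field T (F : (T -> R) -> R) y s : mpower_like F ->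
  pos_ens y ->
  mpower_like (fun g =>
    esum y (fun W : bool -> R => F (fun t => g t * W (s t)))).
Proof.
move=> Fm [_ ypos]; split=> [g gpos|c g g' gpos g'pos gg'].
  apply: esum_ge0 => u uy; have [u0 up] := ypos u uy => //.
  by case: Fm => F0 _; apply: F0 => t; exact: mulr_gt0.
rewrite -esumZ; apply: ler_esum => u uy; have [u0 up] := ypos u uy => //.
by have [_] := mpower_like_fac Fm (fun t => up (s t)); apply.
Qed.

Lemma dominated_fac T c (e : ens T) A B : pos_ens e ->
  (forall t, 0 < A t) -> (forall t, 0 < B t) ->
  (forall t, A t <= expR c * B t) -> dominated c (addfac e A) (addfac e B).
Proof.
move=> [_ epos] Apos Bpos AB F [F0 Fm]; rewrite !esum_addfac -esumZ.
apply: ler_esum => x xe; have [x0 xpos] := epos x xe => //.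
by apply: Fm => t; rewrite ?mulr_gt0// mulrCA ler_wpM2l// ltW.
Qed.

Lemma dominated_addfield T c (e e' : ens T) y s :
  pos_ens y -> dominated c e e' ->
  dominated c (addfield e y s) (addfield e' y s).
Proof.
move=> ypos ee' F Fm; rewrite !esum_addfield; apply: ee'.
exact: mpower_like_field.
Qed.

Lemma dominated_field T c (e : ens T) y y' s : pos_ens e ->
  dominated c y y' -> dominated c (addfield e y s) (addfield e y' s).
Proof.
move=> [_ epos] yy' F Fm; rewrite !esum_addfield -esumZ.
apply: ler_esum => x xe; have [x0 xpos] := epos x xe => //.
by apply: yy'; exact: mpower_like_pull.
Qed.

Lemma dominated_trans T c c' (e1 e2 e3 : ens T) :
  dominated c e1 e2 -> dominated c' e2 e3 -> dominated (c + c') e1 e3.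
Proof.
move=> e12 e23 F Fm; apply: (le_trans (e12 F Fm)).
rewrite mulrDr expRD -mulrA ler_wpM2l ?expR_ge0//; exact: e23.
Qed.

Definition bounded_field (k : R) (y : ens bool) : Prop :=
  pos_ens y /\
  forall u, u \in y -> forall s, expR (- k) <= u.2 s <= expR k.

Lemma dominated_trivial k y : bounded_field k y ->
  dominated k y (trivial_ens bool).
Proof.
move=> [[y1 ypos] yb] F Fm; rewrite /trivial_ens esum1.
apply: (@le_trans _ _ (esum y (fun=> expR (m * k) * F (fun=> 1)))).
  apply: ler_esum => u uy; have [u0 up] := ypos u uy => //.
  case: Fm => F0; apply => // s; rewrite ?ltr01// mulr1.
  by case/andP: (yb u uy s).
by rewrite esum_const.
Qed.

Lemma trivial_dominated k y : bounded_field k y ->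
  dominated k (trivial_ens bool) y.
Proof.
move=> [[y1 ypos] yb] F Fm; rewrite /trivial_ens esum1 -esumZ.
apply: (@le_trans _ _ (esum y (fun=> F (fun=> 1)))).
  by rewrite esum_const.
apply: ler_esum => u uy; have [u0 up] := ypos u uy => //.
case: Fm => F0; apply => // s.
by rewrite mulrC -ler_pdivrMr ?expR_gt0// mul1r -expRN; case/andP: (yb u uy s).
Qed.

Section value.
Variables (T : finType) (t0 : T).

Definition mass (g : T -> R) : R := (\sum_t g t) `^ m.

(** For an ensemble made of one Gibbs weight this is the logarithm of the
    partition function (ens_val1). *)
Definition ens_val (e : ens T) : R := m^-1 * ln (esum e mass).

Lemma sum_gt0 (g : T -> R) : (forall t, 0 < g t) -> 0 < \sum_t g t.
Proof.
move=> gpos; rewrite (bigD1 t0)//= ltr_pwDl// sumr_ge0// => t _.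
exact: ltW.
Qed.

Lemma mass_gt0 g : (forall t, 0 < g t) -> 0 < mass g.
Proof. by move=> gpos; rewrite powR_gt0// sum_gt0. Qed.

Lemma powR_expR (c : R) : (expR c) `^ m = expR (m * c).
Proof. by rewrite mulrC expRM. Qed.

Lemma mpower_like_mass : mpower_like mass.
Proof.
split=> [g gpos|c g g' gpos g'pos gg']; first exact/ltW/mass_gt0.
rewrite -powR_expR -powRM ?expR_ge0//; last exact/ltW/sum_gt0.
apply: ge0_ler_powR; rewrite ?nnegrE; [exact: ltW|exact/ltW/sum_gt0| |].
  by rewrite mulr_ge0 ?expR_ge0// ltW// sum_gt0.
by rewrite big_distrr /=; apply: ler_sum.
Qed.

Lemma esum_gt0 U (e : ens U) F : pos_ens e ->
  (forall x, x \in e -> 0 < F x.2) -> 0 < esum e F.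
Proof.
move=> [e1 epos] F0.
have [|all0] := boolP (has (fun x => 0 < x.1) e).
  move=> /hasP[x xe x0]; rewrite /esum (big_rem x)//= ltr_pwDl//.
    by rewrite mulr_gt0// F0.
  rewrite big_seq; apply: sumr_ge0 => y /mem_rem ye.
  by rewrite mulr_ge0 ?(proj1 (epos y ye))// ltW// F0.
have : \sum_(x <- e) x.1 = 0.
  rewrite big_seq big1// => x xe; apply/eqP; rewrite eq_le.
  rewrite (proj1 (epos x xe)) andbT leNgt.
  by move/hasPn: all0 => /(_ x xe).
by rewrite e1 => /eqP; rewrite oner_eq0.
Qed.

Lemma esum_mass_gt0 e : pos_ens e -> 0 < esum e mass.
Proof.
move=> epos; apply: esum_gt0 => // x xe; apply: mass_gt0.
by case: epos => _ /(_ x xe)[].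
Qed.

Lemma dominated_val c e e' : pos_ens e -> pos_ens e' -> dominated c e e' ->
  ens_val e <= c + ens_val e'.
Proof.
move=> epos e'pos ee'; rewrite /ens_val.
rewrite -(@ler_pM2l _ m)// mulrDr !mulrA divff ?gt_eqF// !mul1r.
rewrite -[m * c]expRK -lnM ?posrE ?expR_gt0 ?esum_mass_gt0//.
rewrite ler_ln ?posrE ?mulr_gt0 ?expR_gt0 ?esum_mass_gt0//.
exact: (ee' _ mpower_like_mass).
Qed.

Lemma ens_val1 (g : T -> R) : ens_val [:: (1, g)] = ln (\sum_t g t).
Proof.
rewrite /ens_val esum1 /mass ln_powR mulrA mulVf ?mul1r//.
by rewrite gt_eqF.
Qed.

End value.
End ensembles.

(** * Uniform draws of half-edges *)

Section fresh_half_edges.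
Variables (R : realType) (H : finType).
Implicit Types (U : {set H}) (k : nat).

Definition pick_weight U (v : H) : R := (v \notin U)%:R / #|~: U|%:R.

Definition pick_mean U (F : H -> R) : R := \sum_v pick_weight U v * F v.

(** Successive draws without replacement; the continuation receives the
    half-edges drawn and the enlarged set of used ones. *)
Fixpoint fresh k (G : seq H -> {set H} -> R) U : R :=
  if k is k'.+1 then
    pick_mean U (fun v => fresh k' (fun vs U' => G (v :: vs) U') (v |: U))
  else G [::] U.

Fixpoint iid k (G : seq H -> R) U : R :=
  if k is k'.+1 then
    pick_mean U (fun v => iid k' (fun vs => G (v :: vs)) U)
  else G [::].

Lemma pick_weight_ge0 U v : 0 <= pick_weight U v.
Proof. by rewrite mulr_ge0 ?invr_ge0 ?ler0n. Qed.

Lemma pick_meanE U F :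
  pick_mean U F = (\sum_(v in ~: U) F v) / #|~: U|%:R.
Proof.
rewrite /pick_mean mulr_suml [RHS]big_mkcond /=; apply: eq_bigr => v _.
rewrite /pick_weight inE; case: (v \in U) => /=; first by rewrite !mul0r.
by rewrite mul1r mulrC.
Qed.

Lemma cardC_gt0 U : (#|U| < #|H|)%N -> (0 < #|~: U|)%N.
Proof. by move=> UH; rewrite cardsCs finset.setCK subn_gt0. Qed.

Lemma sum_pick_weight U : (#|U| < #|H|)%N -> \sum_v pick_weight U v = 1.
Proof.
move=> /cardC_gt0 UH.
have -> : \sum_v pick_weight U v = pick_mean U (fun=> 1).
  by apply: eq_bigr => v _; rewrite mulr1.
by rewrite pick_meanE sumr_const divff// pnatr_eq0 -lt0n.
Qed.

Lemma pick_mean_const U c : (#|U| < #|H|)%N -> pick_mean U (fun=> c) = c.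
Proof. by move=> UH; rewrite /pick_mean -mulr_suml sum_pick_weight ?mul1r. Qed.

Lemma eq_pick_mean U F G : (forall v, v \notin U -> F v = G v) ->
  pick_mean U F = pick_mean U G.
Proof.
move=> FG; rewrite !pick_meanE; congr (_ / _); apply: eq_bigr => v.
by rewrite inE; exact: FG.
Qed.

Lemma ler_pick_mean U F G : (forall v, v \notin U -> F v <= G v) ->
  pick_mean U F <= pick_mean U G.
Proof.
move=> FG; rewrite !pick_meanE ler_wpM2r ?invr_ge0 ?ler0n//.
by apply: ler_sum => v; rewrite inE; exact: FG.
Qed.

Lemma pick_meanD U F G :
  pick_mean U (fun v => F v + G v) = pick_mean U F + pick_mean U G.
Proof. by rewrite /pick_mean -big_split; apply: eq_bigr => v _; rewrite mulrDr. Qed.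

Lemma pick_mean_sum U (I : Type) (s : seq I) (a : I -> R) F :
  pick_mean U (fun v => \sum_(i <- s) a i * F i v) =
  \sum_(i <- s) a i * pick_mean U (F i).
Proof.
rewrite /pick_mean; under eq_bigr do rewrite big_distrr.
rewrite exchange_big; apply: eq_bigr => i _ /=; rewrite big_distrr.
by apply: eq_bigr => v _; rewrite /= mulrCA.
Qed.

Lemma fresh_sum k U (I : Type) (s : seq I) (a : I -> R) G :
  fresh k (fun vs U' => \sum_(i <- s) a i * G i vs U') U =
  \sum_(i <- s) a i * fresh k (G i) U.
Proof.
elim: k G U => [|k IHk] G U //=.
by rewrite -pick_mean_sum; apply: eq_pick_mean => v _; rewrite IHk.
Qed.

Lemma eq_fresh k G G' U : (forall vs U', G vs U' = G' vs U') ->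
  fresh k G U = fresh k G' U.
Proof. by move=> GG'; congr fresh; do 2 apply/funext => ?; exact: GG'. Qed.

Lemma cardsU1_notin U v : v \notin U -> #|v |: U| = #|U|.+1.
Proof. by move=> vU; rewrite cardsU1 vU. Qed.

(** Two draws without replacement are exchangeable, which is why the order of
    the objects of a system does not matter. *)
Lemma pick_weightC U v v' :
  pick_weight U v * pick_weight (v |: U) v' =
  pick_weight U v' * pick_weight (v' |: U) v.
Proof.
rewrite /pick_weight !inE.
have [vU|vU] := boolP (v \in U).
  by rewrite !mul0r /= !orbT /= !mul0r mulr0.
have [v'U|v'U] := boolP (v' \in U).
  by rewrite !orbT /= !mul0r mulr0.
rewrite /= !orbF (eq_sym v' v); case: (v == v'); first by rewrite /= !mul0r.
have -> // : #|~: (v |: U)| = #|~: (v' |: U)|.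
have := cardsC (v |: U); have := cardsC (v' |: U).
by rewrite !cardsU1_notin//; lia.
Qed.

Lemma pick_meanC U F :
  pick_mean U (fun v => pick_mean (v |: U) (F v)) =
  pick_mean U (fun v => pick_mean (v |: U) (F^~ v)).
Proof.
rewrite /pick_mean; under eq_bigr do rewrite big_distrr.
under [RHS]eq_bigr do rewrite big_distrr.
rewrite exchange_big /=; apply: eq_bigr => v _; apply: eq_bigr => v' _.
by rewrite mulrA pick_weightC -mulrA.
Qed.

Lemma pick_fresh k U G :
  pick_mean U (fun v => fresh k (G v) (v |: U)) =
  fresh k (fun vs U' => pick_mean U' (fun v => G v vs (v |: U'))) U.
Proof.
elim: k U G => [|k IHk] U G //=.
rewrite pick_meanC; apply: eq_pick_mean => v _.
rewrite -(IHk (v |: U) (fun v0 vs => G v0 (v :: vs))).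
apply: eq_pick_mean => v' _.
by rewrite finset.setUCA.
Qed.

Lemma freshC k k' U G :
  fresh k (fun vs U' => fresh k' (fun vs' U'' => G vs vs' U'') U') U =
  fresh k' (fun vs' U' => fresh k (fun vs U'' => G vs vs' U'') U') U.
Proof.
elim: k U G => [|k IHk] U G //=.
rewrite -(pick_fresh k' U (fun v vs' U' =>
  fresh k (fun vs U'' => G (v :: vs) vs' U'') U')).
by apply: eq_pick_mean => v _; rewrite IHk.
Qed.

Lemma ler_fresh k c G G' U : (#|U| + k <= #|H|)%N ->
  (forall vs U', #|U'| = (#|U| + k)%N -> G vs U' <= G' vs U' + c) ->
  fresh k G U <= fresh k G' U + c.
Proof.
elim: k G G' U => [|k IHk] G G' U Uk GG' /=.
  by apply: GG'; rewrite addn0.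
have UH : (#|U| < #|H|)%N by lia.
rewrite -[c](pick_mean_const _ UH) -pick_meanD; apply: ler_pick_mean => v vU.
have cU := cardsU1_notin vU.
apply: IHk => [|vs U' cU']; first by rewrite cU; lia.
by apply: GG'; rewrite cU' cU; lia.
Qed.

Lemma fresh_const k c U : (#|U| + k <= #|H|)%N -> fresh k (fun _ _ => c) U = c.
Proof.
elim: k U => [|k IHk] U Uk //=.
have UH : (#|U| < #|H|)%N by lia.
rewrite -[RHS](pick_mean_const _ UH); apply: eq_pick_mean => v vU.
by rewrite IHk// cardsU1_notin//; lia.
Qed.

Lemma iid_norm_le k G U B : (#|U| < #|H|)%N -> (forall vs, `|G vs| <= B) ->
  `|iid k G U| <= B.
Proof.
move=> UH; elim: k G => [|k IHk] G GB //=.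
apply: (le_trans (ler_norm_sum _ _ _)).
rewrite -[leRHS](pick_mean_const _ UH); apply: ler_sum => v _.
by rewrite normrM ger0_norm ?pick_weight_ge0// ler_wpM2l ?pick_weight_ge0// IHk.
Qed.

Lemma pick_mean_norm_le U F B : (#|U| < #|H|)%N ->
  (forall v, v \notin U -> `|F v| <= B) -> `|pick_mean U F| <= B.
Proof.
move=> UH FB; rewrite ler_norml; apply/andP; split.
  rewrite -[leLHS](pick_mean_const _ UH); apply: ler_pick_mean => v /FB.
  by rewrite ler_norml => /andP[].
rewrite -[leRHS](pick_mean_const _ UH); apply: ler_pick_mean => v /FB.
by rewrite ler_norml => /andP[].
Qed.

Lemma pick_mean_subset U U' F (B : R) : U \subset U' -> (#|U'| < #|H|)%N ->
  (forall v, `|F v| <= B) ->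
  `|pick_mean U' F - pick_mean U F| <=
    2 * B * (#|U'| - #|U|)%:R / #|~: U|%:R.
Proof.
move=> UU' U'H FB.
have le_UU' := subset_leq_card UU'.
have cU : #|~: U| = (#|H| - #|U|)%N by rewrite cardsCs finset.setCK.
have cU' : #|~: U'| = (#|H| - #|U'|)%N by rewrite cardsCs finset.setCK.
have nU : 0 < #|~: U|%:R :> R by rewrite ltr0n cU; lia.
have nU' : 0 < #|~: U'|%:R :> R by rewrite ltr0n cU'; lia.
have sub : ~: U' \subset ~: U by rewrite finset.setCS.
have jE : (#|U'| - #|U|)%:R = #|~: U|%:R - #|~: U'|%:R :> R.
  rewrite -natrB ?cU ?cU' ?leq_sub2l//; congr _%:R.
  have : (#|U'| < #|H|)%N by [].
  by lia.
rewrite !pick_meanE.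
have -> : \sum_(v in ~: U) F v =
    \sum_(v in ~: U') F v + \sum_(v in ~: U :\: ~: U') F v.
  rewrite (big_setID (~: U')) /=; congr (_ + _).
  by apply: eq_bigl => v; rewrite (finset.setIidPr sub).
set S := \sum_(v in ~: U') F v; set S' := \sum_(v in _ :\: _) F v.
have SB : `|S| <= #|~: U'|%:R * B.
  apply: (le_trans (ler_norm_sum _ _ _)).
  by rewrite mulr_natl -sumr_const; apply: ler_sum.
have S'B : `|S'| <= (#|~: U|%:R - #|~: U'|%:R) * B.
  apply: (le_trans (ler_norm_sum _ _ _)).
  rewrite -jE mulr_natl.
  have -> : (#|U'| - #|U|)%N = #|~: U :\: ~: U'|.
    by rewrite cardsDS// cU cU'; lia.
  by rewrite -sumr_const; apply: ler_sum.
have B0 : 0 <= B.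
  have /card_gt0P[v _] : (0 < #|~: U'|)%N by rewrite -(ltr0n R).
  exact: le_trans (FB v).
have -> : S / #|~: U'|%:R - (S + S') / #|~: U|%:R =
    S * (#|~: U'|%:R^-1 - #|~: U|%:R^-1) - S' / #|~: U|%:R by ring.
apply: (le_trans (ler_normB _ _)).
have d0 : 0 <= #|~: U'|%:R^-1 - #|~: U|%:R^-1 :> R.
  by rewrite subr_ge0 lef_pV2 ?posrE// ler_nat subset_leq_card.
rewrite normrM (ger0_norm d0) normrM normfV normr_nat.
have -> : 2 * B * (#|U'| - #|U|)%:R / #|~: U|%:R =
    #|~: U'|%:R * B * (#|~: U'|%:R^-1 - #|~: U|%:R^-1) +
    (#|~: U|%:R - #|~: U'|%:R) * B / #|~: U|%:R :> R.
  rewrite jE; field; by rewrite !gt_eqF.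
by rewrite lerD// ler_wpM2r// invr_ge0 ltW.
Qed.

(** The two ways of drawing differ by the probability of hitting a half-edge
    drawn before, of order k^2 over the number of available half-edges. *)
Lemma fresh_iid k (G : seq H -> R) U U' (B : R) : U \subset U' ->
  (#|U'| + k <= #|H|)%N -> (#|U| < #|H|)%N -> (forall vs, `|G vs| <= B) ->
  `|fresh k (fun vs _ => G vs) U' - iid k G U| <=
    2 * B * (k * (#|U'| - #|U| + k))%:R / #|~: U|%:R.
Proof.
move=> UU' U'k UH GB; elim: k G U' UU' U'k GB => [|k IHk] G U' UU' U'k GB /=.
  by rewrite subrr normr0 mul0n mulr0 mul0r.
have le_UU' := subset_leq_card UU'.
have U'H : (#|U'| < #|H|)%N by lia.
have nU : 0 < #|~: U|%:R :> R by rewrite ltr0n cardC_gt0.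
have B0 : 0 <= B by exact: le_trans (GB [::]).
set F := fun v => iid k (fun vs => G (v :: vs)) U.
rewrite -[pick_mean U' _](subrK (pick_mean U' F)) -addrA.
apply: (le_trans (ler_normD _ _)).
have := pick_mean_subset UU' U'H (B := B) (F := F).
have FB v : `|F v| <= B by apply: iid_norm_le.
move=> /(_ FB) le2.
have le1 : `|pick_mean U' (fun v => fresh k (fun vs _ => G (v :: vs)) (v |: U'))
    - pick_mean U' F| <=
    2 * B * (k * (#|U'| - #|U| + k.+1))%:R / #|~: U|%:R.
  have -> : pick_mean U' (fun v => fresh k (fun vs _ => G (v :: vs)) (v |: U'))
    - pick_mean U' F = pick_mean U' (fun v =>
      fresh k (fun vs _ => G (v :: vs)) (v |: U') - F v).
    rewrite pick_meanD; congr (_ + _); rewrite /pick_mean -sumrN.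
    by apply: eq_bigr => v _; rewrite mulrN.
  apply: pick_mean_norm_le => // v vU'; have cU' := cardsU1_notin vU'.
  apply: (le_trans (IHk _ (v |: U') _ _ _)) => //.
  - by rewrite (fintype.subset_trans UU') ?finset.subsetUr.
  - by rewrite cU'; lia.
  rewrite ler_wpM2r ?invr_ge0 ?(ltW nU)// ler_wpM2l ?mulr_ge0//.
  by rewrite ler_nat leq_mul2l cU'; apply/orP; right; lia.
apply: (le_trans (lerD le1 le2)).
rewrite -mulrDl -mulrDr -natrD ler_wpM2r ?invr_ge0 ?(ltW nU)//.
rewrite ler_wpM2l ?mulr_ge0// ler_nat.
by rewrite mulSn addnC leq_add2r; lia.
Qed.

End fresh_half_edges.

(** * Trading cavity fields for edges *)

(** The arithmetic tactic explores the whole context, which is large below;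
    only the facts about natural numbers are kept for it. *)
Ltac nlia :=
  repeat match goal with
  | h : is_true (leq _ _) |- _ => revert h
  | h : @eq nat _ _ |- _ => revert h
  end; clear; intros; lia.

Lemma sum_seq_const (R : realType) (A : Type) (s : seq A) (x : R) :
  \sum_(i <- s) x = (size s)%:R * x.
Proof. by rewrite big_const_seq count_predT iter_addr_0 mulr_natl. Qed.

Lemma iid_subr (R : realType) (H : finType) k (F : seq H -> R) P (U : {set H}) :
  (#|U| < #|H|)%N -> iid k (fun vs => F vs - P) U = iid k F U - P.
Proof.
move=> UH; elim: k F => [//|k IH] F /=.
rewrite -[in RHS](pick_mean_const P UH) /pick_mean -sumrB.
by apply: eq_bigr => v _; rewrite -mulrBr -IH.
Qed.

Section interpolation_operators.
Variables (R : realType) (m kap : R).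
Hypotheses (m_gt0 : 0 < m) (kap_ge0 : 0 <= kap).
Variables (H T : finType) (t0 : T) (sp : H -> T -> bool).
Variables (Y : finType) (pY : Y -> R) (mk : Y -> ens R bool).
Hypotheses (pY_ge0 : forall y, 0 <= pY y) (pY_sum : \sum_y pY y = 1)
  (mk_bd : forall y, bounded_field kap (mk y)).
Variables (I : nat -> finType) (pI : forall p, I p -> R)
  (th : forall p, I p -> config p -> R).
Hypotheses (pI_ge0 : forall p x, 0 <= @pI p x)
  (pI_sum : forall p, \sum_(x : I p) pI x = 1)
  (th_bd : forall p (x : I p) e, `|th x e| <= kap).

(** The second argument is the set of the half-edges that are already used. *)
Definition state_fun := ens R T -> {set H} -> R.

Definition edge_factor p (x : I p) (vs : seq H) : T -> R := fun t =>
  expR (th x [ffun l : 'I_p => nth false [seq sp v t | v <- vs] l]).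

Definition add_field_op (G : state_fun) : state_fun := fun e U =>
  pick_mean U (fun v =>
    \sum_y pY y * G (addfield e (mk y) (sp v)) (v |: U)).

Definition add_edge_op p (G : state_fun) : state_fun := fun e U =>
  fresh p (fun vs U' => \sum_(x : I p) pI x * G (addfac e (edge_factor x vs)) U') U.

(** The objects act before G does, so that G is evaluated on the system that
    carries all of them. *)
Definition objects_op L (es : seq nat) (G : state_fun) : state_fun :=
  iter L add_field_op (foldr add_edge_op G es).

Definition Phi : state_fun := fun e _ => ens_val m e.

Lemma edge_factor_gt0 p (x : I p) vs t : 0 < edge_factor x vs t.
Proof. exact: expR_gt0. Qed.

Lemma add_field_opC p G :
  add_field_op (add_edge_op p G) = add_edge_op p (add_field_op G).
Proof.
apply/funext => e; apply/funext => U; rewrite /add_field_op /add_edge_op.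
under eq_pick_mean => v _ do rewrite -(fresh_sum p (v |: U) (index_enum Y) pY).
rewrite (pick_fresh p U (fun v vs U' => \sum_y pY y * \sum_(x : I p) pI x *
   G (addfac (addfield e (mk y) (sp v)) (edge_factor x vs)) U')).
apply: eq_fresh => vs U'.
rewrite -(pick_mean_sum U' (index_enum (I p)) (@pI p)
  (fun x v => \sum_y pY y * G (addfield (addfac e (edge_factor x vs)) (mk y)
     (sp v)) (v |: U'))).
apply: eq_pick_mean => v _.
under eq_bigr do rewrite big_distrr.
rewrite exchange_big; apply: eq_bigr => x _ /=; rewrite big_distrr.
by apply: eq_bigr => y _; rewrite /= mulrCA addfac_addfield.
Qed.

Lemma add_edge_opC p p' G :
  add_edge_op p (add_edge_op p' G) = add_edge_op p' (add_edge_op p G).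
Proof.
apply/funext => e; apply/funext => U; rewrite /add_edge_op.
under eq_fresh => vs U' do
  rewrite -(fresh_sum p' U' (index_enum (I p)) (@pI p)).
under [RHS]eq_fresh => vs U' do
  rewrite -(fresh_sum p U' (index_enum (I p')) (@pI p')).
rewrite (freshC p p' U (fun vs vs' U' => \sum_(x : I p) pI x * \sum_(x0 : I p') pI x0 *
   G (addfac (addfac e (edge_factor x vs)) (edge_factor x0 vs')) U')).
apply: eq_fresh => vs U'; apply: eq_fresh => vs' U''.
under eq_bigr do rewrite big_distrr.
rewrite exchange_big; apply: eq_bigr => x _ /=; rewrite big_distrr.
by apply: eq_bigr => y _; rewrite /= mulrCA addfacC.
Qed.

Lemma objects_op_field L es G :
  objects_op L.+1 es G = objects_op L es (add_field_op G).
Proof.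
rewrite /objects_op iterSr; congr iter.
by elim: es => //= p es <-; rewrite add_field_opC.
Qed.

Lemma objects_op_edge L p es G :
  objects_op L (p :: es) G = objects_op L es (add_edge_op p G).
Proof.
rewrite /objects_op; congr iter => /=.
by elim: es => //= p' es IH; rewrite add_edge_opC IH.
Qed.

Lemma objects_op_cat L es es' G :
  objects_op L (es ++ es') G = objects_op L es (foldr add_edge_op G es').
Proof. by rewrite /objects_op foldr_cat. Qed.

Lemma objects_op_perm L es es' G : perm_eq es es' ->
  objects_op L es G = objects_op L es' G.
Proof.
move=> pes; suff : foldr add_edge_op G es = foldr add_edge_op G es'.
  by rewrite /objects_op => ->.
apply: (catCA_perm_ind (P := fun s =>
  foldr add_edge_op G es = foldr add_edge_op G s)) pes _ => // s1 s2 s3 ->.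
rewrite !foldr_cat; elim: s1 => [|p s1 IH] //=; rewrite {}IH.
by elim: s2 => //= p' s2 <-; rewrite add_edge_opC.
Qed.

Lemma add_field_op_sum (J : Type) (s : seq J) (a : J -> R) (G : J -> state_fun) :
  add_field_op (fun e U => \sum_(i <- s) a i * G i e U) =
  fun e U => \sum_(i <- s) a i * add_field_op (G i) e U.
Proof.
apply/funext => e; apply/funext => U; rewrite /add_field_op.
rewrite -pick_mean_sum; apply: eq_pick_mean => v _.
under eq_bigr do rewrite big_distrr.
rewrite exchange_big; apply: eq_bigr => x _ /=; rewrite big_distrr.
by apply: eq_bigr => y _; rewrite /= mulrCA.
Qed.

Lemma add_edge_op_sum p (J : Type) (s : seq J) (a : J -> R) (G : J -> state_fun) :
  add_edge_op p (fun e U => \sum_(i <- s) a i * G i e U) =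
  fun e U => \sum_(i <- s) a i * add_edge_op p (G i) e U.
Proof.
apply/funext => e; apply/funext => U; rewrite /add_edge_op.
rewrite -fresh_sum; apply: eq_fresh => vs U'.
under eq_bigr do rewrite big_distrr.
rewrite exchange_big; apply: eq_bigr => x _ /=; rewrite big_distrr.
by apply: eq_bigr => y _; rewrite /= mulrCA.
Qed.

Lemma objects_op_sum L es (J : Type) (s : seq J) (a : J -> R)
    (G : J -> state_fun) :
  objects_op L es (fun e U => \sum_(i <- s) a i * G i e U) =
  fun e U => \sum_(i <- s) a i * objects_op L es (G i) e U.
Proof.
rewrite /objects_op.
have -> : foldr add_edge_op (fun e U => \sum_(i <- s) a i * G i e U) es =
    fun e U => \sum_(i <- s) a i * foldr add_edge_op (G i) es e U.
  by elim: es => //= p es ->; rewrite add_edge_op_sum.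
by elim: L => //= L ->; rewrite add_field_op_sum.
Qed.

(** Every object uses a fixed number of half-edges; counting them exactly
    guarantees that fresh ones are left for the next objects. *)
Definition le_at k (c : R) (G G' : state_fun) : Prop :=
  forall e (U : {set H}), pos_ens e -> #|U| = k -> G e U <= G' e U + c.

Lemma le_at_field k c G G' : (k < #|H|)%N -> le_at k.+1 c G G' ->
  le_at k c (add_field_op G) (add_field_op G').
Proof.
move=> kH GG' e U epos Uk; rewrite /add_field_op.
have UH : (#|U| < #|H|)%N by rewrite Uk.
rewrite -[c](pick_mean_const _ UH) -pick_meanD; apply: ler_pick_mean => v vU.
rewrite -[c in leRHS]mul1r -pY_sum mulr_suml -big_split.
apply: ler_sum => y _ /=; rewrite -mulrDr ler_wpM2l//; apply: GG'.
  by apply: pos_ens_addfield => //; case: (mk_bd y).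
by rewrite cardsU1_notin ?Uk.
Qed.

Lemma le_at_edge k p c G G' : (k + p <= #|H|)%N -> le_at (k + p) c G G' ->
  le_at k c (add_edge_op p G) (add_edge_op p G').
Proof.
move=> kH GG' e U epos Uk; rewrite /add_edge_op.
apply: ler_fresh => [|vs U' cU']; first by rewrite Uk.
rewrite -[c in leRHS]mul1r -(pI_sum p) mulr_suml -big_split.
apply: ler_sum => x _ /=; rewrite -mulrDr ler_wpM2l//; apply: GG'.
  by apply: pos_ens_addfac => // t; exact: edge_factor_gt0.
by rewrite cU' Uk.
Qed.

Lemma le_at_edges k es c G G' : (k + sumn es <= #|H|)%N ->
  le_at (k + sumn es) c G G' ->
  le_at k c (foldr add_edge_op G es) (foldr add_edge_op G' es).
Proof.
elim: es k => [|p es IH] k /=; first by rewrite addn0.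
rewrite addnA => kH GG'; apply: le_at_edge; last exact: IH.
exact: leq_trans (leq_addr _ _) kH.
Qed.

Lemma le_at_objects k L es c G G' : (k + L + sumn es <= #|H|)%N ->
  le_at (k + L + sumn es) c G G' ->
  le_at k c (objects_op L es G) (objects_op L es G').
Proof.
rewrite /objects_op; elim: L k => [|L IH] k /=.
  by rewrite addn0; exact: le_at_edges.
rewrite addnS -addSn => kH GG'; apply: le_at_field; last exact: IH.
by apply: leq_trans kH; rewrite -addnA ltn_addr.
Qed.

Lemma le_at_trans k c c' G1 G2 G3 :
  le_at k c G1 G2 -> le_at k c' G2 G3 -> le_at k (c + c') G1 G3.
Proof.
move=> G12 G23 e U epos Uk; apply: (le_trans (G12 e U epos Uk)).
by rewrite (addrC c) addrA lerD2r G23.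
Qed.

(** A field with values between exp(-kap) and exp(kap) is dominated by, and
    dominates, the trivial one. *)
Lemma ens_val_addfield e y s : pos_ens e -> bounded_field kap y ->
  ens_val m (addfield e y s) <= ens_val m (T:=T) e + kap /\
  ens_val m e <= ens_val m (addfield e y s) + kap.
Proof.
move=> epos yb; have ypos := yb.1.
have pe := pos_ens_addfield s epos ypos.
rewrite ![_ + kap]addrC; split; apply: dominated_val => //.
  rewrite -[X in dominated m kap _ X](addfield_trivial _ s).
  by apply: dominated_field => //; exact: dominated_trivial.
rewrite -[X in dominated m kap X _](addfield_trivial _ s).
by apply: dominated_field => //; exact: trivial_dominated.
Qed.

Lemma edge_factor_bd p (x : I p) vs t :
  expR (- kap) <= edge_factor x vs t <= expR kap.
Proof. by rewrite /edge_factor !ler_expR -ler_norml. Qed.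

Lemma ens_val_addfac e A : pos_ens e ->
  (forall t, expR (- kap) <= A t <= expR kap) ->
  ens_val m (addfac e A) <= ens_val m (T:=T) e + kap /\
  ens_val m e <= ens_val m (addfac e A) + kap.
Proof.
move=> epos Ab.
have Apos t : 0 < A t by case/andP: (Ab t) => + _; apply: lt_le_trans; exact: expR_gt0.
have pe := pos_ens_addfac epos Apos.
rewrite ![_ + kap]addrC; split; apply: dominated_val => //.
  rewrite -[X in dominated m kap _ X]addfac1.
  apply: dominated_fac => // t; rewrite ?ltr01// mulr1.
  by case/andP: (Ab t).
rewrite -[X in dominated m kap X _]addfac1.
apply: dominated_fac => // t; rewrite ?ltr01//.
by rewrite mulrC -ler_pdivrMr ?expR_gt0// mul1r -expRN; case/andP: (Ab t).
Qed.

Lemma le_at_field_Phi k : (k < #|H|)%N ->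
  le_at k kap (add_field_op Phi) Phi /\ le_at k kap Phi (add_field_op Phi).
Proof.
move=> kH; split=> e U epos Uk; rewrite /add_field_op /Phi;
  have UH : (#|U| < #|H|)%N by rewrite Uk.
  rewrite -[leRHS](pick_mean_const _ UH); apply: ler_pick_mean => v _.
  rewrite -[leRHS]mul1r -pY_sum mulr_suml; apply: ler_sum => y _.
  by rewrite ler_wpM2l//; case: (ens_val_addfield (sp v) epos (mk_bd y)).
rewrite -lerBlDr -[leLHS](pick_mean_const _ UH); apply: ler_pick_mean => v _.
rewrite -[leLHS]mul1r -pY_sum mulr_suml; apply: ler_sum => y _.
rewrite ler_wpM2l// lerBlDr.
by case: (ens_val_addfield (sp v) epos (mk_bd y)).
Qed.

Lemma le_at_edge_Phi k p : (k + p <= #|H|)%N ->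
  le_at k kap (add_edge_op p Phi) Phi /\ le_at k kap Phi (add_edge_op p Phi).
Proof.
move=> kH; split=> e U epos Uk; rewrite /add_edge_op /Phi;
  have UH : (#|U| + p <= #|H|)%N by rewrite Uk.
  rewrite -[ens_val m e](fresh_const (ens_val m e) UH).
  apply: ler_fresh => // vs U' _.
  rewrite -[leRHS]mul1r -(pI_sum p) mulr_suml; apply: ler_sum => x _.
  rewrite ler_wpM2l//.
  by case: (ens_val_addfac epos (edge_factor_bd x vs)).
rewrite -[ens_val m e](fresh_const (ens_val m e) UH).
apply: ler_fresh => // vs U' _; rewrite -lerBlDr.
rewrite -[leLHS]mul1r -(pI_sum p) mulr_suml; apply: ler_sum => x _.
rewrite ler_wpM2l// lerBlDr.
by case: (ens_val_addfac epos (edge_factor_bd x vs)).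
Qed.

Lemma le_at_edges_Phi k es : (k + sumn es <= #|H|)%N ->
  le_at k ((size es)%:R * kap) (foldr add_edge_op Phi es) Phi /\
  le_at k ((size es)%:R * kap) Phi (foldr add_edge_op Phi es).
Proof.
elim: es k => [|p es IH] k /=.
  by move=> _; rewrite mul0r; split=> e U _ _; rewrite addr0.
rewrite addnA => kH; have [IH1 IH2] := IH _ kH.
have kp : (k + p <= #|H|)%N by exact: leq_trans (leq_addr _ _) kH.
have [E1 E2] := le_at_edge_Phi kp.
rewrite -natr1 mulrDl mul1r; split.
  by apply: le_at_trans E1; exact: le_at_edge.
by rewrite addrC; apply: le_at_trans E2 _; exact: le_at_edge.
Qed.

Lemma le_at_fields_Phi k L : (k + L <= #|H|)%N ->
  le_at k (L%:R * kap) (objects_op L [::] Phi) Phi /\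
  le_at k (L%:R * kap) Phi (objects_op L [::] Phi).
Proof.
elim: L k => [|L IH] k kH.
  by rewrite mul0r; split=> e U _ _; rewrite addr0.
have [IH1 IH2] := IH k.+1 ltac:(nlia).
have [E1 E2] := @le_at_field_Phi k ltac:(nlia).
rewrite -natr1 mulrDl mul1r; split.
  by apply: le_at_trans E1; apply: le_at_field => //; nlia.
rewrite addrC; apply: le_at_trans E2 _.
by apply: le_at_field => //; nlia.
Qed.

Lemma le_at_objects_Phi k L es : (k + L + sumn es <= #|H|)%N ->
  le_at k ((L + size es)%:R * kap) (objects_op L es Phi) Phi /\
  le_at k ((L + size es)%:R * kap) Phi (objects_op L es Phi).
Proof.
move=> kH.
have [F1 F2] := le_at_fields_Phi (leq_trans (leq_addr _ _) kH).
have [E1 E2] := @le_at_edges_Phi (k + L) es kH.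
have comp c G G' : le_at (k + L) c G G' ->
    le_at k c (objects_op L [::] G) (objects_op L [::] G').
  move=> GG'; apply: le_at_objects => /=; rewrite addn0 //.
  exact: leq_trans (leq_addr _ _) kH.
rewrite addnC natrD mulrDl; split.
  exact: (le_at_trans (comp _ _ _ E1) F1).
by rewrite addrC; exact: (le_at_trans F2 (comp _ _ _ E2)).
Qed.

(** Two systems are compared through the edges that they share; each of the
    others costs at most kap. *)
Lemma split_common (s1 s2 : seq nat) : exists c d1 d2,
  [/\ perm_eq s1 (c ++ d1), perm_eq s2 (c ++ d2) &
      forall x, x \in d1 -> x \notin d2].
Proof.
elim: s1 s2 => [|x s1 IH] s2; first by exists [::], [::], s2.
have [xs2|xs2] := boolP (x \in s2).
  have [c [d1 [d2 [p1 p2 dd]]]] := IH (rem x s2).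
  exists (x :: c), d1, d2; split => //=; first by rewrite perm_cons.
  by rewrite (perm_trans (perm_to_rem xs2))// perm_cons.
have [c [d1 [d2 [p1 p2 dd]]]] := IH s2.
exists c, (x :: d1), d2; split => //.
  by rewrite perm_sym perm_catC /= perm_cons perm_catC perm_sym.
move=> y; rewrite inE => /predU1P[->|/dd//].
by apply: contra xs2; rewrite (perm_mem p2) mem_cat orbC => ->.
Qed.

Variables (e0 : ens R T) (es0 : seq nat) (ts : seq nat) (K : nat)
  (q c : nat -> R).
Hypotheses (e0_pos : pos_ens e0) (es0_sum : sumn es0 = #|H|)
  (es0_gt0 : forall p, p \in es0 -> (0 < p)%N).
Hypotheses (ts_uniq : uniq ts) (ts_K : forall p, p \in ts -> (0 < p <= K)%N)
  (q_ge0 : forall p, 0 <= q p) (q_le1 : \sum_(p <- ts) p%:R * q p <= 1)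
  (c_bd : forall p, p \in ts -> `|c p| <= kap).

Variables (Yp : nat -> finType) (pYp : forall p, Yp p -> R)
  (mkp : forall p, Yp p -> ens R bool) (eta : R).
Hypothesis fields_by_type : forall F : ens R bool -> R,
  \sum_y pY y * F (mk y) =
  \sum_(p <- ts) p%:R * q p * \sum_(y : Yp p) pYp y * F (mkp y) +
  (1 - \sum_(p <- ts) p%:R * q p) * F (trivial_ens R bool).
Hypothesis edge_vs_fields : forall p e (U : {set H}), p \in ts -> pos_ens e ->
  (#|U| < #|H|)%N ->
  iid p (fun vs => \sum_(x : I p) pI x * ens_val m (addfac e (edge_factor x vs))) U
    - ens_val m e
  - p%:R * (pick_mean U (fun v =>
      \sum_(y : Yp p) pYp y * ens_val m (addfield e (mkp y) (sp v)))
    - ens_val m e) + (p%:R - 1) * c p <= eta.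

(** The second term of the bound: q p is the number of p-edges per half-edge. *)
Definition edge_correction : R := \sum_(p <- ts) q p * ((p%:R - 1) * c p).

Lemma sum_q_le1 : \sum_(p <- ts) q p <= 1.
Proof.
apply: le_trans q_le1; rewrite !big_seq; apply: ler_sum => p /ts_K /andP[p0 _].
by rewrite -[leLHS]mul1r ler_wpM2r// ler1n.
Qed.

Lemma edge_correction_bd : `|edge_correction| <= kap.
Proof.
apply: (le_trans (ler_norm_sum _ _ _)).
apply: (@le_trans _ _ (\sum_(p <- ts) p%:R * q p * kap)); last first.
  by rewrite -mulr_suml -[leRHS]mul1r ler_wpM2r.
rewrite !big_seq; apply: ler_sum => p pts; have /andP[p0 _] := ts_K pts.
rewrite mulrA normrM ler_pM ?normr_ge0 ?c_bd// normrM (ger0_norm (q_ge0 p)).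
rewrite mulrC ler_wpM2r// ger0_norm ?subr_ge0 ?ler1n//.
by rewrite lerBlDr lerDl.
Qed.

Hypothesis eta_ge0 : 0 <= eta.

Definition step_err (n0 : nat) : R := eta + 2 * kap * (K ^ 2)%:R / n0%:R.

Lemma step_err_ge0 n0 : 0 <= step_err n0.
Proof. by rewrite addr_ge0// !mulr_ge0 ?invr_ge0. Qed.

Definition step_fun : option nat -> state_fun :=
  fun o => if o is Some p then add_edge_op p Phi else Phi.

Definition step_wt : option nat -> R :=
  fun o => if o is Some p then q p else 1 - \sum_(p <- ts) q p.

Definition step_seq : seq (option nat) := None :: [seq Some p | p <- ts].

Lemma step_sum (F : option nat -> R) :
  \sum_(o <- step_seq) step_wt o * F o =
  (1 - \sum_(p <- ts) q p) * F None + \sum_(p <- ts) q p * F (Some p).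
Proof. by rewrite /step_seq big_cons big_map. Qed.

(** On the side of the fields, fields_by_type splits the mean by type, a field
    of type p having probability p q(p). On the side of the edges, the p fresh
    half-edges are replaced by independent ones, at the cost of fresh_iid, and
    edge_vs_fields applies. The part of the probability that is not carried by
    the types corresponds to a trivial field, and cancels. *)
Lemma step_le n0 k : (K <= n0)%N -> (0 < n0)%N -> (k + n0 <= #|H|)%N ->
  le_at k (step_err n0 - edge_correction)
    (fun e U => \sum_(o <- step_seq) step_wt o * step_fun o e U)
    (add_field_op Phi).
Proof.
move=> Kn0 n0_gt0 kH e U epos Uk; rewrite step_sum /=.
have UH : (#|U| < #|H|)%N by rewrite Uk; lia.
set P := ens_val m e.
pose fl p := pick_mean U (fun v =>
      \sum_(y : Yp p) pYp y * ens_val m (addfield e (mkp y) (sp v))).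
have -> : add_field_op Phi e U = \sum_(p <- ts) p%:R * q p * fl p +
    (1 - \sum_(p <- ts) p%:R * q p) * P.
  rewrite /add_field_op /Phi.
  under eq_pick_mean => v _ do
    rewrite (fields_by_type (fun y => ens_val m (addfield e y (sp v))))
      addfield_trivial.
  by rewrite pick_meanD pick_mean_const// pick_mean_sum.
have edge p : p \in ts -> q p * add_edge_op p Phi e U <= q p * P +
    (p%:R * q p * fl p - p%:R * q p * P) - q p * ((p%:R - 1) * c p) +
    p%:R * q p * step_err n0.
  move=> pts; have /andP[p0 pK] := ts_K pts.
  have pH : (#|U| + p <= #|H|)%N by rewrite Uk; lia.
  pose G vs := \sum_(x : I p) pI x * ens_val m (addfac e (edge_factor x vs)) - P.
  have GB vs : `|G vs| <= kap.
    have -> : G vs = \sum_(x : I p) pI x *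
        (ens_val m (addfac e (edge_factor x vs)) - P).
      rewrite /G -[P in LHS]mul1r -(pI_sum p) mulr_suml -sumrB.
      by apply: eq_bigr => x _; rewrite mulrBr.
    apply: (le_trans (ler_norm_sum _ _ _)).
    rewrite -[kap]mul1r -(pI_sum p) mulr_suml; apply: ler_sum => x _.
    rewrite normrM ger0_norm// ler_wpM2l// ler_norml.
    have [] := ens_val_addfac epos (edge_factor_bd x vs).
    rewrite -/P => h1 h2; apply/andP; split; first by rewrite lerBrDr addrC lerBlDr.
    by rewrite lerBlDr addrC.
  have tv := fresh_iid (subxx U) pH UH GB.
  rewrite subnn add0n in tv.
  have fG : fresh p (fun vs _ => G vs) U = add_edge_op p Phi e U - P.
    rewrite -[P in RHS](fresh_const P pH) /add_edge_op /Phi.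
    have := fresh_sum p U [:: true; false] (fun b : bool => if b then 1 else -1)
      (fun b vs U' => if b then \sum_(x : I p) pI x *
          ens_val m (addfac e (edge_factor x vs)) else P).
    rewrite !big_cons big_nil /= addr0 mul1r mulN1r => <-.
    by apply: eq_fresh => vs U'; rewrite !big_cons big_nil addr0 mul1r mulN1r.
  have iG : iid p G U = iid p (fun vs => \sum_(x : I p) pI x *
      ens_val m (addfac e (edge_factor x vs))) U - P by exact: iid_subr.
  have := edge_vs_fields pts epos UH; rewrite -/P -/(fl p) -iG => he.
  have tv2 : 2 * kap * (p * p)%:R / #|~: U|%:R <= 2 * kap * (K ^ 2)%:R / n0%:R.
    apply: ler_pM; rewrite ?mulr_ge0 ?invr_ge0//.
      by rewrite ler_wpM2l ?mulr_ge0// ler_nat expnS expn1 leq_mul.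
    have cC := cardsC U.
    by rewrite lef_pV2 ?posrE ?ltr0n ?ler_nat//; rewrite Uk in cC; nlia.
  have tv3 : add_edge_op p Phi e U - P <= iid p G U + 2 * kap * (K ^ 2)%:R / n0%:R.
    rewrite -fG addrC -lerBlDr; apply: le_trans tv2; apply: le_trans tv.
    exact: ler_norm.
  have q0 := q_ge0 p.
  have : add_edge_op p Phi e U <= P + p%:R * (fl p - P) - (p%:R - 1) * c p +
      step_err n0.
    by move: he tv3; rewrite /step_err; set X := iid p G U; lra.
  move=> /(ler_wpM2l q0)/le_trans; apply.
  have : q p * step_err n0 <= p%:R * q p * step_err n0.
    by rewrite ler_wpM2r ?step_err_ge0// -[leLHS]mul1r ler_wpM2r// ler1n.
  by set X := p%:R * q p * step_err n0; nra.
have : \sum_(p <- ts) q p * add_edge_op p Phi e U <= \sum_(p <- ts) (q p * P +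
    (p%:R * q p * fl p - p%:R * q p * P) - q p * ((p%:R - 1) * c p) +
    p%:R * q p * step_err n0).
  by rewrite big_seq [leRHS]big_seq; apply: ler_sum.
rewrite big_split sumrB big_split sumrB /= -!mulr_suml -/edge_correction.
have := step_err_ge0 n0.
have : (\sum_(p <- ts) p%:R * q p) * step_err n0 <= step_err n0.
  by rewrite -[leRHS]mul1r ler_wpM2r ?step_err_ge0.
rewrite /Phi -/P.
set A := \sum_(p <- ts) q p; set B := \sum_(p <- ts) p%:R * q p.
set C := B * step_err _; set D := \sum_(i <- ts) _ * fl i.
set E := \sum_(p <- ts) _; lra.
Qed.

Variables (M n0 : nat) (delta lam : R).
Hypotheses (delta_gt0 : 0 < delta) (K_n0 : (K <= n0)%N) (n0_gt0 : (0 < n0)%N)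
  (M_H : (M + n0 <= #|H|)%N) (lam_ge0 : 0 <= lam) (K_gt0 : (0 < K)%N)
  (gap : 3 * #|H|%:R <=
     lam * (#|H| - M - n0)%:R / K%:R - (size ts)%:R * (lam ^+ 2 * delta / 2)).

(** M - L moves have been made when L fields are left, and each of them has
    produced a p-edge with probability q p. *)
Definition fluct p (es : seq nat) (L : nat) : R :=
  (count_mem p es)%:R + (L%:R - M%:R) * q p.

Definition count_err : R :=
  \sum_(p <- ts) `|M%:R * q p - (count_mem p es0)%:R| +
  (count [predC ts] es0)%:R.

(** The square is a bound of the absolute value, x^2/(2 delta) + delta/2 being
    at least |x|; the term linear in L is the variance of the moves still to
    come. *)
Definition potential (es : seq nat) (L : nat) : R :=
  count_err + \sum_(p <- ts) (delta / 2 +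
    (fluct p es L ^+ 2 + L%:R * q p) / (2 * delta)).

(** fluct is a martingale, and the variance q p of each of its steps is paid
    by the decrease of L. *)
Lemma potential_step es L :
  \sum_(p <- ts) q p * potential (p :: es) L +
  (1 - \sum_(p <- ts) q p) * potential es L <= potential es L.+1.
Proof.
have dpos : 0 < 2 * delta by rewrite mulr_gt0.
have d p' : p' \in ts ->
  potential (p' :: es) L = potential es L + (2 * fluct p' es L + 1) / (2 * delta).
  move=> p'ts; rewrite /potential; move: count_err => ce.
  rewrite -addrA; congr (_ + _).
  rewrite (bigD1_seq p' p'ts ts_uniq) /= [in RHS](bigD1_seq p' p'ts ts_uniq) /=.
  rewrite [RHS]addrAC.
  congr (_ + _).
    rewrite /fluct /= eqxx add1n -natr1; field; exact: lt0r_neq0.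
  by apply: eq_bigr => p /negPf pp'; rewrite /fluct /= eq_sym pp' add0n.
have -> : \sum_(p <- ts) q p * potential (p :: es) L =
    \sum_(p <- ts) q p * potential es L +
    \sum_(p <- ts) q p * ((2 * fluct p es L + 1) / (2 * delta)).
  rewrite -big_split big_seq [RHS]big_seq; apply: eq_bigr => p pts /=.
  by rewrite d// mulrDr.
rewrite -mulr_suml addrAC -mulrDl addrC (addrC _ (1 - _)) subrK mul1r addrC.
rewrite /potential; move: count_err => ce.
rewrite -addrA lerD2l -big_split; apply: ler_sum => p _ /=.
rewrite -subr_ge0.
have -> : fluct p es L.+1 = fluct p es L + q p.
  by rewrite /fluct -natr1; ring.
have -> : delta / 2 + ((fluct p es L + q p) ^+ 2 + L.+1%:R * q p) / (2 * delta) -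
  (delta / 2 + (fluct p es L ^+ 2 + L%:R * q p) / (2 * delta) +
   q p * ((2 * fluct p es L + 1) / (2 * delta))) = q p ^+ 2 / (2 * delta).
  rewrite -natr1; field; exact: lt0r_neq0.
by rewrite divr_ge0 ?sqr_ge0// ltW.
Qed.

Let phi L es : R := objects_op L es Phi e0 finset.set0.

(** This is 0 <= (|x| - y delta)^2. *)
Lemma potential_abs (x y : R) : y * `|x| - y ^+ 2 * delta / 2 <= x ^+ 2 / (2 * delta).
Proof.
rewrite -subr_ge0.
have -> : x ^+ 2 / (2 * delta) - (y * `|x| - y ^+ 2 * delta / 2) =
    (`|x| - y * delta) ^+ 2 / (2 * delta).
  rewrite -[x ^+ 2]real_normK ?num_real//; field; exact: lt0r_neq0.
by rewrite divr_ge0 ?sqr_ge0// mulr_ge0// ltW.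
Qed.

Lemma sum_ts_count es : all (mem ts) es ->
  (\sum_(p <- ts) count_mem p es)%N = size es.
Proof.
move=> /allP ets; rewrite -(@sum1_size _ es).
under eq_bigr do rewrite -sum1_count big_mkcond.
rewrite exchange_big /= big_seq [RHS]big_seq; apply: eq_bigr => p pes.
have pts : p \in ts by exact: ets.
rewrite (bigD1_seq p pts ts_uniq) /= eqxx big1 ?addn0// => p' /negPf pp'.
by rewrite eq_sym pp'.
Qed.

Lemma sum_ts_count_mul es : all (mem ts) es ->
  (\sum_(p <- ts) p * count_mem p es)%N = sumn es.
Proof.
move=> /allP ets; rewrite sumnE.
under eq_bigr do rewrite -sum1_count big_mkcond big_distrr.
rewrite exchange_big /= big_seq [RHS]big_seq; apply: eq_bigr => p pes.
have pts : p \in ts by exact: ets.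
rewrite (bigD1_seq p pts ts_uniq) /= eqxx muln1 big1 ?addn0// => p' /negPf pp'.
by rewrite eq_sym pp' muln0.
Qed.

Lemma edges_compare es : all (mem ts) es -> (sumn es <= #|H|)%N ->
  phi 0 es0 <= phi 0 es + kap * (\sum_(p <- ts)
      `|(count_mem p es)%:R - (count_mem p es0)%:R| +
    (count [predC ts] es0)%:R).
Proof.
move=> ets esH; have [cm [d1 [d2 [p1 p2 dd]]]] := split_common es es0.
have s1 : (sumn cm + sumn d1 <= #|H|)%N.
  by rewrite -sumn_cat -(perm_sumn p1).
have s2 : (sumn cm + sumn d2 <= #|H|)%N.
  by rewrite -sumn_cat -(perm_sumn p2) es0_sum.
have E d : (sumn cm + sumn d <= #|H|)%N ->
    phi 0 (cm ++ d) <= phi 0 cm + (size d)%:R * kap /\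
    phi 0 cm <= phi 0 (cm ++ d) + (size d)%:R * kap.
  move=> sd; have [l1 l2] := @le_at_edges_Phi (sumn cm) d sd.
  rewrite /phi objects_op_cat; split.
    apply: (@le_at_objects 0 0 cm) => //; last by rewrite cards0.
    by rewrite !add0n; apply: leq_trans sd; rewrite leq_addr.
  apply: (@le_at_objects 0 0 cm) => //; last by rewrite cards0.
  by rewrite !add0n; apply: leq_trans sd; rewrite leq_addr.
have [_ e1] := E _ s1; have [e2 _] := E _ s2.
have -> : phi 0 es0 = phi 0 (cm ++ d2) by rewrite /phi (objects_op_perm _ _ p2).
have -> : phi 0 es = phi 0 (cm ++ d1) by rewrite /phi (objects_op_perm _ _ p1).
apply: (le_trans e2); apply: (le_trans (lerD e1 (lexx _))).
rewrite -addrA lerD2l -mulrDl mulrC ler_wpM2l// -natrD.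
have d1ts : all (mem ts) d1.
  by apply/allP => p pd1; apply: (allP ets); rewrite (perm_mem p1) mem_cat pd1 orbT.
have -> : size d2 = (size [seq p <- d2 | p \in ts] + count [predC ts] es0)%N.
  have /permP -> := p2; rewrite count_cat.
  have -> : count [predC ts] cm = 0%N.
    apply/eqP; rewrite -leqn0 leqNgt -has_count; apply/negP => /hasP[p pc].
    move=> /=; rewrite /= => /negP; apply; apply: (allP ets).
    by rewrite (perm_mem p1) mem_cat pc.
  by rewrite add0n size_filter -(count_predC (mem ts) d2).
rewrite addnA natrD lerD2r.
have d2ts : all (mem ts) [seq p <- d2 | p \in ts].
  by apply/allP => p; rewrite mem_filter => /andP[].
rewrite -(sum_ts_count d1ts) -(sum_ts_count d2ts) -big_split /= natr_sum; rewrite !big_seq; apply: ler_sum => p pts.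
have /permP -> := p1; have /permP -> := p2; rewrite !count_cat !natrD.
have -> : count_mem p [seq p0 <- d2 | p0 \in ts] = count_mem p d2.
  rewrite count_filter; apply: eq_count => x /=.
  by case: eqP => [->|//]; rewrite pts.
have -> : forall x y z : R, x + y - (x + z) = y - z by move=> x y z; ring.
have [pd1|pd1] := boolP (p \in d1).
  by rewrite (count_memPn (dd p pd1)) addr0 subr0 ger0_norm.
by rewrite (count_memPn pd1) add0r sub0r normrN ger0_norm.
Qed.

Lemma size_le_sumn es : (forall p, p \in es -> (0 < p)%N) -> (size es <= sumn es)%N.
Proof.
elim: es => //= p es IH h; rewrite -add1n leq_add ?h ?mem_head//.
by apply: IH => x xes; apply: h; rewrite inE xes orbT.
Qed.

(** When the edges and the remaining fields almost exhaust the half-edges,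
    more edges than expected have been produced; the deviations, weighted by
    the sizes, are at least the number of half-edges left out of the M moves,
    and the hypothesis gap turns this into a bound of their squares. *)
Lemma potential_big es L : all (mem ts) es -> (L <= M)%N ->
  (#|H| < sumn es + L + n0)%N -> 3 * #|H|%:R <= potential es L.
Proof.
move=> ets LM big; apply: (le_trans gap); rewrite /potential.
rewrite -[leLHS]add0r lerD//.
  by rewrite addr_ge0// sumr_ge0.
have Kpos : 0 < K%:R :> R by rewrite ltr0n.
apply: (@le_trans _ _ (\sum_(p <- ts)
    (lam * `|fluct p es L| - lam ^+ 2 * delta / 2))); last first.
  apply: ler_sum => p _; apply: (le_trans (potential_abs _ _)).
  rewrite -[leLHS]add0r; apply: lerD; first by rewrite divr_ge0 ?ltW.
  apply: ler_wpM2r.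
    by rewrite invr_ge0 mulr_ge0// ltW.
  by rewrite lerDl mulr_ge0.
rewrite sumrB sum_seq_const lerD2r.
rewrite -big_distrr -mulrA ler_wpM2l//= ler_pdivrMr// mulr_suml.
have -> : (#|H| - M - n0)%:R = #|H|%:R - M%:R - n0%:R :> R.
  by rewrite -subnDA natrB// natrD opprD addrA.
apply: (@le_trans _ _ (\sum_(p <- ts) p%:R * fluct p es L)); last first.
  rewrite !big_seq; apply: ler_sum => p /ts_K/andP[_ pK].
  rewrite mulrC; apply: (@le_trans _ _ (`|fluct p es L| * p%:R)).
    by rewrite ler_wpM2r// ler_norm.
  by rewrite ler_wpM2l// ler_nat.
rewrite /fluct; under eq_bigr do rewrite mulrDr mulrCA.
rewrite big_split /= -big_distrr /=.
have -> : \sum_(p <- ts) p%:R * (count_mem p es)%:R = (sumn es)%:R :> R.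
  by rewrite -sum_ts_count_mul// natr_sum; apply: eq_bigr => p _; rewrite natrM.
have : (M%:R - L%:R) * (\sum_(p <- ts) p%:R * q p) <= M%:R - L%:R.
  by rewrite -[leRHS]mulr1 ler_wpM2l// subr_ge0 ler_nat.
have : #|H|%:R <= (sumn es)%:R + L%:R + n0%:R :> R.
  by rewrite -!natrD ler_nat ltnW.
have -> : (L%:R - M%:R) * (\sum_(p <- ts) p%:R * q p) =
   - ((M%:R - L%:R) * (\sum_(p <- ts) p%:R * q p)) by ring.
by set X := _ * \sum_(_ <- _) _; lra.
Qed.

(** Each cavity field is removed in turn and replaced by a p-edge with
    probability q p: both moves start from the same system, which is where the
    comparison of one edge with p fields applies. If the objects do not fit,
    the potential alone exceeds the trivial bound. *)
Lemma interpolation L es : all (mem ts) es -> (L <= M)%N ->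
  (sumn es + L <= #|H|)%N ->
  phi 0 es0 <= phi L es - L%:R * edge_correction + L%:R * step_err n0 +
    kap * potential es L.
Proof.
elim: L es => [|L IH] es ets LM esL.
  rewrite !mul0r oppr0 !addr0; apply: (le_trans (edges_compare ets _)).
    by rewrite addn0 in esL.
  rewrite lerD2l ler_wpM2l// /potential /count_err addrAC lerD2r.
  rewrite -big_split; apply: ler_sum => p _ /=.
  have := potential_abs (fluct p es 0) 1.
  rewrite /fluct mul0r addr0 sub0r mulNr mul1r expr1n mul1r.
  move: (M%:R * q p) => z; move: (count_mem p es)%:R => x.
  move: (count_mem p es0)%:R => y h.
  have := ler_normD (x - z) (z - y); rewrite addrA subrK.
  by move: h; set A := `|_|; set B := `|_|; set C := `|_|; lra.
(* If no n0 half-edges are left for the next move, the trivial bound for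
   adding and removing all the objects is below the potential. *)
have [fit|nofit] := leqP (sumn es + L + n0) #|H|; last first.
  have p3 := @potential_big es L.+1 ets LM ltac:(nlia).
  have [l1 l2] := @le_at_objects_Phi 0 L.+1 es ltac:(nlia).
  have [l3 l4] := @le_at_objects_Phi 0 0 es0 ltac:(nlia).
  have := l2 e0 finset.set0 e0_pos (cards0 _).
  have := l3 e0 finset.set0 e0_pos (cards0 _).
  rewrite -/(phi L.+1 es) -/(phi 0 es0) add0n.
  move=> h1 h2; apply: (le_trans h1); apply: (le_trans (lerD h2 (lexx _))).
  have -> : phi L.+1 es + (L.+1 + size es)%:R * kap + (size es0)%:R * kap =
      phi L.+1 es + (L.+1 + size es + size es0)%:R * kap.
    by rewrite [in RHS]natrD mulrDl addrA.
  have -> : forall x y z t : R, x - y + z + t = x + (z + t - y).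
    by move=> x y z t; ring.
  rewrite lerD2l.
  have esgt0 p : p \in es -> (0 < p)%N.
    by move=> /(allP ets)/ts_K/andP[].
  have k1 : (L.+1 + size es + size es0)%:R <= 2 * #|H|%:R :> R.
    rewrite -natrM ler_nat.
    rewrite mulSn mul1n; apply: leq_add.
      by apply: leq_trans esL; rewrite addnC leq_add2r size_le_sumn.
    by rewrite -es0_sum size_le_sumn.
  have k2 : L.+1%:R * edge_correction <= #|H|%:R * kap.
    apply: (@le_trans _ _ (L.+1%:R * kap)); first by rewrite ler_wpM2l// ler_normlW// edge_correction_bd.
    by rewrite ler_wpM2r// ler_nat; nlia.
  have k3 : 0 <= L.+1%:R * step_err n0 by rewrite mulr_ge0// step_err_ge0.
  have := ler_wpM2r kap_ge0 k1; have := ler_wpM2l kap_ge0 p3.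
  move: k2 k3; set A := L.+1%:R * edge_correction; set B := L.+1%:R * step_err _.
  set C := (L.+1 + _ + _)%:R; set Q := kap * potential _ _; set h := #|H|%:R.
  by lra.
pose bnd := fun (o : option nat) =>
  phi L (if o is Some p then p :: es else es).
pose pot := fun (o : option nat) =>
  potential (if o is Some p then p :: es else es) L.
have IHo o : o \in step_seq ->
  phi 0 es0 <= bnd o - L%:R * edge_correction + L%:R * step_err n0 + kap * pot o.
  rewrite inE => /predU1P[->|/mapP[p pts ->]]; apply: IH => //=.
  - exact: ltnW.
  - by apply: leq_trans esL; rewrite leq_add2l.
  - by rewrite ets andbT.
  - exact: ltnW.
  - apply: leq_trans fit; rewrite addnC -[(p + _)%N]addnC addnA leq_add //.
      by rewrite addnC.
    by have /andP[_ pK] := ts_K pts; exact: leq_trans pK K_n0.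
have wt_ge0 o : 0 <= step_wt o.
  by case: o => [p|] //=; rewrite subr_ge0 sum_q_le1.
have wt1 : \sum_(o <- step_seq) step_wt o = 1.
  have := step_sum (fun=> 1); under eq_bigr do rewrite mulr1.
  by move=> ->; rewrite mulr1 -mulr_suml mulr1 subrK.
have -> : phi 0 es0 = \sum_(o <- step_seq) step_wt o * phi 0 es0.
  by rewrite -mulr_suml wt1 mul1r.
have : \sum_(o <- step_seq) step_wt o * phi 0 es0 <=
   \sum_(o <- step_seq) step_wt o *
     (bnd o - L%:R * edge_correction + L%:R * step_err n0 + kap * pot o).
  by rewrite !big_seq; apply: ler_sum => o os; rewrite ler_wpM2l ?IHo.
move=> /le_trans; apply.
have -> : \sum_(o <- step_seq) step_wt o *
     (bnd o - L%:R * edge_correction + L%:R * step_err n0 + kap * pot o) =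
    \sum_(o <- step_seq) step_wt o * bnd o - L%:R * edge_correction + L%:R * step_err n0 +
    kap * \sum_(o <- step_seq) step_wt o * pot o.
  transitivity (\sum_(o <- step_seq) (step_wt o * bnd o +
      step_wt o * (L%:R * step_err n0 - L%:R * edge_correction) + kap * (step_wt o * pot o))).
    by apply: eq_bigr => o _; ring.
  by rewrite !big_split /= -mulr_suml wt1 mul1r -mulr_sumr; ring.
have s1 : \sum_(o <- step_seq) step_wt o * bnd o <= phi L.+1 es + (step_err n0 - edge_correction).
  have -> : \sum_(o <- step_seq) step_wt o * bnd o =
      objects_op L es (fun e U => \sum_(o <- step_seq) step_wt o * step_fun o e U)
        e0 finset.set0.
    rewrite objects_op_sum; apply: eq_bigr => -[p|] _ //; congr (_ * _).
    by rewrite /bnd /phi objects_op_edge.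
  rewrite /phi objects_op_field.
  apply: (@le_at_objects 0 L es) => //; last by rewrite cards0.
    by nlia.
  by apply: step_le => //; nlia.
have s2 : \sum_(o <- step_seq) step_wt o * pot o <= potential es L.+1.
  by rewrite step_sum /pot addrC; exact: potential_step.
have := ler_wpM2l kap_ge0 s2; rewrite -natr1.
set A := \sum_(_ <- _) _; set Q := kap * _; set Q' := kap * _.
by move: s1; rewrite -/A; move: (step_err n0) => se; lra.
Qed.

(** Only M of the half-edges take part in the moves; the fields on the others
    are added at the end, each at the cost kap. *)
Lemma interpolation_bound :
  phi 0 es0 <= phi #|H| [::] - #|H|%:R * edge_correction + M%:R * step_err n0 +
    2 * kap * (#|H| - M)%:R +
    kap * (count_err + (size ts)%:R * (delta / 2) + M%:R / (2 * delta)).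
Proof.
have MH : (M <= #|H|)%N by nlia.
have := @interpolation M [::] isT (leqnn _) MH.
have pM : potential [::] M <=
    count_err + (size ts)%:R * (delta / 2) + M%:R / (2 * delta).
  rewrite /potential; move: count_err => ce.
  rewrite -addrA lerD2l big_split /= sum_seq_const.
  rewrite lerD2l -mulr_suml ler_wpM2r//.
    by rewrite invr_ge0 mulr_ge0// ltW.
  rewrite /fluct; under eq_bigr do rewrite subrr mul0r addr0 expr0n /= add0r.
  by rewrite -big_distrr -[leRHS]mulr1 ler_wpM2l// sum_q_le1.
have : phi M [::] <= phi #|H| [::] + kap * (#|H| - M)%:R.
  have MHe : (0 + M + (#|H| - M) <= #|H|)%N by nlia.
  have [_ f2] := @le_at_fields_Phi M (#|H| - M) ltac:(nlia).
  have -> : phi #|H| [::] = objects_op M [::] (objects_op (#|H| - M) [::] Phi) e0 finset.set0.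
    by rewrite /phi /objects_op -iterD subnKC.
  rewrite mulrC; apply: (@le_at_objects 0 M [::]) => //=; last by rewrite cards0.
    by rewrite !addn0 add0n.
  by rewrite !addn0 add0n.
have : - M%:R * edge_correction <= - #|H|%:R * edge_correction + kap * (#|H| - M)%:R.
  rewrite natrB// mulrBr; have /ler_normlP[c1 c2] := edge_correction_bd.
  have : 0 <= (#|H|%:R - M%:R) * (kap - edge_correction) :> R.
    by rewrite mulr_ge0// subr_ge0// ler_nat.
  by rewrite !mulNr mulrBr !mulrBl (mulrC kap) (mulrC kap); lra.
have := ler_wpM2l kap_ge0 pM.
set A := kap * potential _ _; set B := kap * _; rewrite !mulNr.
have -> : 2 * kap * (#|H| - M)%:R = B + B by rewrite /B; ring.
move: A B => A B.
by set C := M%:R * step_err _; set Q := kap * (_ + _ + _); lra.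
Qed.

End interpolation_operators.

(** * Power series with nonnegative coefficients *)

Section positive_power_series.
Variable R : realType.

(** Functions that are uniform limits on [-r, r] of polynomials with
    nonnegative coefficients. *)
Definition pos_approx (f : R -> R) (r : R) : Prop :=
  forall eps, 0 < eps -> exists (N : nat) (c : nat -> R),
    (forall k, 0 <= c k) /\
    forall y, `|y| <= r -> `|f y - \sum_(k < N) c k * y ^+ k| <= eps.

(** Mean value inequality; the remainder of a partial sum of a power series is
    estimated through its derivative. *)
Lemma norm_le_derive (f df : R -> R) (r C : R) :
  (forall t : R, `|t| <= r -> is_derive t (1 : R) f (df t)) -> f 0 = 0 ->
  (forall t : R, `|t| <= r -> `|df t| <= C) ->
  forall y, `|y| <= r -> `|f y| <= C * r.
Proof.
move=> dfP f0 dfC y yr.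
have r0 : 0 <= r by exact: le_trans yr.
have C0 : 0 <= C by apply: le_trans (dfC 0 _); rewrite ?normr0.
have cf : forall a b : R, `|a| <= r -> `|b| <= r -> {within `[a, b], continuous f}.
  move=> a b ar br; apply: continuous_in_subspaceT => x.
  rewrite inE /= in_itv /= => /andP[ax xb].
  have xr : `|x| <= r.
    move: ar br; rewrite !ler_norml => /andP[ar _] /andP[_ br].
    by rewrite (le_trans ar ax) (le_trans xb br).
  apply: differentiable_continuous; apply/derivable1_diffP.
  by have [] := dfP x xr.
have [y0|y0] := leP 0 y.
  have [c cy E] : exists2 c, c \in `[0, y]%R & f y - f 0 = df c * (y - 0).
    apply: MVT_segment => //; last by apply: cf; rewrite ?normr0.
    move=> x; rewrite in_itv /= => /andP[x0 xy]; apply: dfP.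
    by rewrite ger0_norm ?ltW// (lt_le_trans xy)// (le_trans (ler_norm _)).
  have cr : `|c| <= r.
    move: cy; rewrite in_itv /= => /andP[c0 cy].
    by rewrite ger0_norm// (le_trans cy)// (le_trans (ler_norm _)).
  by rewrite -[f y]subr0 -f0 E subr0 normrM ler_pM ?normr_ge0 ?dfC.
have [c cy E] : exists2 c, c \in `[y, 0]%R & f 0 - f y = df c * (0 - y).
  apply: MVT_segment; rewrite ?ltW//; last by apply: cf; rewrite ?normr0.
  move=> x; rewrite in_itv /= => /andP[x0 xy]; apply: dfP.
  rewrite ltr0_norm// (le_trans _ yr)// ltr0_norm//.
  by rewrite lerN2 ltW.
have cr : `|c| <= r.
  move: cy; rewrite in_itv /= => /andP[c0 cy].
  by rewrite (ler0_norm cy) (le_trans _ yr)// ltr0_norm// lerN2.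
rewrite -[f y]opprK normrN -[- f y]add0r -[X in X - _]f0 E sub0r normrM normrN.
by rewrite ler_pM ?normr_ge0 ?dfC.
Qed.

Lemma is_derive_pow (n : nat) (t : R) :
  is_derive t (1 : R) (fun y : R => y ^+ n) (n%:R * t ^+ n.-1).
Proof.
elim: n => [|n IH].
  by rewrite mul0r; exact: (is_derive_cst (1 : R)).
have -> : (fun y : R => y ^+ n.+1) = (id : R -> R) * (fun y => y ^+ n).
  by apply/funext => y; rewrite exprS.
apply: (is_derive_eq (is_deriveM (is_derive_id t (1 : R)) IH)).
rewrite /GRing.scale /= mulr1 mulrCA -[in RHS]natr1 mulrDl mul1r.
congr (_ + _); case: n {IH} => [|n]; first by rewrite !mul0r.
by rewrite -exprS.
Qed.

Lemma expr_small (r C eps : R) : 0 <= r < 1 -> 0 < eps ->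
  exists N : nat, C * r ^+ N <= eps.
Proof.
move=> /andP[r0 r1] eps0.
have [C0|C0] := leP C 0.
  by exists 0%N; rewrite expr0 mulr1 (le_trans C0)// ltW.
have : (fun n => r ^+ n) @ \oo --> (0 : R) by apply: cvg_expr; rewrite ger0_norm.
move=> /cvgrPdist_le/(_ _ (divr_gt0 eps0 C0))[N _ /(_ N (leqnn N))].
rewrite sub0r normrN ger0_norm ?exprn_ge0// => h; exists N.
by rewrite mulrC -ler_pdivlMr.
Qed.

Lemma pos_approx_ln (r : R) : 0 < r < 1 -> pos_approx (fun y => - ln (1 - y)) r.
Proof.
move=> /andP[r0 r1] eps eps0.
have [|N hN] := @expr_small r (r / (1 - r)) eps _ eps0.
  by rewrite ltW.
exists N.+1, (fun k => k%:R^-1); split=> [k|y yr]; first by rewrite invr_ge0.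
pose S N := fun y : R => \sum_(k < N.+1) k%:R^-1 * y ^+ k.
have SS n : S n.+1 = S n + (n.+1%:R^-1 \*: (fun y : R => y ^+ n.+1)).
  by apply/funext => x; rewrite /S big_ord_recr.
have y1 t : `|t| <= r -> 0 < 1 - t.
  by rewrite subr_gt0 => tr; rewrite (le_lt_trans (ler_norm _)) ?(le_lt_trans tr).
have dS n t : `|t| <= r ->
    is_derive t (1 : R) (S n) ((1 - t ^+ n) / (1 - t)).
  move=> tr; elim: n => [|n IH].
    rewrite expr0 subrr mul0r.
    have -> : S 0%N = cst 0.
      by apply/funext => x; rewrite /S big_ord1 invr0 mul0r.
    exact: is_derive_cst.
  rewrite SS; apply: (is_derive_eq (is_deriveD IH (is_deriveZ _ (is_derive_pow n.+1 t)))).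
  rewrite /GRing.scale /= mulrA mulVf ?mul1r ?pnatr_eq0//.
  rewrite exprS; field; rewrite gt_eqF//.
  exact: y1.
have dl t : `|t| <= r -> is_derive t (1 : R) (fun y => - ln (1 - y)) ((1 - t)^-1).
  move=> tr.
  have d1 : is_derive t (1 : R) (fun y => 1 - y) (- 1).
    apply: is_derive_eq (is_deriveB (is_derive_cst (1 : R) t (1 : R)) (is_derive_id t (1 : R))) _.
    by rewrite sub0r.
  have d2 := is_derive1_ln (y1 t tr).
  have d3 : is_derive t (1 : R) (@ln R \o (fun y => 1 - y)) ((1 - t)^-1 * -1).
    by apply: is_derive1_comp.
  have := is_deriveN d3; rewrite mulrN1 opprK.
  exact.
have := @norm_le_derive ((fun y => - ln (1 - y)) - S N)
  (fun t => (1 - t)^-1 - (1 - t ^+ N) / (1 - t)) r (r ^+ N / (1 - r)) _ _ _ y yr.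
rewrite /S /=; move=> /(_ _ _ _)/le_trans; apply.
- by move=> t tr; apply: is_deriveB; [exact: dl|exact: dS].
- have -> : forall F G : R -> R, (F - G) 0 = F 0 - G 0 by [].
  rewrite subr0 ln1 oppr0 add0r.
  rewrite big_ord_recl big1 ?invr0 ?mul0r ?addr0 ?oppr0// => i _.
  by rewrite expr0n mulr0.
- move=> t tr; have t1 := y1 t tr.
  have -> : (1 - t)^-1 - (1 - t ^+ N) / (1 - t) = t ^+ N / (1 - t).
    by field; rewrite gt_eqF.
  rewrite normrM normrX normfV (gtr0_norm t1) ler_pM ?exprn_ge0 ?invr_ge0 ?(ltW t1)//.
    by rewrite lerXn2r ?nnegrE// ltW.
  rewrite lef_pV2 ?posrE ?t1 ?subr_gt0//.
  by rewrite lerD2l lerN2 (le_trans (ler_norm _)).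
have -> // : r ^+ N / (1 - r) * r = r / (1 - r) * r ^+ N.
by move: (r ^+ N) (1 - r)^-1 => u v; ring.
Qed.

Variable m : R.
Hypotheses (m_gt0 : 0 < m) (m_lt1 : m < 1).

(** The coefficients of the binomial series of (1 - x)^m. *)
Fixpoint bcoef (n : nat) : R :=
  if n is n'.+1 then bcoef n' * (n'%:R - m) / n'.+1%:R else 1.

Lemma bcoef_le0 n : bcoef n.+1 <= 0.
Proof.
elim: n => [|n IH]; first by rewrite /= mul1r sub0r divr1 oppr_le0 ltW.
rewrite [bcoef _.+2]/= -/(bcoef n.+1) -mulrA mulr_le0_ge0//.
rewrite mulr_ge0 ?invr_ge0// subr_ge0 (le_trans (ltW m_lt1))//.
by rewrite ler1n.
Qed.

Lemma bcoef_bd n : `|n%:R * bcoef n| <= 1.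
Proof.
case: n => [|n]; first by rewrite mul0r normr0.
elim: n => [|n IH].
  by rewrite /= mul1r mul1r sub0r divr1 normrN gtr0_norm ?ltW.
have -> : n.+2%:R * bcoef n.+2 = (n.+1%:R * bcoef n.+1) * ((n.+1%:R - m) / n.+1%:R).
  rewrite [bcoef n.+2]/= -/(bcoef n.+1); set A := n.+1%:R; set B := n.+2%:R.
  have A0 : A != 0 by rewrite pnatr_eq0.
  have B0 : B != 0 by rewrite pnatr_eq0.
  by rewrite [LHS]mulrC divfK// [RHS]mulrC mulrA divfK// mulrC.
rewrite normrM -[leRHS]mulr1 ler_pM ?normr_ge0//.
have n1 : (1 : R) <= n.+1%:R by rewrite ler1n.
rewrite ger0_norm; last by rewrite divr_ge0// subr_ge0 (le_trans (ltW m_lt1)).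
by rewrite ler_pdivrMr ?mul1r ?lerBlDr ?lerDl ?ltW// (lt_le_trans ltr01).
Qed.

(** bcoef_le0 holds because 0 < m < 1, and makes the coefficients of 1 - (1 -
    x)^m nonnegative. The partial sums satisfy the differential equation of (1
    - x)^m up to a small term, so that their quotient by it is almost
    constant. *)
Lemma pos_approx_powR (s : R) : 0 < s < 1 ->
  pos_approx (fun x => 1 - (1 - x) `^ m) s.
Proof.
move=> /andP[s0 s1] eps eps0.
have y1 t : `|t| <= s -> 0 < 1 - t.
  by rewrite subr_gt0 => tr; rewrite (le_lt_trans (ler_norm _)) ?(le_lt_trans tr).
set C := (1 - s) `^ (- m - 1) * s * 2 `^ m.
have [|N hN] := @expr_small s C eps _ eps0; first by rewrite ltW.
exists N.+2, (fun k => if k is 0 then 0 else - bcoef k); split=> [[//|k]|y ys].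
  by rewrite oppr_ge0 bcoef_le0.
pose S N := fun y : R => \sum_(k < N) bcoef k * y ^+ k.
have SS n : S n.+1 = S n + (bcoef n \*: (fun y : R => y ^+ n)).
  by apply/funext => x; rewrite /S big_ord_recr.
have -> : 1 - (1 - y) `^ m -
   \sum_(k < N.+2) (if nat_of_ord k is 0 then 0 else - bcoef k) * y ^+ k =
   S N.+2 y - (1 - y) `^ m.
  rewrite /S big_ord_recl [in RHS]big_ord_recl /= mul0r add0r mul1r expr0.
  have -> : \sum_(i < N.+1) - bcoef (bump 0 i) * y ^+ (bump 0 i) =
     - \sum_(i < N.+1) bcoef (bump 0 i) * y ^+ (bump 0 i).
    by rewrite -sumrN; apply: eq_bigr => i _; rewrite mulNr.
  by rewrite opprK addrAC.
pose dS n t := \sum_(k < n) bcoef k * (k%:R * t ^+ k.-1).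
have dSP n t : is_derive t (1 : R) (S n) (dS n t).
  elim: n => [|n IH].
    rewrite /dS big_ord0; have -> : S 0%N = cst 0.
      by apply/funext => x; rewrite /S big_ord0.
    exact: is_derive_cst.
  rewrite SS; apply: (is_derive_eq (is_deriveD IH (is_deriveZ _ (is_derive_pow n t)))).
  by rewrite /dS big_ord_recr.
have ode n t : (1 - t) * dS n t + m * S n t = - (n%:R * bcoef n * t ^+ n.-1).
  elim: n => [|n IH]; first by rewrite /dS /S !big_ord0 !mulr0 !mul0r addr0 oppr0.
  rewrite /dS /S !big_ord_recr /= -/(dS n t) -/(S n t) !mulrDr.
  have -> : (1 - t) * dS n t + (1 - t) * (bcoef n * (n%:R * t ^+ n.-1)) +
     (m * S n t + m * (bcoef n * t ^+ n)) = ((1 - t) * dS n t + m * S n t) +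
     ((1 - t) * (bcoef n * (n%:R * t ^+ n.-1)) + m * (bcoef n * t ^+ n)).
    by ring.
  rewrite {}IH; case: n => [|n] /=; first by rewrite expr0; field.
  rewrite exprS; set A := n.+1%:R; set B := n.+2%:R.
  have A0 : A != 0 by rewrite pnatr_eq0.
  have B0 : B != 0 by rewrite pnatr_eq0.
  set u := bcoef n * (n%:R - m) / A; rewrite [B * _]mulrC divfK//.
  by move: (t ^+ n) => T; ring.
pose g t := S N.+2 t * (1 - t) `^ (- m) - 1.
pose dg t := - (N.+2%:R * bcoef N.+2 * t ^+ N.+1) * (1 - t) `^ (- m - 1).
have dgP t : `|t| <= s -> is_derive t (1 : R) g (dg t).
  move=> ts; have t1 := y1 t ts.
  have d1 : is_derive t (1 : R) (fun y => 1 - y) (- 1).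
    apply: is_derive_eq (is_deriveB (is_derive_cst (1 : R) t (1 : R)) (is_derive_id t (1 : R))) _.
    by rewrite sub0r.
  have d2 := @is_derive1_powR R (- m) _ t1.
  have d3 : is_derive t (1 : R) ((@powR R ^~ (- m)) \o (fun y => 1 - y))
     ((- m * (1 - t) `^ (- m - 1)) * -1) by apply: is_derive1_comp.
  have d4 := is_deriveM (dSP N.+2 t) d3.
  have d5 := is_deriveB d4 (is_derive_cst (1 : R) t (1 : R)).
  apply: is_derive_eq d5 _.
  rewrite subr0 /dg -(ode N.+2 t) /GRing.scale /=.
  have -> : (1 - t) `^ (- m) = (1 - t) * (1 - t) `^ (- m - 1).
    have E : - m = 1 + (- m - 1) by rewrite addrC subrK.
    rewrite [in LHS]E.
    rewrite powRD; last by rewrite (gt_eqF t1) implybT.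
    by rewrite powRr1 ?(ltW t1).
  by ring.
have gy : `|g y| <= (s ^+ N.+1 * (1 - s) `^ (- m - 1)) * s.
  apply: (@norm_le_derive g dg s _ dgP) => //.
    rewrite /g /S subr0 powR1 mulr1 big_ord_recl big1 ?expr0 ?mulr1 ?addr0 ?subrr//.
    by move=> i _; rewrite expr0n mulr0.
  move=> t ts; rewrite /dg normrM normrN normrM normrX.
  rewrite (ger0_norm (powR_ge0 _ _)) ler_pM ?mulr_ge0 ?exprn_ge0 ?powR_ge0//.
    by rewrite -[leRHS]mul1r ler_pM ?exprn_ge0 ?bcoef_bd// lerXn2r ?nnegrE// ltW.
  have -> : - m - 1 = - (m + 1) by rewrite opprD.
  have p1 : 0 < 1 - s by rewrite subr_gt0.
  have p2 := y1 t ts.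
  rewrite !powRN lef_pV2 ?posrE ?powR_gt0//.
  apply: ge0_ler_powR; rewrite ?nnegrE ?(ltW p1) ?(ltW p2)//.
    by rewrite addr_ge0// ltW.
  by rewrite lerD2l lerN2 (le_trans (ler_norm _)).
have -> : S N.+2 y - (1 - y) `^ m = g y * (1 - y) `^ m.
  rewrite /g mulrBl mul1r -mulrA powRN mulVf ?mulr1// gt_eqF// powR_gt0//.
  exact: y1.
rewrite normrM (ger0_norm (powR_ge0 _ _)).
apply: (@le_trans _ _ ((s ^+ N.+1 * (1 - s) `^ (- m - 1)) * s * 2 `^ m)).
  rewrite ler_pM ?powR_ge0// ge0_ler_powR ?nnegrE ?(ltW m_gt0)//.
    by rewrite ltW// y1.
  move: ys; rewrite ler_norml => /andP[ys _]; lra.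
apply: le_trans hN; rewrite /C.
have -> : s ^+ N.+1 * (1 - s) `^ (- m - 1) * s * 2 `^ m =
  (1 - s) `^ (- m - 1) * s * 2 `^ m * s ^+ N.+1 by ring.
rewrite ler_wpM2l ?mulr_ge0 ?powR_ge0 ?(ltW s0)//.
by rewrite exprS -[leRHS]mul1r ler_wpM2r ?exprn_ge0 ?ltW.
Qed.

End positive_power_series.

(** * The logarithm of the edge functional in terms of replicas *)

Lemma wsum_gt0 (R : realType) (I : eqType) (r : seq I) (Q F : I -> R) :
  (forall i, i \in r -> 0 <= Q i) -> \sum_(i <- r) Q i = 1 ->
  (forall i, i \in r -> 0 < F i) -> 0 < \sum_(i <- r) Q i * F i.
Proof.
move=> Q0 Q1 F0; have [|all0] := boolP (has (fun i => 0 < Q i) r).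
  move=> /hasP[x xr x0]; rewrite (big_rem x)//= ltr_pwDl ?mulr_gt0 ?F0//.
  rewrite big_seq; apply: sumr_ge0 => y /mem_rem yr.
  by rewrite mulr_ge0 ?Q0// ltW// F0.
have : \sum_(i <- r) Q i = 0.
  rewrite big_seq big1// => x xr; apply/eqP; rewrite eq_le Q0// andbT leNgt.
  by move/hasPn: all0 => /(_ x xr).
by rewrite Q1 => /eqP; rewrite oner_eq0.
Qed.

Lemma ln_dist_le (R : realType) (c u v : R) : 0 < c -> c <= u -> c <= v ->
  `|ln u - ln v| <= `|u - v| / c.
Proof.
move=> c0.
have half x y : c <= x -> c <= y -> ln x - ln y <= `|x - y| / c.
  move=> cx cy; have x0 : 0 < x by exact: lt_le_trans cx.
  have y0 : 0 < y by exact: lt_le_trans cy.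
  rewrite -ln_div ?posrE//.
  have -> : x / y = 1 + (x - y) / y by field; rewrite gt_eqF.
  apply: (@le_trans _ _ ((x - y) / y)).
    apply: le_ln1Dx; rewrite -subr_gt0 opprK.
    have -> : (x - y) / y + 1 = x / y by field; rewrite gt_eqF.
    exact: divr_gt0.
  apply: (@le_trans _ _ (`|x - y| / y)).
    by rewrite ler_wpM2r ?invr_ge0 ?(ltW y0)// ler_norm.
  by rewrite ler_wpM2l// lef_pV2.
move=> cu cv; rewrite ler_norml half// andbT lerNl opprB (le_trans (half v u _ _))//.
by rewrite distrC.
Qed.

(** With y the average of 1 - (1 - s x)^m, the logarithm is log(1 - y); the
    two sums are the approximations of - log(1 - y) and of 1 - (1 - x)^m. The
    coefficients do not depend on the averages Q, x, hence can be chosen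
    before the randomness. *)
Definition log_approx (R : realType) (m s eps : R) (N1 N2 : nat)
    (c1 c2 : nat -> R) : Prop :=
  forall (I : eqType) (r : seq I) (Q x : I -> R),
    (forall i, i \in r -> 0 <= Q i) -> \sum_(i <- r) Q i = 1 ->
    (forall i, i \in r -> `|x i| <= 1) ->
    `|ln (\sum_(i <- r) Q i * (1 - s * x i) `^ m) +
      \sum_(k < N2) c2 k *
        (\sum_(n < N1) c1 n * \sum_(i <- r) Q i * x i ^+ n) ^+ k| <= eps.

Lemma log_approx_exists (R : realType) (m s eps : R) :
  0 < m -> m < 1 -> 0 < s < 1 -> 0 < eps ->
  exists N1 N2 c1 c2, [/\ forall n, 0 <= c1 n, forall n, 0 <= c2 n &
    log_approx m s eps N1 N2 c1 c2].
Proof.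
move=> m0 m1 s01 eps0; have /andP[s0 s1] := s01.
set t := (1 - s) `^ m.
have t0 : 0 < t by rewrite powR_gt0// subr_gt0.
have t1 : t < 1.
  have : (1 - s) `^ m < 1 `^ m.
    by apply: gt0_ltr_powR; rewrite ?nnegrE ?ler01 ?subr_ge0 ?(ltW s1)// ltrBlDr ltrDl.
  by rewrite powR1.
set r0 := Num.max s (1 - t).
have r01 : r0 < 1 by rewrite gt_max s1 /= ltrBlDr ltrDl.
have sr0 : s <= r0 by rewrite le_max lexx.
have tr0 : 1 - t <= r0 by rewrite le_max lexx orbT.
pose r1 := (1 + r0) / 2.
have r1_gt0 : 0 < r1 by rewrite /r1; lra.
have r1_lt1 : r1 < 1 by rewrite /r1; lra.
pose e1 := Num.min ((1 - r0) / 2) (eps / 2 * (1 - r1)).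
have e1_gt0 : 0 < e1.
  by rewrite lt_min !divr_gt0 ?mulr_gt0 ?subr_gt0 ?invr_gt0 ?ltr0n.
have [N1 [d1 [d10 h1]]] := pos_approx_powR m0 m1 s01 e1_gt0.
have e2_gt0 : 0 < eps / 2 by rewrite divr_gt0.
have r1P : 0 < r1 < 1 by rewrite r1_gt0.
have [N2 [c2 [c20 h2]]] := pos_approx_ln r1P e2_gt0.
exists N1, N2, (fun n => d1 n * s ^+ n), c2; split => // [n|].
  by rewrite mulr_ge0// exprn_ge0// ltW.
move=> I r Q x Q0 Q1 x1.
set y' := \sum_(n < N1) _.
set w := \sum_(i <- r) _.
have sx i : i \in r -> `|s * x i| <= s.
  by move=> ir; rewrite normrM gtr0_norm// -[leRHS]mulr1 ler_wpM2l ?x1 ?ltW.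
have y'E : y' = \sum_(i <- r) Q i * \sum_(n < N1) d1 n * (s * x i) ^+ n.
  rewrite /y'; under eq_bigr do rewrite mulr_sumr.
  rewrite exchange_big; apply: eq_bigr => i _ /=; rewrite mulr_sumr.
  by apply: eq_bigr => n _; rewrite exprMn; ring.
have wE : 1 - w = \sum_(i <- r) Q i * (1 - (1 - s * x i) `^ m).
  by under [RHS]eq_bigr do rewrite mulrBr mulr1; rewrite sumrB Q1.
have meanB (F : I -> R) C : (forall i, i \in r -> `|F i| <= C) ->
    `|\sum_(i <- r) Q i * F i| <= C.
  move=> FC; apply: (le_trans (ler_norm_sum _ _ _)).
  rewrite -[leRHS]mul1r -Q1 mulr_suml !big_seq; apply: ler_sum => i ir.
  by rewrite normrM ger0_norm ?Q0// ler_wpM2l ?Q0 ?FC.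
have yy' : `|1 - w - y'| <= e1.
  rewrite wE y'E -sumrB; under eq_bigr do rewrite -mulrBr.
  by apply: meanB => i ir; apply: h1; exact: sx.
have phi_bd i : i \in r -> `|1 - (1 - s * x i) `^ m| <= r0.
  move=> ir; have := sx i ir; rewrite ler_norml => /andP[l1 l2].
  rewrite ler_norml; apply/andP; split.
    apply: (@le_trans _ _ (- s)); first by rewrite lerN2.
    have : (1 - s * x i) `^ m <= (1 + s) `^ m.
      by rewrite ge0_ler_powR ?nnegrE ?(ltW m0)//; lra.
    have : (1 + s) `^ m <= 1 + s by rewrite ler1_powR// ?ltW//; lra.
    lra.
  apply: le_trans tr0; rewrite lerD2l lerN2 /t.
  by rewrite ge0_ler_powR ?nnegrE ?(ltW m0)//; lra.
have wB : `|1 - w| <= r0 by rewrite wE; exact: meanB.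
have y'B : `|y'| <= r1.
  have -> : y' = (1 - w) - (1 - w - y') by ring.
  rewrite (le_trans (ler_normB _ _))//.
  have : e1 <= (1 - r0) / 2 by rewrite ge_min lexx.
  move: wB yy'; rewrite /r1; set A := `|_|; set B := `|_|; lra.
have := h2 y' y'B.
have le_r : r0 <= r1 by rewrite /r1; lra.
have w1 : 1 - r1 <= w.
  by move: wB; rewrite ler_norml => /andP[_ ?]; lra.
have w2 : 1 - r1 <= 1 - y'.
  by move: y'B; rewrite ler_norml => /andP[_ ?]; lra.
have r1s : 0 < 1 - r1 by rewrite subr_gt0.
have := ln_dist_le r1s w1 w2.
have : `|w - (1 - y')| / (1 - r1) <= eps / 2.
  rewrite ler_pdivrMr//; have -> : w - (1 - y') = - (1 - w - y') by ring.
  rewrite normrN (le_trans yy')// ge_min.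
  by rewrite lexx orbT.
set P := \sum_(k < N2) _; move=> l1 l2 l3.
have -> : ln w + P = (ln w - ln (1 - y')) - (- ln (1 - y') - P) by ring.
apply: (le_trans (ler_normB _ _)); have := le_trans l2 l1.
by move: l3; set A := `|_|; set B := `|_|; lra.
Qed.

Section replica_polynomials.
Variables (R : realType) (J IZ : Type).

(** A function of a random spin function that keeps its meaning in every case
    of the comparison: its expectation exists when f is bounded, and it is
    nonnegative when f is. *)
Definition nice (F : (bool -> R) -> R) : Prop :=
  [/\ measurable_fun [set: funspace R bool] (F : funspace R bool -> R),
      forall C, exists D, forall f, (forall s, `|f s| <= C) -> `|F f| <= D &
      forall f, (forall s, 0 <= f s) -> 0 <= F f].

Lemma nice_eval s : nice (fun f => f s).
Proof.
split=> [|C|f]; [|by exists C|exact].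
move=> _ B mB; rewrite setTI; apply: sub_sigma_algebra.
by exists s, B; split.
Qed.

Lemma nice_cst (c : R) : 0 <= c -> nice (fun=> c).
Proof.
move=> c0; split=> [|C|//]; first exact: measurable_cst.
by exists `|c|.
Qed.

Lemma niceM F G : nice F -> nice G -> nice (fun f => F f * G f).
Proof.
move=> [mF bF pF] [mG bG pG]; split=> [|C|f f0].
- exact: measurable_realfun.measurable_funM.
- have [D hD] := bF C; have [D' hD'] := bG C; exists (D * D') => f fC.
  by rewrite normrM ler_pM ?hD ?hD'.
- by rewrite mulr_ge0 ?pF ?pG.
Qed.

Lemma niceD F G : nice F -> nice G -> nice (fun f => F f + G f).
Proof.
move=> [mF bF pF] [mG bG pG]; split=> [|C|f f0].
- exact: measurable_realfun.measurable_funD.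
- have [D hD] := bF C; have [D' hD'] := bG C; exists (D + D') => f fC.
  by rewrite (le_trans (ler_normD _ _))// lerD ?hD ?hD'.
- by rewrite addr_ge0 ?pF ?pG.
Qed.

Lemma nice_sum (I : Type) (s : seq I) (F : I -> (bool -> R) -> R) :
  (forall i, nice (F i)) -> nice (fun f => \sum_(i <- s) F i f).
Proof.
move=> nF; elim: s => [|i s IH].
  rewrite (_ : (fun f => _) = fun=> 0); first exact: nice_cst.
  by apply/funext => f; rewrite big_nil.
rewrite (_ : (fun f => _) = fun f => F i f + \sum_(i <- s) F i f).
  exact: niceD.
by apply/funext => f; rewrite big_cons.
Qed.

Lemma nice_prod (I : Type) (s : seq I) (F : I -> (bool -> R) -> R) :
  (forall i, nice (F i)) -> nice (fun f => \prod_(i <- s) F i f).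
Proof.
move=> nF; elim: s => [|i s IH].
  rewrite (_ : (fun f => _) = fun=> 1); first exact: nice_cst.
  by apply/funext => f; rewrite big_nil.
rewrite (_ : (fun f => _) = fun f => F i f * \prod_(i <- s) F i f).
  exact: niceM.
by apply/funext => f; rewrite big_cons.
Qed.

Lemma nice_exp F n : nice F -> nice (fun f => F f ^+ n).
Proof.
move=> nF; rewrite (_ : (fun f => _) = fun f => \prod_(i <- iota 0 n) F f).
  exact: nice_prod.
by apply/funext => f; rewrite big_const_seq count_predT size_iota iter_mulr_1.
Qed.

(** Monomials in the replicas. A position of the edge carries either a vertex
    (factor fact_vertex) or a cavity field (factor fact_cavity); which of the
    two is decided at evaluation, so that one monomial describes the edge, the
    cavity field and the compensating term at once. *)
Record monomial := Monomial {
  degree : nat;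
  coef : R;
  fact_vertex : (bool -> R) -> J -> R;
  fact_cavity : (bool -> R) -> IZ -> R }.

Definition wf_monomial (M : monomial) : Prop :=
  [/\ 0 <= coef M, forall j, nice (fact_vertex M ^~ j) &
      forall i, nice (fact_cavity M ^~ i)].

Section evaluation.
Variables (p : nat) (pos : 'I_p -> bool) (b : R) (f : 'I_p -> bool -> R)
  (o : 'I_p -> J) (z : 'I_p -> IZ).

Definition mval (M : monomial) : R :=
  coef M * ((- b) ^+ degree M *
    \prod_l (if pos l then fact_vertex M (f l) (o l)
             else fact_cavity M (f l) (z l))).

Definition pval (P : seq monomial) : R := \sum_(M <- P) mval M.

End evaluation.

Definition mmul (M M' : monomial) : monomial :=
  Monomial (degree M + degree M') (coef M * coef M')
    (fun f j => fact_vertex M f j * fact_vertex M' f j)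
    (fun f i => fact_cavity M f i * fact_cavity M' f i).

Definition mscale (c : R) (M : monomial) : monomial :=
  Monomial (degree M) (c * coef M) (fact_vertex M) (fact_cavity M).

Definition mone : monomial := Monomial 0 1 (fun _ _ => 1) (fun _ _ => 1).

Definition pmul (P Q : seq monomial) : seq monomial :=
  [seq mmul M M' | M <- P, M' <- Q].

Definition pscale (c : R) (P : seq monomial) := map (mscale c) P.

Fixpoint pexp (P : seq monomial) (n : nat) : seq monomial :=
  if n is n'.+1 then pmul P (pexp P n') else [:: mone].

Definition pcomb (c : nat -> R) (P : nat -> seq monomial) (N : nat) :=
  flatten [seq pscale (c n) (P n) | n <- iota 0 N].

Definition wf_poly (P : seq monomial) : Prop := List.Forall wf_monomial P.

Lemma pval_mul p (pos : 'I_p -> bool) b f o z P Q :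
  pval pos b f o z (pmul P Q) = pval pos b f o z P * pval pos b f o z Q.
Proof.
rewrite /pval /pmul big_allpairs_dep mulr_suml; apply: eq_bigr => M _ /=.
rewrite mulr_sumr; apply: eq_bigr => M' _; rewrite /mval /=.
have -> : \prod_l (if pos l then fact_vertex M (f l) (o l) * fact_vertex M' (f l) (o l)
     else fact_cavity M (f l) (z l) * fact_cavity M' (f l) (z l)) =
   (\prod_l (if pos l then fact_vertex M (f l) (o l) else fact_cavity M (f l) (z l))) *
   (\prod_l (if pos l then fact_vertex M' (f l) (o l) else fact_cavity M' (f l) (z l))).
  by rewrite -big_split; apply: eq_bigr => l _; case: (pos l).
by rewrite exprD; ring.
Qed.

Lemma pval_scale p (pos : 'I_p -> bool) b f o z c P :
  pval pos b f o z (pscale c P) = c * pval pos b f o z P.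
Proof.
rewrite /pval /pscale big_map mulr_sumr; apply: eq_bigr => M _.
by rewrite /mval /= mulrA.
Qed.

Lemma pval_exp p (pos : 'I_p -> bool) b f o z P n :
  pval pos b f o z (pexp P n) = pval pos b f o z P ^+ n.
Proof.
elim: n => [|n IH] /=; last by rewrite pval_mul IH exprS.
rewrite /pval big_seq1 /mval /= expr0 !mul1r big1// => l _.
by case: (pos l).
Qed.

Lemma pval_comb p (pos : 'I_p -> bool) b f o z c P N :
  pval pos b f o z (pcomb c P N) = \sum_(n < N) c n * pval pos b f o z (P n).
Proof.
rewrite -(big_mkord xpredT (fun n => c n * pval pos b f o z (P n))).
rewrite /index_iota subn0 /pcomb.
elim: (iota 0 N) => [|n s IH]; first by rewrite big_nil /pval big_nil.
by rewrite big_cons -IH -pval_scale /pval /= big_cat.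
Qed.

Lemma wf_poly_cat P Q : wf_poly P -> wf_poly Q -> wf_poly (P ++ Q).
Proof. by move=> hP hQ; apply/List.Forall_app; split. Qed.

Lemma wf_poly_mul P Q : wf_poly P -> wf_poly Q -> wf_poly (pmul P Q).
Proof.
move=> hP hQ; rewrite /pmul; elim: hP => [|M {}P wM _ IH]; first by constructor.
rewrite /=; apply: wf_poly_cat => //.
elim: hQ {IH} => [|M' {}Q wM' _ IHQ]; first by constructor.
constructor => //; move: wM wM' => [c0 nv nc] [c0' nv' nc'].
by split=> [|j|i] /=; [exact: mulr_ge0|exact: niceM|exact: niceM].
Qed.

Lemma wf_poly_scale c P : 0 <= c -> wf_poly P -> wf_poly (pscale c P).
Proof.
move=> c0; elim=> [|M {}P [cM nv nc] _ IH]; first by constructor.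
by constructor => //; split=> //=; exact: mulr_ge0.
Qed.

Lemma wf_poly_exp P n : wf_poly P -> wf_poly (pexp P n).
Proof.
move=> hP; elim: n => [|n IH] /=; last exact: wf_poly_mul.
by constructor => //; split=> //= *; exact: nice_cst.
Qed.

Lemma wf_poly_comb c P N : (forall n, 0 <= c n) -> (forall n, wf_poly (P n)) ->
  wf_poly (pcomb c P N).
Proof.
move=> c0 hP; rewrite /pcomb; elim: (iota 0 N) => [|n s IH]; first by constructor.
by apply: wf_poly_cat => //; exact: wf_poly_scale.
Qed.

End replica_polynomials.

Section edge_functionals.
Variables (R : realType) (m : R).
Hypotheses (m_gt0 : 0 < m) (m_lt1 : m < 1).
Variables (p : nat) (T J IZ G : finType).
Variables (sp : J -> T -> bool) (zg : IZ -> G -> R) (xg : G -> R).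
Hypotheses (zg_ge0 : forall i g, 0 <= zg i g)
  (zg_sum : forall i, \sum_g zg i g = 1).
Variable e : ens R T.
Hypotheses (e_sum : \sum_(x <- e) x.1 = 1) (e_ge0 : forall x, x \in e -> 0 <= x.1)
  (e_gt0 : forall x, x \in e -> forall t, 0 < x.2 t)
  (e_prob : forall x, x \in e -> \sum_t x.2 t = 1).

Definition spin_prob (x : R) (s : bool) : R :=
  expR (x * spin_val R s) / \sum_s' expR (x * spin_val R s').

Definition spin_avg (x : R) (f : bool -> R) : R := \sum_s spin_prob x s * f s.

Lemma spin_norm_gt0 (x : R) : 0 < \sum_s' expR (x * spin_val R s').
Proof. by rewrite big_bool addr_gt0 ?expR_gt0. Qed.

Lemma spin_prob_gt0 x s : 0 < spin_prob x s.
Proof. by rewrite divr_gt0 ?expR_gt0 ?spin_norm_gt0. Qed.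

Lemma spin_prob_sum x : \sum_s spin_prob x s = 1.
Proof. by rewrite -mulr_suml divff// gt_eqF// spin_norm_gt0. Qed.

(** The n-th power of an average over configurations is an average over n
    independent replicas tau: a vertex contributes the product of the values
    of f at its n spins, a cavity variable its n-th moment. *)
Definition base_monomial (n : nat) (x : R * (T -> R)) (tau : {ffun 'I_n -> T})
  : monomial R J IZ :=
  Monomial n (x.1 * \prod_(i < n) x.2 (tau i))
    (fun f j => \prod_(i < n) f (sp j (tau i)))
    (fun f i => \sum_g zg i g * spin_avg (xg g) f ^+ n).

Definition base_poly (n : nat) : seq (monomial R J IZ) :=
  [seq base_monomial x tau | x <- e, tau <- index_enum {ffun 'I_n -> T}].

Lemma wf_base_poly n : wf_poly (base_poly n).
Proof.
rewrite /base_poly.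
suff wfe e' : (forall x, x \in e' -> x \in e) -> wf_poly
    [seq base_monomial x tau | x <- e', tau <- index_enum {ffun 'I_n -> T}].
  exact: wfe.
elim: e' => [|x e' IH] sub; first by constructor.
apply: wf_poly_cat; last first.
  by apply: IH => y ye; apply: sub; rewrite inE ye orbT.
have xe : x \in e by apply: sub; rewrite mem_head.
elim: (index_enum _) => [|tau s IHs]; constructor => //.
split=> [|j|i] /=.
- rewrite mulr_ge0 ?e_ge0// prodr_ge0// => i _; exact/ltW/e_gt0.
- by apply: nice_prod => i; exact: nice_eval.
- apply: nice_sum => g; apply: niceM; first exact: nice_cst.
  apply: nice_exp; apply: nice_sum => s'.
  by apply: niceM; [exact/nice_cst/ltW/spin_prob_gt0|exact: nice_eval].
Qed.

Definition log_poly (N1 N2 : nat) (c1 c2 : nat -> R) : seq (monomial R J IZ) :=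
  pcomb c2 (fun k => pexp (pcomb c1 base_poly N1) k) N2.

Lemma wf_log_poly N1 N2 c1 c2 : (forall n, 0 <= c1 n) -> (forall n, 0 <= c2 n) ->
  wf_poly (log_poly N1 N2 c1 c2).
Proof.
move=> c10 c20; apply: wf_poly_comb => // k; apply: wf_poly_exp.
by apply: wf_poly_comb => // n; exact: wf_base_poly.
Qed.

Section position.
Variables (pos : 'I_p -> bool) (o : 'I_p -> J) (z : 'I_p -> IZ).

(** At a position of the edge that lies on a vertex the spin is that of the
    vertex; at the others it is distributed according to the cavity variable. *)
Definition position_wt (t : T) (g : 'I_p -> G) (l : 'I_p) (s : bool) : R :=
  if pos l then (s == sp (o l) t)%:R else spin_prob (xg (g l)) s.

Definition edge_avg (A : config p -> R) (t : T) (g : 'I_p -> G) : R :=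
  \sum_(c : config p) (\prod_l position_wt t g l (c l)) * A c.

Definition cavity_wt (g : 'I_p -> G) : R := \prod_l zg (z l) (g l).

(** pos decides which positions of the edge lie on vertices. All positions,
    the last one and none give the edge itself, a cavity field and the term
    c(p). *)
Definition edge_mass (A : config p -> R) : R :=
  esum e (fun gam => \sum_(g : {ffun 'I_p -> G})
    cavity_wt g * (\sum_t gam t * edge_avg A t g) `^ m).

Definition edge_log (A : config p -> R) : R := ln (edge_mass A).

Lemma position_wt_ge0 t g l s : 0 <= position_wt t g l s.
Proof. by rewrite /position_wt; case: (pos l) => //; exact/ltW/spin_prob_gt0. Qed.

Lemma position_wt_sum t g l : \sum_s position_wt t g l s = 1.
Proof.
rewrite /position_wt; case: (pos l); last exact: spin_prob_sum.
by rewrite big_bool; case: (sp _ _); rewrite /= ?addr0 ?add0r.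
Qed.

Lemma prod_position_wt_sum t g :
  \sum_(c : config p) \prod_l position_wt t g l (c l) = 1.
Proof.
rewrite -(bigA_distr_bigA (fun l s => position_wt t g l s)) big1// => l _.
exact: position_wt_sum.
Qed.

Lemma cavity_wt_ge0 g : 0 <= cavity_wt g.
Proof. exact: prodr_ge0. Qed.

Lemma cavity_wt_sum : \sum_(g : {ffun 'I_p -> G}) cavity_wt g = 1.
Proof.
by rewrite /cavity_wt -(bigA_distr_bigA (fun l => zg (z l))) big1.
Qed.

Lemma edge_avg_le A B c t g : (forall s, A s <= c * B s) ->
  edge_avg A t g <= c * edge_avg B t g.
Proof.
move=> AB; rewrite /edge_avg mulr_sumr; apply: ler_sum => s _.
by rewrite mulrCA ler_wpM2l// prodr_ge0// => l _; exact: position_wt_ge0.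
Qed.

Lemma edge_avg_cst c t g : edge_avg (fun=> c) t g = c.
Proof. by rewrite /edge_avg -mulr_suml prod_position_wt_sum mul1r. Qed.

Lemma edge_avg_ge A t g c : (forall s, c <= A s) -> c <= edge_avg A t g.
Proof.
move=> cA; rewrite -[leLHS](edge_avg_cst c t g).
rewrite -[leRHS]mul1r; apply: edge_avg_le => s; by rewrite mul1r.
Qed.

Lemma edge_avg_gt0 A t g : (forall s, 0 < A s) -> 0 < edge_avg A t g.
Proof.
move=> A0; have [s0 _ hs0] := @arg_minP _ R _ [ffun=> false] xpredT A isT.
by apply: lt_le_trans (edge_avg_ge (c := A s0) t g _) => // s; exact: hs0.
Qed.

Lemma sum_gam_gt0 x A g : x \in e -> (forall s, 0 < A s) ->
  0 < \sum_t x.2 t * edge_avg A t g.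
Proof.
move=> xe A0; have [t _|T0] := pickP (@predT T).
  rewrite (bigD1 t)//= ltr_pwDl// ?mulr_gt0 ?e_gt0 ?edge_avg_gt0//.
  by apply: sumr_ge0 => u _; rewrite ltW// mulr_gt0 ?e_gt0 ?edge_avg_gt0.
have := e_prob xe; rewrite big_pred0 => [/esym/eqP|t]; last by have := T0 t.
by rewrite oner_eq0.
Qed.

Definition system_pairs : seq ((R * (T -> R)) * {ffun 'I_p -> G}) :=
  [seq (x, g) | x <- e, g <- index_enum {ffun 'I_p -> G}].

Lemma system_pairsE F :
  esum e (fun gam => \sum_(g : {ffun 'I_p -> G}) cavity_wt g * F gam g) =
  \sum_(u <- system_pairs) u.1.1 * cavity_wt u.2 * F u.1.2 u.2.
Proof.
rewrite /system_pairs big_allpairs; apply: eq_bigr => x _.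
by rewrite mulr_sumr; apply: eq_bigr => g _; rewrite mulrA.
Qed.

Lemma system_pairs_ge0 u : u \in system_pairs -> 0 <= u.1.1 * cavity_wt u.2.
Proof.
move=> /allpairsP[[x g] /= [xe _ ->]] /=.
by rewrite mulr_ge0 ?e_ge0 ?cavity_wt_ge0.
Qed.

Lemma system_pairs_sum : \sum_(u <- system_pairs) u.1.1 * cavity_wt u.2 = 1.
Proof.
have := system_pairsE (fun _ _ => 1); under [RHS]eq_bigr do rewrite mulr1.
move=> <-; rewrite -[RHS]e_sum; apply: eq_bigr => x _.
by under eq_bigr do rewrite mulr1; rewrite cavity_wt_sum mulr1.
Qed.

Lemma mem_system_pairs u : u \in system_pairs -> u.1 \in e.
Proof. by move=> /allpairsP[[x g] /= [xe _ ->]]. Qed.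

Lemma edge_mass_gt0 A : (forall s, 0 < A s) -> 0 < edge_mass A.
Proof.
move=> A0; rewrite /edge_mass.
rewrite (system_pairsE (fun gam g => (\sum_t gam t * edge_avg A t g) `^ m)).
apply: wsum_gt0 => [u /system_pairs_ge0//||u /mem_system_pairs ue].
  exact: system_pairs_sum.
by rewrite powR_gt0// sum_gam_gt0.
Qed.

Lemma edge_log_le A B c : (forall s, 0 < A s) -> (forall s, 0 < B s) ->
  (forall s, A s <= expR c * B s) -> edge_log A <= m * c + edge_log B.
Proof.
move=> A0 B0 AB; rewrite -[m * c]expRK -lnM ?posrE ?expR_gt0 ?edge_mass_gt0//.
rewrite ler_ln ?posrE ?mulr_gt0 ?expR_gt0 ?edge_mass_gt0// /edge_mass -esumZ.
rewrite /esum !big_seq; apply: ler_sum => x xe; rewrite ler_wpM2l ?e_ge0//.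
rewrite mulr_sumr; apply: ler_sum => g _.
rewrite mulrCA ler_wpM2l ?cavity_wt_ge0//.
have -> : expR (m * c) = expR c `^ m by rewrite mulrC expRM.
rewrite -powRM ?expR_ge0//; last exact/ltW/sum_gam_gt0.
apply: ge0_ler_powR; rewrite ?nnegrE ?(ltW m_gt0) ?(ltW (sum_gam_gt0 _ _ _))//.
  by rewrite mulr_ge0 ?expR_ge0// ltW// sum_gam_gt0.
rewrite mulr_sumr; apply: ler_sum => t _.
by rewrite mulrCA ler_wpM2l ?(ltW (e_gt0 _ _))// edge_avg_le.
Qed.

Section factorised.
Variables (b : R) (f : 'I_p -> bool -> R).

Definition edge_prod (t : T) (g : 'I_p -> G) : R :=
  \prod_l (if pos l then f l (sp (o l) t) else spin_avg (xg (g l)) (f l)).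

Lemma edge_avg_prod t g :
  edge_avg (fun c => \prod_l f l (c l)) t g = edge_prod t g.
Proof.
rewrite /edge_avg; under eq_bigr do rewrite -big_split.
rewrite -(bigA_distr_bigA (fun l s => position_wt t g l s * f l s)).
apply: eq_bigr => l _; rewrite /position_wt /spin_avg; case: (pos l) => //.
by rewrite big_bool; case: (sp _ _); rewrite /= !mul1r !mul0r ?addr0 ?add0r.
Qed.

Definition replica_mean (gam : T -> R) (g : 'I_p -> G) : R :=
  \sum_t gam t * edge_prod t g.

Lemma edge_avg_factorised a c t g :
  edge_avg (fun s => a * (1 + c * \prod_l f l (s l))) t g =
  a * (1 + c * edge_prod t g).
Proof.
rewrite -edge_avg_prod /edge_avg.
have -> : \sum_(s : config p) (\prod_l position_wt t g l (s l)) *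
   (a * (1 + c * \prod_l f l (s l))) =
  \sum_(s : config p) (a * (\prod_l position_wt t g l (s l)) +
   a * c * ((\prod_l position_wt t g l (s l)) * \prod_l f l (s l))).
  by apply: eq_bigr => s _; ring.
by rewrite big_split -!mulr_sumr /= prod_position_wt_sum; ring.
Qed.

(** Sums of products over replicas and over cavity variables factorise
    position by position. *)
Lemma pval_base n : pval pos b f o z (base_poly n) =
  esum e (fun gam => \sum_(g : {ffun 'I_p -> G})
    cavity_wt g * (- b * replica_mean gam g) ^+ n).
Proof.
rewrite /pval /base_poly big_allpairs_dep; apply: eq_bigr => x _ /=.
pose X t := \prod_l (if pos l then f l (sp (o l) t) else 1).
pose Y (g : 'I_p -> G) := \prod_l (if pos l then 1 else spin_avg (xg (g l)) (f l)).
have XY t g : edge_prod t g = X t * Y g.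
  rewrite /edge_prod -big_split; apply: eq_bigr => l _ /=.
  by case: (pos l); rewrite ?mulr1 ?mul1r.
pose Z := \prod_l (if pos l then 1 else
   \sum_g zg (z l) g * spin_avg (xg g) (f l) ^+ n).
have -> : \sum_(g : {ffun 'I_p -> G}) cavity_wt g * (- b * replica_mean x.2 g) ^+ n
    = (- b) ^+ n * (\sum_t x.2 t * X t) ^+ n * Z.
  have -> : Z = \sum_(g : {ffun 'I_p -> G}) cavity_wt g * Y g ^+ n.
    rewrite /Z /cavity_wt /Y; under [RHS]eq_bigr do rewrite -prodrXl -big_split.
    rewrite -(bigA_distr_bigA (fun l g => zg (z l) g *
       (if pos l then 1 else spin_avg (xg g) (f l)) ^+ n)).
    apply: eq_bigr => l _; case: (pos l) => //.
    by under eq_bigr do rewrite expr1n mulr1; rewrite zg_sum.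
  rewrite mulr_sumr; apply: eq_bigr => g _.
  rewrite /replica_mean; under eq_bigr do rewrite XY mulrA.
  by rewrite -mulr_suml !exprMn; ring.
have -> : (\sum_t x.2 t * X t) ^+ n =
   \sum_(tau : {ffun 'I_n -> T}) (\prod_(i < n) x.2 (tau i)) *
      \prod_(i < n) X (tau i).
  under [RHS]eq_bigr do rewrite -big_split.
  rewrite -(bigA_distr_bigA (fun (i : 'I_n) t => x.2 t * X t)).
  by rewrite big_const_ord iter_mulr_1.
rewrite mulrAC mulr_sumr mulr_sumr; apply: eq_bigr => tau _; rewrite /mval /=.
have -> : \prod_l (if pos l then \prod_(i < n) f l (sp (o l) (tau i))
    else \sum_g zg (z l) g * spin_avg (xg g) (f l) ^+ n) =
  (\prod_(i < n) X (tau i)) * Z.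
  rewrite /Z exchange_big -big_split; apply: eq_bigr => l _ /=.
  case: (pos l); first by rewrite mulr1.
  by rewrite big1_eq mul1r.
by ring.
Qed.

Hypothesis prod_le1 : forall c : config p, `|b * \prod_l f l (c l)| <= 1.

Lemma replica_mean_le1 x g : x \in e -> `|b * replica_mean x.2 g| <= 1.
Proof.
move=> xe; rewrite /replica_mean mulr_sumr.
apply: (le_trans (ler_norm_sum _ _ _)).
rewrite -[leRHS](e_prob xe); apply: ler_sum => t _.
rewrite mulrCA normrM gtr0_norm ?e_gt0// -[leRHS]mulr1 ler_wpM2l ?(ltW (e_gt0 _ _))//.
rewrite -edge_avg_prod /edge_avg mulr_sumr.
apply: (le_trans (ler_norm_sum _ _ _)).
rewrite -[leRHS](prod_position_wt_sum t g); apply: ler_sum => c _.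
have w0 : 0 <= \prod_l position_wt t g l (c l).
  by apply: prodr_ge0 => l _; exact: position_wt_ge0.
by rewrite mulrCA normrM (ger0_norm w0) -[leRHS]mulr1 ler_wpM2l.
Qed.

Lemma edge_mass_factorised a s : 0 < a -> 0 < s < 1 ->
  edge_mass (fun c => a * (1 + s * b * \prod_l f l (c l))) =
  a `^ m * esum e (fun gam => \sum_(g : {ffun 'I_p -> G})
     cavity_wt g * (1 - s * (- b * replica_mean gam g)) `^ m).
Proof.
move=> a0 /andP[s0 s1]; rewrite -esumZ /edge_mass /esum big_seq [RHS]big_seq.
apply: eq_bigr => x xe; congr (_ * _); rewrite mulr_sumr.
apply: eq_bigr => g _; rewrite mulrCA; congr (_ * _).
have -> : \sum_t x.2 t * edge_avg (fun c => a * (1 + s * b * \prod_l f l (c l))) t g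
  = a * (1 - s * (- b * replica_mean x.2 g)).
  under eq_bigr do rewrite edge_avg_factorised.
  rewrite /replica_mean.
  have -> : \sum_t x.2 t * (a * (1 + s * b * edge_prod t g)) =
    \sum_t (a * x.2 t + a * s * b * (x.2 t * edge_prod t g)).
    by apply: eq_bigr => t _; ring.
  by rewrite big_split -!mulr_sumr /= e_prob//; ring.
rewrite powRM ?(ltW a0)//.
have := replica_mean_le1 g xe; rewrite ler_norml => /andP[h1 h2].
rewrite mulNr mulrN opprK; nra.
Qed.

Variable s : R.
Hypothesis s01 : 0 < s < 1.

(** The logarithm of the edge functional is, up to a constant, minus a power
    series in -b with nonnegative coefficients in the replica monomials. *)
Lemma edge_log_poly eps N1 N2 c1 c2 a : 0 < a ->
  log_approx m s eps N1 N2 c1 c2 ->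
  `|edge_log (fun c => a * (1 + s * b * \prod_l f l (c l))) - m * ln a +
    pval pos b f o z (log_poly N1 N2 c1 c2)| <= eps.
Proof.
move=> a0 ap; rewrite /edge_log edge_mass_factorised//.
rewrite (system_pairsE (fun gam g => (1 - s * (- b * replica_mean gam g)) `^ m)).
have le1 u : u \in system_pairs -> `|- b * replica_mean u.1.2 u.2| <= 1.
  move=> /mem_system_pairs ue; rewrite mulNr normrN.
  exact: replica_mean_le1.
rewrite lnM ?posrE ?powR_gt0//; last first.
  apply: wsum_gt0 => [u /system_pairs_ge0//||u us]; first exact: system_pairs_sum.
  have /andP[s0 s1] := s01; rewrite powR_gt0// subr_gt0.
  have := le1 u us; rewrite ler_norml => /andP[_ h].
  by apply: le_lt_trans s1; rewrite -[leRHS]mulr1 ler_wpM2l ?(ltW s0).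
rewrite ln_powR (addrC (m * ln a)) addrK pval_comb.
under [X in _ + X]eq_bigr do rewrite pval_exp pval_comb.
have E n : pval pos b f o z (base_poly n) =
    \sum_(u <- system_pairs) u.1.1 * cavity_wt u.2 *
       (- b * replica_mean u.1.2 u.2) ^+ n.
  by rewrite pval_base (system_pairsE (fun gam g => (- b * replica_mean gam g) ^+ n)).
under [X in _ + X]eq_bigr => k _ do under eq_bigr => n _ do rewrite E.
by apply: ap => //; [exact: system_pairs_ge0|exact: system_pairs_sum].
Qed.

End factorised.
End position.
End edge_functionals.

(** * Expectations, decision trees and rounding *)

Section expectations.
Context (R : realType) (d : measure_display) (Omega : measurableType d)
  (P : probability Omega R).
Implicit Types (f g : Omega -> R).

Definition bounded_meas f : Prop :=
  measurable_fun [set: Omega] f /\ exists C, forall w, `|f w| <= C.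

Definition mean f : R := \int[P]_w f w.

Lemma bounded_meas_integrable f : bounded_meas f ->
  P.-integrable [set: Omega] (EFin \o f).
Proof.
move=> [mf [C fC]]; apply: measurable_bounded_integrable => //.
  by rewrite -ge0_fin_numE// fin_num_measure.
exists C; split; first exact: num_real.
by move=> x Cx w _ /=; exact: le_trans (fC w) (ltW Cx).
Qed.

Lemma bounded_meas_cst c : bounded_meas (fun=> c).
Proof. by split; [exact: measurable_cst|exists `|c|]. Qed.

Lemma bounded_measD f g : bounded_meas f -> bounded_meas g ->
  bounded_meas (fun w => f w + g w).
Proof.
move=> [mf [C fC]] [mg [C' gC]]; split; first exact: measurable_realfun.measurable_funD.
by exists (C + C') => w; rewrite (le_trans (ler_normD _ _))// lerD.
Qed.

Lemma bounded_measM f g : bounded_meas f -> bounded_meas g ->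
  bounded_meas (fun w => f w * g w).
Proof.
move=> [mf [C fC]] [mg [C' gC]]; split; first exact: measurable_realfun.measurable_funM.
by exists (C * C') => w; rewrite normrM ler_pM.
Qed.

Lemma bounded_measZ c f : bounded_meas f -> bounded_meas (fun w => c * f w).
Proof. by move=> bf; apply: bounded_measM => //; exact: bounded_meas_cst. Qed.

Lemma bounded_meas_sum (I : Type) (s : seq I) (F : I -> Omega -> R) :
  (forall i, bounded_meas (F i)) ->
  bounded_meas (fun w => \sum_(i <- s) F i w).
Proof.
move=> bF; elim: s => [|i s IH].
  rewrite (_ : (fun w => _) = fun=> 0); first exact: bounded_meas_cst.
  by apply/funext => w; rewrite big_nil.
rewrite (_ : (fun w => _) = fun w => F i w + \sum_(i <- s) F i w).
  exact: bounded_measD.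
by apply/funext => w; rewrite big_cons.
Qed.

Lemma bounded_meas_prod (I : Type) (s : seq I) (F : I -> Omega -> R) :
  (forall i, bounded_meas (F i)) ->
  bounded_meas (fun w => \prod_(i <- s) F i w).
Proof.
move=> bF; elim: s => [|i s IH].
  rewrite (_ : (fun w => _) = fun=> 1); first exact: bounded_meas_cst.
  by apply/funext => w; rewrite big_nil.
rewrite (_ : (fun w => _) = fun w => F i w * \prod_(i <- s) F i w).
  exact: bounded_measM.
by apply/funext => w; rewrite big_cons.
Qed.

Lemma bounded_meas_indic (A : set Omega) : measurable A ->
  bounded_meas (\1_A : Omega -> R).
Proof.
move=> mA; split; first exact: measurable_indic.
by exists 1 => w; rewrite indicE ger0_norm// lern1; case: (_ \in _).
Qed.

Lemma mean_cst c : mean (fun=> c) = c.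
Proof. rewrite /mean /Rintegral; have := expectation_cst P c.
by rewrite unlock /= => ->. Qed.

Lemma meanD f g : bounded_meas f -> bounded_meas g ->
  mean (fun w => f w + g w) = mean f + mean g.
Proof.
by move=> bf bg; rewrite /mean RintegralD//; exact: bounded_meas_integrable.
Qed.

Lemma meanZ c f : bounded_meas f -> mean (fun w => c * f w) = c * mean f.
Proof. by move=> bf; rewrite /mean RintegralZl//; exact: bounded_meas_integrable. Qed.

Lemma mean_sum (I : Type) (s : seq I) (F : I -> Omega -> R) :
  (forall i, bounded_meas (F i)) ->
  mean (fun w => \sum_(i <- s) F i w) = \sum_(i <- s) mean (F i).
Proof.
move=> bF; elim: s => [|i s IH].
  rewrite big_nil (_ : (fun w => _) = fun=> 0); first exact: mean_cst.
  by apply/funext => w; rewrite big_nil.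
rewrite big_cons -IH -meanD//; last exact: bounded_meas_sum.
by congr mean; apply/funext => w; rewrite big_cons.
Qed.

Lemma mean_indic (A : set Omega) : measurable A -> mean (\1_A) = fine (P A).
Proof. by move=> mA; rewrite /mean /Rintegral integral_indic// setIT. Qed.

(** The integral of a nonnegative function is a supremum over the simple
    functions below it, so that monotonicity holds for arbitrary functions and
    the integrands of the theorem can be compared directly with simple random
    variables. *)
Lemma ge0_integral_mono (f g : Omega -> \bar R) :
  (forall w, 0 <= f w)%E -> (forall w, f w <= g w)%E ->
  (\int[P]_w f w <= \int[P]_w g w)%E.
Proof.
move=> f0 fg; have g0 w : (0 <= g w)%E by exact: le_trans (fg w).
rewrite !ge0_integralTE//; apply: le_ereal_sup => _ [h /= hf <-].
by exists h => // w; exact: le_trans (fg w).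
Qed.

Lemma integral_mono (f g : Omega -> \bar R) :
  (forall w, f w <= g w)%E -> (\int[P]_w f w <= \int[P]_w g w)%E.
Proof.
move=> fg; rewrite integralE [leRHS]integralE; apply: leeB.
  apply: ge0_integral_mono => w; first exact: funepos_ge0.
  by rewrite !funeposE ge_max !le_max fg lexx orbT.
apply: ge0_integral_mono => w; first exact: funeneg_ge0.
by rewrite !funenegE ge_max !le_max leeN2 fg lexx orbT.
Qed.

(** The comparison may be changed on a null set after enlarging the right-hand
    side to infinity there, which does not change its integral. *)
Lemma integral_ae_le (f g : Omega -> R) : measurable_fun [set: Omega] g ->
  {ae P, forall w, f w <= g w} ->
  (\int[P]_w (f w)%:E <= \int[P]_w (g w)%:E)%E.
Proof.
move=> mg [N [mN PN0 subN]].
pose g' := fun w => if w \in N then +oo%E else (g w)%:E.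
have fg' w : ((f w)%:E <= g' w)%E.
  rewrite /g'; case: (boolP (w \in N)) => wN; first exact: leey.
  rewrite lee_fin; move: wN; rewrite notin_setE => wN.
  by apply: contra_notP wN => h; exact: subN.
apply: (le_trans (integral_mono fg')).
have mg' : @measurable_fun _ _ Omega (\bar R) setT g'.
  rewrite /g'; apply: measurable_fun_ifT => //.
    apply: (measurable_fun_bool true); rewrite setTI.
    rewrite (_ : _ @^-1` _ = N)//; apply/seteqP; split => x /=.
      by move/set_mem.
    by move/mem_set.
  exact/measurable_EFinP.
rewrite (@ae_eq_integral _ _ _ P setT (EFin \o g) g')//.
  exact/measurable_EFinP.
exists N; split => // w /=; apply: contra_notP => wN _.
by rewrite /g' memNset.
Qed.

Lemma integral_ae_ge (f g : Omega -> R) : measurable_fun [set: Omega] g ->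
  {ae P, forall w, g w <= f w} ->
  (\int[P]_w (g w)%:E <= \int[P]_w (f w)%:E)%E.
Proof.
move=> mg [N [mN PN0 subN]].
pose g' := fun w => if w \in N then -oo%E else (g w)%:E.
have fg' w : (g' w <= (f w)%:E)%E.
  rewrite /g'; case: (boolP (w \in N)) => wN; first exact: leNye.
  rewrite lee_fin; move: wN; rewrite notin_setE => wN.
  by apply: contra_notP wN => h; exact: subN.
apply: (le_trans _ (integral_mono fg')).
have mg' : @measurable_fun _ _ Omega (\bar R) setT g'.
  rewrite /g'; apply: measurable_fun_ifT => //.
    apply: (measurable_fun_bool true); rewrite setTI.
    rewrite (_ : _ @^-1` _ = N)//; apply/seteqP; split => x /=.
      by move/set_mem.
    by move/mem_set.
  exact/measurable_EFinP.
rewrite (@ae_eq_integral _ _ _ P setT (EFin \o g) g')//.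
  exact/measurable_EFinP.
exists N; split => // w /=; apply: contra_notP => wN _.
by rewrite /g' memNset.
Qed.

Lemma mean_EFin f : bounded_meas f -> (\int[P]_w (f w)%:E)%E = (mean f)%:E.
Proof.
move=> bf; rewrite /mean /Rintegral fineK//.
exact/integrable_fin_num/bounded_meas_integrable.
Qed.

Lemma mean_ae_le f g : bounded_meas f -> bounded_meas g ->
  {ae P, forall w, f w <= g w} -> mean f <= mean g.
Proof.
move=> bf bg fg; rewrite -lee_fin -!mean_EFin//.
by apply: integral_ae_le => //; case: bg.
Qed.

Lemma mean_le f g : bounded_meas f -> bounded_meas g ->
  (forall w, f w <= g w) -> mean f <= mean g.
Proof. by move=> bf bg fg; apply: mean_ae_le => //; exact: aeW. Qed.

Lemma mean_ae_eq f g : bounded_meas f -> bounded_meas g ->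
  {ae P, forall w, f w = g w} -> mean f = mean g.
Proof.
move=> bf bg fg; apply/eqP; rewrite eq_le; apply/andP; split;
  by apply: mean_ae_le => //; apply: filterS fg => w ->.
Qed.

Lemma expectation_ae_le (f g : Omega -> R) : bounded_meas g ->
  {ae P, forall w, f w <= g w} -> ('E_P[f] <= (mean g)%:E)%E.
Proof.
move=> bg fg; rewrite unlock -mean_EFin//.
by apply: integral_ae_le => //; case: bg.
Qed.

End expectations.

Section decision_trees.
Context (R : realType) (d : measure_display) (Omega : measurableType d)
  (P : probability Omega R).
Variables (S : eqType) (D : set S) (F : S -> set (set Omega)).
Hypotheses (F_meas : forall s A, D s -> F s A -> measurable A)
  (F_indep : mutually_independent P D F).

(** A random variable that reads finitely many independent sources one after
    the other, through finitely-valued functions; which source is read next may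
    depend on the values read so far. Its mean is the iterated sum, without
    product measures. *)
Inductive tree : Type :=
  | Leaf of R
  | Node (s : S) (J : finType) (r : Omega -> J) (k : J -> tree).

Fixpoint tree_eval (t : tree) (w : Omega) : R :=
  match t with
  | Leaf c => c
  | Node _ _ r k => tree_eval (k (r w)) w
  end.

Fixpoint tree_mean (t : tree) : R :=
  match t with
  | Leaf c => c
  | Node _ J r k => \sum_(i : J) fine (P (r @^-1` [set i])) * tree_mean (k i)
  end.

(** used contains the sources read on the way from the root. *)
Fixpoint tree_wf (used : seq S) (t : tree) : Prop :=
  match t with
  | Leaf _ => True
  | Node s J r k => [/\ D s, s \notin used,
      (forall i : J, F s (r @^-1` [set i])) &
      forall i : J, tree_wf (s :: used) (k i)]
  end.

Lemma node_evalE s (I : finType) (r : Omega -> I) k w :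
  tree_eval (Node s r k) w =
  \sum_(i : I) \1_(r @^-1` [set i]) w * tree_eval (k i) w.
Proof.
rewrite /= (bigD1 (r w))//= big1 ?addr0; last first.
  move=> i /eqP ir; rewrite indicE memNset ?mul0r// => h.
  by apply: ir; rewrite -h.
by rewrite indicE mem_set ?mul1r.
Qed.

Lemma tree_bounded_meas used t : tree_wf used t -> bounded_meas (tree_eval t).
Proof.
elim: t used => [c|s J r k IH] used /=; first by move=> _; exact: bounded_meas_cst.
move=> [Ds _ Fr wfk].
rewrite (_ : (fun w => _) =
    fun w => \sum_(i : J) \1_(r @^-1` [set i]) w * tree_eval (k i) w).
  apply: bounded_meas_sum => i; apply: bounded_measM; last exact: IH (wfk i).
  by apply: bounded_meas_indic; exact: F_meas (Fr i).
by apply/funext => w; rewrite -(node_evalE s).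
Qed.

Definition joint_event (l : seq (S * set Omega)) : set Omega :=
  foldr (fun x A => x.2 `&` A) setT l.

Definition distinct_events (l : seq (S * set Omega)) : Prop :=
  uniq [seq x.1 | x <- l] /\ List.Forall (fun x => D x.1 /\ F x.1 x.2) l.

Lemma forall_nth l : List.Forall (fun x => D x.1 /\ F x.1 x.2) l ->
  forall x0 i, (i < size l)%N -> D (nth x0 l i).1 /\ F (nth x0 l i).1 (nth x0 l i).2.
Proof.
elim: l => [|x l IH] // h x0 i; inversion h; subst.
by case: i => [|i] //= il; apply: IH.
Qed.

Lemma joint_eventE x0 l : joint_event l = \bigcap_(k in [set: 'I_(size l)]) (nth x0 l k).2.
Proof.
elim: l => [|x l IH].
  by rewrite /=; apply/seteqP; split => // w _ [].
rewrite /= IH; apply/seteqP; split => w /=.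
  move=> [xw h] [[|i] il] _ //=.
  exact: (h (Ordinal (il : (i < size l)%N)) Logic.I).
move=> h; split; first exact: (h ord0 Logic.I).
by move=> i _; exact: (h (lift ord0 i) Logic.I).
Qed.

Lemma joint_event_prob l : distinct_events l -> fine (P (joint_event l)) = \prod_(x <- l) fine (P x.2).
Proof.
case: l => [|x0 l0]; first by rewrite /= probability_setT big_nil.
set l := x0 :: l0 => -[ul hl].
have nl := forall_nth hl.
rewrite (joint_eventE x0).
have -> := @F_indep (size l) (fun k => (nth x0 l k).1) _ _ (fun k => (nth x0 l k).2) _.
- rewrite (big_nth x0) big_mkord.
  have fin (k : 'I_(size l)) : P (nth x0 l k).2 = (fine (P (nth x0 l k).2))%:E.
    have [Dk Fk] := nl x0 k (ltn_ord k).
    by rewrite fineK// fin_num_measure//; exact: F_meas Fk.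
  by under eq_bigr do rewrite fin; rewrite prodEFin.
- move=> i j; rewrite -!(nth_map x0 x0.1)// => h; apply/val_inj.
  by apply: (uniqP x0.1 ul _ _ _ _ h); rewrite inE size_map.
- by move=> k; have [] := nl x0 k (ltn_ord k).
- by move=> k; have [] := nl x0 k (ltn_ord k).
Qed.

Lemma joint_event_meas l : distinct_events l -> measurable (joint_event l).
Proof.
move=> [_]; elim: l => [|x l IH] h /=; first exact: measurableT.
inversion h; subst; apply: measurableI; last exact: IH.
by case: H1 => Dx Fx; exact: F_meas Fx.
Qed.

(** The event l records the values read so far; the induction multiplies its
    probability by that of the next value, by independence of the sources on
    the path. *)
Lemma tree_mean_cond t l : distinct_events l -> tree_wf [seq x.1 | x <- l] t ->
  mean P (fun w => \1_(joint_event l) w * tree_eval t w) =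
  (\prod_(x <- l) fine (P x.2)) * tree_mean t.
Proof.
elim: t l => [c|s J r k IH] l cl wf.
  rewrite /= (_ : (fun w => _) = fun w => c * \1_(joint_event l) w); last first.
    by apply/funext => w; rewrite mulrC.
  have ml := joint_event_meas cl; rewrite meanZ; last exact: bounded_meas_indic ml.
  by rewrite mean_indic// joint_event_prob// mulrC.
have [Ds sl Fr wfk] := wf; have [ul hl] := cl.
have cli i : distinct_events ((s, r @^-1` [set i]) :: l).
  split; first by rewrite /= sl.
  by constructor => //; split => /=.
have -> : (fun w => \1_(joint_event l) w * tree_eval (Node s r k) w) =
  fun w => \sum_(i : J) \1_(joint_event ((s, r @^-1` [set i]) :: l)) w * tree_eval (k i) w.
  apply/funext => w; rewrite node_evalE mulr_sumr; apply: eq_bigr => i _.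
  by rewrite /= indicI /= mulrCA mulrA.
rewrite mean_sum; last first.
  move=> i; apply: bounded_measM; first exact/bounded_meas_indic/joint_event_meas.
  exact: tree_bounded_meas (wfk i).
rewrite /= mulr_sumr; apply: eq_bigr => i _.
rewrite (IH i ((s, r @^-1` [set i]) :: l))//; last exact: wfk.
by rewrite big_cons /= mulrCA mulrA.
Qed.

Lemma mean_tree t : tree_wf [::] t -> mean P (tree_eval t) = tree_mean t.
Proof.
move=> wf; have c0 : distinct_events [::] by split => //; constructor.
have := tree_mean_cond c0 wf; rewrite big_nil mul1r => <-.
by congr mean; apply/funext => w; rewrite /= indicT mul1r.
Qed.

End decision_trees.

(** * Products of independent bounded variables *)

Section rounding.
Variables (R : realType) (T : Type) (J : finType) (phi : J -> T -> R) (C : R)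
  (N : nat) (good : T -> Prop) (t0 : T).
Hypotheses (C_gt0 : 0 < C) (N_gt0 : (0 < N)%N).

Definition code : finType := {ffun J * 'I_N -> bool}.

(** The positions of the real numbers phi j t with respect to a subdivision of
    [-C, C]. *)
Definition rnd (t : T) : code :=
  [ffun u : J * 'I_N =>
     - C + (nat_of_ord u.2)%:R * (2 * C / N%:R) <= phi u.1 t].

(** Cells are represented by one of their points, so that every property of
    points holds for the rounded values. *)
Definition unrnd (g : code) : T :=
  if pselect (exists t, good t /\ rnd t = g) is left h then projT1 (cid h)
  else t0.

Lemma unrndK t : good t -> good (unrnd (rnd t)) /\ rnd (unrnd (rnd t)) = rnd t.
Proof.
move=> gt; rewrite /unrnd; case: pselect => [h|[]]; last by exists t.
by have [] := projT2 (cid h).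
Qed.

Lemma rnd_close_lt t t' j : rnd t = rnd t' -> - C <= phi j t -> phi j t' <= C ->
  phi j t' - phi j t <= 2 * C / N%:R.
Proof.
move=> tt' xC x'C; set h := 2 * C / N%:R.
have N0 : 0 < N%:R :> R by rewrite ltr0n.
have h0 : 0 < h by rewrite divr_gt0// mulr_gt0.
rewrite leNgt; apply/negP => far.
pose y := (phi j t + C) / h.
have y0 : 0 <= y by rewrite divr_ge0 ?(ltW h0)//; move: xC; lra.
have /andP[ny yn] := truncn_itv y0.
set n := (Num.truncn y).+1 in yn.
have yh : y * h = phi j t + C by rewrite /y divfK ?gt_eqF.
have lo : phi j t < - C + n%:R * h.
  by have := yn; rewrite -(ltr_pM2r h0) yh; lra.
have hi : - C + n%:R * h <= phi j t'.
  have : (Num.truncn y)%:R * h <= y * h by rewrite ler_pM2r.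
  by rewrite yh /n -natr1; move: far; lra.
have nN : (n < N)%N.
  rewrite -(ltr_nat R) -(ltr_pM2r h0).
  have -> : N%:R * h = 2 * C by rewrite /h mulrC divfK ?gt_eqF.
  have : - C + (Num.truncn y)%:R * h <= phi j t.
    have : (Num.truncn y)%:R * h <= y * h by rewrite ler_pM2r.
    by rewrite yh; lra.
  by rewrite /n -natr1; move: far x'C; lra.
have := congr1 (fun g : code => g (j, Ordinal nN)) tt'.
by rewrite !ffunE /= -/h hi leNgt lo.
Qed.

Lemma rnd_close t t' j : rnd t = rnd t' -> `|phi j t| <= C -> `|phi j t'| <= C ->
  `|phi j t - phi j t'| <= 2 * C / N%:R.
Proof.
move=> tt' /ler_normlP[a1 a2] /ler_normlP[b1 b2].
rewrite ler_norml; apply/andP; split; last first.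
  by apply: rnd_close_lt => //; rewrite lerNl.
rewrite lerNl opprB; apply: rnd_close_lt => //.
by rewrite lerNl.
Qed.

End rounding.

Lemma measurable_rnd (R : realType) (d : measure_display) (T : measurableType d)
    (J : finType) (phi : J -> T -> R) (C : R) (N : nat) (g : code J N) :
  (forall j, measurable_fun [set: T] (phi j)) ->
  measurable (rnd phi C N @^-1` [set g]).
Proof.
move=> mphi.
rewrite (_ : _ @^-1` _ = \bigcap_(u in [set: J * 'I_N])
    [set t | (- C + (nat_of_ord u.2)%:R * (2 * C / N%:R) <= phi u.1 t) = g u]).
  apply: fin_bigcap_measurable => // u _.
  have m1 : measurable [set t | - C + (nat_of_ord u.2)%:R * (2 * C / N%:R) <= phi u.1 t].
    have := mphi u.1 measurableT `[- C + (nat_of_ord u.2)%:R * (2 * C / N%:R), +oo[%classic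
      (measurable_itv _).
    rewrite setTI; congr measurable; apply/seteqP; split => t /=.
      by rewrite in_itv /= andbT.
    by rewrite in_itv /= andbT.
  case: (g u).
    rewrite (_ : [set t | _] = [set t | - C + (nat_of_ord u.2)%:R * (2 * C / N%:R) <= phi u.1 t]) //.
  rewrite (_ : [set t | _] = ~` [set t | - C + (nat_of_ord u.2)%:R * (2 * C / N%:R) <= phi u.1 t]).
    exact: measurableC.
  by apply/seteqP; split => t /= => [->|/negP/negbTE].
apply/seteqP; split => t /=.
  by move=> <- u _; rewrite ffunE.
by move=> h; apply/ffunP => u; rewrite ffunE h.
Qed.

Section product_expectation.
Context (R : realType) (d : measure_display) (Omega : measurableType d)
  (P : probability Omega R).

Lemma prod_close (J : Type) (s : seq J) (x y : J -> R) (C h : R) :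
  0 <= h -> (forall j, `|x j| <= C) -> (forall j, `|y j| <= C) ->
  (forall j, `|x j - y j| <= h) ->
  `|\prod_(j <- s) x j - \prod_(j <- s) y j| <= (size s)%:R * (1 + C) ^+ size s * h.
Proof.
move=> h0 xC yC xy; elim: s => [|j s IH].
  by rewrite !big_nil subrr normr0 !mul0r.
have C0 : 0 <= C by exact: le_trans (xC j).
have pB z : (forall j, `|z j| <= C) -> `|\prod_(j <- s) z j| <= (1 + C) ^+ size s.
  move=> zC; elim: (s) => [|i s' IHs]; first by rewrite big_nil normr1.
  rewrite big_cons normrM exprS ler_pM// (le_trans (zC i))//.
  by rewrite lerDr.
rewrite !big_cons.
have -> : x j * \prod_(j <- s) x j - y j * \prod_(j <- s) y j =
  (x j - y j) * \prod_(j <- s) x j + y j * (\prod_(j <- s) x j - \prod_(j <- s) y j).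
  by ring.
apply: (le_trans (ler_normD _ _)); rewrite !normrM /=.
have p0 : 0 <= (1 + C) ^+ size s by rewrite exprn_ge0// addr_ge0.
have l1 : `|x j - y j| * `|\prod_(j <- s) x j| <= h * (1 + C) ^+ size s.
  by rewrite ler_pM ?normr_ge0// pB.
have l2 : `|y j| * `|\prod_(j <- s) x j - \prod_(j <- s) y j| <=
   C * ((size s)%:R * (1 + C) ^+ size s * h).
  by rewrite ler_pM ?normr_ge0.
apply: (le_trans (lerD l1 l2)).
rewrite exprS -natr1 -subr_ge0.
set n := (size s)%:R; set Q := (1 + C) ^+ size s.
have n0 : 0 <= n by exact: ler0n.
have -> : (n + 1) * ((1 + C) * Q) * h - (h * Q + C * (n * Q * h)) =
   n * (Q * h) + C * (Q * h) by ring.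
by rewrite addr_ge0 ?mulr_ge0.
Qed.

Lemma eq_eps (x y K : R) : 0 <= K ->
  (forall N : nat, (0 < N)%N -> `|x - y| <= K / N%:R) -> x = y.
Proof.
move=> K0 h; apply/eqP; rewrite -subr_eq0 -normr_le0 leNgt; apply/negP => xy.
pose N := (Num.truncn (K / `|x - y|)).+1.
have := h N isT; rewrite leNgt => /negP; apply.
rewrite ltr_pdivrMr ?ltr0n// mulrC -ltr_pdivrMr//.
by apply: truncnS_gt.
Qed.

Variables (S : finType) (F : S -> set (set Omega)) (X : S -> Omega -> R).
Hypotheses (F_meas : forall s A, F s A -> measurable A)
  (F_indep : mutually_independent P [set: S] F)
  (X_F : forall s (B : set (measurableTypeR R)), measurable B -> F s (X s @^-1` B)).
Variable C : R.
Hypotheses (C_gt0 : 0 < C) (X_bd : forall s w, `|X s w| <= C).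

Lemma X_meas s : measurable_fun [set: Omega] (X s).
Proof. by move=> _ B mB; rewrite setTI; exact: F_meas (X_F s mB). Qed.

Lemma X_bounded_meas s : bounded_meas (X s).
Proof. by split; [exact: X_meas|exists C]. Qed.

Let rX N s (w : Omega) : code unit N := rnd (fun _ : unit => @id R) C N (X s w).
Let uX N (g : code unit N) : R :=
  unrnd (fun _ : unit => @id R) C (fun x => `|x| <= C) 0 g.

Fixpoint prod_tree N (l : seq S) (acc : R) : @tree R d Omega S :=
  if l is s :: l' then
    Node s (rX N s) (fun g => prod_tree N l' (acc * uX g))
  else @Leaf R d Omega S acc.

Lemma prod_tree_eval N l acc w :
  tree_eval (prod_tree N l acc) w = acc * \prod_(s <- l) uX (rX N s w).
Proof.
elim: l acc => [|s l IH] acc /=; first by rewrite big_nil mulr1.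
by rewrite IH big_cons mulrA.
Qed.

Lemma prod_tree_mean N l acc :
  tree_mean P (prod_tree N l acc) =
  acc * \prod_(s <- l) \sum_(g : code unit N) fine (P (rX N s @^-1` [set g])) * uX g.
Proof.
elim: l acc => [|s l IH] acc /=; first by rewrite big_nil mulr1.
under eq_bigr do rewrite IH.
rewrite big_cons mulrA mulr_sumr mulr_suml; apply: eq_bigr => g _.
by ring.
Qed.

Lemma prod_tree_wf N l acc used : uniq (l ++ used) ->
  tree_wf [set: S] F used (prod_tree N l acc).
Proof.
elim: l acc used => [//|s l IH] acc used /= /andP[sl ul]; split => //.
- by move: sl; rewrite mem_cat => /norP[].
- move=> g; rewrite /rX comp_preimage.
  apply: X_F; exact: measurable_rnd.
- by move=> g; apply: IH; rewrite -cat1s uniq_catCA cat1s /= sl ul.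
Qed.

(** After rounding, the product is a decision tree that reads each source
    once; the mesh then tends to 0. *)
Lemma mean_prod : mean P (fun w => \prod_s X s w) = \prod_s mean P (X s).
Proof.
have wf0 N l acc : uniq l -> tree_wf [set: S] F [::] (prod_tree N l acc).
  by move=> ul; apply: prod_tree_wf; rewrite cats0.
have u1 (s : S) : uniq [:: s] by [].
have szS : size (index_enum S) = #|S|.
  by rewrite -sum1_size -sum1_card; apply: eq_bigl.
pose K := 2 * (#|S|%:R * (1 + C) ^+ #|S| * (2 * C)).
have K0 : 0 <= #|S|%:R * (1 + C) ^+ #|S| * (2 * C).
  by rewrite !mulr_ge0 ?exprn_ge0 ?addr_ge0 ?(ltW C_gt0).
apply: (@eq_eps _ _ K) => [|N N0]; first by rewrite mulr_ge0.
have close s w : `|uX (rX N s w)| <= C /\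
    `|X s w - uX (rX N s w)| <= 2 * C / N%:R.
  have [g1 g2] := unrndK (fun _ : unit => @id R) C N (good := fun x => `|x| <= C) 0 (X_bd s w).
  split => //.
  exact: (rnd_close (phi := fun _ : unit => @id R) C_gt0 N0 (j := tt) (esym g2) (X_bd s w) g1).
have mF s A : [set: S] s -> F s A -> measurable A by move=> _; exact: F_meas.
pose Xh s w := uX (rX N s w).
have bXh s : bounded_meas (Xh s).
  have := @tree_bounded_meas R d Omega S setT F mF [::] (prod_tree N [:: s] 1)
    (wf0 _ _ _ (u1 s)).
  congr bounded_meas; apply/funext => w.
  by rewrite prod_tree_eval big_seq1 mul1r.
have mXh s : \sum_(g : code unit N) fine (P (rX N s @^-1` [set g])) * uX g = mean P (Xh s).
  have := mean_tree mF F_indep (wf0 N [:: s] 1 (u1 s)).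
  rewrite prod_tree_mean big_seq1 mul1r => <-; congr mean; apply/funext => w.
  by rewrite prod_tree_eval big_seq1 mul1r.
have prodXh : mean P (fun w => \prod_s Xh s w) = \prod_s mean P (Xh s).
  have := mean_tree mF F_indep (wf0 N (index_enum S) 1 (index_enum_uniq _)).
  rewrite prod_tree_mean mul1r; under [RHS]eq_bigr do rewrite mXh.
  move=> <-; congr mean; apply/funext => w.
  by rewrite prod_tree_eval mul1r.
have h0 : 0 <= 2 * C / N%:R by rewrite divr_ge0// mulr_ge0// ltW.
have bpX : bounded_meas (fun w => \prod_s X s w).
  by apply: bounded_meas_prod => s; exact: X_bounded_meas.
have bpXh : bounded_meas (fun w => \prod_s Xh s w) by exact: bounded_meas_prod.
have meanB (f g : Omega -> R) D : bounded_meas f -> bounded_meas g ->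
    (forall w, `|f w - g w| <= D) -> `|mean P f - mean P g| <= D.
  move=> bf bg fg; rewrite ler_norml; apply/andP; split.
    rewrite lerBrDr -[D](mean_cst P) addrC -lerBrDr opprK.
    have bD : bounded_meas (fun w => f w + D) by apply: bounded_measD => //; exact: bounded_meas_cst.
    rewrite mean_cst -[X in _ <= _ + X](mean_cst P D) -meanD//; last exact: bounded_meas_cst.
    apply: mean_le => // w; have := fg w; rewrite ler_norml => /andP[h _].
    by rewrite -lerBlDl -[leRHS]opprK lerNr opprB; move: h; lra.
  rewrite lerBlDr -[D in leRHS](mean_cst P) -meanD//; last exact: bounded_meas_cst.
  apply: mean_le => //.
    by apply: bounded_measD => //; exact: bounded_meas_cst.
  by move=> w; have := fg w; rewrite ler_norml => /andP[_]; rewrite lerBlDr.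
have l1 : `|mean P (fun w => \prod_s X s w) - mean P (fun w => \prod_s Xh s w)| <=
    #|S|%:R * (1 + C) ^+ #|S| * (2 * C / N%:R).
  apply: meanB => // w.
  have := @prod_close S (index_enum S) (X ^~ w) (Xh ^~ w) C _ h0.
  rewrite szS; apply => // s.
    by have [] := close s w.
  by have [] := close s w.
have l2 : `|\prod_s mean P (X s) - \prod_s mean P (Xh s)| <=
    #|S|%:R * (1 + C) ^+ #|S| * (2 * C / N%:R).
  have mC (f : Omega -> R) : bounded_meas f -> (forall w, `|f w| <= C) -> `|mean P f| <= C.
    have b0 : bounded_meas (fun _ : Omega => 0 : R) by exact: bounded_meas_cst.
    move=> bf fC; have := meanB f _ C bf b0.
    by rewrite mean_cst subr0; apply => w; rewrite subr0.
  have := @prod_close S (index_enum S) (fun s => mean P (X s)) (fun s => mean P (Xh s)) C _ h0.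
  rewrite szS; apply => s.
  - by apply: mC => //; exact: X_bounded_meas.
  - by apply: mC => // w; have [] := close s w.
  - by apply: meanB => // [|w]; [exact: X_bounded_meas|have [] := close s w].
have -> : mean P (fun w => \prod_s X s w) - \prod_s mean P (X s) =
  (mean P (fun w => \prod_s X s w) - mean P (fun w => \prod_s Xh s w)) -
  (\prod_s mean P (X s) - \prod_s mean P (Xh s)) by rewrite prodXh; ring.
apply: (le_trans (ler_normB _ _)); apply: (le_trans (lerD l1 l2)).
rewrite /K !mulrA -mulrDl -mulrDl ler_wpM2r ?invr_ge0//.
move: (_ ^+ _) => v; move: #|S|%:R => u.
by rewrite le_eqVlt; apply/orP; left; apply/eqP; ring.
Qed.

End product_expectation.

Section same_law_mean.
Context (R : realType) (d d' : measure_display) (Omega : measurableType d)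
  (T : measurableType d') (P : probability Omega R).

Lemma mean_same_law (X Y : {RV P >-> T}) (F : T -> R) : same_law X Y ->
  measurable_fun [set: T] F -> bounded_meas (F \o X) -> bounded_meas (F \o Y) ->
  mean P (F \o X) = mean P (F \o Y).
Proof.
move=> XY mF bX bY; rewrite /mean /Rintegral.
have mF' : measurable_fun [set: T] (EFin \o F) by exact/measurable_EFinP.
have := @integral_distribution _ _ _ _ _ P X (EFin \o F) mF'
  (bounded_meas_integrable P bX).
have := @integral_distribution _ _ _ _ _ P Y (EFin \o F) mF'
  (bounded_meas_integrable P bY).
rewrite /= => <- <-; congr fine; apply: eq_measure_integral => A mA _.
exact: XY.
Qed.

End same_law_mean.

(** * Tails and bounds of independent factors *)

Section tails.
Context (R : realType) (d : measure_display) (Omega : measurableType d)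
  (P : probability Omega R).

Lemma tail_small (X : Omega -> R) (eps : R) : measurable_fun [set: Omega] X ->
  0 < eps -> exists A, 0 < A /\ fine (P [set w | A <= X w]) < eps.
Proof.
move=> mX e0; pose F n := [set w | n%:R <= X w].
have mF n : measurable (F n).
  have -> : F n = X @^-1` `[n%:R, +oo[.
    by apply/seteqP; split => w; rewrite /F /= in_itv/= andbT.
  by rewrite -[_ @^-1` _]setTI; exact: mX.
have cap0 : \bigcap_n F n = set0.
  rewrite -subset0 => w h.
  have /= := h (Num.truncn (X w)).+1 Logic.I.
  by rewrite /F /= leNgt truncnS_gt.
have /fine_cvgP[_ /cvgr0Pnorm_lt/(_ eps e0)[n _ hn]] :
    P \o F @ \oo --> (0 : R)%:E.
  have -> : (0 : R)%:E = P (\bigcap_n F n) by rewrite cap0 measure0.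
  apply: nonincreasing_cvg_mu => //.
  - by rewrite ltey_eq fin_num_measure.
  - by rewrite cap0.
  - move=> i j ij; apply/subsetPset => w /=; apply: le_trans.
    by rewrite ler_nat.
exists n.+1%:R; split; first by rewrite ltr0n.
by have := hn n.+1 (leqnSn n); rewrite /= ger0_norm// fine_ge0.
Qed.

(** The sets where X is at least 1/n exhaust the set where it is positive. *)
Lemma positive_somewhere (X : Omega -> R) : measurable_fun [set: Omega] X ->
  (forall w, 0 <= X w) -> {ae P, forall w, X w = 0} \/
  exists del, 0 < del /\ 0 < fine (P [set w | del <= X w]).
Proof.
move=> mX X0; pose F n := [set w | n.+1%:R^-1 <= X w].
have mF n : measurable (F n).
  have -> : F n = X @^-1` `[n.+1%:R^-1, +oo[.
    by apply/seteqP; split => w; rewrite /F /= in_itv/= andbT.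
  by rewrite -[_ @^-1` _]setTI; exact: mX.
have [all0|] := pselect (forall n, P (F n) = 0%E); last first.
  move=> /existsNP[n /eqP Fn]; right; exists n.+1%:R^-1; split.
    by rewrite invr_gt0 ltr0n.
  have fn : P (F n) \is a fin_num by exact: fin_num_measure.
  by apply: fine_gt0; rewrite -/(F n) lt0e Fn measure_ge0/= ltey_eq fn.
left; apply: (@negligibleS _ _ _ P (\bigcup_n F n)); last first.
  by apply: negligible_bigcup => n; apply/negligibleP; [exact: mF|exact: all0].
move=> w /= /eqP Xw0; have Xw : 0 < X w by rewrite lt_neqAle eq_sym Xw0/=.
exists (Num.truncn (X w)^-1) => //=.
rewrite /F /= invf_ple ?posrE ?ltr0n//; exact/ltW/truncnS_gt.
Qed.

Variables (S : finType) (F : S -> set (set Omega)) (X : S -> Omega -> R).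
Hypotheses (F_meas : forall s A, F s A -> measurable A)
  (F_indep : mutually_independent P [set: S] F)
  (X_F : forall s (B : set (measurableTypeR R)), measurable B -> F s (X s @^-1` B))
  (X_ge0 : forall s w, 0 <= X s w).

(** Each factor is bounded where the others are bounded below, an event of
    positive probability that is independent of it. *)
Lemma bounded_factors (D : R) : 0 < D -> {ae P, forall w, \prod_s X s w <= D} ->
  (exists s, {ae P, forall w, X s w = 0}) \/
  exists C, 0 < C /\ {ae P, forall w, forall s, X s w <= C}.
Proof.
move=> D0 prodD.
have mX s : measurable_fun [set: Omega] (X s).
  by move=> _ B mB; rewrite setTI; exact: F_meas (X_F s mB).
have [[s Xs0]|noz] := pselect (exists s, {ae P, forall w, X s w = 0}).
  by left; exists s.
right; have /choice[del hdel] : forall s, exists del, 0 < del /\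
    0 < fine (P [set w | del <= X s w]).
  move=> s; have [Xs0|//] := @positive_somewhere (X s) (mX s) (X_ge0 s).
  by case: noz; exists s.
pose C s := (D + 1) / \prod_(s' | s' != s) del s'.
have prod_gt0 s : 0 < \prod_(s' | s' != s) del s'.
  by apply: prodr_gt0 => s' _; have [] := hdel s'.
have C0 s : 0 < C s by rewrite divr_gt0// addr_gt0.
pose thr s s' := if s' == s then C s else del s'.
have tail0 s : fine (P [set w | C s <= X s w]) = 0.
  pose Y s' w : R := ((thr s s' <= X s' w)%R)%:R.
  have Y_ind s' : Y s' = \1_[set w | thr s s' <= X s' w].
    apply/funext => w; rewrite indicE /Y; congr ((nat_of_bool _)%:R); apply/idP/idP => h.
      by rewrite mem_set.
    by rewrite inE in h.
  have mthr s' : measurable [set w | thr s s' <= X s' w].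
    have -> : [set w | thr s s' <= X s' w] = X s' @^-1` `[thr s s', +oo[.
      by apply/seteqP; split => w; rewrite /= in_itv/= andbT.
    by rewrite -[_ @^-1` _]setTI; exact: mX.
  have meanY s' : mean P (Y s') = fine (P [set w | thr s s' <= X s' w]).
    by rewrite Y_ind mean_indic.
  have YF s' (B : set (measurableTypeR R)) : measurable B -> F s' (Y s' @^-1` B).
    move=> mB; have -> : Y s' @^-1` B =
      X s' @^-1` ((fun x : measurableTypeR R => ((thr s s' <= x)%R)%:R : R) @^-1` B) by [].
    apply: X_F; rewrite -[_ @^-1` _]setTI.
    have : measurable_fun [set: measurableTypeR R]
        (\1_(`[thr s s', +oo[%classic : set (measurableTypeR R)) : _ -> R).
      exact: measurable_indic.
    rewrite (_ : \1_ _ = fun x : measurableTypeR R => ((thr s s' <= x)%R)%:R).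
      exact.
    apply/funext => x; rewrite indicE; congr ((nat_of_bool _)%:R); apply/idP/idP => h.
      by rewrite inE /= in_itv/= andbT in h.
    by rewrite mem_set//= in_itv/= andbT.
  have Y1 s' w : `|Y s' w| <= 1.
    by rewrite /Y; case: (thr s s' <= X s' w); rewrite ?normr1 ?normr0.
  have := @mean_prod R d Omega P S F Y F_meas F_indep YF 1 ltr01 Y1.
  have -> : mean P (fun w => \prod_s' Y s' w) = 0.
    rewrite -[RHS](mean_cst P 0); apply: mean_ae_eq.
    - apply: bounded_meas_prod => s'; rewrite Y_ind; exact: bounded_meas_indic.
    - exact: bounded_meas_cst.
    apply: filterS prodD => w hw; apply/eqP.
    have [/existsP[s' ns']|] := boolP [exists s', ~~ (thr s s' <= X s' w)].
      by rewrite (bigD1 s')//= /Y (negbTE ns') mul0r.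
    rewrite negb_exists => /forallP h; exfalso.
    have {}h s' : thr s s' <= X s' w by rewrite -[_ <= _]negbK h.
    have : D + 1 <= \prod_s' X s' w.
      rewrite (bigD1 s)//= -[leLHS](divfK (lt0r_neq0 (prod_gt0 s))).
      have := h s; rewrite /thr eqxx => hs.
      apply: ler_pM; rewrite ?(ltW (C0 s)) ?(ltW (prod_gt0 s))//.
      apply: ler_prod => s' ss'; have [d0 _] := hdel s'.
      by rewrite (ltW d0)/=; have := h s'; rewrite /thr (negbTE ss').
    by move=> /le_trans/(_ hw); lra.
  move=> /esym/eqP; rewrite prodf_seq_eq0 => /hasP[s' _].
  rewrite meanY /thr /=; have [->/eqP//|_ /eqP h] := eqVneq s' s.
  by have [_] := hdel s'; rewrite h ltxx.
exists (1 + \sum_s C s); split; first by rewrite ltr_pwDl ?sumr_ge0// => s _; exact/ltW.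
have H s : {ae P, forall w, X s w <= C s}.
  have mA : measurable [set w | C s <= X s w].
    have -> : [set w | C s <= X s w] = X s @^-1` `[C s, +oo[.
      by apply/seteqP; split => w; rewrite /= in_itv/= andbT.
    by rewrite -[_ @^-1` _]setTI; exact: mX.
  exists [set w | C s <= X s w]; split => //.
  - by rewrite -[LHS]fineK ?tail0//; exact: fin_num_measure.
  - by move=> w /= /negP; rewrite -ltNge => /ltW.
apply: filterS (filter_forall _ H) => w hw s; apply: le_trans (hw s) _.
rewrite (bigD1 s)//= addrCA lerDl addr_ge0// sumr_ge0// => s' _; exact/ltW.
Qed.

End tails.

(** * One edge against its cavity fields *)

(** For nonnegative x and y this is the convexity of the p-th power; if p is
    even, x and y can be replaced by their absolute values. *)
Lemma pow_comparison (R : realType) (p : nat) (x y : R) :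
  ~~ odd p \/ (0 <= x /\ 0 <= y) -> (0 < p)%N ->
  0 <= x ^+ p - p%:R * (x * y ^+ p.-1) + (p%:R - 1) * y ^+ p.
Proof.
have nn : forall n (u v : R), 0 <= u -> 0 <= v ->
    0 <= u ^+ n.+1 - n.+1%:R * (u * v ^+ n) + (n.+1%:R - 1) * v ^+ n.+1.
  move=> n u v u0 v0; elim: n => [|n IH].
    by rewrite subrr mul0r addr0 !expr1 expr0 mulr1 mul1r subrr.
  have -> : u ^+ n.+2 - n.+2%:R * (u * v ^+ n.+1) + (n.+2%:R - 1) * v ^+ n.+2 =
    v * (u ^+ n.+1 - n.+1%:R * (u * v ^+ n) + (n.+1%:R - 1) * v ^+ n.+1) +
    (u ^+ n.+1 - v ^+ n.+1) * (u - v).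
    by rewrite -(natr1 n.+1) !exprS; move: (u ^+ n) (v ^+ n) => a b; ring.
  apply: addr_ge0; first exact: mulr_ge0.
  have [uv|vu] := leP u v.
    rewrite -mulrNN mulr_ge0// oppr_ge0 subr_le0//.
    by rewrite lerXn2r.
  by rewrite mulr_ge0// subr_ge0 ?lerXn2r ?nnegrE ?(ltW vu).
case: p => // n [ev|[x0 y0]] _; last exact: nn.
apply: le_trans (nn n `|x| `|y| (normr_ge0 _) (normr_ge0 _)) _.
have e (z : R) : `|z| ^+ n.+1 = z ^+ n.+1.
  by rewrite -normrX ger0_norm// exprn_even_ge0.
rewrite !e lerD2r lerD2l lerN2 ler_wpM2l//=.
by rewrite -normrX -normrM ler_norm.
Qed.

Section step_inequality.
Context (R : realType) (dd : measure_display) (Omega : measurableType dd)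
  (P : probability Omega R).
Variables (m : R) (m_gt0 : 0 < m) (m_lt1 : m < 1).
Variables (p : nat) (p_gt0 : (0 < p)%N).
Variables (T J IZ G : finType) (sp : J -> T -> bool) (zg : IZ -> G -> R)
  (xg : G -> R).
Hypotheses (zg_ge0 : forall i g, 0 <= zg i g)
  (zg_sum : forall i, \sum_g zg i g = 1).
Variables (wJ : J -> R) (pZ : IZ -> R).
Hypotheses (wJ_ge0 : forall j, 0 <= wJ j) (wJ_sum : \sum_j wJ j = 1)
  (pZ_ge0 : forall i, 0 <= pZ i) (pZ_sum : \sum_i pZ i = 1).
Variable e : ens R T.
Hypotheses (e_sum : \sum_(x <- e) x.1 = 1) (e_ge0 : forall x, x \in e -> 0 <= x.1)
  (e_gt0 : forall x, x \in e -> forall t, 0 < x.2 t)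
  (e_prob : forall x, x \in e -> \sum_t x.2 t = 1).

Definition all_pos : 'I_p -> bool := fun=> true.
Definition last_pos : 'I_p -> bool := fun l => nat_of_ord l == p.-1.
Definition no_pos : 'I_p -> bool := fun=> false.

Definition site_mean (V : {ffun 'I_p -> J} -> {ffun 'I_p -> IZ} -> R) : R :=
  \sum_(o : {ffun 'I_p -> J}) \sum_(z : {ffun 'I_p -> IZ})
    (\prod_l wJ (o l)) * (\prod_l pZ (z l)) * V o z.

(** This is the quantity whose mean is nonpositive when V is the logarithm of
    the edge functional. The factors 1, -p and p-1 sum to 0, so that constants
    do not contribute. *)
Definition combination (V : ('I_p -> bool) -> {ffun 'I_p -> J} -> {ffun 'I_p -> IZ} -> R)
  : R :=
  site_mean (V all_pos) - p%:R * site_mean (V last_pos) +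
  (p%:R - 1) * site_mean (V no_pos).

Definition edge_log' A pos (o : {ffun 'I_p -> J}) (z : {ffun 'I_p -> IZ}) : R :=
  edge_log m sp zg xg e pos o z A.

Definition comb (A : config p -> R) : R := combination (edge_log' A).

Lemma site_mean_cst c : site_mean (fun _ _ => c) = c.
Proof.
rewrite /site_mean; under eq_bigr do rewrite -mulr_suml -mulr_sumr.
rewrite -mulr_suml -mulr_suml -[RHS]mul1r; congr (_ * _).
rewrite -(bigA_distr_bigA (fun l : 'I_p => wJ)) -(bigA_distr_bigA (fun l : 'I_p => pZ)).
by rewrite big1 ?mul1r => [|l _]; [rewrite big1// => l _; exact: pZ_sum|exact: wJ_sum].
Qed.

Lemma site_mean_le V V' : (forall o z, V o z <= V' o z) ->
  site_mean V <= site_mean V'.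
Proof.
move=> VV'; apply: ler_sum => o _; apply: ler_sum => z _.
by rewrite ler_wpM2l ?mulr_ge0 ?prodr_ge0.
Qed.

Lemma site_meanD V V' :
  site_mean (fun o z => V o z + V' o z) = site_mean V + site_mean V'.
Proof.
rewrite /site_mean -big_split; apply: eq_bigr => o _ /=.
by rewrite -big_split; apply: eq_bigr => z _; rewrite /= mulrDr.
Qed.

Lemma combination_close V V' c D : (forall pos o z, `|V pos o z - V' pos o z - c| <= D) ->
  combination V <= combination V' + 2 * p%:R * D.
Proof.
move=> VV'.
have lo pos : site_mean (V pos) <= site_mean (V' pos) + c + D.
  rewrite -addrA -[c + D]site_mean_cst -site_meanD; apply: site_mean_le => o z.
  by have := VV' pos o z; rewrite ler_norml => /andP[_ h]; lra.
have hi pos : site_mean (V' pos) + c - D <= site_mean (V pos).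
  rewrite -addrA -[c - D]site_mean_cst -site_meanD; apply: site_mean_le => o z.
  by have := VV' pos o z; rewrite ler_norml => /andP[h _]; lra.
have p1 : 1 <= p%:R :> R by rewrite ler1n.
have a1 := lo all_pos.
have a2 : p%:R * (site_mean (V' last_pos) + c - D) <= p%:R * site_mean (V last_pos).
  by rewrite ler_wpM2l.
have a3 : (p%:R - 1) * site_mean (V no_pos) <= (p%:R - 1) * (site_mean (V' no_pos) + c + D).
  by rewrite ler_wpM2l// subr_ge0.
rewrite /combination; move: a1 a2 a3.
move: (site_mean (V all_pos)) (site_mean (V' all_pos)) (site_mean (V last_pos))
  (site_mean (V' last_pos)) (site_mean (V no_pos)) (site_mean (V' no_pos)) (p%:R : R)
  => v1 u1 v2 u2 v3 u3 q; lra.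
Qed.

Lemma combination_cst c : combination (fun _ _ _ => c) = 0.
Proof. by rewrite /combination !site_mean_cst; ring. Qed.

Lemma comb_close A B c D : (forall s, 0 < A s) -> (forall s, 0 < B s) ->
  (forall s, expR (c - D) * B s <= A s <= expR (c + D) * B s) ->
  comb A <= comb B + 2 * p%:R * (m * D).
Proof.
move=> A0 B0 AB; apply: (@combination_close _ _ (m * c)) => pos o z.
have l1 := @edge_log_le R m m_gt0 p T J IZ G sp zg xg zg_ge0 zg_sum e e_sum e_ge0
  e_gt0 e_prob pos o z A B (c + D) A0 B0.
have l2 := @edge_log_le R m m_gt0 p T J IZ G sp zg xg zg_ge0 zg_sum e e_sum e_ge0
  e_gt0 e_prob pos o z B A (D - c) B0 A0.
have := l1 (fun s => proj2 (andP (AB s))).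
have h2 s : B s <= expR (D - c) * A s.
  have /andP[h _] := AB s.
  rewrite -(ler_pM2l (expR_gt0 (c - D))) mulrA -expRD.
  have -> : c - D + (D - c) = 0 by ring.
  by rewrite expR0 mul1r.
have := l2 h2; rewrite !mulrDr mulrN /edge_log'.
set u := edge_log _ _ _ _ _ _ _ _ A; set v := edge_log _ _ _ _ _ _ _ _ B.
by move=> h h'; rewrite ler_norml; apply/andP; split; lra.
Qed.

Lemma comb_cst c : 0 < c -> comb (fun=> c) = 0.
Proof.
move=> c0; rewrite /comb -[RHS](combination_cst (m * ln c)).
suff E pos o z : edge_log' (fun=> c) pos o z = m * ln c.
  rewrite /combination; congr (_ - _ * _ + _ * _);
    by congr site_mean; do 2 apply/funext => ?; exact: E.
rewrite /edge_log' /edge_log /edge_mass.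
have -> : esum e (fun gam => \sum_(g : {ffun 'I_p -> G})
    cavity_wt zg z g * (\sum_t gam t * edge_avg sp xg pos o (fun=> c) t g) `^ m) =
    c `^ m.
  rewrite /esum big_seq -[RHS]mul1r -e_sum mulr_suml [RHS]big_seq.
  apply: eq_bigr => x xe; congr (_ * _).
  under eq_bigr do under eq_bigr do rewrite edge_avg_cst.
  under eq_bigr do rewrite -mulr_suml (e_prob xe) mul1r.
  by rewrite -mulr_suml cavity_wt_sum// mul1r.
exact: ln_powR.
Qed.

Variables (theta : Omega -> config p -> R)
  (fc : 'I_p -> {RV P >-> funspace R bool}) (f : {RV P >-> funspace R bool})
  (a b : {RV P >-> measurableTypeR R}).
Hypotheses (fc_law : forall j, same_law (fc j) f)
  (fab_indep : mutually_independent P [set: option 'I_p] (fun o =>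
        if o is Some j then g_sigma_algebra_preimage (fc j)
        else g_sigma_algebra_preimage (fun w => (a w, b w))))
  (theta_fact : {ae P, forall w, forall s : config p,
      expR (theta w s) = a w * (1 + b w * \prod_(j < p) fc j w (s j)) /\
      `|b w * \prod_(j < p) fc j w (s j)| < 1})
  (b_moments : forall n, (1 <= n)%N -> (0 <= 'E_P[fun w => ((- b w) ^+ n)%R])%E)
  (even_or_nonneg : ~~ odd p \/ {ae P, forall w, forall s : bool, 0 <= f w s}).

(** Values larger than C are replaced by 0: on an almost sure event nothing
    changes, and expectations become those of bounded variables. *)
Definition cut (C x : R) : R := if `|x| <= C then x else 0.

Definition cutf (C : R) (g : funspace R bool) : funspace R bool :=
  fun s => cut C (g s).

Lemma cut_bd C x : 0 <= C -> `|cut C x| <= C.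
Proof. by move=> C0; rewrite /cut; case: ifP => //; rewrite normr0. Qed.

Lemma cut_id C x : `|x| <= C -> cut C x = x.
Proof. by rewrite /cut => ->. Qed.

Lemma measurable_cut C : measurable_fun [set: measurableTypeR R] (cut C : _ -> R).
Proof.
apply: measurable_fun_ifT => //.
by apply: measurable_fun_ler => //; exact: measurableT_comp.
Qed.

Lemma measurable_evalf (s : bool) :
  measurable_fun [set: funspace R bool] (fun g : funspace R bool => g s : R).
Proof.
move=> _ B mB; rewrite setTI; apply: sub_sigma_algebra.
by exists s, B; split.
Qed.

Lemma measurable_cutf C : measurable_fun [set: funspace R bool] (cutf C).
Proof.
apply: (@measurability _ _ _ (funspace R bool) _ _ (@evaluation_sets R bool)) => //.
move=> _ [_ [s [B [mB ->]]] <-]; rewrite setTI.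
have H : measurable_fun [set: funspace R bool] (cut C \o (fun g : funspace R bool => g s)).
  exact: measurableT_comp (measurable_cut C) (measurable_evalf s).
by have := H measurableT B mB; rewrite setTI.
Qed.

Section bounded_case.
Variable C : R.
Hypothesis C_gt0 : 0 < C.
Hypotheses (b_bd : {ae P, forall w, `|b w| <= C})
  (fc_bd : {ae P, forall w, forall j s, `|fc j w s| <= C}).

Let bt w := cut C (b w).
Let ft j w : bool -> R := cutf C (fc j w).

Lemma nice_meas F j : nice F -> measurable_fun [set: Omega] (fun w => F (ft j w)).
Proof.
move=> [mF _ _]; apply: measurableT_comp => //.
by apply: measurableT_comp => //; exact: measurable_cutf.
Qed.

Lemma nice_bounded F j : nice F -> bounded_meas (fun w => F (ft j w)).
Proof.
move=> nF; split; first exact: nice_meas.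
have [_ /(_ C)[D hD] _] := nF; exists D => w; apply: hD => s.
by rewrite /ft /cutf cut_bd// ltW.
Qed.

Lemma bounded_bt n : bounded_meas (fun w => (- bt w) ^+ n).
Proof.
have h : bounded_meas (fun w => - bt w).
  split.
    apply: measurableT_comp => //.
    by apply: measurableT_comp => //; exact: measurable_cut.
  by exists C => w; rewrite normrN cut_bd// ltW.
elim: n => [|n IH].
  rewrite (_ : (fun w => _) = fun=> 1); first exact: bounded_meas_cst.
  by apply/funext => w; rewrite expr0.
rewrite (_ : (fun w => _) = fun w => (- bt w) * (- bt w) ^+ n).
  exact: bounded_measM.
by apply/funext => w; rewrite exprS.
Qed.

Lemma mean_bt_ge0 n : 0 <= mean P (fun w => (- bt w) ^+ n).
Proof.
case: n => [|n].
  have -> : (fun w => (- bt w) ^+ 0) = fun=> 1 by apply/funext => w; rewrite expr0.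
  by rewrite mean_cst.
have := @b_moments n.+1 isT; rewrite unlock.
rewrite (@ae_eq_integral _ _ _ P setT (fun w => ((- bt w) ^+ n.+1)%:E)) //.
- by rewrite (mean_EFin P (bounded_bt n.+1)) lee_fin.
- apply/measurable_EFinP; apply: measurable_funX.
  exact: measurableT_comp.
- by apply/measurable_EFinP; case: (bounded_bt n.+1).
- by apply: filterS b_bd => w bw _; rewrite /bt cut_id.
Qed.

Lemma prod_option (I : finType) (F : option I -> R) :
  \prod_o F o = F None * \prod_i F (Some i).
Proof.
rewrite (bigD1 None)//=; congr (_ * _).
rewrite (reindex_omap (@Some I) id) => [|[i|]//].
by apply: eq_bigl => i; rewrite /= eqxx.
Qed.

Lemma mean_factor n (F : 'I_p -> (bool -> R) -> R) : (forall l, nice (F l)) ->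
  mean P (fun w => (- bt w) ^+ n * \prod_l F l (ft l w)) =
  mean P (fun w => (- bt w) ^+ n) * \prod_l mean P (fun w => F l (ft l w)).
Proof.
move=> nF.
pose X (o : option 'I_p) (w : Omega) : R :=
  if o is Some l then F l (ft l w) else (- bt w) ^+ n.
have bX o : bounded_meas (X o).
  by case: o => [l|]; [exact: nice_bounded|exact: bounded_bt].
have [D [D0 hD]] : exists D, 0 < D /\ forall o w, `|X o w| <= D.
  have /choice[D hD] : forall o, exists D, forall w, `|X o w| <= D.
    by move=> o; case: (bX o) => _ [D hD]; exists D.
  exists (1 + \sum_o `|D o|); split; first by rewrite ltr_pwDl// sumr_ge0.
  move=> o w; rewrite (le_trans (hD o w))// (le_trans (ler_norm _))//.
  by rewrite (bigD1 o)//= addrCA lerDl addr_ge0// sumr_ge0.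
have := @mean_prod R dd Omega P _ _ X _ fab_indep _ D D0 hD.
have split_prod w : \prod_o X o w = (- bt w) ^+ n * \prod_l F l (ft l w).
  by rewrite prod_option.
have -> : (fun w => \prod_o X o w) = (fun w => (- bt w) ^+ n * \prod_l F l (ft l w)).
  by apply/funext.
move=> ->.
- by rewrite prod_option.
- move=> [j|] A [B mB <-]; rewrite setTI.
    by rewrite -[_ @^-1` _]setTI; exact: measurable_funPT.
  rewrite -[_ @^-1` _]setTI; apply: (measurable_fun_prod _ _ measurableT) => //.
- move=> [j|] B mB.
    exists ((fun g : funspace R bool => F j (cutf C g)) @^-1` B); last by rewrite setTI.
    have [mF _ _] := nF j.
    have := measurableT_comp mF (measurable_cutf C) measurableT mB.
    by rewrite setTI.
  exists ((fun u : measurableTypeR R * measurableTypeR R => (- cut C u.2) ^+ n) @^-1` B).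
    have : measurable_fun [set: measurableTypeR R * measurableTypeR R]
      (fun u : measurableTypeR R * measurableTypeR R => (- cut C u.2) ^+ n : R).
      apply: measurable_funX; apply: measurableT_comp => //.
      apply: measurableT_comp => //; exact: measurable_cut.
    by move=> /(_ measurableT _ mB); rewrite setTI.
  by rewrite setTI.
Qed.

Lemma site_mean_mval (u : R) (g : 'I_p -> bool -> R) (M : monomial R J IZ) pos :
  site_mean (fun o z => mval pos u g o z M) =
  coef M * ((- u) ^+ degree M * \prod_l
    (if pos l then \sum_j wJ j * fact_vertex M (g l) j
     else \sum_i pZ i * fact_cavity M (g l) i)).
Proof.
transitivity (coef M * ((- u) ^+ degree M *
  \prod_l \sum_j \sum_i wJ j * pZ i * (if pos l then fact_vertex M (g l) j
      else fact_cavity M (g l) i))); last first.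
  congr (_ * (_ * _)); apply: eq_bigr => l _; case: (pos l).
    apply: eq_bigr => j _; rewrite -mulr_suml -mulr_sumr pZ_sum.
    by rewrite mulr1.
  rewrite exchange_big; apply: eq_bigr => i _; rewrite -mulr_suml -mulr_suml wJ_sum.
  by rewrite mul1r.
rewrite (bigA_distr_bigA (fun l j => \sum_i wJ j * pZ i *
  (if pos l then fact_vertex M (g l) j else fact_cavity M (g l) i))) /=.
rewrite /site_mean !mulr_sumr; apply: eq_bigr => o _.
rewrite (bigA_distr_bigA (fun l i => wJ (o l) * pZ i *
  (if pos l then fact_vertex M (g l) (o l) else fact_cavity M (g l) i))) /=.
rewrite !mulr_sumr; apply: eq_bigr => z _.
rewrite !big_split /= /mval; move: (_ ^+ _) (\prod_l _) (\prod_l _) (\prod_l _).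
by move=> x1 x2 x3 x4; ring.
Qed.

Lemma mean_vertex_same (F : (bool -> R) -> R) l l' : nice F ->
  mean P (fun w => F (ft l w)) = mean P (fun w => F (ft l' w)).
Proof.
move=> nF.
suff H k : mean P (fun w => F (ft k w)) = mean P (fun w => F (cutf C (f w))).
  by rewrite !H.
have mF : measurable_fun [set: funspace R bool] (fun g : funspace R bool => F (cutf C g)).
  by case: nF => mF _ _; apply: (measurableT_comp mF); exact: measurable_cutf.
apply: (@mean_same_law _ _ _ _ _ P (fc k) f (fun g => F (cutf C g)) (fc_law k) mF).
  exact: nice_bounded.
split; first exact: measurableT_comp.
have [_ /(_ C)[D hD] _] := nF; exists D => w; apply: hD => s.
by rewrite /cutf cut_bd// ltW.
Qed.

Lemma mean_nice_ge0 (F : (bool -> R) -> R) l : nice F ->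
  {ae P, forall w, forall s : bool, 0 <= f w s} -> 0 <= mean P (fun w => F (ft l w)).
Proof.
move=> nF f0.
have mF : measurable_fun [set: funspace R bool] (fun g : funspace R bool => F (cutf C g)).
  by case: nF => mF _ _; apply: (measurableT_comp mF); exact: measurable_cutf.
have bf : bounded_meas (fun w => F (cutf C (f w))).
  split; first exact: (measurableT_comp mF).
  have [_ /(_ C)[D hD] _] := nF; exists D => w; apply: hD => s.
  by rewrite /cutf cut_bd// ltW.
rewrite (_ : mean _ _ = mean P (fun w => F (cutf C (f w)))); last first.
  apply: (@mean_same_law _ _ _ _ _ P (fc l) f (fun g => F (cutf C g)) (fc_law l) mF) => //.
  exact: nice_bounded.
rewrite -[leLHS](mean_cst P 0); apply: mean_ae_le => //; first exact: bounded_meas_cst.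
apply: filterS f0 => w f0; have [_ _ h] := nF; apply: h => s.
by rewrite /cutf /cut; case: ifP.
Qed.

(** The mean of a monomial is its coefficient times E[(-b)^n] times a product
    over positions of X for a vertex and Y for a cavity variable, the same for
    all positions because the factors have the same law. The combination is
    then that of pow_comparison. *)
Lemma monomial_comb_ge0 (M : monomial R J IZ) : wf_monomial M ->
  bounded_meas (fun w => combination (fun pos o z => mval pos (bt w) (fun j => ft j w) o z M)) /\
  0 <= mean P (fun w => combination (fun pos o z => mval pos (bt w) (fun j => ft j w) o z M)).
Proof.
move=> [c0 nv nc].
pose FA g := \sum_j wJ j * fact_vertex M g j.
pose FB g := \sum_i pZ i * fact_cavity M g i.
have nA : nice FA by apply: nice_sum => j; apply: niceM => //; exact: nice_cst.
have nB : nice FB by apply: nice_sum => i; apply: niceM => //; exact: nice_cst.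
pose Fp (pos : 'I_p -> bool) l : (bool -> R) -> R := if pos l then FA else FB.
have nFp pos l : nice (Fp pos l) by rewrite /Fp; case: (pos l).
have l0 : 'I_p := Ordinal p_gt0.
set A := mean P (fun w => FA (ft l0 w)); set B := mean P (fun w => FB (ft l0 w)).
pose u := mean P (fun w => (- bt w) ^+ degree M).
pose X pos w := (- bt w) ^+ degree M * \prod_l Fp pos l (ft l w).
have bX pos : bounded_meas (X pos).
  apply: bounded_measM; first exact: bounded_bt.
  by apply: bounded_meas_prod => l; exact: nice_bounded.
have XE pos w : site_mean (fun o z => mval pos (bt w) (fun j => ft j w) o z M) =
    coef M * X pos w.
  rewrite site_mean_mval /X; congr (_ * (_ * _)); apply: eq_bigr => l _.
  by rewrite /Fp; case: (pos l).
have mX pos : mean P (X pos) = u * \prod_l (if pos l then A else B).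
  rewrite /X mean_factor//; congr (_ * _); apply: eq_bigr => l _.
  by rewrite /Fp; case: (pos l); exact: mean_vertex_same.
have -> : (fun w => combination (fun pos o z => mval pos (bt w) (fun j => ft j w) o z M)) =
    fun w => coef M * (X all_pos w + (- p%:R * X last_pos w + (p%:R - 1) * X no_pos w)).
  by apply/funext => w; rewrite /combination !XE; ring.
have b1 : bounded_meas (fun w => - p%:R * X last_pos w) by exact: bounded_measZ.
have b2 : bounded_meas (fun w => (p%:R - 1) * X no_pos w) by exact: bounded_measZ.
have b3 : bounded_meas (fun w => - p%:R * X last_pos w + (p%:R - 1) * X no_pos w).
  exact: bounded_measD.
have b4 : bounded_meas (fun w => X all_pos w + (- p%:R * X last_pos w + (p%:R - 1) * X no_pos w)).
  exact: bounded_measD.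
split; first exact: bounded_measZ.
rewrite (meanZ P _ b4) (meanD P (bX all_pos) b3) (meanD P b1 b2) !meanZ// !mX.
have -> : \prod_(l < p) (if all_pos l then A else B) = A ^+ p.
  by rewrite prodr_const card_ord.
have -> : \prod_(l < p) (if no_pos l then A else B) = B ^+ p.
  by rewrite prodr_const card_ord.
have -> : \prod_(l < p) (if last_pos l then A else B) = A * B ^+ p.-1.
  have p1p : (p.-1 < p)%N by rewrite prednK.
  rewrite (bigD1 (Ordinal p1p))//= /last_pos eqxx; congr (_ * _).
  rewrite (eq_bigr (fun=> B)) => [|l]; last first.
    by rewrite -val_eqE /= => /negbTE ->.
  by rewrite prodr_const cardC1 card_ord.
have u0 : 0 <= u := mean_bt_ge0 _.
rewrite (_ : _ + _ = u * (A ^+ p - p%:R * (A * B ^+ p.-1) + (p%:R - 1) * B ^+ p)); last by ring.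
rewrite mulr_ge0// mulr_ge0//; apply: pow_comparison => //.
by case: even_or_nonneg => [ev|f0]; [left|right; split; exact: mean_nice_ge0].
Qed.

Lemma poly_comb_ge0 (Q : seq (monomial R J IZ)) : wf_poly Q ->
  bounded_meas (fun w => combination (fun pos o z => pval pos (bt w) (fun j => ft j w) o z Q)) /\
  0 <= mean P (fun w => combination (fun pos o z => pval pos (bt w) (fun j => ft j w) o z Q)).
Proof.
elim=> [|M {}Q wM _ [bQ mQ]].
  have -> : (fun w => combination (fun pos o z =>
      pval pos (bt w) (fun j => ft j w) o z [::])) = fun=> 0.
    apply/funext => w; rewrite -[RHS](combination_cst 0) /combination.
    by congr (_ - _ * _ + _ * _); congr site_mean;
      do 2 apply/funext => ?; rewrite /pval big_nil.
  by split; [exact: bounded_meas_cst|rewrite mean_cst].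
have [bM mM] := monomial_comb_ge0 wM.
have -> : (fun w => combination (fun pos o z =>
    pval pos (bt w) (fun j => ft j w) o z (M :: Q))) = fun w =>
    combination (fun pos o z => mval pos (bt w) (fun j => ft j w) o z M) +
    combination (fun pos o z => pval pos (bt w) (fun j => ft j w) o z Q).
  apply/funext => w.
  have E pos : site_mean (fun o z => pval pos (bt w) (fun j => ft j w) o z (M :: Q)) =
     site_mean (fun o z => mval pos (bt w) (fun j => ft j w) o z M) +
     site_mean (fun o z => pval pos (bt w) (fun j => ft j w) o z Q).
    rewrite -site_meanD; congr site_mean; do 2 apply/funext => ?.
    by rewrite /pval big_cons.
  by rewrite /combination !E; ring.
split; first exact: bounded_measD.
by rewrite meanD// addr_ge0.
Qed.

(** Mixing with the constant a multiplies b by s and keeps the product form,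
    while 1 + s b f stays away from 0, where the logarithm is singular. *)
Definition reg (s : R) w (c : config p) : R := (1 - s) * a w + s * expR (theta w c).

(** The mean of the combination of - log is that of a polynomial with
    nonnegative coefficients, up to eps, since a and b enter the polynomial
    only through powers of -b. *)
Lemma comb_reg_le (s eps : R) : 0 < s < 1 -> 0 < eps ->
  exists g : Omega -> R, [/\ bounded_meas g, 0 <= mean P g &
    {ae P, forall w, comb (reg s w) <= 2 * p%:R * eps - g w}].
Proof.
move=> s01 eps0.
have [N1 [N2 [c1 [c2 [c10 c20 ap]]]]] := log_approx_exists m_gt0 m_lt1 s01 eps0.
pose Q := log_poly sp zg xg e N1 N2 c1 c2.
have wQ : wf_poly Q by exact: wf_log_poly.
have [bQ mQ] := poly_comb_ge0 wQ.
exists (fun w => combination (fun pos o z => pval pos (bt w) (fun j => ft j w) o z Q)).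
split => //.
apply: filterS3 theta_fact b_bd fc_bd => w tw bw fw.
have ca (c : config p) : expR (theta w c) = a w * (1 + bt w * \prod_l ft l w (c l)).
  rewrite /bt cut_id// (eq_bigr (fun j => fc j w (c j))) => [|l _].
    by have [] := tw c.
  by rewrite /ft /cutf cut_id.
have le1 (c : config p) : `|bt w * \prod_l ft l w (c l)| < 1.
  rewrite /bt cut_id// (eq_bigr (fun j => fc j w (c j))) => [|l _].
    by have [] := tw c.
  by rewrite /ft /cutf cut_id.
have a0 : 0 < a w.
  have := expR_gt0 (theta w [ffun=> true]); rewrite ca pmulr_lgt0//.
  by have := le1 [ffun=> true]; rewrite ltr_norml => /andP[]; lra.
have -> : reg s w = fun c => a w * (1 + s * bt w * \prod_l ft l w (c l)).
  by apply/funext => c; rewrite /reg ca; ring.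
rewrite addrC -mulrN1.
have -> : forall V, combination V * -1 = combination (fun pos o z => - V pos o z).
  move=> V; have E W : site_mean (fun o z => - W o z) = - site_mean W.
    rewrite /site_mean -sumrN; apply: eq_bigr => o _; rewrite -sumrN.
    by apply: eq_bigr => z _; rewrite mulrN.
  by rewrite /combination !E; ring.
apply: (@combination_close _ _ (m * ln (a w))) => pos o z.
have le1' (c : config p) : `|bt w * \prod_l ft l w (c l)| <= 1 by exact/ltW.
rewrite opprK addrAC.
exact: (edge_log_poly sp xg zg_ge0 zg_sum e_sum e_ge0 e_gt0 e_prob pos o z le1' s01 a0 ap).
Qed.

End bounded_case.

Lemma factors_measurable (F : funspace R bool -> R) (F' : R -> R) :
  measurable_fun [set: funspace R bool] F -> measurable_fun [set: measurableTypeR R] F' ->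
  let X (o : option 'I_p) (w : Omega) : R := if o is Some l then F (fc l w) else F' (b w) in
  let FF (o : option 'I_p) := if o is Some j then g_sigma_algebra_preimage (fc j)
        else g_sigma_algebra_preimage (fun w => (a w, b w)) in
  (forall o A, FF o A -> measurable A) /\
  (forall o (B : set (measurableTypeR R)), measurable B -> FF o (X o @^-1` B)).
Proof.
move=> mF mF' X FF; split.
  move=> [j|] A [B mB <-]; rewrite setTI.
    by rewrite -[_ @^-1` _]setTI; exact: measurable_funPT.
  by rewrite -[_ @^-1` _]setTI; apply: (measurable_fun_pair _ _ measurableT).
move=> [j|] B mB.
  exists (F @^-1` B); last by rewrite setTI.
  by have := mF measurableT B mB; rewrite setTI.
exists ((fun u : measurableTypeR R * measurableTypeR R => F' u.2) @^-1` B); last by rewrite setTI.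
have : measurable_fun [set: measurableTypeR R * measurableTypeR R]
  (fun u : measurableTypeR R * measurableTypeR R => F' u.2 : R) by exact: measurableT_comp.
by move=> /(_ measurableT _ mB); rewrite setTI.
Qed.

(** The product of b and of the p independent factors is bounded by 1; either
    it vanishes or each of the factors is bounded. *)
Lemma bounded_or_null :
  {ae P, forall w, forall c : config p, b w * \prod_(l < p) fc l w (c l) = 0} \/
  exists C, [/\ 0 < C, {ae P, forall w, `|b w| <= C} &
    {ae P, forall w, forall l s, `|fc l w s| <= C}].
Proof.
pose F (g : funspace R bool) := `|g true| + `|g false|.
have mF : measurable_fun [set: funspace R bool] F.
  by apply: measurable_realfun.measurable_funD;
     apply: measurableT_comp => //; exact: measurable_evalf.
have mF' : measurable_fun [set: measurableTypeR R] (@Num.norm R R).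
  exact: normr_measurable.
have [F_meas X_F0] := factors_measurable mF mF'.
pose X (o : option 'I_p) (w : Omega) : R := if o is Some l then F (fc l w) else `|b w|.
have X_F := X_F0 : forall o (B : set (measurableTypeR R)), measurable B -> _ (X o @^-1` B).
have X0 o w : 0 <= X o w by case: o => [l|] /=; rewrite ?addr_ge0.
have prodX w : \prod_o X o w = \sum_(c : config p) `|b w * \prod_l fc l w (c l)|.
  rewrite prod_option /= /F.
  transitivity (`|b w| * \prod_(l < p) \sum_s `|fc l w s|).
    by congr (_ * _); apply: eq_bigr => l _; rewrite big_bool.
  rewrite (bigA_distr_bigA (fun l s => `|fc l w s|)) mulr_sumr.
  by apply: eq_bigr => c _; rewrite normrM normr_prod.
have D0 : 0 < #|config p|%:R :> R by rewrite ltr0n; apply/card_gt0P; exists [ffun=> true].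
have prodD : {ae P, forall w, \prod_o X o w <= #|config p|%:R}.
  apply: filterS theta_fact => w tw; rewrite prodX -sum1_card natr_sum.
  by apply: ler_sum => c _; apply/ltW; have [] := tw c.
have [ [i Xi]|[C [C0 hC]] ] := bounded_factors F_meas fab_indep X_F X0 D0 prodD.
  left; apply: filterS Xi => w Xi c; apply/eqP; rewrite -normr_eq0.
  have : \prod_o X o w = 0 by rewrite (bigD1 i)//= Xi mul0r.
  rewrite prodX => /eqP; rewrite psumr_eq0// => /allP/(_ c); apply.
  by rewrite mem_index_enum.
right; exists C; split => //; apply: filterS hC => w h.
  exact: h None.
move=> l s; have := h (Some l); rewrite /= /F; apply: le_trans.
by case: s; rewrite ?lerDl ?lerDr.
Qed.

Variable kap : R.
Hypotheses (kap_gt0 : 0 < kap)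
  (theta_bd : {ae P, forall w, forall s : config p, `|theta w s| <= kap}).
Variables (XX : finType) (r : Omega -> XX) (Ahat : XX -> config p -> R) (del : R).
Hypotheses (r_meas : forall x, measurable (r @^-1` [set x]))
  (Ahat_gt0 : forall x c, 0 < Ahat x c)
  (Ahat_close : {ae P, forall w, forall c,
     expR (- del) * expR (theta w c) <= Ahat (r w) c <= expR del * expR (theta w c)}).

Lemma comb_expR_le w : (forall s : config p, `|theta w s| <= kap) ->
  comb (fun c => expR (theta w c)) <= 2 * p%:R * (m * kap).
Proof.
move=> tw; rewrite -[leRHS]add0r -[X in _ <= X + _](comb_cst ltr01).
apply: (@comb_close _ _ 0 kap) => [c|//|c]; first exact: expR_gt0.
rewrite !mulr1 sub0r add0r.
by rewrite !ler_expR -ler_norml.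
Qed.

(** With theta bounded by kap, the mixture is between exp(-kap) and exp(kap)
    times a constant, for which the combination vanishes. *)
Lemma comb_reg_ge s w : 0 < s < 1 -> 0 < a w ->
  (forall s : config p, `|theta w s| <= kap) ->
  0 <= comb (reg s w) + 2 * p%:R * (m * kap).
Proof.
move=> /andP[s0 s1] a0 tw.
have s1' : 0 < 1 - s by rewrite subr_gt0.
have c0 : 0 < (1 - s) * a w + s by rewrite addr_gt0// mulr_gt0.
have k1 : 1 <= expR kap by rewrite -expR0 ler_expR ltW.
have k2 : expR (- kap) <= 1 by rewrite -expR0 ler_expR oppr_le0 ltW.
rewrite -[leLHS](comb_cst c0).
apply: (@comb_close _ _ 0 kap) => [//|c|c].
  by rewrite /reg addr_gt0// mulr_gt0 ?expR_gt0.
rewrite /reg.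
have /ler_normlP[t1 t2] := tw c.
have e1 : expR (theta w c) <= expR kap by rewrite ler_expR.
have e2 : expR (- kap) <= expR (theta w c) by rewrite ler_expR lerNl.
have e3 : expR (- kap) * expR kap = 1 by rewrite -expRD addNr expR0.
have ek := expR_gt0 kap; have enk := expR_gt0 (- kap).
have aa : 0 < (1 - s) * a w by rewrite mulr_gt0.
rewrite sub0r add0r; apply/andP; split.
  apply: (@le_trans _ _ (expR (- kap) * ((1 - s) * a w + s * expR kap))).
    by rewrite ler_pM2l// lerD2l ler_pM2l.
  have -> : expR (- kap) * ((1 - s) * a w + s * expR kap) =
    expR (- kap) * ((1 - s) * a w) + s * (expR (- kap) * expR kap) by ring.
  by rewrite e3 mulr1 lerD2r -[leRHS]mul1r ler_wpM2r// ltW.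
apply: (@le_trans _ _ (expR kap * ((1 - s) * a w + s * expR (- kap)))).
  have -> : expR kap * ((1 - s) * a w + s * expR (- kap)) =
    expR kap * ((1 - s) * a w) + s * (expR (- kap) * expR kap) by ring.
  rewrite e3 mulr1 lerD2r.
  by rewrite -[leLHS]mul1r ler_wpM2r// ltW.
by rewrite ler_pM2l// lerD2l ler_pM2l.
Qed.

(** Where a is bounded, the mixture approaches exp theta as s tends to 1. *)
Lemma comb_expR_reg s A w : 0 < s < 1 -> 0 < a w -> a w <= A ->
  (forall s : config p, `|theta w s| <= kap) ->
  comb (fun c => expR (theta w c)) <=
  comb (reg s w) + 2 * p%:R * (m * ((1 - s) / s + (1 - s) * A * expR kap)).
Proof.
move=> /andP[s0 s1] a0 aA tw.
have s1' : 0 < 1 - s by rewrite subr_gt0.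
set D := _ + _ * _ * _.
have D1 : (1 - s) / s <= D.
  rewrite lerDl mulr_ge0 ?expR_ge0// mulr_ge0 ?(ltW s1')//; exact: le_trans (ltW a0) aA.
have D2 : (1 - s) * A * expR kap <= D by rewrite lerDr divr_ge0 ?ltW.
apply: (@comb_close _ _ 0 D) => [c|c|c]; first exact: expR_gt0.
  by rewrite /reg addr_gt0// mulr_gt0 ?expR_gt0.
have t0 := expR_gt0 (theta w c).
have /ler_normlP[t1 t2] := tw c.
have e2 : 1 <= expR kap * expR (theta w c).
  by rewrite -expRD -expR0 ler_expR; move: t1; lra.
have eD : 1 + D <= expR D by exact: expR_ge1Dx.
rewrite sub0r add0r expRN; apply/andP; split.
  rewrite ler_pdivrMl ?expR_gt0//.
  apply: (@le_trans _ _ ((1 + D) * expR (theta w c))); last by rewrite ler_wpM2r// ltW.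
  rewrite /reg; apply: (@le_trans _ _ ((1 - s) * A * (expR kap * expR (theta w c)) +
     s * expR (theta w c))).
    rewrite lerD2r; apply: (@le_trans _ _ ((1 - s) * A)).
      by rewrite ler_wpM2l// ltW.
    rewrite -[leLHS]mulr1 ler_wpM2l// mulr_ge0 ?(ltW s1')//; exact: le_trans (ltW a0) aA.
  rewrite mulrA -mulrDl ler_wpM2r ?(ltW t0)// addrC lerD ?(ltW s1)//.
apply: (@le_trans _ _ (expR D * (s * expR (theta w c)))).
  rewrite mulrA -[leLHS]mul1r ler_wpM2r ?(ltW t0)//.
  rewrite -ler_pdivrMr//; apply: le_trans eD.
  rewrite (_ : 1 / s = 1 + (1 - s) / s) ?lerD2l//.
  by rewrite mulrBl divff ?gt_eqF// addrC subrK.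
by rewrite ler_wpM2l ?expR_ge0// /reg lerDr mulr_ge0 ?ltW.
Qed.

(** The factor exp theta is replaced by the mixture, for which the mean is at
    most 0, outside of the event where a is large; there the combination is
    bounded by a multiple of kap. The probability of this event and 1 - s are
    arbitrarily small, so that only the rounding error del remains. *)
Lemma edge_step : \sum_x fine (P (r @^-1` [set x])) * comb (Ahat x) <=
  2 * p%:R * (m * del).
Proof.
have combE w : comb (Ahat (r w)) = \sum_x \1_(r @^-1` [set x]) w * comb (Ahat x).
  rewrite (bigD1 (r w))//= big1 ?addr0 => [|x /eqP xr].
    by rewrite indicE mem_set// mul1r.
  by rewrite indicE memNset ?mul0r// => h; apply: xr; rewrite -h.
have bx x : bounded_meas (fun w => \1_(r @^-1` [set x]) w * comb (Ahat x)).
  by apply: bounded_measM; [exact: bounded_meas_indic|exact: bounded_meas_cst].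
have bcomb : bounded_meas (fun w => comb (Ahat (r w))).
  rewrite (_ : (fun w => _) = fun w => \sum_x \1_(r @^-1` [set x]) w * comb (Ahat x)).
    exact: bounded_meas_sum.
  by apply/funext.
have -> : \sum_x fine (P (r @^-1` [set x])) * comb (Ahat x) =
    mean P (fun w => comb (Ahat (r w))).
  under [in RHS]eq_fun do rewrite combE.
  rewrite mean_sum//; apply: eq_bigr => x _.
  under [in RHS]eq_fun do rewrite mulrC.
  rewrite meanZ ?mean_indic// 1?mulrC//; exact: bounded_meas_indic.
have close1 : {ae P, forall w, comb (Ahat (r w)) <=
    comb (fun c => expR (theta w c)) + 2 * p%:R * (m * del)}.
  apply: filterS Ahat_close => w hw.
  apply: (@comb_close _ _ 0 del) => // c; [exact: expR_gt0|].
  by rewrite sub0r add0r.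
have p0 : 0 < p%:R :> R by rewrite ltr0n.
case: bounded_or_null => [null|[C [C0 bC fC]]].
  rewrite -[leRHS](mean_cst P); apply: mean_ae_le => //; first exact: bounded_meas_cst.
  apply: filterS3 close1 null theta_fact => w h nw tw; apply: le_trans h _.
  have -> : (fun c => expR (theta w c)) = fun=> a w.
    by apply/funext => c; have [-> _] := tw c; rewrite nw addr0 mulr1.
  rewrite comb_cst ?add0r//.
  have [h _] := tw [ffun=> true].
  by move: h; rewrite nw addr0 mulr1 => <-; exact: expR_gt0.
apply/ler_addgt0Pr => eta eta0.
have [A [A0 hA]] : exists A, 0 < A /\
    fine (P [set w | A <= a w]) < eta / (3 * (4 * p%:R * (m * kap))).
  apply: tail_small; first exact: (measurable_funPT a).
  by rewrite divr_gt0// !mulr_gt0.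
pose B := 2 + A * expR kap.
have B0 : 0 < B by rewrite addr_gt0// mulr_gt0// expR_gt0.
(* t = 1 - s is small enough for the error of comb_expR_reg to be at most
   eta/3. *)
pose t := Num.min (2^-1) (eta / (6 * p%:R * m * B)).
have t0 : 0 < t by rewrite lt_min invr_gt0 ltr0n divr_gt0// !mulr_gt0.
have t2 : t <= 2^-1 by rewrite ge_min lexx.
have tB : 2 * p%:R * (m * (t * B)) <= eta / 3.
  have : t <= eta / (6 * p%:R * m * B) by rewrite ge_min lexx orbT.
  rewrite ler_pdivlMr ?mulr_gt0// => h; rewrite ler_pdivlMr//.
  by apply: le_trans h; rewrite le_eqVlt; apply/orP; left; apply/eqP; ring.
pose s := 1 - t.
have s01 : 0 < s < 1 by apply/andP; split; rewrite /s; lra.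
have eps0 : 0 < eta / (6 * p%:R) by rewrite divr_gt0// mulr_gt0.
have [g [bg mg hg]] := comb_reg_le C0 bC fC s01 eps0.
have mA : measurable [set w | A <= a w].
  have -> : [set w | A <= a w] = a @^-1` `[A, +oo[.
    by apply/seteqP; split => w; rewrite /= in_itv/= andbT.
  by rewrite -[_ @^-1` _]setTI; exact: measurable_funPT.
have bA := bounded_meas_indic R mA.
set k4 := 4 * p%:R * (m * kap).
have k40 : 0 < k4 by rewrite !mulr_gt0.
pose maj w := (2 * p%:R * (m * del) + eta / 3 + eta / 3) + (-1 * g w + k4 * \1_[set w | A <= a w] w).
have bG1 : bounded_meas (fun w => -1 * g w) by exact: bounded_measZ.
have bG2 : bounded_meas (fun w => k4 * \1_[set w | A <= a w] w) by exact: bounded_measZ.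
have bG3 : bounded_meas (fun w => -1 * g w + k4 * \1_[set w | A <= a w] w) by exact: bounded_measD.
have bc c : bounded_meas (fun _ : Omega => c : R) by exact: bounded_meas_cst.
have bG : bounded_meas maj by exact: bounded_measD.
apply: (@le_trans _ _ (mean P maj)); last first.
  rewrite /maj (meanD P (bc _) bG3) (meanD P bG1 bG2) mean_cst !meanZ// mean_indic//.
  move: hA; rewrite ltr_pdivlMr ?mulr_gt0// => hA.
  have : k4 * fine (P [set w | A <= a w]) <= eta / 3.
    by rewrite ler_pdivlMr// /k4; move: hA; rewrite -/k4; lra.
  by move: mg; move: (mean P g) (k4 * _) => u v; lra.
apply: mean_ae_le => //.
apply: filterS3 close1 hg (filterI theta_fact theta_bd) => w h1 h2 [tw kw]; apply: le_trans h1 _.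
have a0 : 0 < a w.
  have [h le1] := tw [ffun=> true].
  have := expR_gt0 (theta w [ffun=> true]); rewrite h pmulr_lgt0//.
  by move: le1; rewrite ltr_norml => /andP[]; lra.
have e6 : 2 * p%:R * (eta / (6 * p%:R)) = eta / 3.
  by field; rewrite gt_eqF.
rewrite e6 in h2.
rewrite /maj indicE; have [Aa|aA] := leP A (a w).
  rewrite mem_set//= mulr1.
  have := comb_expR_le kw; have := comb_reg_ge s01 a0 kw; rewrite /k4.
  by move: (comb (reg s w)) (comb _) (m * kap) (m * del) h2 eta0 => u v x y; lra.
rewrite memNset/= ?mulr0; last by rewrite leNgt aA.
have := comb_expR_reg s01 a0 (ltW aA) kw.
have : (1 - s) / s + (1 - s) * A * expR kap <= t * B.
  have -> : 1 - s = t by rewrite /s; ring.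
  rewrite /B mulrDr mulrA lerD2r ler_pM2l//.
  have /andP[s0 _] := s01.
  rewrite -[leRHS]invrK lef_pV2 ?posrE ?invr_gt0//; rewrite /s; lra.
rewrite -(ler_pM2l m_gt0) -(ler_pM2l (mulr_gt0 (ltr0n _ 2) p0)) => hD.
have := le_trans hD tB.
by move: (comb (reg s w)) (comb _) (2 * _ * (m * del)) (2 * _ * _) h2 eta0 => u v x y; lra.
Qed.

End step_inequality.

(** * The comparison for unnormalised ensembles *)

Section sums_over_functions.

Lemma sum_ffun_option (V : nmodType) (I I' G : finType) (e : I -> option I')
    (e' : option I' -> I) : cancel e e' -> cancel e' e ->
  forall F : {ffun I -> G} -> V,
  \sum_g F g = \sum_x \sum_(g' : {ffun I' -> G})
    F [ffun i => if e i is Some k then g' k else x].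
Proof.
move=> ee' e'e F; rewrite pair_big /=.
rewrite (reindex (fun u : G * {ffun I' -> G} =>
  [ffun i => if e i is Some k then u.2 k else u.1])) //=.
exists (fun g => (g (e' None), [ffun k => g (e' (Some k))])) => [[x g'] _|g _] /=.
  congr pair; first by rewrite ffunE e'e.
  by apply/ffunP => k; rewrite !ffunE e'e.
apply/ffunP => i; rewrite ffunE; case E : (e i) => [k|].
  by rewrite ffunE -E ee'.
by rewrite -E ee'.
Qed.

Definition rcons_ffun (G : finType) n (g : {ffun 'I_n -> G}) (x : G) : {ffun 'I_n.+1 -> G} :=
  [ffun l : 'I_n.+1 => if insub (val l) is Some k then g k else x].

Definition cons_ffun (G : finType) n (x : G) (g : {ffun 'I_n -> G}) : {ffun 'I_n.+1 -> G} :=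
  [ffun l : 'I_n.+1 => if unlift ord0 l is Some k then g k else x].

Definition widen1 n : 'I_n -> 'I_n.+1 := widen_ord (leqnSn n).

Lemma rcons_ffun_widen (G : finType) n (g : {ffun 'I_n -> G}) x k :
  rcons_ffun g x (widen1 k) = g k.
Proof. by rewrite ffunE /= valK. Qed.

Lemma rcons_ffun_max (G : finType) n (g : {ffun 'I_n -> G}) x :
  rcons_ffun g x ord_max = x.
Proof. by rewrite ffunE /= insubF// ltnn. Qed.

Lemma sum_rcons (V : nmodType) (G : finType) n (F : {ffun 'I_n.+1 -> G} -> V) :
  \sum_g F g = \sum_x \sum_(g : {ffun 'I_n -> G}) F (rcons_ffun g x).
Proof.
apply: (@sum_ffun_option _ _ _ _ (fun l : 'I_n.+1 => insub (val l))
  (fun o => if o is Some k then widen1 k else ord_max)) => [l|[k|]] /=.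
- by case: insubP => [k _ kl|nl]; apply: val_inj => //=; have := ltn_ord l; move: nl => /=; lia.
- by rewrite valK.
- by rewrite insubF// ltnn.
Qed.

Lemma sum_cons (V : nmodType) (G : finType) n (F : {ffun 'I_n.+1 -> G} -> V) :
  \sum_g F g = \sum_x \sum_(g : {ffun 'I_n -> G}) F (cons_ffun x g).
Proof.
apply: (@sum_ffun_option _ _ _ _ (unlift ord0)
  (fun o => if o is Some k then lift ord0 k else ord0)) => [l|[k|]] /=.
- by case: unliftP.
- by rewrite liftK.
- by rewrite unlift_none.
Qed.

Lemma sum_ffun0 (V : nmodType) (G : finType) (F : {ffun 'I_0 -> G} -> V)
    (g0 : {ffun 'I_0 -> G}) : \sum_g F g = F g0.
Proof.
rewrite (eq_bigl (pred1 g0)) ?big_pred1_eq// => g.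
by apply/esym/eqP/ffunP => -[].
Qed.

Lemma enum_cons_ffun (G : finType) n x (g : {ffun 'I_n -> G}) :
  [seq cons_ffun x g l | l <- enum 'I_n.+1] = x :: [seq g l | l <- enum 'I_n].
Proof.
rewrite enum_ordSl /= ffunE unlift_none; congr cons.
by rewrite -map_comp; apply: eq_map => k /=; rewrite ffunE liftK.
Qed.

Lemma prod_cons_ffun (V : pzSemiRingType) (G : finType) n x (g : {ffun 'I_n -> G})
    (F : 'I_n.+1 -> G -> V) :
  \prod_l F l (cons_ffun x g l) = F ord0 x * \prod_l F (lift ord0 l) (g l).
Proof.
rewrite big_ord_recl ffunE unlift_none; congr (_ * _).
by apply: eq_bigr => l _; rewrite ffunE liftK.
Qed.

Lemma prod_rcons_ffun (V : pzSemiRingType) (G : finType) n x (g : {ffun 'I_n -> G})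
    (F : 'I_n.+1 -> G -> V) :
  \prod_l F l (rcons_ffun g x l) = (\prod_l F (widen1 l) (g l)) * F ord_max x.
Proof.
rewrite big_ord_recr /= rcons_ffun_max; congr (_ * _).
by apply: eq_bigr => l _; rewrite rcons_ffun_widen.
Qed.

Lemma iid_ffun (R : realType) (H : finType) k (F : seq H -> R) (U : {set H}) :
  iid k F U = \sum_(o : {ffun 'I_k -> H})
    (\prod_l pick_weight R U (o l)) * F [seq o l | l <- enum 'I_k].
Proof.
elim: k F => [|k IH] F.
  rewrite (@sum_ffun0 R H (fun o => _) (ffun0 (card_ord 0))) big_ord0 mul1r /=.
  by rewrite enum_ord0.
rewrite /= sum_cons /pick_mean; apply: eq_bigr => v _.
rewrite IH big_distrr; apply: eq_bigr => o _ /=.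
by rewrite (prod_cons_ffun v o (fun _ => pick_weight R U)) enum_cons_ffun mulrA.
Qed.

Lemma sum_prod_ffun (R : realType) (G : finType) n (w : G -> R) : \sum_x w x = 1 ->
  \sum_(g : {ffun 'I_n -> G}) \prod_l w (g l) = 1.
Proof.
by move=> w1; rewrite -(bigA_distr_bigA (fun _ : 'I_n => w)) big1.
Qed.

End sums_over_functions.

Section finite_model.
Context (R : realType) (m : R) (m_gt0 : 0 < m).
Variables (G IZ : finType) (xg : G -> R) (zg : IZ -> G -> R) (pZ : IZ -> R).
Hypotheses (zg_ge0 : forall i g, 0 <= zg i g)
  (zg_sum : forall i, \sum_g zg i g = 1)
  (pZ_ge0 : forall i, 0 <= pZ i) (pZ_sum : \sum_i pZ i = 1).

(** The field that an edge, seen from its last vertex, exerts on it, when the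
    cavity variables take the value xg g with weight w l g. *)
Definition weighted_field p (th : config p -> R) (w : 'I_p.-1 -> G -> R) : ens R bool :=
  [seq (\prod_l w l (g l),
        fun s => cavity_avg (exp_theta th) (fun l => xg (g l)) s)
  | g : {ffun 'I_p.-1 -> G}].

Definition cavity_field p (th : config p -> R) (z : {ffun 'I_p.-1 -> IZ}) : ens R bool :=
  weighted_field th (fun l => zg (z l)).

Definition edge_value p (th : config p -> R) (z : {ffun 'I_p -> IZ}) : R :=
  m^-1 * ln (\sum_(g : {ffun 'I_p -> G}) (\prod_l zg (z l) (g l)) *
    gibbs_avg (exp_theta th) (fun l => xg (g l)) `^ m).

Lemma esum_weighted_field p (th : config p -> R) w (F : (bool -> R) -> R) :
  esum (weighted_field th w) F = \sum_(g : {ffun 'I_p.-1 -> G}) (\prod_l w l (g l)) *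
    F (fun s => cavity_avg (exp_theta th) (fun l => xg (g l)) s).
Proof. by rewrite /esum /weighted_field big_image. Qed.

Lemma field_weight_prod n (x : 'I_n -> R) (c : config n) :
  field_weight x c = \prod_l expR (x l * spin_val R (c l)).
Proof. by rewrite /field_weight expR_sum. Qed.

Lemma field_weight_norm n (x : 'I_n -> R) :
  \sum_(c : config n) field_weight x c = \prod_l \sum_s expR (x l * spin_val R s).
Proof.
rewrite (bigA_distr_bigA (fun l s => expR (x l * spin_val R s))).
by apply: eq_bigr => c _; exact: field_weight_prod.
Qed.

Lemma gibbs_weight n (x : 'I_n -> R) (c : config n) :
  field_weight x c / \sum_(c' : config n) field_weight x c' =
  \prod_l spin_prob (x l) (c l).
Proof. by rewrite field_weight_norm field_weight_prod -prodf_div. Qed.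

Lemma gibbs_avgE p (A : config p -> R) x :
  gibbs_avg A x = \sum_(c : config p) (\prod_l spin_prob (x l) (c l)) * A c.
Proof.
rewrite /gibbs_avg mulr_suml; apply: eq_bigr => c _.
by rewrite -gibbs_weight -mulrA mulrC.
Qed.

Lemma cavity_avgE p (A : config p -> R) x s :
  cavity_avg A x s = \sum_(c : config p.-1)
    (\prod_l spin_prob (x l) (c l)) * A (rcons_config c s).
Proof.
rewrite /cavity_avg mulr_suml; apply: eq_bigr => c _.
by rewrite -gibbs_weight -mulrA mulrC.
Qed.

Section one_step.
Variables (T H : finType) (t0 : T) (sp : H -> T -> bool) (n : nat) (U : {set H}).
Hypothesis UH : (#|U| < #|H|)%N.
Notation p := n.+1.
Notation massT := (@mass R m T).
Variable e : ens R T.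
Hypothesis e_pos : pos_ens e.

(** The normalisation of each Gibbs weight is moved to the weights, with the
    power m; logarithms of ratios are unchanged. *)
Definition tilt : ens R T :=
  [seq (x.1 * massT x.2 / esum e massT, fun t => x.2 t / \sum_t' x.2 t') | x <- e].

Let Z_gt0 : 0 < esum e massT. Proof. exact: esum_mass_gt0. Qed.

Lemma esum_tilt F : (forall c g, 0 < c -> (forall t, 0 < g t) -> F (fun t => g t * c) = F g * c `^ m) ->
  esum tilt F = esum e F / esum e massT.
Proof.
move=> Fh; rewrite /tilt; set Z := esum e massT; have Zn0 : Z != 0 by exact: lt0r_neq0.
rewrite /esum big_map mulr_suml big_seq [RHS]big_seq.
apply: eq_bigr => x xe /=; have [_ /(_ x xe)[x0 xpos]] := e_pos.
have S0 : 0 < \sum_t' x.2 t' by exact: sum_gt0.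
rewrite Fh ?invr_gt0// /mass.
have -> : (\sum_t' x.2 t')^-1 `^ m = ((\sum_t' x.2 t') `^ m)^-1.
  by rewrite -powR_inv1 ?ltW// -powRrM mulrC powRrM powR_inv1// powR_ge0.
have a0 : (\sum_t' x.2 t') `^ m != 0 by rewrite gt_eqF// powR_gt0.
by move: (_ `^ m) a0 (F _) (x.1) => u u0 v w; field; rewrite u0 Zn0.
Qed.

Lemma tilt_sum : \sum_(x <- tilt) x.1 = 1.
Proof.
rewrite /tilt big_map -mulr_suml; apply: divff; exact: lt0r_neq0.
Qed.

Lemma tilt_ge0 x : x \in tilt -> 0 <= x.1.
Proof.
move=> /mapP[y ye ->] /=; have [_ /(_ y ye)[y0 _]] := e_pos.
by rewrite mulr_ge0 ?invr_ge0 ?(ltW Z_gt0)// mulr_ge0// powR_ge0.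
Qed.

Lemma tilt_gt0 x : x \in tilt -> forall t, 0 < x.2 t.
Proof.
move=> /mapP[y ye ->] t /=; have [_ /(_ y ye)[_ ypos]] := e_pos.
by rewrite divr_gt0//; exact: sum_gt0.
Qed.

Lemma tilt_prob x : x \in tilt -> \sum_t x.2 t = 1.
Proof.
move=> /mapP[y ye ->] /=; have [_ /(_ y ye)[_ ypos]] := e_pos.
by rewrite -mulr_suml divff//; exact/lt0r_neq0/sum_gt0.
Qed.

Variable th : config p -> R.
Let A := exp_theta th.

Let A_gt0 c : 0 < A c. Proof. exact: expR_gt0. Qed.

Lemma edge_mass_tilt pos (o : {ffun 'I_p -> H}) (z : {ffun 'I_p -> IZ}) :
  edge_mass m sp zg xg tilt pos o z A =
  edge_mass m sp zg xg e pos o z A / esum e massT.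
Proof.
apply: esum_tilt => c g c0 g0; rewrite mulr_suml; apply: eq_bigr => gg _.
rewrite -mulrA; congr (_ * _).
have -> : \sum_t g t * c * edge_avg sp xg pos o A t gg =
  (\sum_t g t * edge_avg sp xg pos o A t gg) * c.
  by rewrite mulr_suml; apply: eq_bigr => t _; ring.
rewrite powRM ?(ltW c0)//; apply: sumr_ge0 => t _.
rewrite mulr_ge0 ?(ltW (g0 t))//; apply: sumr_ge0 => c' _.
by rewrite mulr_ge0 ?(ltW (A_gt0 _))//; apply: prodr_ge0 => l _; exact: position_wt_ge0.
Qed.

Lemma sum_cavity_wt (z : {ffun 'I_p -> IZ}) :
  \sum_(g : {ffun 'I_p -> G}) cavity_wt zg z g = 1.
Proof. exact: cavity_wt_sum. Qed.

(** All positions on vertices: the edge itself. *)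
Lemma edge_mass_all (o : {ffun 'I_p -> H}) (z : {ffun 'I_p -> IZ}) :
  edge_mass m sp zg xg e (@all_pos p) o z A =
  esum (addfac e (fun t => A [ffun l => sp (o l) t])) massT.
Proof.
rewrite esum_addfac /edge_mass; apply: eq_esum => g.
have E t gg : edge_avg sp xg (@all_pos p) o A t gg = A [ffun l => sp (o l) t].
  rewrite /edge_avg (bigD1 [ffun l => sp (o l) t])//= [X in _ + X]big1 ?addr0 => [|c cne].
    by rewrite big1 ?mul1r// => l _; rewrite /position_wt /= ffunE eqxx.
  have [l cl] : exists l, c l != sp (o l) t.
    apply/existsP; apply: contraNT cne; rewrite negb_exists => /forallP h.
    by apply/eqP/ffunP => l; rewrite ffunE; apply/eqP; rewrite -[_ == _]negbK h.
  by rewrite (bigD1 l)//= /position_wt /= (negbTE cl) !mul0r.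
under eq_bigr do under eq_bigr do rewrite E.
by rewrite -mulr_suml sum_cavity_wt mul1r.
Qed.

(** All positions on cavity variables: a factor without vertices. *)
Lemma edge_mass_none (o : {ffun 'I_p -> H}) (z : {ffun 'I_p -> IZ}) :
  edge_mass m sp zg xg e (@no_pos p) o z A =
  esum e massT * \sum_(g : {ffun 'I_p -> G}) (\prod_l zg (z l) (g l)) *
    gibbs_avg A (fun l => xg (g l)) `^ m.
Proof.
rewrite mulrC -esumZ /edge_mass /esum big_seq [RHS]big_seq; apply: eq_bigr => x xe.
congr (_ * _); rewrite mulr_suml; apply: eq_bigr => gg _.
rewrite -mulrA; congr (_ * _).
have E t : edge_avg sp xg (@no_pos p) o A t gg = gibbs_avg A (fun l => xg (gg l)).
  by rewrite gibbs_avgE.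
under eq_bigr do rewrite E.
have [_ /(_ x xe)[_ x0]] := e_pos.
rewrite -mulr_suml powRM 1?mulrC//; first exact/ltW/sum_gt0.
rewrite gibbs_avgE; apply: sumr_ge0 => c _; rewrite mulr_ge0 ?(ltW (A_gt0 _))//.
by apply: prodr_ge0 => l _; exact/ltW/spin_prob_gt0.
Qed.

(** One position on a vertex: a cavity field on that vertex. *)
Lemma edge_mass_last (o : {ffun 'I_n -> H}) (v : H) (z : {ffun 'I_n -> IZ}) i :
  edge_mass m sp zg xg e (@last_pos p) (rcons_ffun o v) (rcons_ffun z i) A =
  esum (addfield e (cavity_field th z) (sp v)) massT.
Proof.
rewrite esum_addfield /edge_mass; apply: eq_esum => g.
rewrite esum_weighted_field sum_rcons.
have E x (gg : {ffun 'I_n -> G}) t :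
  edge_avg sp xg (@last_pos p) (rcons_ffun o v) A t (rcons_ffun gg x) =
  cavity_avg A (fun l : 'I_n => xg (gg l)) (sp v t).
  rewrite /edge_avg sum_rcons cavity_avgE exchange_big /=; apply: eq_bigr => c _.
  rewrite (bigD1 (sp v t))//= [X in _ + X]big1 ?addr0 => [|s sv].
    rewrite prod_rcons_ffun; congr (_ * _).
    rewrite {2}/position_wt /last_pos /= eqxx rcons_ffun_max eqxx mulr1.
    apply: eq_bigr => l _; rewrite /position_wt /last_pos /= rcons_ffun_widen.
    by rewrite ltn_eqF// rcons_ffun_widen.
  rewrite (bigD1 ord_max)//= /position_wt /last_pos /= eqxx !rcons_ffun_max.
  by rewrite (negbTE sv) !mul0r.
rewrite exchange_big /=; apply: eq_bigr => gg _.
have C x : cavity_wt zg (rcons_ffun z i) (rcons_ffun gg x) =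
    (\prod_l zg (z l) (gg l)) * zg i x.
  rewrite /cavity_wt (prod_rcons_ffun x gg (fun l => zg (rcons_ffun z i l))).
  rewrite rcons_ffun_max; congr (_ * _); apply: eq_bigr => l _.
  by rewrite rcons_ffun_widen.
have E' x : \sum_t g t * edge_avg sp xg (@last_pos p) (rcons_ffun o v) A t (rcons_ffun gg x) =
    \sum_t g t * cavity_avg A (fun l : 'I_n => xg (gg l)) (sp v t).
  by apply: eq_bigr => t _; rewrite E.
under eq_bigr do rewrite C E'.
by rewrite -mulr_suml -mulr_sumr zg_sum mulr1.
Qed.

Let wU_sum : \sum_v pick_weight R U v = 1. Proof. exact: sum_pick_weight. Qed.

Lemma edge_log_tilt pos (o : {ffun 'I_p -> H}) (z : {ffun 'I_p -> IZ}) M :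
  edge_mass m sp zg xg e pos o z A = M -> 0 < M ->
  edge_log' m sp zg xg tilt A pos o z = ln M - m * ens_val m e.
Proof.
move=> EM M0; rewrite /edge_log' /edge_log edge_mass_tilt EM ln_div ?posrE//.
by rewrite /ens_val mulrA divff ?mul1r ?gt_eqF.
Qed.

Lemma m_ens_val (S : finType) (e' : ens R S) : m * ens_val m e' = ln (esum e' (@mass R m S)).
Proof. by rewrite /ens_val mulrA divff ?mul1r ?gt_eqF. Qed.

Lemma site_mean_all : site_mean (pick_weight R U) pZ
    (edge_log' m sp zg xg tilt A (@all_pos p)) =
  m * (iid p (fun vs => ens_val m (addfac e (fun t =>
         A [ffun l : 'I_p => nth false [seq sp v t | v <- vs] l]))) U - ens_val m e).
Proof.
rewrite iid_ffun mulrBr mulr_sumr.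
rewrite -[m * ens_val m e]mul1r -[in 1 * _](sum_prod_ffun p wU_sum) mulr_suml -sumrB.
rewrite /site_mean; apply: eq_bigr => o _.
under [LHS]eq_bigr => z _.
  rewrite (edge_log_tilt (edge_mass_all o z)); last first.
    by apply: esum_mass_gt0 => //; exact: pos_ens_addfac.
  over.
rewrite -mulr_suml -mulr_sumr (sum_prod_ffun p pZ_sum) mulr1 mulrBr -m_ens_val mulrCA.
congr (_ * (_ * ens_val m (addfac e _)) - _); apply/funext => t; congr A.
apply/ffunP => l; rewrite !ffunE -map_comp (nth_map l) ?size_enum_ord//=.
by rewrite nth_ord_enum.
Qed.

Lemma site_mean_none : site_mean (pick_weight R U) pZ
    (edge_log' m sp zg xg tilt A (@no_pos p)) =
  m * \sum_(z : {ffun 'I_p -> IZ}) (\prod_l pZ (z l)) * edge_value th z.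
Proof.
have g0 (z : {ffun 'I_p -> IZ}) : 0 < \sum_(g : {ffun 'I_p -> G}) (\prod_l zg (z l) (g l)) *
    gibbs_avg A (fun l => xg (g l)) `^ m.
  apply: (@wsum_gt0 R _ (index_enum {ffun 'I_p -> G}) (fun g => \prod_l zg (z l) (g l))
    (fun g => gibbs_avg A (fun l => xg (g l)) `^ m)).
  - by move=> g _; exact: prodr_ge0.
  - exact: sum_cavity_wt z.
  - move=> g _; rewrite powR_gt0// gibbs_avgE.
    apply: (@wsum_gt0 R _ (index_enum (config p)) (fun c => \prod_l spin_prob (xg (g l)) (c l))).
    + by move=> c _; apply: prodr_ge0 => l _; exact/ltW/spin_prob_gt0.
    + rewrite -(bigA_distr_bigA (fun l s => spin_prob (xg (g l)) s)) big1// => l _.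
      exact: spin_prob_sum.
    + by move=> c _; exact: A_gt0.
rewrite /site_mean exchange_big mulr_sumr; apply: eq_bigr => z _.
under [LHS]eq_bigr => o _.
  rewrite (edge_log_tilt (edge_mass_none o z)) ?mulr_gt0//.
  rewrite lnM ?posrE// -m_ens_val addrC addKr.
  over.
rewrite -mulr_suml -mulr_suml (sum_prod_ffun p wU_sum) mul1r mulrCA; congr (_ * _).
by rewrite /edge_value mulrA divff ?mul1r ?gt_eqF.
Qed.

Lemma site_mean_last : site_mean (pick_weight R U) pZ
    (edge_log' m sp zg xg tilt A (@last_pos p)) =
  m * (pick_mean U (fun v => \sum_(z : {ffun 'I_n -> IZ}) (\prod_l pZ (z l)) *
        ens_val m (addfield e (cavity_field th z) (sp v))) - ens_val m e).
Proof.
pose X v (z : {ffun 'I_n -> IZ}) := m * ens_val m (addfield e (cavity_field th z) (sp v)) -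
  m * ens_val m e.
have ypos (z : {ffun 'I_n -> IZ}) : pos_ens (cavity_field th z).
  split.
    have := esum_weighted_field th (fun l => zg (z l)) (fun=> 1); rewrite /esum.
    under eq_bigr do rewrite mulr1; move=> ->; under eq_bigr do rewrite mulr1.
    by rewrite -(bigA_distr_bigA (fun l => zg (z l))) big1.
  move=> _ /mapP[g _ ->] /=; split; first exact: prodr_ge0.
  move=> s; rewrite cavity_avgE.
  apply: (@wsum_gt0 R _ (index_enum (config n)) (fun c => \prod_l spin_prob (xg (g l)) (c l))).
  + by move=> c _; apply: prodr_ge0 => l _; exact/ltW/spin_prob_gt0.
  + rewrite -(bigA_distr_bigA (fun l s => spin_prob (xg (g l)) s)) big1// => l _.
    exact: spin_prob_sum.
  + by move=> c _; exact: A_gt0.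
have V o v (z : {ffun 'I_n -> IZ}) i :
    edge_log' m sp zg xg tilt A (@last_pos p) (rcons_ffun o v) (rcons_ffun z i) = X v z.
  rewrite (edge_log_tilt (edge_mass_last o v z i)) /X ?m_ens_val//.
  by apply: esum_mass_gt0 => //; exact: pos_ens_addfield.
transitivity (\sum_v \sum_(z : {ffun 'I_n -> IZ}) pick_weight R U v * (\prod_l pZ (z l)) * X v z).
  rewrite /site_mean sum_rcons; apply: eq_bigr => v _.
  under eq_bigr do rewrite sum_rcons exchange_big /=.
  rewrite exchange_big /=; apply: eq_bigr => z _.
  under eq_bigr => o _.
    under eq_bigr => i _.
      rewrite V (prod_rcons_ffun v o (fun _ => pick_weight R U)).
      rewrite (prod_rcons_ffun i z (fun _ => pZ)) mulrA.
      rewrite [X in X * _](_ : _ = (\prod_l pick_weight R U (o l)) *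
        (pick_weight R U v * \prod_l pZ (z l)) * pZ i); last by ring.
      rewrite -[_ * _ * X v z]mulrA (mulrC (pZ i)).
      over.
    rewrite /= -mulr_sumr -mulr_sumr pZ_sum mulr1.
    over.
  rewrite /= -mulr_suml -mulr_suml (sum_prod_ffun n wU_sum) mul1r//.
rewrite mulrBr -[m * ens_val m e]mul1r -[in 1 * _]wU_sum mulr_suml /pick_mean mulr_sumr -sumrB.
apply: eq_bigr => v _.
rewrite mulrCA -mulrBr; under eq_bigr do rewrite -mulrA.
rewrite -mulr_sumr; congr (_ * _); rewrite /X.
under eq_bigr do rewrite mulrBr.
rewrite sumrB -mulr_suml (sum_prod_ffun n pZ_sum) mul1r mulr_sumr; congr (_ - _).
by apply: eq_bigr => z _; rewrite mulrCA.
Qed.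

Lemma combination_edge :
  combination (pick_weight R U) pZ (edge_log' m sp zg xg tilt A) =
  m * (iid p (fun vs => ens_val m (addfac e (fun t =>
         A [ffun l : 'I_p => nth false [seq sp v t | v <- vs] l]))) U - ens_val m e
    - p%:R * (pick_mean U (fun v => \sum_(z : {ffun 'I_n -> IZ}) (\prod_l pZ (z l)) *
        ens_val m (addfield e (cavity_field th z) (sp v))) - ens_val m e)
    + (p%:R - 1) * \sum_(z : {ffun 'I_p -> IZ}) (\prod_l pZ (z l)) * edge_value th z).
Proof.
rewrite /combination site_mean_all site_mean_none site_mean_last.
by move: (iid _ _ _) (pick_mean _ _) (\sum_z _) (ens_val _ _) => u v w x; ring.
Qed.

End one_step.

Lemma iid_sum (H : finType) k (U : {set H}) (X : finType) (w : X -> R) (F : X -> seq H -> R) :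
  iid k (fun vs => \sum_x w x * F x vs) U = \sum_x w x * iid k (F x) U.
Proof.
rewrite iid_ffun; under eq_bigr do rewrite mulr_sumr; rewrite exchange_big /=.
apply: eq_bigr => x _; rewrite iid_ffun mulr_sumr; apply: eq_bigr => o _.
by rewrite mulrCA.
Qed.

(** The comparison is scale invariant, hence passes from normalised ensembles
    to all of them through tilt. *)
Lemma edge_vs_cavity_fields (T H : finType) (t0 : T) (sp : H -> T -> bool)
    (I : nat -> finType) (pI : forall p, I p -> R) (th : forall p, I p -> config p -> R)
    (p : nat) (U : {set H}) (e : ens R T) (del : R) :
  (0 < p)%N -> (#|U| < #|H|)%N -> pos_ens e -> \sum_(x : I p) pI p x = 1 ->
  (forall e' : ens R T, \sum_(x <- e') x.1 = 1 -> (forall x, x \in e' -> 0 <= x.1) ->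
    (forall x, x \in e' -> forall t, 0 < x.2 t) ->
    (forall x, x \in e' -> \sum_t x.2 t = 1) ->
    \sum_(x : I p) pI p x *
      comb m sp zg xg (pick_weight R U) pZ e' (exp_theta (th p x)) <= m * del) ->
  iid p (fun vs => \sum_(x : I p) pI p x * ens_val m (addfac e (edge_factor sp th x vs))) U
    - ens_val m e
  - p%:R * (pick_mean U (fun v =>
      \sum_(y : (I p * {ffun 'I_p.-1 -> IZ})%type) (pI p y.1 * \prod_l pZ (y.2 l)) *
        ens_val m (addfield e (cavity_field (th p y.1) y.2) (sp v)))
    - ens_val m e)
  + (p%:R - 1) * (\sum_(x : I p) \sum_(z : {ffun 'I_p -> IZ}) pI p x * (\prod_l pZ (z l)) *
      edge_value (th p x) z) <= del.
Proof.
case: p => // n _ UH e_pos pX1 step.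
have : \sum_(x : I n.+1) pI n.+1 x *
      comb m sp zg xg (pick_weight R U) pZ (tilt e) (exp_theta (th n.+1 x)) <= m * del.
  by apply: step; [exact: tilt_sum|exact: tilt_ge0|exact: tilt_gt0|exact: tilt_prob].
rewrite /comb; under eq_bigr do rewrite combination_edge// mulrCA.
rewrite -mulr_sumr ler_pM2l//; apply: le_trans; rewrite le_eqVlt; apply/orP; left; apply/eqP.
rewrite iid_sum.
have -> : pick_mean U (fun v =>
      \sum_(y : (I n.+1 * {ffun 'I_n -> IZ})%type) (pI n.+1 y.1 * \prod_l pZ (y.2 l)) *
        ens_val m (addfield e (cavity_field (th n.+1 y.1) y.2) (sp v))) =
  \sum_(x : I n.+1) pI n.+1 x * pick_mean U (fun v =>
      \sum_(z : {ffun 'I_n -> IZ}) (\prod_l pZ (z l)) *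
        ens_val m (addfield e (cavity_field (th n.+1 x) z) (sp v))).
  rewrite -pick_mean_sum; apply: eq_pick_mean => v _.
  rewrite -(pair_bigA _ (fun (x : I n.+1) (z : {ffun 'I_n -> IZ}) =>
    (pI n.+1 x * \prod_l pZ (z l)) *
        ens_val m (addfield e (cavity_field (th n.+1 x) z) (sp v)))) /=.
  by apply: eq_bigr => x _; rewrite mulr_sumr; apply: eq_bigr => z _; rewrite mulrA.
have -> : \sum_(x : I n.+1) \sum_(z : {ffun 'I_n.+1 -> IZ}) pI n.+1 x * (\prod_l pZ (z l)) *
      edge_value (th n.+1 x) z =
   \sum_(x : I n.+1) pI n.+1 x * (\sum_(z : {ffun 'I_n.+1 -> IZ}) (\prod_l pZ (z l)) *
      edge_value (th n.+1 x) z).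
  by apply: eq_bigr => x _; rewrite mulr_sumr; apply: eq_bigr => z _; rewrite mulrA.
rewrite -[ens_val m e in LHS]mul1r -pX1 !mulr_suml -!sumrB !mulr_sumr -sumrB -big_split /=.
by apply: eq_bigr => x _; rewrite /edge_factor; ring.
Qed.

End finite_model.

(** * Systems with fields only *)

Section fields_only.
Context (R : realType) (m : R) (m_gt0 : 0 < m).
Variables (N : nat) (deg : 'I_N -> nat).
Variables (Y : finType) (pY : Y -> R) (mk : Y -> ens R bool).
Hypotheses (pY_sum : \sum_y pY y = 1) (mk_pos : forall y, pos_ens (mk y)).
Notation T := (config N).
Notation H := {i : 'I_N & 'I_(deg i)}.

Definition vertex_spin (v : H) (sigma : T) : bool := sigma (tag v).

Fixpoint field_mean k (e : ens R bool) : R :=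
  if k is k'.+1 then \sum_y pY y * field_mean k' (addfield e (mk y) id)
  else ens_val m e.

(** Testing against products of functions of one spin expresses that the
    ensemble is a product over the vertices; es i is the ensemble of the
    vertex i. *)
Definition factorised (e : ens R T) (es : 'I_N -> ens R bool) : Prop :=
  forall w : 'I_N -> bool -> R, (forall i s, 0 < w i s) ->
  esum e (fun g => (\sum_(sigma : T) g sigma * \prod_i w i (sigma i)) `^ m) =
  \prod_i esum (es i) (fun g => (\sum_s g s * w i s) `^ m).

Lemma factorised_addfield e es y v : factorised e es -> pos_ens y ->
  factorised (addfield e y (vertex_spin v))
    (fun j => if j == tag v then addfield (es j) y id else es j).
Proof.
move=> fe [_ ypos] w w0; rewrite esum_addfield esumC (bigD1 (tag v))//= eqxx.
rewrite esum_addfield [in RHS]esumC -esumZr /esum big_seq [RHS]big_seq.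
apply: eq_bigr => u uy; congr (_ * _); have [_ u0] := ypos u uy.
pose w' i s := if i == tag v then u.2 s * w i s else w i s.
have w'0 i s : 0 < w' i s by rewrite /w'; case: ifP => _; rewrite ?mulr_gt0.
have := fe w' w'0; rewrite (bigD1 (tag v))//= => E.
rewrite (_ : \prod_(i < N | i != tag v) _ = \prod_(i < N | i != tag v)
    esum (es i) (fun g => (\sum_s g s * w' i s) `^ m)); last first.
  by apply: eq_bigr => i /negbTE iv; rewrite iv /w' iv.
transitivity (esum e (fun g => (\sum_(sigma : T) g sigma * \prod_i w' i (sigma i)) `^ m)).
  apply: eq_bigr => x _; congr (_ * _ `^ _); apply: eq_bigr => sigma _.
  rewrite -mulrA; congr (_ * _); rewrite (bigD1 (tag v))//= [RHS](bigD1 (tag v))//=.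
  rewrite mulrA {1}/w' eqxx; congr (_ * _); apply: eq_bigr => i /negbTE iv.
  by rewrite /w' iv.
rewrite E; congr (_ * _); apply: eq_bigr => x _; congr (_ * _ `^ _).
by apply: eq_bigr => s _; rewrite /w' eqxx mulrA.
Qed.

Lemma factorised_init (h : 'I_N -> bool -> R) :
  factorised [:: (1, fun sigma : T => \prod_i expR (h i (sigma i)))]
    (fun i => [:: (1, fun s => expR (h i s))]).
Proof.
move=> w w0; rewrite esum1; under [X in X `^ m]eq_bigr do rewrite -big_split.
rewrite -(bigA_distr_bigA (fun i s => expR (h i s) * w i s)).
under [RHS]eq_bigr do rewrite esum1.
have S0 i : 0 <= \sum_s expR (h i s) * w i s.
  by apply: sumr_ge0 => s _; rewrite mulr_ge0 ?expR_ge0 ?(ltW (w0 i s)).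
elim: (index_enum _) => [|i s IH]; first by rewrite !big_nil powR1.
by rewrite !big_cons powRM ?IH//; apply: prodr_ge0.
Qed.

Lemma factorised_val e es : factorised e es -> (forall i, pos_ens (es i)) ->
  ens_val m e = \sum_i ens_val m (es i).
Proof.
move=> /(_ (fun _ _ => 1) (fun _ _ => ltr01)) fe espos.
have fe' : esum e (@mass R m _) = \prod_i esum (es i) (@mass R m _).
  rewrite -[LHS]/(esum e (fun g => _)) (_ : esum e _ = esum e (fun g =>
    (\sum_(sigma : T) g sigma * \prod_(i < N) 1) `^ m)).
    rewrite fe; apply: eq_bigr => i _; apply: eq_esum => g; congr (_ `^ _).
    by apply: eq_bigr => s _; rewrite mulr1.
  apply: eq_esum => g; congr (_ `^ _); apply: eq_bigr => s _.
  by rewrite big1 ?mulr1.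
rewrite /ens_val fe' -mulr_sumr; congr (_ * _).
have e0 i : 0 < esum (es i) (@mass R m _) by exact: (esum_mass_gt0 m true).
elim: (index_enum _) => [|i s IH]; first by rewrite !big_nil ln1.
by rewrite !big_cons lnM ?posrE ?IH//; apply: prodr_gt0.
Qed.

Definition unused (U : {set H}) (i : 'I_N) : nat := #|[set v in ~: U | tag v == i]|.

Lemma unused_add (U : {set H}) v : v \notin U ->
  unused U (tag v) = (unused (v |: U) (tag v)).+1.
Proof.
move=> vU; rewrite /unused (cardsD1 v) !inE vU eqxx /= add1n; congr _.+1.
by apply: eq_card => u; rewrite !inE; case: eqP; rewrite //= andbT.
Qed.

Lemma unused_other (U : {set H}) v i : i != tag v -> unused (v |: U) i = unused U i.
Proof.
move=> iv; apply: eq_card => u; rewrite !inE.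
by have [->|] := eqVneq u v; rewrite //= eq_sym (negbTE iv) !andbF.
Qed.

Lemma unused_init i : unused finset.set0 i = deg i.
Proof.
rewrite /unused -[RHS]card_ord -(@fintype.card_image _ _ (fun l : 'I_(deg i) =>
  Tagged (fun i => 'I_(deg i)) l)); last by move=> l l' /eqP; rewrite eq_Tagged => /eqP.
apply: eq_card => v; rewrite !inE /=; apply/eqP/fintype.imageP => [|[l _ ->//]].
by case: v => j l /= ji; subst j; exists l.
Qed.

(** A field on a half-edge of i only changes the factor of i, and i receives
    as many fields as it has unused half-edges, whichever order they come in. *)
Lemma iter_fields L e es (U : {set H}) : factorised e es -> (forall i, pos_ens (es i)) ->
  #|~: U| = L ->
  iter L (add_field_op vertex_spin pY mk) (@Phi R m _ _) e U =
  \sum_i field_mean (unused U i) (es i).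
Proof.
elim: L e es U => [|L IH] e es U fe espos UL.
  rewrite /= /Phi (factorised_val fe)//; apply: eq_bigr => i _.
  have -> // : unused U i = 0%N.
  apply/eqP; rewrite -leqn0 -UL /unused subset_leq_card//.
  by apply/fintype.subsetP => v; rewrite inE => /andP[].
have UH : (#|U| < #|{: H}|)%N by rewrite -(cardsC U) UL addnS ltnS leq_addr.
rewrite iterS -[RHS](pick_mean_const _ UH) /add_field_op; apply: eq_pick_mean => v vU.
have vUL : #|~: (v |: U)| = L.
  have := cardsC U; rewrite -(cardsC (v |: U)) cardsU1_notin// UL addSnnS.
  by move=> /eqP; rewrite eqn_add2l => /eqP [].
transitivity (\sum_y pY y * \sum_i field_mean (unused (v |: U) i)
    (if i == tag v then addfield (es i) (mk y) id else es i)).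
  apply: eq_bigr => y _; rewrite (IH _ _ _ (factorised_addfield v fe (mk_pos y)))//.
  by move=> i; case: ifP => // _; exact: pos_ens_addfield.
under eq_bigr do rewrite mulr_sumr; rewrite exchange_big; apply: eq_bigr => i _ /=.
have [->|iv] := eqVneq i (tag v); first by rewrite (unused_add vU) /=; apply: eq_bigr => y _; rewrite ?eqxx.
by rewrite unused_other// -mulr_suml pY_sum mul1r.
Qed.

(** With fields only, the vertices decouple. *)
Lemma fields_only (h : 'I_N -> bool -> R) :
  iter #|{: H}| (add_field_op vertex_spin pY mk) (@Phi R m _ _)
    [:: (1, fun sigma : T => \prod_i expR (h i (sigma i)))] finset.set0 =
  \sum_i field_mean (deg i) [:: (1, fun s => expR (h i s))].
Proof.
rewrite (iter_fields (@factorised_init h)); first by under eq_bigr do rewrite unused_init.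
  by move=> i; apply: pos_ens1 => s; exact: expR_gt0.
by rewrite finset.setC0 cardsT.
Qed.

Variable kap : R.
Hypotheses (kap_ge0 : 0 <= kap) (pY_ge0 : forall y, 0 <= pY y)
  (mk_bd : forall y, bounded_field kap (mk y)).

(** Each of the k fields changes the value by at most kap. *)
Lemma field_mean_bd k e : pos_ens e -> `|field_mean k e - ens_val m e| <= k%:R * kap.
Proof.
elim: k e => [|k IH] e epos /=; first by rewrite subrr normr0 mul0r.
rewrite -[ens_val m e]mul1r -pY_sum mulr_suml -sumrB.
apply: (le_trans (ler_norm_sum _ _ _)).
apply: (@le_trans _ _ (\sum_y pY y * (k.+1%:R * kap))); last first.
  by rewrite -mulr_suml pY_sum mul1r.
apply: ler_sum => y _.
rewrite -mulrBr normrM ger0_norm// ler_wpM2l//.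
have := IH _ (pos_ens_addfield id epos (mk_pos y)); have k1E : k.+1%:R = k%:R + 1 :> R by rewrite -natr1.
have [] := @ens_val_addfield R m kap m_gt0 bool true e (mk y) id epos (mk_bd y).
rewrite !ler_norml k1E => h1 h2 /andP[h3 h4]; apply/andP; split; lra.
Qed.

End fields_only.

(** * Systems with edges only *)

Section uniform_lists.
Variables (R : realType) (H : finType).

Lemma eq_fresh_size k (F F' : seq H -> {set H} -> R) (U : {set H}) :
  (forall vs U', size vs = k -> F vs U' = F' vs U') -> fresh k F U = fresh k F' U.
Proof.
elim: k F F' U => [|k IH] F F' U FF' /=; first exact: FF'.
apply: eq_pick_mean => v _; apply: IH => vs U' sv.
by apply: FF'; rewrite /= sv.
Qed.

Lemma fresh_add p q (F : seq H -> R) (U : {set H}) :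
  fresh p (fun vs U' => fresh q (fun vs' _ => F (vs ++ vs')) U') U =
  fresh (p + q) (fun vs _ => F vs) U.
Proof.
elim: p F U => [|p IH] F U //=.
by apply: eq_pick_mean => v _; rewrite -(IH (fun vs => F (v :: vs))).
Qed.

Definition listed k (o : {ffun 'I_k -> H}) : seq H := [seq o l | l <- enum 'I_k].

Definition fresh_list (U : {set H}) (s : seq H) : bool :=
  uniq s && all (fun v => v \notin U) s.

Lemma fresh_list_cons U v s :
  fresh_list U (v :: s) = (v \notin U) && fresh_list (v |: U) s.
Proof.
rewrite /fresh_list /=.
have -> : all (fun u => u \notin v |: U) s = (v \notin s) && all (fun u => u \notin U) s.
  elim: s => //= u s ->; rewrite !inE negb_or eq_sym negb_or.
  by case: (v == u); case: (u \in U); case: (v \in s); rewrite //= ?andbF.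
by case: (v \in U); case: (v \in s); case: (uniq s); rewrite /= ?andbF.
Qed.

(** Draws without replacement give the same weight c to every list of distinct
    unused half-edges. *)
Lemma fresh_uniform k u : exists c : R, forall (U : {set H}) (F : seq H -> R), #|U| = u ->
  fresh k (fun vs _ => F vs) U =
  c * \sum_(o : {ffun 'I_k -> H}) (fresh_list U (listed o))%:R * F (listed o).
Proof.
elim: k u => [|k IH] u.
  exists 1 => U F _.
  by rewrite mul1r (sum_ffun0 _ (ffun0 (card_ord 0))) /listed enum_ord0 /= mul1r.
have [c hc] := IH u.+1; exists ((#|H| - u)%:R^-1 * c) => U F Uu /=.
rewrite sum_cons /pick_mean mulr_sumr; apply: eq_bigr => v _.
under [in RHS]eq_bigr => o _ do
  rewrite /listed enum_cons_ffun fresh_list_cons.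
rewrite /pick_weight; have [vU|vU] /= := boolP (v \in U).
  by rewrite !mul0r big1 ?mulr0// => o _; rewrite mul0r.
rewrite mul1r (hc (v |: U) (fun s => F (v :: s))) ?cardsU1_notin ?Uu// mulrA.
by rewrite cardsCs finset.setCK Uu.
Qed.

Lemma fresh_all (F : seq H -> R) : fresh #|H| (fun vs _ => F vs) finset.set0 =
  (\sum_(o : {ffun 'I_#|H| -> H} | uniq (listed o)) F (listed o)) /
  #|[pred o : {ffun 'I_#|H| -> H} | uniq (listed o)]|%:R.
Proof.
have [c hc] := fresh_uniform #|H| 0.
have E (G : seq H -> R) : fresh #|H| (fun vs _ => G vs) finset.set0 =
    c * \sum_(o : {ffun 'I_#|H| -> H} | uniq (listed o)) G (listed o).
  rewrite (hc _ _ (cards0 H)) [in RHS]big_mkcond /=; congr (_ * _).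
  apply: eq_bigr => o _; rewrite /fresh_list.
  have -> : all (fun v => v \notin finset.set0) (listed o) by apply/allP => v _; rewrite inE.
  by rewrite andbT; case: (uniq _); rewrite ?mul1r ?mul0r.
have c1 : 1 = c * #|[pred o : {ffun 'I_#|H| -> H} | uniq (listed o)]|%:R.
  have := E (fun=> 1); rewrite fresh_const ?cards0// sumr_const => c1.
  by rewrite [LHS]c1.
rewrite E mulrC; congr (_ * _).
have n0 : #|[pred o : {ffun 'I_#|H| -> H} | uniq (listed o)]|%:R != 0 :> R.
  by apply: contra_eq_neq c1 => ->; rewrite mulr0 oner_neq0.
by apply: (mulIf n0); rewrite mulVf.
Qed.

Variables (B : finType) (bs : seq B).
Hypotheses (bs_perm : perm_eq bs (enum B)) (BH : #|B| = #|H|).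

(** Drawing all the half-edges lists them in a uniformly random order, and
    such lists are the perfect matchings with the enumeration bs of the other
    half-edges. *)
Lemma fresh_matchings (F : seq H -> R) :
  fresh #|H| (fun vs _ => F vs) finset.set0 =
  (\sum_(M in [set M : {ffun B -> H} | injectiveb M & [forall v, exists x, M x == v]])
    F [seq M b | b <- bs]) /
  #|[set M : {ffun B -> H} | injectiveb M & [forall v, exists x, M x == v]]|%:R.
Proof.
have mem_bs b : b \in bs by rewrite (perm_mem bs_perm) mem_enum.
have size_bs : size bs == #|H| by rewrite (perm_size bs_perm) -cardE BH.
have uniq_bs : uniq bs by rewrite (perm_uniq bs_perm) enum_uniq.
have idx_lt b : (index b bs < #|H|)%N by rewrite -(eqP size_bs) index_mem.
pose idx b : 'I_#|H| := Ordinal (idx_lt b).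
pose t := Tuple size_bs.
have idxK b : tnth t (idx b) = b by rewrite (tnth_nth b) nth_index.
have tnthK l : idx (tnth t l) = l.
  by apply: val_inj => /=; rewrite (tnth_nth (tnth t l)) index_uniq// (eqP size_bs).
have E (F' : seq H -> R) : \sum_(M in [set M : {ffun B -> H} |
      injectiveb M & [forall v, exists x, M x == v]]) F' [seq M b | b <- bs] =
    \sum_(o : {ffun 'I_#|H| -> H} | uniq (listed o)) F' (listed o).
  have L (o : {ffun 'I_#|H| -> H}) :
      [seq [ffun b => o (idx b)] b | b <- bs] = listed o.
    rewrite -[bs]/(tval t) -(map_tnth_enum t) -map_comp /listed.
    by apply: eq_map => l /=; rewrite ffunE tnthK.
  rewrite (reindex (fun o : {ffun 'I_#|H| -> H} => [ffun b => o (idx b)])); last first.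
    exists (fun M : {ffun B -> H} => [ffun l => M (tnth t l)]) => [x|M] _.
      by apply/ffunP => l; rewrite !ffunE tnthK.
    by apply/ffunP => b; rewrite !ffunE idxK.
  apply: eq_big => [x|x _]; last by rewrite L.
  rewrite inE -L.
  have -> : injectiveb [ffun b => x (idx b)] = uniq [seq [ffun b => x (idx b)] b | b <- bs].
    rewrite /injectiveb /dinjectiveb; apply: perm_uniq; apply: perm_map.
    by rewrite perm_sym.
  set M := [ffun b => _]; case uM : (uniq _) => //=.
  have /injectiveP iM : injectiveb M.
    by rewrite /injectiveb /dinjectiveb -(perm_uniq (perm_map M bs_perm)).
  apply/forallP => v; apply/existsP.
  have /codomP[b ->] : v \in codom M by apply: inj_card_onto; rewrite ?BH.
  by exists b.
rewrite fresh_all E; congr (_ / _).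
have := E (fun=> 1); rewrite !sumr_const => E1; exact: (esym E1).
Qed.

End uniform_lists.

Section edges_only.
Context (R : realType) (m : R).
Variables (N : nat) (deg : 'I_N -> nat) (E : nat -> nat).
Variables (I : nat -> finType) (pI : forall p, I p -> R)
  (th : forall p, I p -> config p -> R).
Notation T := (config N).
Notation H := {i : 'I_N & 'I_(deg i)}.
Notation sp := (@vertex_spin N deg).
Hypothesis m_gt0 : 0 < m.

Fixpoint edges_mean (es : seq nat) (vs : seq H) (g : T -> R) : R :=
  if es is p :: es' then
    \sum_(x : I p) pI x * edges_mean es' (drop p vs)
      (fun t => g t * edge_factor sp th x (take p vs) t)
  else ln (\sum_t g t).

Lemma edges_op es (g : T -> R) (U : {set H}) :
  foldr (add_edge_op sp pI th) (@Phi R m _ _) es [:: (1, g)] U =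
  fresh (sumn es) (fun vs _ => edges_mean es vs g) U.
Proof.
elim: es g U => [|p es IH] g U /=; first by rewrite /Phi ens_val1.
rewrite -(fresh_add p (sumn es) (fun vs => edges_mean (p :: es) vs g)).
apply: eq_fresh_size => vs U' svs.
under eq_bigr do rewrite IH; rewrite -fresh_sum; apply: eq_fresh => vs' U'' /=.
by rewrite take_size_cat// drop_size_cat.
Qed.

Notation EDGE := {p : 'I_(total_degree deg).+1 & 'I_(E p)}.

Fixpoint graph_edges_mean (M : half_edge_map deg E) (l : seq EDGE) (g : T -> R) : R :=
  if l is e :: l' then
    \sum_(x : I (edge_size e)) pI x * graph_edges_mean M l'
      (fun sigma => g sigma * expR (th x [ffun k => sigma (endpoint M k)]))
  else ln (\sum_t g t).

Definition edge_slots (e : EDGE) : seq {e : EDGE & 'I_(edge_size e)} :=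
  [seq Tagged (fun e : EDGE => 'I_(edge_size e)) k | k <- enum 'I_(edge_size e)].

Lemma edges_mean_graph (M : half_edge_map deg E) (l : seq EDGE) g :
  edges_mean [seq edge_size e | e <- l]
    [seq M b | b <- flatten [seq edge_slots e | e <- l]] g = graph_edges_mean M l g.
Proof.
elim: l g => [//|e l IH] g /=; apply: eq_bigr => x _; congr (_ * _).
have s_e : size [seq M b | b <- edge_slots e] = edge_size e.
  rewrite size_map /edge_slots size_map.
  by rewrite -cardE card_ord.
rewrite map_cat take_size_cat// drop_size_cat// IH; congr graph_edges_mean.
apply/funext => sigma; congr (_ * expR (th x _)); apply/ffunP => k; rewrite !ffunE.
rewrite /edge_slots -map_comp -map_comp (nth_map k) /=; last by rewrite -cardE card_ord.
rewrite /vertex_spin /endpoint; congr (sigma (tag (M (Tagged _ _)))).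
exact: nth_ord_enum.
Qed.

Lemma perm_slots : perm_eq (flatten [seq edge_slots e | e <- enum {: EDGE}])
  (enum {: {e : EDGE & 'I_(edge_size e)}}).
Proof.
have -> : flatten [seq edge_slots e | e <- enum {: EDGE}] =
  [seq Tagged (fun e : EDGE => 'I_(edge_size e)) k | e <- enum {: EDGE},
     k <- enum 'I_(edge_size e)] by [].
apply: uniq_perm; last 1 first.
- move=> b; rewrite mem_enum; apply/allpairsPdep.
  by exists (tag b), (tagged b); rewrite !mem_enum; case: b.
- apply: allpairs_uniq_dep; first exact: enum_uniq.
    by move=> e _; exact: enum_uniq.
  by move=> [e k] [e' k'] _ _ /=.
- exact: enum_uniq.
Qed.

(** With edges only, the successive draws of half-edges make up a uniform
    perfect matching. *)
Lemma edges_only (g : T -> R) :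
  #|{: {e : EDGE & 'I_(edge_size e)}}| = #|{: H}| ->
  foldr (add_edge_op sp pI th) (@Phi R m _ _) [seq edge_size e | e <- enum {: EDGE}]
    [:: (1, g)] finset.set0 =
  graph_mean (fun M : half_edge_map deg E => graph_edges_mean M (enum {: EDGE}) g).
Proof.
move=> BH; rewrite edges_op.
have -> : sumn [seq edge_size e | e <- enum {: EDGE}] = #|{: H}|.
  rewrite -BH cardE -(perm_size perm_slots) size_flatten /shape -[in RHS]map_comp.
  congr sumn; apply: eq_map => e /=.
  by rewrite /edge_slots size_map size_enum_ord.
rewrite (fresh_matchings perm_slots BH (fun vs => edges_mean _ vs g)).
rewrite /graph_mean; congr (_ / _).
by apply: eq_bigr => M _; rewrite edges_mean_graph.
Qed.

End edges_only.

(** * Expectations in the cavity variables *)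

Section cavity_expectation.
Context (R : realType).
Local Notation RT := (measurableTypeR R).

Definition rectangle n (A : 'I_n -> set RT) : set (n.-tuple RT) :=
  [set t | forall i, A i (tnth t i)].

Lemma measurable_rectangle n (A : 'I_n -> set RT) : (forall i, measurable (A i)) ->
  measurable (rectangle A).
Proof.
move=> mA.
have -> : rectangle A = \bigcap_(i in [set: 'I_n]) ((fun t : n.-tuple RT => tnth t i) @^-1` A i).
  by apply/seteqP; split => t h i; [move=> _; exact: h|exact: (h i Logic.I)].
apply: fin_bigcap_measurable => // i _; rewrite -[_ @^-1` _]setTI.
exact: measurable_tnth.
Qed.

(** The product law is only needed on rectangles, since the integrands are
    functions of the cells of the coordinates. *)
Lemma product_law_rectangle n (z : 'I_n -> L1 R) (A : 'I_n -> set RT) :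
  (forall i, measurable (A i)) ->
  product_law z (rectangle A) = (\prod_(i < n) (z i : probability RT R) (A i))%E.
Proof.
elim: n z A => [|n IH] z A mA.
  rewrite big_ord0 /= /dirac indicE mem_set//.
  by move=> -[].
rewrite big_ord_recl /= /distribution /pushforward.
have -> : @cons_pair _ RT n @^-1` rectangle A =
    A ord0 `*` rectangle (fun i => A (lift ord0 i)).
  apply/seteqP; split => -[x t] /=.
    move=> h; split; first exact: h ord0.
    by move=> i; have := h (lift ord0 i); rewrite tnthS.
  move=> [h0 h] i; case: (unliftP ord0 i) => [j ->|->] //.
  by rewrite tnthS; exact: h.
rewrite product_measure1E//; last by apply: measurable_rectangle.
by rewrite -IH.
Qed.

Variables (G : finType) (rho : RT -> G).
Hypothesis cell_meas : forall g, measurable (rho @^-1` [set g]).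

Definition cell_mass (z : L1 R) (g : G) : R :=
  fine ((z : probability RT R) (rho @^-1` [set g])).

Lemma cell_mass_ge0 z g : 0 <= cell_mass z g.
Proof. by rewrite fine_ge0. Qed.

Lemma sum_cells d (Omega : measurableType d) (P : probability Omega R) (X : finType)
    (r : Omega -> X) : (forall x, measurable (r @^-1` [set x])) ->
  \sum_x fine (P (r @^-1` [set x])) = 1.
Proof.
move=> mr.
have bI x : bounded_meas (\1_(r @^-1` [set x]) : Omega -> R) by exact: bounded_meas_indic.
under eq_bigr do rewrite -mean_indic//.
rewrite -mean_sum// -[RHS](mean_cst P 1); congr mean; apply/funext => w.
rewrite (bigD1 (r w))//= big1 ?addr0 ?indicE ?mem_set// => x /eqP xr.
by rewrite indicE memNset// => h; apply: xr; rewrite -h.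
Qed.

Lemma cell_mass_sum z : \sum_g cell_mass z g = 1.
Proof. exact: sum_cells. Qed.

Lemma mean_product_law n (z : 'I_n -> L1 R) (F : {ffun 'I_n -> G} -> R) :
  let X (t : n.-tuple RT) := F [ffun i => rho (tnth t i)] in
  bounded_meas X /\
  mean (product_law z) X = \sum_(g : {ffun 'I_n -> G}) (\prod_i cell_mass (z i) (g i)) * F g.
Proof.
move=> X; pose rect (g : {ffun 'I_n -> G}) := rectangle (fun i => rho @^-1` [set g i]).
have mrect g : measurable (rect g) by exact: measurable_rectangle.
have XE : X = fun t => \sum_g F g * \1_(rect g) t.
  apply/funext => t; rewrite (bigD1 [ffun i => rho (tnth t i)])//= big1 ?addr0.
    by rewrite indicE mem_set ?mulr1// => i /=; rewrite ffunE.
  move=> g /eqP gt; rewrite indicE memNset ?mulr0// => h; apply: gt.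
  by apply/ffunP => i; rewrite ffunE; exact/esym/h.
have bX g : bounded_meas (fun t => F g * \1_(rect g) t).
  by apply: bounded_measZ; exact: bounded_meas_indic.
split; first by rewrite XE; exact: bounded_meas_sum.
rewrite XE mean_sum//; apply: eq_bigr => g _.
rewrite meanZ; last exact: bounded_meas_indic.
rewrite mean_indic// mulrC product_law_rectangle//; congr (_ * _).
elim: (index_enum _) => [|i s IH]; first by rewrite !big_nil.
by rewrite !big_cons fineM ?fin_num_measure ?IH//= prode_fin_num// => j _;
  exact: fin_num_measure.
Qed.

Definition cell_mean (I : finType) (z : I -> L1 R) (F : {ffun I -> G} -> R) : R :=
  \sum_(g : {ffun I -> G}) (\prod_i cell_mass (z i) (g i)) * F g.

Lemma cell_meanE (I : finType) (z : I -> L1 R) (F : {ffun I -> G} -> R) :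
  mean (product_law (fun k : 'I_#|I| => z (enum_val k)))
    (fun t => F [ffun i => rho (tnth t (enum_rank i))]) = cell_mean z F /\
  bounded_meas (fun t : #|I|.-tuple RT => F [ffun i => rho (tnth t (enum_rank i))]).
Proof.
pose F' (g : {ffun 'I_#|I| -> G}) := F [ffun i => g (enum_rank i)].
have [bF mF] := mean_product_law (fun k : 'I_#|I| => z (enum_val k)) F'.
have E : (fun t : #|I|.-tuple RT => F [ffun i => rho (tnth t (enum_rank i))]) =
    fun t => F' [ffun i => rho (tnth t i)].
  by apply/funext => t; congr F; apply/ffunP => i; rewrite !ffunE.
rewrite E; split => //; rewrite mF /cell_mean.
rewrite [RHS](reindex (fun g : {ffun 'I_#|I| -> G} => [ffun i => g (enum_rank i)])) /=.
  apply: eq_bigr => g _; congr (_ * _).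
  rewrite [RHS](reindex (@enum_val I I)) /=.
    by apply: eq_bigr => k _; rewrite ffunE enum_valK.
  by exists enum_rank => k _; [exact: enum_valK|exact: enum_rankK].
exists (fun g : {ffun I -> G} => [ffun k => g (enum_val k)]) => g _;
  by apply/ffunP => i; rewrite !ffunE ?enum_valK ?enum_rankK.
Qed.

(** A function of the rounded variables has a finite sum as expectation, and
    the expectation of X is squeezed between two of them. *)
Lemma Eprime_between (I : finType) (z : I -> L1 R) (X : (I -> R) -> R)
    (F F' : {ffun I -> G} -> R) :
  (forall x : I -> R, F [ffun i => rho (x i)] <= X x <= F' [ffun i => rho (x i)]) ->
  cell_mean z F <= Eprime z X <= cell_mean z F'.
Proof.
move=> FX; have [mF bF] := cell_meanE z F; have [mF' bF'] := cell_meanE z F'.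
have lo := @integral_mono _ _ _ (product_law (fun k : 'I_#|I| => z (enum_val k)))
  (fun t => (F [ffun i => rho (tnth t (enum_rank i))])%:E)
  (fun t => (X (fun i => tnth t (enum_rank i)))%:E).
have hi := @integral_mono _ _ _ (product_law (fun k : 'I_#|I| => z (enum_val k)))
  (fun t => (X (fun i => tnth t (enum_rank i)))%:E)
  (fun t => (F' [ffun i => rho (tnth t (enum_rank i))])%:E).
have {}lo := lo (fun t => proj1 (andP (FX (fun i => tnth t (enum_rank i))))).
have {}hi := hi (fun t => proj2 (andP (FX (fun i => tnth t (enum_rank i))))).
move: lo hi; rewrite (mean_EFin _ bF) (mean_EFin _ bF') mF mF' /Eprime /Rintegral.
case: (\int[_]_t _)%E => [r| |] //=; rewrite !lee_fin => -> -> //.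
Qed.

End cavity_expectation.

(** * Codes for reals, random measures and functions *)

Section codes.
Context (R : realType).
Local Notation RT := (measurableTypeR R).

Section unrounding.
Variables (T : Type) (J : finType) (phi : J -> T -> R) (C : R)
  (N : nat) (good : T -> Prop) (t0 : T).

Lemma unrnd_good (g : code J N) : good t0 -> good (unrnd phi C good t0 g).
Proof.
move=> g0; rewrite /unrnd; case: pselect => // h.
by have [] := projT2 (cid h).
Qed.

End unrounding.

Variables (nx nz : nat).
Hypotheses (nx_gt0 : (0 < nx)%N) (nz_gt0 : (0 < nz)%N).

(** A real number enters the averages only through the probability of a
    positive spin in its field; rounding this number rather than x makes
    finitely many cells suffice for the whole line. *)
Definition up_prob (_ : unit) (x : R) : R := spin_prob x true.
Definition cell : finType := code unit nx.
Definition cell_of (x : RT) : cell := rnd up_prob 1 nx x.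
Definition cell_pt (g : cell) : R := unrnd up_prob 1 (fun=> True) 0 g.

Lemma spin_prob_le1 (x : R) s : spin_prob x s <= 1.
Proof.
rewrite -(spin_prob_sum x) (bigD1 s)//= lerDl sumr_ge0// => s' _.
exact/ltW/spin_prob_gt0.
Qed.

Lemma cell_close (x : R) s :
  `|spin_prob x s - spin_prob (cell_pt (cell_of x)) s| <= 2 / nx%:R.
Proof.
have bd y : `|up_prob tt y| <= 1.
  by rewrite ger0_norm ?spin_prob_le1//; exact/ltW/spin_prob_gt0.
have [_ E] := @unrndK R R unit up_prob 1 nx (fun=> True) 0 x Logic.I.
have := @rnd_close R R unit up_prob 1 nx ltr01 nx_gt0 x (cell_pt (cell_of x)) tt (esym E)
  (bd _) (bd _).
rewrite mulr1 /up_prob; case: s => //.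
have F (y : R) : spin_prob y false = 1 - spin_prob y true.
  by have := spin_prob_sum y; rewrite big_bool => <- /=; ring.
rewrite !F; set u := spin_prob _ _; set v := spin_prob _ _.
by rewrite (_ : 1 - u - (1 - v) = v - u) 1?distrC//; ring.
Qed.

Lemma measurable_spin_prob : measurable_fun [set: RT] (fun x : RT => spin_prob x true).
Proof.
have m1 (s : bool) : measurable_fun [set: RT] (fun x : RT => expR (x * spin_val R s)).
  apply: measurableT_comp => //; apply: measurable_funM => //; exact: measurable_cst.
have -> : (fun x : RT => spin_prob x true) =
    fun x : RT => expR (x * spin_val R true) *
      (expR (x * spin_val R true) + expR (x * spin_val R false)) `^ (-1).
  by apply/funext => x; rewrite /spin_prob big_bool powR_inv1// addr_ge0 ?expR_ge0.
apply: measurable_funM => //.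
apply: (measurableT_comp (measurable_powR (-1))).
exact: measurable_funD.
Qed.

Lemma measurable_cell g : measurable (cell_of @^-1` [set g]).
Proof.
apply: (@measurable_rnd R _ RT unit up_prob 1 nx g) => -[].
exact: measurable_spin_prob.
Qed.

Lemma cell_mass_le1 (z : L1 R) g : cell_mass cell_of z g <= 1.
Proof.
rewrite -(cell_mass_sum measurable_cell z) (bigD1 g)//= lerDl sumr_ge0// => g' _.
exact: cell_mass_ge0.
Qed.

Lemma measurable_cell_mass g : measurable_fun [set: L1 R] (fun z : L1 R => cell_mass cell_of z g).
Proof.
have mA := measurable_cell g.
apply/measurable_EFinP.
rewrite (_ : _ \o _ = fun z : L1 R => (z : probability RT R) (cell_of @^-1` [set g])); last first.
  by apply/funext => z; rewrite /= /cell_mass fineK// fin_num_measure.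
apply: (measurability _ (ErealGenInftyO.measurableE R)) => _ /= -[_ [r ->] <-].
rewrite setTI.
have -> : (fun z : L1 R => (z : probability RT R) (cell_of @^-1` [set g])) @^-1` `]-oo, r%:E[%classic
    = @mset _ RT R (cell_of @^-1` [set g]) r.
  by apply/seteqP; split => z; rewrite /mset /= in_itv/=.
have [r0|r0] := ltP r 0; first by rewrite lt0_mset.
have [r1|r1] := ltP 1 r; first by rewrite gt1_mset//; exact: measurableT.
by apply: sub_sigma_algebra; exists r; [rewrite /= in_itv/= r0 r1|exists (cell_of @^-1` [set g])].
Qed.

(** A random measure is known through the masses that it gives to the cells. *)
Definition zcode : finType := code cell nz.
Definition zcode_of (z : L1 R) : zcode := rnd (fun g z => cell_mass cell_of z g) 1 nz z.
(** A code is represented by a measure that has it, so that its masses are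
    nonnegative and sum to 1. *)
Definition zcode_law (c : zcode) : L1 R :=
  unrnd (fun g z => cell_mass cell_of z g) 1 (fun=> True) (\d_(0 : RT) : L1 R) c.
Definition zcode_mass (c : zcode) (g : cell) : R := cell_mass cell_of (zcode_law c) g.

Lemma zcode_mass_ge0 c g : 0 <= zcode_mass c g.
Proof. exact: cell_mass_ge0. Qed.

Lemma zcode_mass_sum c : \sum_g zcode_mass c g = 1.
Proof. exact: (cell_mass_sum measurable_cell). Qed.

Lemma zcode_close z g : `|cell_mass cell_of z g - zcode_mass (zcode_of z) g| <= 2 / nz%:R.
Proof.
have bd y : `|cell_mass cell_of y g| <= 1 by rewrite ger0_norm ?cell_mass_le1 ?cell_mass_ge0.
have [_ E] := @unrndK R (L1 R) cell (fun g z => cell_mass cell_of z g) 1 nz (fun=> True)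
  (\d_(0 : RT) : L1 R) z Logic.I.
have := @rnd_close R (L1 R) cell (fun g z => cell_mass cell_of z g) 1 nz ltr01 nz_gt0 z
  (zcode_law (zcode_of z)) g (esym E) (bd _) (bd _).
by rewrite mulr1.
Qed.

Lemma measurable_zcode c : measurable (zcode_of @^-1` [set c]).
Proof. by apply: measurable_rnd => g; exact: measurable_cell_mass. Qed.

Section functions.
Variables (S : finType) (kap : R).
Hypothesis kap_gt0 : 0 < kap.

Definition fcode : finType := code S nz.
Definition fcode_of (f : funspace R S) : fcode := rnd (fun (s : S) f => f s) kap nz f.
Definition fcode_fun (c : fcode) : S -> R :=
  unrnd (fun (s : S) f => f s) kap (fun f : S -> R => forall s, `|f s| <= kap) (fun=> 0) c.

Lemma fcode_fun_bd c s : `|fcode_fun c s| <= kap.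
Proof.
apply: (@unrnd_good (S -> R) S (fun s f => f s) kap nz (fun f => forall s, `|f s| <= kap)
  (fun=> 0) c) => s'.
by rewrite normr0 ltW.
Qed.

Lemma fcode_close (f : S -> R) s : (forall s, `|f s| <= kap) ->
  `|f s - fcode_fun (fcode_of f) s| <= 2 * kap / nz%:R.
Proof.
move=> fk.
have [bd E] := @unrndK R (S -> R) S (fun s f => f s) kap nz
  (fun f => forall s, `|f s| <= kap) (fun=> 0) f fk.
exact: (@rnd_close R (S -> R) S (fun s f => f s) kap nz kap_gt0 nz_gt0 f
  (fcode_fun (fcode_of f)) s (esym E) (fk s) (bd s)).
Qed.

Lemma measurable_fcode c : measurable (fcode_of @^-1` [set c]).
Proof.
apply: (@measurable_rnd R _ (funspace R S)) => s _ B mB; rewrite setTI.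
by apply: sub_sigma_algebra; exists s, B.
Qed.

End functions.
End codes.

(** * Continuity of averages in their weights *)

Section averages.
Context (R : realType).

(** The averages of A differ by at most hi times the total variation t, which
    is at most hi/lo t times the second average. *)
Lemma avg_close (X : finType) (p p' A : X -> R) (t lo hi : R) :
  (forall x, 0 <= p' x) -> \sum_x p' x = 1 -> \sum_x `|p x - p' x| <= t ->
  0 < lo -> (forall x, lo <= A x <= hi) ->
  \sum_x p x * A x <= expR (hi / lo * t) * \sum_x p' x * A x.
Proof.
move=> p'0 p'1 pp' lo0 Ab.
have A0 x : 0 <= A x by have /andP[h _] := Ab x; apply: le_trans h; exact: ltW.
have loS : lo <= \sum_x p' x * A x.
  rewrite -[lo]mul1r -p'1 mulr_suml; apply: ler_sum => x _.
  by rewrite ler_wpM2l//; have /andP[] := Ab x.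
have t0 : 0 <= t by apply: le_trans pp'; exact: sumr_ge0.
have hi0 : 0 <= hi.
  rewrite leNgt; apply/negP => hi0.
  have : \sum_x p' x = 0.
    apply: big1 => x _; have /andP[a1 a2] := Ab x.
    by have := lt_trans lo0 (le_lt_trans (le_trans a1 a2) hi0); rewrite ltxx.
  by rewrite p'1 => /eqP; rewrite oner_eq0.
have S1 : \sum_x p x * A x <= \sum_x p' x * A x + hi * t.
  rewrite -lerBlDl -sumrB; apply: (@le_trans _ _ (hi * \sum_x `|p x - p' x|)).
    rewrite mulr_sumr; apply: ler_sum => x _; rewrite -mulrBl.
    apply: (le_trans (ler_norm _)); rewrite normrM mulrC ger0_norm//.
    by rewrite ler_wpM2r//; have /andP[] := Ab x.
  by rewrite ler_wpM2l.
apply: (le_trans S1); apply: (@le_trans _ _ ((1 + hi / lo * t) * \sum_x p' x * A x)).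
  rewrite mulrDl mul1r lerD2l -mulrA mulrAC; apply: (@le_trans _ _ (hi / lo * t * lo)).
    by rewrite le_eqVlt; apply/orP; left; apply/eqP; field; rewrite gt_eqF.
  rewrite [leRHS](_ : _ = hi / lo * t * \sum_x p' x * A x); last by ring.
  by rewrite ler_wpM2l// mulr_ge0// divr_ge0// ltW.
by rewrite ler_wpM2r ?expR_ge1Dx//; apply: le_trans loS; exact: ltW.
Qed.

(** Bound of the total variation between two products of k weights on X that
    are uniformly h-close. *)
Definition tv_bound (X : finType) k (h : R) : R :=
  #|{ffun 'I_k -> X}|%:R * (k%:R * (1 + 1) ^+ k * h).

Lemma tv_bound_ge0 X k h : 0 <= h -> 0 <= tv_bound X k h.
Proof. by move=> h0; rewrite mulr_ge0// mulr_ge0// mulr_ge0// exprn_ge0. Qed.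

Lemma prod_weights_close (X : finType) k (w w' : 'I_k -> X -> R) h : 0 <= h ->
  (forall l x, 0 <= w l x <= 1) -> (forall l x, 0 <= w' l x <= 1) ->
  (forall l x, `|w l x - w' l x| <= h) ->
  \sum_(g : {ffun 'I_k -> X}) `|\prod_l w l (g l) - \prod_l w' l (g l)| <= tv_bound X k h.
Proof.
move=> h0 w1 w'1 ww'.
have n1 (v : 'I_k -> X -> R) l x : 0 <= v l x <= 1 -> `|v l x| <= 1.
  by move=> /andP[a b]; rewrite ger0_norm.
have -> : tv_bound X k h = \sum_(g : {ffun 'I_k -> X}) k%:R * (1 + 1) ^+ k * h.
  by rewrite sumr_const /tv_bound -[RHS]mulr_natl.
apply: ler_sum => g _.
have := @prod_close R _ (index_enum 'I_k) (fun l => w l (g l)) (fun l => w' l (g l)) 1 h h0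
  (fun l => n1 w l _ (w1 l _)) (fun l => n1 w' l _ (w'1 l _)) (fun l => ww' l _).
have -> : size (index_enum 'I_k) = k by rewrite -[RHS](card_ord k) cardE enumT.
by [].
Qed.

Lemma avg_between (X : finType) (p A : X -> R) lo hi : (forall x, 0 <= p x) ->
  \sum_x p x = 1 -> (forall x, lo <= A x <= hi) -> lo <= \sum_x p x * A x <= hi.
Proof.
move=> p0 p1 Ab; apply/andP; split.
  rewrite -[leLHS]mul1r -[X in X * _]p1 mulr_suml; apply: ler_sum => x _.
  by rewrite ler_wpM2l//; have /andP[] := Ab x.
rewrite -[leRHS]mul1r -[X in _ <= X * _]p1 mulr_suml; apply: ler_sum => x _.
by rewrite ler_wpM2l//; have /andP[] := Ab x.
Qed.

Lemma le1_of_sum (X : finType) (w : X -> R) x : (forall x, 0 <= w x) -> \sum_x w x = 1 ->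
  0 <= w x <= 1.
Proof.
by move=> w0 <-; rewrite w0/= (bigD1 x)//= lerDl sumr_ge0.
Qed.

Lemma spin_prob01 (x : R) s : 0 <= spin_prob x s <= 1.
Proof.
apply: le1_of_sum; last exact: spin_prob_sum.
by move=> s'; exact/ltW/spin_prob_gt0.
Qed.

Lemma prod_spin_ge0 k (x : 'I_k -> R) (c : 'I_k -> bool) :
  0 <= \prod_l spin_prob (x l) (c l).
Proof. by apply: prodr_ge0 => l _; exact/ltW/spin_prob_gt0. Qed.

Lemma prod_spin_sum k (x : 'I_k -> R) :
  \sum_(c : config k) \prod_l spin_prob (x l) (c l) = 1.
Proof.
rewrite -(bigA_distr_bigA (fun l s => spin_prob (x l) s)) big1// => l _.
exact: spin_prob_sum.
Qed.

Variables (kap : R).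
Hypothesis kap_ge0 : 0 <= kap.

Definition avg_err k (h : R) : R := expR kap / expR (- kap) * tv_bound bool k h.

Section one_edge.
Variables (p : nat) (th th' : config p -> R).
Hypotheses (th_bd : forall c, `|th c| <= kap).

Lemma exp_theta_bd c : expR (- kap) <= exp_theta th c <= expR kap.
Proof. by rewrite /exp_theta !ler_expR -ler_norml. Qed.

Lemma cavity_avg_bd x s : expR (- kap) <= cavity_avg (exp_theta th) x s <= expR kap.
Proof.
rewrite cavity_avgE; apply: avg_between => [c||c]; [exact: prod_spin_ge0|exact: prod_spin_sum|].
exact: exp_theta_bd.
Qed.

Lemma gibbs_avg_bd x : expR (- kap) <= gibbs_avg (exp_theta th) x <= expR kap.
Proof.
rewrite gibbs_avgE; apply: avg_between => [c||c]; [exact: prod_spin_ge0|exact: prod_spin_sum|].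
exact: exp_theta_bd.
Qed.

Lemma cavity_avg_close x x' s h : 0 <= h ->
  (forall l s, `|spin_prob (x l) s - spin_prob (x' l) s| <= h) ->
  cavity_avg (exp_theta th) x s <=
  expR (avg_err p.-1 h) * cavity_avg (exp_theta th) x' s.
Proof.
move=> h0 xx'; rewrite !cavity_avgE; apply: avg_close.
- by move=> c; exact: prod_spin_ge0.
- exact: prod_spin_sum.
- by apply: (@prod_weights_close bool p.-1 (fun l => spin_prob (x l)) (fun l => spin_prob (x' l))) => // l s';
     exact: spin_prob01.
- exact: expR_gt0.
- by move=> c; exact: exp_theta_bd.
Qed.

Lemma gibbs_avg_close x x' h : 0 <= h ->
  (forall l s, `|spin_prob (x l) s - spin_prob (x' l) s| <= h) ->
  gibbs_avg (exp_theta th) x <= expR (avg_err p h) * gibbs_avg (exp_theta th) x'.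
Proof.
move=> h0 xx'; rewrite !gibbs_avgE; apply: avg_close.
- by move=> c; exact: prod_spin_ge0.
- exact: prod_spin_sum.
- by apply: (@prod_weights_close bool p (fun l => spin_prob (x l)) (fun l => spin_prob (x' l))) => // l s';
     exact: spin_prob01.
- exact: expR_gt0.
- by move=> c; exact: exp_theta_bd.
Qed.

Variable del : R.
Hypothesis th_close : forall c, `|th c - th' c| <= del.

Lemma exp_theta_close c : exp_theta th c <= expR del * exp_theta th' c.
Proof.
rewrite /exp_theta -expRD ler_expR.
by have := th_close c; rewrite ler_norml => /andP[_]; lra.
Qed.

Lemma cavity_avg_theta x s :
  cavity_avg (exp_theta th) x s <= expR del * cavity_avg (exp_theta th') x s.
Proof.
rewrite !cavity_avgE mulr_sumr; apply: ler_sum => c _.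
by rewrite mulrCA ler_wpM2l ?prod_spin_ge0// exp_theta_close.
Qed.

Lemma gibbs_avg_theta x :
  gibbs_avg (exp_theta th) x <= expR del * gibbs_avg (exp_theta th') x.
Proof.
rewrite !gibbs_avgE mulr_sumr; apply: ler_sum => c _.
by rewrite mulrCA ler_wpM2l ?prod_spin_ge0// exp_theta_close.
Qed.

End one_edge.

Variables (m : R) (m_gt0 : 0 < m).
Variables (G : finType) (pt : G -> R).

Lemma weighted_field_bounded p (th : config p -> R) (w : 'I_p.-1 -> G -> R) :
  (forall c, `|th c| <= kap) -> (forall l g, 0 <= w l g) ->
  (forall l, \sum_g w l g = 1) -> bounded_field kap (weighted_field pt th w).
Proof.
move=> thb w0 w1; split; last first.
  by move=> _ /mapP[g _ ->] s /=; exact: cavity_avg_bd.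
split.
  have := esum_weighted_field pt th w (fun=> 1); rewrite /esum.
  under eq_bigr do rewrite mulr1; move=> ->; under eq_bigr do rewrite mulr1.
  by rewrite -(bigA_distr_bigA w) big1.
move=> _ /mapP[g _ ->] /=; split; first exact: prodr_ge0.
move=> s; have /andP[h _] := @cavity_avg_bd p _ thb (fun l => pt (g l)) s.
by apply: lt_le_trans h; exact: expR_gt0.
Qed.

Definition weight_err k (h : R) : R :=
  m^-1 * (expR (m * kap) / expR (- (m * kap)) * tv_bound G k h).

(** Both the edge function and the weights change; the ratio of the two values
    of a functional on a field is controlled by the bounds of the field,
    uniformly in the functional. *)
Lemma weighted_field_dominated p (th th' : config p -> R) (w w' : 'I_p.-1 -> G -> R) h del :
  0 <= h -> (forall c, `|th c| <= kap) -> (forall c, `|th' c| <= kap) ->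
  (forall c, `|th c - th' c| <= del) ->
  (forall l g, 0 <= w l g) -> (forall l, \sum_g w l g = 1) ->
  (forall l g, 0 <= w' l g) -> (forall l, \sum_g w' l g = 1) ->
  (forall l g, `|w l g - w' l g| <= h) ->
  dominated m (del + weight_err p.-1 h) (weighted_field pt th w) (weighted_field pt th' w').
Proof.
move=> h0 thb th'b thth' w0 w1 w'0 w'1 ww' F [F0 Fm].
rewrite !esum_weighted_field.
pose f (th : config p -> R) (g : {ffun 'I_p.-1 -> G}) s :=
  cavity_avg (exp_theta th) (fun l => pt (g l)) s.
have f0 th1 : (forall c, `|th1 c| <= kap) -> forall g s, 0 < f th1 g s.
  move=> b g s; have /andP[h1 _] := @cavity_avg_bd p _ b (fun l => pt (g l)) s.
  by apply: lt_le_trans h1; exact: expR_gt0.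
have prod0 (v : 'I_p.-1 -> G -> R) (g : {ffun 'I_p.-1 -> G}) :
    (forall l g, 0 <= v l g) -> 0 <= \prod_l v l (g l).
  by move=> v0; exact: prodr_ge0.
have one_gt0 (s : bool) : 0 < 1 :> R by [].
have up g : F (f th' g) <= expR (m * kap) * F (fun=> 1).
  apply: Fm => // [s|s]; first exact: f0.
  by rewrite mulr1; have /andP[] := @cavity_avg_bd p _ th'b (fun l => pt (g l)) s.
have down g : F (fun=> 1) <= expR (m * kap) * F (f th' g).
  apply: Fm => // [s|s]; first exact: f0.
  have /andP[h1 _] := @cavity_avg_bd p _ th'b (fun l => pt (g l)) s.
  rewrite -ler_pdivrMl ?expR_gt0// mulr1 -expRN; exact: h1.
have S1 : \sum_(g : {ffun 'I_p.-1 -> G}) (\prod_l w l (g l)) * F (f th g) <=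
    expR (m * del) * \sum_(g : {ffun 'I_p.-1 -> G}) (\prod_l w l (g l)) * F (f th' g).
  rewrite mulr_sumr; apply: ler_sum => g _; rewrite mulrCA ler_wpM2l ?prod0//.
  apply: Fm => [s|s|s]; [exact: f0|exact: f0|exact: cavity_avg_theta].
apply: (le_trans S1); rewrite mulrDr expRD -mulrA ler_wpM2l ?expR_ge0//.
have [F1|F1] := eqVneq (F (fun=> 1)) 0.
  have Z g : F (f th' g) = 0.
    apply/eqP; rewrite eq_le F0 ?andbT; last by move=> s; exact: f0.
    by have := up g; rewrite F1 mulr0.
  rewrite big1 => [|g _]; last by rewrite Z mulr0.
  rewrite big1 ?mulr0// => g _; by rewrite -[X in _ * F X]/(f th' g) Z mulr0.
have F1' : 0 < F (fun=> 1) by rewrite lt_neqAle eq_sym F1 F0.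
have -> : m * weight_err p.-1 h =
    (expR (m * kap) * F (fun=> 1)) / (expR (- (m * kap)) * F (fun=> 1)) * tv_bound G p.-1 h.
  rewrite /weight_err mulrA divff ?gt_eqF// mul1r; congr (_ * _).
  by rewrite invfM mulrACA divff ?mulr1// gt_eqF.
apply: avg_close.
- by move=> g; exact: prod0.
- by rewrite -(bigA_distr_bigA w') big1.
- by apply: prod_weights_close => // l g; exact: le1_of_sum.
- by rewrite mulr_gt0// expR_gt0.
- move=> g; rewrite up andbT expRN ler_pdivrMl ?expR_gt0//; exact: down.
Qed.

Lemma edge_value_dominated p (th th' : config p -> R) (w w' : 'I_p -> G -> R) h del :
  0 <= h -> (forall c, `|th c| <= kap) -> (forall c, `|th' c| <= kap) ->
  (forall c, `|th c - th' c| <= del) ->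
  (forall l g, 0 <= w l g) -> (forall l, \sum_g w l g = 1) ->
  (forall l g, 0 <= w' l g) -> (forall l, \sum_g w' l g = 1) ->
  (forall l g, `|w l g - w' l g| <= h) ->
  \sum_(g : {ffun 'I_p -> G}) (\prod_l w l (g l)) *
    gibbs_avg (exp_theta th) (fun l => pt (g l)) `^ m <=
  expR (m * (del + weight_err p h)) *
  \sum_(g : {ffun 'I_p -> G}) (\prod_l w' l (g l)) *
    gibbs_avg (exp_theta th') (fun l => pt (g l)) `^ m.
Proof.
move=> h0 thb th'b thth' w0 w1 w'0 w'1 ww'.
have prod0 (v : 'I_p -> G -> R) (g : {ffun 'I_p -> G}) :
    (forall l g, 0 <= v l g) -> 0 <= \prod_l v l (g l).
  by move=> v0; exact: prodr_ge0.
have pw c u v : 0 <= u -> 0 <= v -> u <= expR c * v -> u `^ m <= expR (m * c) * v `^ m.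
  move=> u0 v0 uv; rewrite -powR_expR -powRM ?expR_ge0//.
  by apply: ge0_ler_powR; rewrite ?nnegrE ?(ltW m_gt0)// mulr_ge0 ?expR_ge0.
have ga0 (th1 : config p -> R) x : (forall c, `|th1 c| <= kap) -> 0 <= gibbs_avg (exp_theta th1) x.
  move=> b; have /andP[h1 _] := @gibbs_avg_bd p th1 b x.
  by apply: le_trans h1; exact: expR_ge0.
apply: (@le_trans _ _ (expR (m * del) * \sum_(g : {ffun 'I_p -> G}) (\prod_l w l (g l)) *
    gibbs_avg (exp_theta th') (fun l => pt (g l)) `^ m)).
  rewrite mulr_sumr; apply: ler_sum => g _; rewrite mulrCA ler_wpM2l ?prod0//.
  by apply: pw; [exact: ga0|exact: ga0|exact: gibbs_avg_theta].
rewrite mulrDr expRD -mulrA ler_wpM2l ?expR_ge0//.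
have -> : m * weight_err p h = expR (m * kap) / expR (- (m * kap)) * tv_bound G p h.
  by rewrite /weight_err mulrA divff ?gt_eqF// mul1r.
apply: avg_close.
- by move=> g; exact: prod0.
- by rewrite -(bigA_distr_bigA w') big1.
- by apply: prod_weights_close => // l g; exact: le1_of_sum.
- exact: expR_gt0.
- move=> g; have /andP[h1 h2] := @gibbs_avg_bd p th' th'b (fun l => pt (g l)).
  have g0 := ga0 th' (fun l => pt (g l)) th'b.
  rewrite -mulrN -!powR_expR; apply/andP; split.
    by apply: ge0_ler_powR; rewrite ?nnegrE ?(ltW m_gt0) ?expR_ge0.
  by apply: ge0_ler_powR; rewrite ?nnegrE ?(ltW m_gt0) ?expR_ge0.
Qed.

End averages.

(** * Several fields on one vertex *)

Section fields_as_sum.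
Context (R : realType).

(** The fields are added to the single spin of one vertex. *)
Definition addfields (e : ens R bool) (ys : seq (ens R bool)) : ens R bool :=
  foldl (fun e y => addfield e y id) e ys.

Section split_first.
Variables (k : nat) (n : 'I_k.+1 -> nat).
Notation I := {i : 'I_k.+1 & 'I_(n i)}.
Notation I' := {i : 'I_k & 'I_(n (lift ord0 i))}.

Definition first_or_later (v : 'I_(n ord0) + I') : I :=
  match v with
  | inl l => Tagged (fun i => 'I_(n i)) l
  | inr u => Tagged (fun i => 'I_(n i)) (tagged u : 'I_(n (lift ord0 (tag u))))
  end.

Lemma first_or_later_bij : bijective first_or_later.
Proof.
have inj : injective first_or_later.
  move=> [l|[i l]] [l'|[i' l']] /=.
  - by move=> /eqP; rewrite eq_Tagged /= => /eqP ->.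
  - by move=> /(congr1 (fun u : I => nat_of_ord (tag u))).
  - by move=> /(congr1 (fun u : I => nat_of_ord (tag u))).
  - move=> E; have ii' : i = i'.
      by have := congr1 (fun u : I => tag u) E => /= /lift_inj.
    by subst i'; move: E => /eqP; rewrite eq_Tagged /= => /eqP ->.
have surj (u : I) : exists v, first_or_later v = u.
  case: u => i l; case: (unliftP ord0 i) l => [j ->|->] l.
    by exists (inr (Tagged (fun j => 'I_(n (lift ord0 j))) l)).
  by exists (inl l).
have /choice[g hg] := surj.
by exists g => [v|u]; [apply: inj; exact: hg|exact: hg].
Qed.

Lemma sum_first_later (G : finType) (F : {ffun 'I_(n ord0) -> G} -> {ffun I' -> G} -> R) :
  \sum_(g : {ffun I -> G})
    F [ffun l => g (first_or_later (inl l))] [ffun u => g (first_or_later (inr u))] =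
  \sum_g1 \sum_g2 F g1 g2.
Proof.
have [e eK e'K] := first_or_later_bij.
rewrite pair_big /= [RHS](reindex (fun g : {ffun I -> G} =>
  ([ffun l => g (first_or_later (inl l))], [ffun u => g (first_or_later (inr u))]))) //=.
exists (fun u : {ffun 'I_(n ord0) -> G} * {ffun I' -> G} =>
  [ffun i => match e i with inl l => u.1 l | inr v => u.2 v end]) => [g _|[g1 g2] _] /=.
  apply/ffunP => i; rewrite ffunE; case E : (e i) => [l|v];
    by rewrite ffunE; have := e'K i; rewrite E => <-.
congr pair; apply/ffunP => v; rewrite !ffunE.
  by have := eK (inl v); rewrite /= => ->.
by have := eK (inr v); rewrite /= => ->; case: v.
Qed.

Lemma prod_first_later (F : I -> R) :
  \prod_u F u = (\prod_l F (first_or_later (inl l))) * \prod_u F (first_or_later (inr u)).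
Proof.
have [e eK e'K] := first_or_later_bij.
rewrite (reindex first_or_later) /=; last by exists e => u _.
by rewrite big_sumType.
Qed.

End split_first.

(** Summing over the cavity variables of all the fields at once, or field by
    field, is the same. *)
Lemma addfields_sum (G : finType) k (n : 'I_k -> nat)
    (W : {i : 'I_k & 'I_(n i)} -> G -> R)
    (phi : forall i, {ffun 'I_(n i) -> G} -> bool -> R) (e : ens R bool)
    (F : (bool -> R) -> R) :
  \sum_(g : {ffun {i : 'I_k & 'I_(n i)} -> G}) (\prod_u W u (g u)) *
    esum e (fun g0 => F (fun s => g0 s *
      \prod_i phi i [ffun l => g (Tagged (fun i => 'I_(n i)) l)] s)) =
  esum (addfields e [seq [seq (\prod_l W (Tagged (fun i => 'I_(n i)) l) (g l), phi i g)
          | g : {ffun 'I_(n i) -> G}] | i <- enum 'I_k]) F.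
Proof.
elim: k n W phi e => [|k IH] n W phi e.
  have I0 (u : {i : 'I_0 & 'I_(n i)}) : False by case: u => -[].
  rewrite (eq_bigl (pred1 [ffun u => False_rect G (I0 u)])); last first.
    by move=> g; apply/esym/eqP/ffunP => u; case: (I0 u).
  rewrite big_pred1_eq big1 => [|u _]; last by case: (I0 u).
  rewrite mul1r enum_ord0 /=; apply: eq_esum => g0; congr F.
  by apply/funext => s; rewrite big_ord0 mulr1.
rewrite enum_ordSl /= -map_comp.
have := IH (fun i => n (lift ord0 i)) (fun u => W (first_or_later (inr u)))
  (fun i => phi (lift ord0 i)) (addfield e [seq (\prod_l W (Tagged (fun i => 'I_(n i)) l) (g l), phi ord0 g)
          | g : {ffun 'I_(n ord0) -> G}] id).
rewrite /addfields /= => <-.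
under [RHS]eq_bigr do rewrite esum_addfield.
pose Fsum := (fun (g1 : {ffun 'I_(n ord0) -> G})
       (g2 : {ffun {i : 'I_k & 'I_(n (lift ord0 i))} -> G}) => (\prod_l W (Tagged (fun i => 'I_(n i)) l) (g1 l)) *
     (\prod_u W (first_or_later (inr u)) (g2 u)) *
     esum e (fun g0 => F (fun s => g0 s * phi ord0 g1 s *
       \prod_i phi (lift ord0 i) [ffun l => g2 (Tagged (fun i => 'I_(n (lift ord0 i))) l)] s))).
transitivity (\sum_(g : {ffun {i : 'I_k.+1 & 'I_(n i)} -> G})
  Fsum [ffun l => g (first_or_later (inl l))] [ffun u => g (first_or_later (inr u))]).
  apply: eq_bigr => g _; rewrite prod_first_later /Fsum; congr (_ * _ * _).
  - by apply: eq_bigr => l _; rewrite ffunE.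
  - by apply: eq_bigr => l _; rewrite ffunE.
  - apply: eq_esum => g0; congr F; apply/funext => s.
    rewrite big_ord_recl mulrA; congr (_ * phi ord0 _ s * _).
    apply: eq_bigr => i _; congr (phi _ _ s).
    by apply/ffunP => l; rewrite !ffunE.
rewrite (sum_first_later Fsum) exchange_big /=; apply: eq_bigr => g2 _.
rewrite esumC /esum big_image /= mulr_sumr; apply: eq_bigr => g1 _.
by rewrite /Fsum /esum [X in X * _]mulrC -mulrA.
Qed.

Lemma pos_ens_addfields e ys : pos_ens e -> List.Forall (fun y : ens R bool => pos_ens y) ys ->
  pos_ens (addfields e ys).
Proof.
move=> epos yp; elim: yp e epos => [//|y s ypos _ IH] e epos /=.
by apply: IH; exact: pos_ens_addfield.
Qed.

End fields_as_sum.

(** * The free energy of the rounded system *)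

HB.instance Definition _ := gen_eqMixin source.

Section common.
Context (R : realType) (dd : measure_display) (Omega : measurableType dd)
  (P : probability Omega R).

Lemma same_law_ae (d : measure_display) (T : measurableType d) (X Y : {RV P >-> T})
    (A : set T) : same_law X Y -> measurable A ->
  {ae P, forall w, A (Y w)} -> {ae P, forall w, A (X w)}.
Proof.
move=> XY mA AY; have mC : measurable (~` A) by exact: measurableC.
have PY : P (Y @^-1` (~` A)) = 0%E.
  have mYA : measurable (Y @^-1` (~` A)).
    by rewrite -[_ @^-1` _]setTI; exact: measurable_funPT.
  by apply/negligibleP.
exists (X @^-1` (~` A)); split => //.
  by rewrite -[_ @^-1` _]setTI; exact: measurable_funPT.
by have := XY _ mC; rewrite /distribution /pushforward PY.
Qed.

Lemma same_law_cell (d : measure_display) (T : measurableType d) (X Y : {RV P >-> T})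
    (A : set T) : same_law X Y -> measurable A ->
  fine (P (X @^-1` A)) = fine (P (Y @^-1` A)).
Proof. by move=> XY mA; have := XY _ mA; rewrite /distribution /pushforward => ->. Qed.

Lemma preimage_sigma (d : measure_display) (T : measurableType d) (X : {RV P >-> T}) (A : set T) :
  measurable A -> g_sigma_algebra_preimage X (X @^-1` A).
Proof. by move=> mA; exists A => //; rewrite setTI. Qed.

Lemma sigma_measurable (d : measure_display) (T : measurableType d) (X : {RV P >-> T}) A :
  g_sigma_algebra_preimage X A -> measurable A.
Proof. by move=> [B mB <-]; rewrite setTI -[_ @^-1` _]setTI; exact: measurable_funPT. Qed.

Lemma bounded_functions_measurable (S : finType) (kap : R) :
  measurable [set g : funspace R S | forall s, `|g s| <= kap].
Proof.
have -> : [set g : funspace R S | forall s, `|g s| <= kap] =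
    \bigcap_(s in [set: S]) [set g : funspace R S | `|g s| <= kap].
  by apply/seteqP; split => g h s; [move=> _; exact: h|exact: (h s Logic.I)].
apply: fin_bigcap_measurable => // s _.
apply: sub_sigma_algebra; exists s, [set x : R | `|x| <= kap]; split => //.
have : measurable_fun [set: measurableTypeR R] (@Num.norm R R) by exact: normr_measurable.
move=> /(_ measurableT `]-oo, kap]%classic); rewrite setTI => /(_ (measurable_itv _)).
by congr (measurable _); apply/seteqP; split => x /=; rewrite in_itv.
Qed.

End common.

Section free_energy_upper_bound.
Context (R : realType) (dd : measure_display) (Omega : measurableType dd)
  (P : probability Omega R).
Variables (PP : set nat)
  (theta : forall p : nat, {RV P >-> funspace R (config p)})
  (thetac : forall p : nat, nat -> {RV P >-> funspace R (config p)})
  (thetac_law : forall p i, PP p -> same_law (thetac p i) (theta p))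
  (h : {RV P >-> funspace R spin})
  (hc : nat -> {RV P >-> funspace R spin})
  (hc_law : forall i, same_law (hc i) h).
Variables (dg : {RV P >-> nat}) (pp : nat -> {RV P >-> nat})
  (zetae : nat -> nat -> nat -> {RV P >-> L1 R}) (zeta : nat -> {RV P >-> L1 R}).
Hypothesis indep : mutually_independent P (source_dom PP)
  (source_sigma theta thetac h hc dg pp zetae zeta).
Variable kap : R.
Hypotheses (kap_gt0 : 0 < kap)
  (theta_bd : forall p, PP p -> {ae P, forall w, forall s : config p, `|theta p w s| <= kap})
  (h_bd : {ae P, forall w, forall s : spin, `|h w s| <= kap}).
Variable nz : nat.
Hypothesis nz_gt0 : (0 < nz)%N.

Definition theta_code (p : nat) : finType := fcode nz (config p).
Definition theta_val p (x : theta_code p) : config p -> R := fcode_fun kap x.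
Definition theta_prob p (x : theta_code p) : R :=
  fine (P (theta p @^-1` (fcode_of nz kap @^-1` [set x]))).
Definition field_code : finType := fcode nz bool.
Definition field_val (x : field_code) : bool -> R := fcode_fun kap x.
Definition field_prob (x : field_code) : R :=
  fine (P (h @^-1` (fcode_of nz kap @^-1` [set x]))).

Lemma source_sigma_measurable s A : source_dom PP s ->
  source_sigma theta thetac h hc dg pp zetae zeta s A -> measurable A.
Proof. by case: s => [p|p i| |i| |i|p i l|l] _; exact: sigma_measurable. Qed.

Variables (N : nat) (deg : 'I_N -> nat) (E : nat -> nat).
Hypothesis E_dom : forall p, ~ PP p -> E p = 0%N.
Notation EDGE := {p : 'I_(total_degree deg).+1 & 'I_(E p)}.
Notation T := (config N).
Notation tree := (@tree R dd Omega source).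

Lemma edge_PP (e : EDGE) : PP (edge_size e).
Proof.
apply: contrapT => /E_dom E0; have [j jlt] := tagged e.
by have : (j < E (edge_size e))%N := jlt; rewrite E0.
Qed.

Definition field_round (i : nat) (w : Omega) : field_code := fcode_of nz kap (hc i w).
Definition theta_round (e : EDGE) (w : Omega) : theta_code (edge_size e) :=
  fcode_of nz kap (thetac (edge_size e) (tagged e) w).

(** The codes of the external fields are read one after the other and
    collected in a function of the vertex. *)
Definition upd (acc : 'I_N -> field_code) i x : 'I_N -> field_code :=
  fun j => if j == i then x else acc j.

Fixpoint fields_tree (l : seq 'I_N) (acc : 'I_N -> field_code)
    (k : ('I_N -> field_code) -> tree) : tree :=
  if l is i :: l' then
    Node (SrcHCopy i) (field_round i) (fun x => fields_tree l' (upd acc i x) k)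
  else k acc.

Fixpoint fields_mean (l : seq 'I_N) (acc : 'I_N -> field_code)
    (F : ('I_N -> field_code) -> R) : R :=
  if l is i :: l' then \sum_x field_prob x * fields_mean l' (upd acc i x) F
  else F acc.

Fixpoint edges_tree (M : half_edge_map deg E) (l : seq EDGE) (g : T -> R) : tree :=
  if l is e :: l' then
    Node (SrcThetaCopy (edge_size e) (tagged e)) (theta_round e)
      (fun x => edges_tree M l'
        (fun sigma => g sigma * expR (theta_val x [ffun k => sigma (endpoint M k)])))
  else @Leaf R dd Omega source (ln (\sum_t g t)).

Definition field_weights (hh : 'I_N -> field_code) (sigma : T) : R :=
  \prod_i expR (field_val (hh i) (sigma i)).

Lemma edges_tree_eval M l g w : tree_eval (edges_tree M l g) w =
  ln (\sum_sigma g sigma * \prod_(e <- l)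
     expR (theta_val (theta_round e w) [ffun k => sigma (endpoint M k)])).
Proof.
elim: l g => [|e l IH] g /=.
  by congr ln; apply: eq_bigr => sigma _; rewrite big_nil mulr1.
by rewrite IH; congr ln; apply: eq_bigr => sigma _; rewrite big_cons mulrA.
Qed.

Lemma fields_tree_eval l acc k w : uniq l -> tree_eval (fields_tree l acc k) w =
  tree_eval (k (fun j => if j \in l then field_round j w else acc j)) w.
Proof.
elim: l acc => [|i l IH] acc /=; first by [].
move=> /andP[il ul]; rewrite IH//; congr (tree_eval (k _) w); apply/funext => j.
rewrite inE /upd; have [->|ji] := eqVneq j i; first by rewrite (negbTE il).
by [].
Qed.

Lemma edges_tree_mean M l g : tree_mean P (edges_tree M l g) =
  graph_edges_mean theta_prob theta_val M l g.
Proof.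
elim: l g => [//|e l IH] g /=; apply: eq_bigr => x _; rewrite IH; congr (_ * _).
apply: (same_law_cell (thetac_law _ (edge_PP e))); exact: measurable_fcode.
Qed.

Lemma fields_tree_mean l acc k : tree_mean P (fields_tree l acc k) =
  fields_mean l acc (fun hh => tree_mean P (k hh)).
Proof.
elim: l acc => [//|i l IH] acc /=; apply: eq_bigr => x _; rewrite IH; congr (_ * _).
apply: (same_law_cell (hc_law i)); exact: measurable_fcode.
Qed.

Notation sigma_of := (source_sigma theta thetac h hc dg pp zetae zeta).

Lemma edges_tree_wf M l g used : uniq l ->
  (forall e, e \in l -> SrcThetaCopy (edge_size e) (tagged e) \notin used) ->
  tree_wf (source_dom PP) sigma_of used (edges_tree M l g).
Proof.
elim: l g used => [//|e l IH] g used /= /andP[el ul] lu; split.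
- exact: edge_PP.
- by apply: lu; rewrite mem_head.
- move=> x; exact: (preimage_sigma (thetac _ _) (measurable_fcode _ x)).
- move=> x; apply: IH => // e' e'l; rewrite inE negb_or; apply/andP; split; last first.
    by apply: lu; rewrite inE e'l orbT.
  apply/eqP => -[pp' jj']; move: el; rewrite (_ : e = e') ?e'l//.
  case: e e' pp' jj' {e'l lu x} => [q j] [q' j'] /= qq'.
  have {}qq' : q = q' by apply: val_inj.
  subst q' => jj'; congr existT; exact: val_inj.
Qed.

Lemma fields_tree_wf l acc k used : uniq l ->
  (forall i, i \in l -> SrcHCopy (i : 'I_N) \notin used) ->
  (forall hh used', (forall s, s \in used' -> s \in used \/ exists i, s = SrcHCopy i) ->
     tree_wf (source_dom PP) sigma_of used' (k hh)) ->
  tree_wf (source_dom PP) sigma_of used (fields_tree l acc k).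
Proof.
elim: l acc used => [|i l IH] acc used /=.
  by move=> _ _ hk; apply: hk => s; left.
move=> /andP[il ul] lu hk; split => //.
- by apply: lu; rewrite mem_head.
- move=> x; exact: (preimage_sigma (hc _) (measurable_fcode _ x)).
- move=> x; apply: IH => // [j jl|hh used' hu].
    rewrite inE negb_or; apply/andP; split; last by apply: lu; rewrite inE jl orbT.
    by apply/eqP => -[/val_inj ji]; move: il; rewrite -ji jl.
  apply: hk => s /hu[|]; last by right.
  by rewrite inE => /orP[/eqP ->|]; [right; exists i|left].
Qed.

Lemma fields_mean_sum l acc (J : Type) (s : seq J) (a : J -> R) F :
  fields_mean l acc (fun hh => \sum_(j <- s) a j * F j hh) =
  \sum_(j <- s) a j * fields_mean l acc (F j).
Proof.
elim: l acc => [//|i l IH] acc /=; under eq_bigr do rewrite IH mulr_sumr.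
rewrite exchange_big; apply: eq_bigr => j _ /=; rewrite mulr_sumr.
by apply: eq_bigr => x _; rewrite mulrCA.
Qed.

Lemma field_prob_sum : \sum_x field_prob x = 1.
Proof.
have := @sum_cells R dd Omega P _ (fun w => fcode_of nz kap (h w)); apply => x.
have := measurable_funPT h measurableT (fcode_of nz kap @^-1` [set x]) (measurable_fcode kap x).
by rewrite setTI.
Qed.

Lemma field_prob_ge0 x : 0 <= field_prob x.
Proof. exact: fine_ge0. Qed.

Lemma fields_mean_le l acc F F' : (forall hh, F hh <= F' hh) ->
  fields_mean l acc F <= fields_mean l acc F'.
Proof.
move=> FF'; elim: l acc => [//|i l IH] acc /=; apply: ler_sum => x _.
by rewrite ler_wpM2l ?field_prob_ge0.
Qed.

(** A sum of functions of one external field each only sees the law of that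
    field. *)
Lemma fields_mean_local l acc (s : seq 'I_N) (f : 'I_N -> field_code -> R) :
  fields_mean l acc (fun hh => \sum_(i <- s) f i (hh i)) =
  \sum_(i <- s) (if i \in l then \sum_x field_prob x * f i x else f i (acc i)).
Proof.
elim: l acc => [//|j l IH] acc /=; under eq_bigr do rewrite IH mulr_sumr.
rewrite exchange_big; apply: eq_bigr => i _ /=; rewrite inE /upd.
have [il|il] := boolP (i \in l).
  by rewrite orbT -mulr_suml field_prob_sum mul1r.
by have [|] := eqVneq i j => [->//|_]; rewrite -mulr_suml field_prob_sum mul1r.
Qed.

Lemma graph_meanE (X : half_edge_map deg E -> R) :
  graph_mean X = \sum_(M <- enum (perfect_matchings deg E))
    #|perfect_matchings deg E|%:R^-1 * X M.
Proof. by rewrite /graph_mean mulr_suml -big_enum; apply: eq_bigr => M _; rewrite mulrC. Qed.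

Definition round_err : R := (#|{: EDGE}| + N)%:R * (2 * kap / nz%:R).

Lemma partition_le M w :
  (forall (e : EDGE) c, `|thetac (edge_size e) (tagged e) w c| <= kap) ->
  (forall (i : 'I_N) s, `|hc i w s| <= kap) ->
  ln (partition_function M (fun p j => thetac p j w) (fun i => hc i w)) <=
  ln (\sum_sigma field_weights (field_round ^~ w) sigma * \prod_(e <- enum {: EDGE})
     expR (theta_val (theta_round e w) [ffun k => sigma (endpoint M k)])) + round_err.
Proof.
move=> tb hb.
set Z := \sum_sigma _.
have Z0 : 0 < Z.
  have t0 : T := [ffun=> true].
  apply: (sum_gt0 t0) => sigma; rewrite mulr_gt0// prodr_gt0// => *; exact: expR_gt0.
have pf0 : 0 < partition_function M (fun p j => thetac p j w) (fun i => hc i w).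
  have t0 : T := [ffun=> true].
  by apply: (sum_gt0 t0) => sigma; exact: expR_gt0.
rewrite -[round_err]expRK -lnM ?posrE ?expR_gt0// ler_ln ?posrE ?mulr_gt0 ?expR_gt0//.
rewrite mulrC /Z mulr_sumr; apply: ler_sum => sigma _.
rewrite /field_weights -!expR_sum -!expRD ler_expR /minus_H.
have -> : \sum_(e <- enum {: EDGE}) theta_val (theta_round e w) [ffun k => sigma (endpoint M k)] =
   \sum_(e : EDGE) theta_val (theta_round e w) [ffun k => sigma (endpoint M k)].
  by rewrite big_enum.
rewrite /round_err natrD mulrDl.
have c1 : \sum_(e : EDGE) thetac (edge_size e) (tagged e) w [ffun k => sigma (endpoint M k)] <=
  \sum_(e : EDGE) theta_val (theta_round e w) [ffun k => sigma (endpoint M k)] +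
  #|{: EDGE}|%:R * (2 * kap / nz%:R).
  rewrite mulr_natl -sumr_const -big_split; apply: ler_sum => e _ /=.
  have := fcode_close nz_gt0 kap_gt0 [ffun k => sigma (endpoint M k)] (tb e).
  by rewrite ler_norml => /andP[_]; rewrite /theta_val /theta_round; lra.
have c2 : \sum_(i < N) hc i w (sigma i) <=
  \sum_(i < N) field_val (field_round i w) (sigma i) + N%:R * (2 * kap / nz%:R).
  rewrite mulr_natl -[X in _ *+ X](card_ord N) -sumr_const -big_split; apply: ler_sum => i _ /=.
  have := fcode_close nz_gt0 kap_gt0 (sigma i) (hb i).
  by rewrite ler_norml => /andP[_]; rewrite /field_val /field_round; lra.
move: c1 c2; set a1 := \sum_e _; set a2 := \sum_e _; set a3 := \sum_i _; set a4 := \sum_i _.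
by move: (_ * _) (_ * _) => u v c1 c2; lra.
Qed.

Lemma graph_mean_le (X Y : half_edge_map deg E -> R) c : 0 <= c ->
  (forall M, X M <= Y M + c) -> graph_mean X <= graph_mean Y + c.
Proof.
move=> c0 XY; rewrite /graph_mean.
have [->|PM] := posnP #|perfect_matchings deg E|.
  by rewrite invr0 !mulr0 add0r.
have PM0 : 0 < #|perfect_matchings deg E|%:R :> R by rewrite ltr0n.
rewrite ler_pdivrMr// mulrDl divfK ?gt_eqF// [c * _]mulr_natr -sumr_const -big_split.
by apply: ler_sum => M _.
Qed.

(** All the functions are bounded by kap almost surely, hence rounding changes
    the Hamiltonian by at most round_err; what remains reads finitely many
    independent codes. *)
Lemma free_energy_le acc : (free_energy deg E thetac hc <=
  (N%:R^-1 * (fields_mean (enum 'I_N) acc (fun hh =>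
     graph_mean (fun M : half_edge_map deg E =>
       graph_edges_mean theta_prob theta_val M (enum {: EDGE}) (field_weights hh)))
   + round_err))%:E)%E.
Proof.
pose tr M := fields_tree (enum 'I_N) acc (fun hh => edges_tree M (enum {: EDGE}) (field_weights hh)).
have wf M : tree_wf (source_dom PP) sigma_of [::] (tr M).
  apply: fields_tree_wf; [exact: enum_uniq|by []|move=> hh used' hu].
  apply: edges_tree_wf; first exact: enum_uniq.
  by move=> e _; apply/negP => /hu[//|[i]].
have bm M : bounded_meas (tree_eval (tr M)).
  apply: (@tree_bounded_meas R dd Omega source _ sigma_of) (wf M) => s A; exact: source_sigma_measurable.
have mt M : mean P (tree_eval (tr M)) = fields_mean (enum 'I_N) acc (fun hh =>
     graph_edges_mean theta_prob theta_val M (enum {: EDGE}) (field_weights hh)).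
  rewrite (mean_tree source_sigma_measurable indep (wf M)) fields_tree_mean.
  by congr fields_mean; apply/funext => hh; rewrite edges_tree_mean.
pose gm w := graph_mean (fun M => tree_eval (tr M) w) + round_err.
have re0 : 0 <= round_err by rewrite mulr_ge0// divr_ge0// mulr_ge0// ltW.
have bgm : bounded_meas (fun w => graph_mean (fun M => tree_eval (tr M) w)).
  under [in X in bounded_meas X]eq_fun do rewrite graph_meanE.
  by apply: bounded_meas_sum => M; exact: bounded_measZ.
have bc : bounded_meas (fun _ : Omega => round_err) by exact: bounded_meas_cst.
have mgm : mean P gm = fields_mean (enum 'I_N) acc (fun hh =>
     graph_mean (fun M : half_edge_map deg E =>
       graph_edges_mean theta_prob theta_val M (enum {: EDGE}) (field_weights hh))) + round_err.
  rewrite /gm meanD// mean_cst; congr (_ + _).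
  under [in LHS]eq_fun do rewrite graph_meanE.
  rewrite mean_sum; last by move=> M; exact: bounded_measZ.
  under [in RHS]eq_fun do rewrite graph_meanE.
  rewrite fields_mean_sum; apply: eq_bigr => M _.
  by rewrite meanZ// mt.
rewrite -mgm EFinM /free_energy; apply: lee_wpmul2l; first by rewrite lee_fin.
apply: expectation_ae_le; first exact: bounded_measD.
have tb : {ae P, forall w, forall (e : EDGE), forall c,
    `|thetac (edge_size e) (tagged e) w c| <= kap}.
  apply: filter_forall => e.
  apply: (same_law_ae (thetac_law (tagged e) (edge_PP e)) (bounded_functions_measurable kap)).
  exact: theta_bd (edge_PP e).
have hb : {ae P, forall w, forall i : 'I_N, forall s, `|hc i w s| <= kap}.
  apply: filter_forall => i.
  exact: (same_law_ae (hc_law i) (bounded_functions_measurable kap)).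
apply: filterS2 tb hb => w tw hw; apply: graph_mean_le => // M.
rewrite /tr fields_tree_eval ?enum_uniq// edges_tree_eval.
have -> : (fun j : 'I_N => if j \in enum 'I_N then field_round j w else acc j) =
  (fun j : 'I_N => field_round j w) by apply/funext => j; rewrite mem_enum.
exact: partition_le.
Qed.

End free_energy_upper_bound.

(** * The rounded vertex term, for given degree, sizes and functions *)

(** Two approximations follow each other: the cavity variables are rounded
    inside E' (integrand_ge), then the function and the random measures
    (field_at_dominated). *)
Section vertex_pointwise.
Context (R : realType) (m kap : R).
Hypotheses (m_gt0 : 0 < m) (kap_gt0 : 0 < kap).
Variables (nx nz K : nat).
Hypotheses (nx_gt0 : (0 < nx)%N) (nz_gt0 : (0 < nz)%N).

Notation G := (cell nx).
Notation pt := (@cell_pt R nx).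

Lemma dominated_weaken (T : Type) c c' (e e' : ens R T) : pos_ens e' -> c <= c' ->
  dominated m c e e' -> dominated m c' e e'.
Proof.
move=> [_ e'pos] cc' ee' F Fm; apply: (le_trans (ee' F Fm)).
rewrite ler_wpM2r ?ler_expR ?ler_pM2l//; apply: esum_ge0 => x xe'.
  by have [] := e'pos x xe'.
by have [F0 _] := Fm; apply: F0; have [] := e'pos x xe'.
Qed.

Lemma dominated_addfields (I : Type) (s : seq I) (y y' : I -> ens R bool) c c0
    (e e' : ens R bool) :
  pos_ens e -> pos_ens e' -> (forall i, pos_ens (y i)) -> (forall i, pos_ens (y' i)) ->
  dominated m c0 e e' -> (forall i, dominated m c (y i) (y' i)) ->
  dominated m (c0 + (size s)%:R * c) (addfields e (map y s)) (addfields e' (map y' s)).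
Proof.
move=> + + yp y'p + yy'; elim: s e e' c0 => [|i s IH] e e' c0 ep e'p ee' /=.
  by rewrite mul0r addr0.
have -> : c0 + (size s).+1%:R * c = (c + c0) + (size s)%:R * c.
  by rewrite -natr1; ring.
apply: IH; [exact: pos_ens_addfield|exact: pos_ens_addfield|].
apply: (@dominated_trans R m bool c c0 _ (addfield e (y' i) id)).
  exact: dominated_field.
exact: dominated_addfield.
Qed.

Variables (tp : nat -> nat) (th : forall i, config (tp i) -> R)
  (zt : forall i, 'I_(tp i).-1 -> L1 R) (h : bool -> R) (k : nat) (good : nat -> bool).
Arguments th : clear implicits.
Arguments zt : clear implicits.
Hypotheses (th_bd : forall i c, `|th i c| <= kap) (h_bd : forall s, `|h s| <= kap)
  (good_K : forall i, good i -> (tp i <= K)%N).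

Definition cell_err : R := \sum_(p < K.+1) avg_err kap p.-1 (2 / nx%:R).
Definition code_err : R :=
  2 * kap / nz%:R + \sum_(p < K.+1) weight_err kap m G p.-1 (2 / nz%:R).

(** The types p and the cavity measures of a vertex enter its rounded version
    only through this ensemble. *)
Definition coded_field p (th : config p -> R) (zt : 'I_p.-1 -> L1 R) : ens R bool :=
  weighted_field pt (fcode_fun kap (fcode_of nz kap th) : config p -> R)
    (fun l => zcode_mass R (zcode_of nx nz (zt l))).

Definition field_at i : ens R bool :=
  if good i then coded_field (th i) (zt i) else trivial_ens R bool.

Definition vertex_integrand (x : {i : 'I_k & 'I_(tp i).-1} -> R) : R :=
  (\sum_(s : bool) expR (\sum_(i < k)
     U (th i) (fun l => x (Tagged (fun i : 'I_k => 'I_(tp i).-1) l)) s + h s)) `^ m.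

Let phi (i : 'I_k) (g : {ffun 'I_(tp i).-1 -> G}) (s : bool) : R :=
  if good i then cavity_avg (exp_theta (th i)) (fun l => pt (g l)) s else 1.

Let W (u : {i : 'I_k & 'I_(tp i).-1}) : G -> R :=
  cell_mass (@cell_of R nx) (zt _ (tagged u)).

Let true_field (i : 'I_k) : ens R bool :=
  [seq (\prod_l W (Tagged (fun i : 'I_k => 'I_(tp i).-1) l) (g l), phi g)
  | g : {ffun 'I_(tp i).-1 -> G}].

Let e_true := addfields [:: (1, fun s => expR (h s))] [seq true_field i | i <- enum 'I_k].

Lemma cell_err_ge p : (p <= K)%N -> avg_err kap p.-1 (2 / nx%:R) <= cell_err.
Proof.
move=> pK; have pK' : (p < K.+1)%N by [].
rewrite /cell_err (bigD1 (Ordinal pK'))//= lerDl sumr_ge0// => q _.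
by rewrite mulr_ge0 ?divr_ge0 ?expR_ge0// tv_bound_ge0// divr_ge0.
Qed.

Lemma weight_err_ge0 p : 0 <= weight_err kap m G p (2 / nz%:R).
Proof.
rewrite mulr_ge0 ?invr_ge0 ?(ltW m_gt0)// mulr_ge0 ?divr_ge0 ?expR_ge0//.
by rewrite tv_bound_ge0// divr_ge0.
Qed.

Lemma code_err_ge p : (p <= K)%N ->
  2 * kap / nz%:R + weight_err kap m G p.-1 (2 / nz%:R) <= code_err.
Proof.
move=> pK; have pK' : (p < K.+1)%N by [].
rewrite /code_err lerD2l (bigD1 (Ordinal pK'))//= lerDl sumr_ge0// => q _.
exact: weight_err_ge0.
Qed.

Lemma code_err_ge0 : 0 <= code_err.
Proof.
apply: le_trans (code_err_ge (leq0n K)).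
by rewrite addr_ge0 ?weight_err_ge0// divr_ge0// mulr_ge0// ltW.
Qed.

Lemma cell_err_ge0 : 0 <= cell_err.
Proof.
apply: le_trans (cell_err_ge (leq0n K)).
by rewrite mulr_ge0 ?divr_ge0 ?expR_ge0// tv_bound_ge0// divr_ge0.
Qed.

Lemma sum_W u : \sum_g W u g = 1.
Proof. by apply: cell_mass_sum => g; exact: measurable_cell. Qed.

Lemma phi_bd (i : 'I_k) (g : {ffun 'I_(tp i).-1 -> G}) s : expR (- kap) <= phi g s <= expR kap.
Proof.
rewrite /phi; case: ifP => _; first exact: cavity_avg_bd.
by rewrite -expR0 !ler_expR oppr_le0 ltW.
Qed.

Lemma phi_gt0 (i : 'I_k) (g : {ffun 'I_(tp i).-1 -> G}) s : 0 < phi g s.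
Proof. by have /andP[h1 _] := phi_bd g s; apply: lt_le_trans h1; exact: expR_gt0. Qed.

Lemma true_field_pos i : pos_ens (true_field i).
Proof.
split; last first.
  move=> _ /mapP[g _ ->] /=; split; last by move=> s; exact: phi_gt0.
  by apply: prodr_ge0 => l _; exact: cell_mass_ge0.
rewrite /true_field big_image /= -(bigA_distr_bigA (fun l => W (Tagged (fun i : 'I_k => 'I_(tp i).-1) l))).
by rewrite big1// => l _; exact: sum_W.
Qed.

Lemma coded_field_bounded p (th' : config p -> R) zt' : bounded_field kap (coded_field th' zt').
Proof.
apply: (@weighted_field_bounded R kap (cell nx) pt p) => [c|l g|l].
- exact: fcode_fun_bd.
- exact: zcode_mass_ge0.
- exact: zcode_mass_sum.
Qed.

Lemma field_at_pos i : pos_ens (field_at i).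
Proof.
rewrite /field_at; case: ifP => _; last exact: pos_ens_trivial.
by have [] := coded_field_bounded (th i) (zt i).
Qed.

Lemma field_at_dominated (i : 'I_k) : dominated m code_err (field_at i) (true_field i).
Proof.
rewrite /field_at; case: ifP => gi; last first.
  apply: (dominated_weaken (true_field_pos i) code_err_ge0).
  move=> F Fm; rewrite mulr0 expR0 mul1r /trivial_ens esum1.
  rewrite /esum /true_field big_image /= /phi gi.
  rewrite -mulr_suml -(bigA_distr_bigA (fun l => W (Tagged (fun i : 'I_k => 'I_(tp i).-1) l))) big1 ?mul1r// => l _.
  exact: sum_W.
apply: (dominated_weaken (true_field_pos i) (code_err_ge (good_K gi))).
have -> : true_field i = weighted_field pt (th i) (fun l => cell_mass (@cell_of R nx) (zt i l)).
  rewrite /true_field /weighted_field; apply: eq_map => g; congr pair.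
  by apply/funext => s; rewrite /phi gi.
apply: weighted_field_dominated.
- exact: m_gt0.
- by rewrite divr_ge0.
- by move=> c; exact: fcode_fun_bd.
- exact: th_bd.
- by move=> c; rewrite distrC; exact: (fcode_close nz_gt0 kap_gt0 c (@th_bd i)).
- by move=> l g; exact: zcode_mass_ge0.
- by move=> l; exact: zcode_mass_sum.
- by move=> l g; exact: cell_mass_ge0.
- by move=> l; apply: cell_mass_sum => g; exact: measurable_cell.
- by move=> l g; rewrite distrC; exact: zcode_close.
Qed.

Let Phi0 (g : {ffun {i : 'I_k & 'I_(tp i).-1} -> G}) : R :=
  esum [:: (1, fun s => expR (h s))] (fun g0 => @mass R m bool (fun s => g0 s *
      \prod_(i < k) @phi i [ffun l => g (Tagged (fun i : 'I_k => 'I_(tp i).-1) l)] s)).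

Definition bad_count : nat := \sum_(i < k) ~~ good i.

Let err : R := k%:R * cell_err + kap * bad_count%:R.

Lemma U_expR (i : 'I_k) x s : expR (U (th i) x s) = cavity_avg (exp_theta (th i)) x s.
Proof.
rewrite /U lnK// posrE; have /andP[h1 _] := cavity_avg_bd (@th_bd i) x s.
by apply: lt_le_trans h1; exact: expR_gt0.
Qed.

(** Rounding the cavity variables changes a field by a factor close to 1 if
    its size is at most K; the field of a larger edge is replaced by 1, at the
    cost kap. *)
Lemma phi_le (i : 'I_k) (x : 'I_(tp i).-1 -> R) s :
  phi [ffun l => cell_of nx (x l)] s <=
  expR (cell_err + kap * (~~ good i)%:R) * expR (U (th i) x s).
Proof.
rewrite U_expR /phi; case: ifP => gi /=.
  rewrite mulr0 addr0.
  apply: (@le_trans _ _ (expR (avg_err kap (tp i).-1 (2 / nx%:R)) *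
     cavity_avg (exp_theta (th i)) x s)); last first.
    rewrite ler_wpM2r ?ler_expR ?cell_err_ge ?good_K//.
    by rewrite -U_expR expR_ge0.
  apply: cavity_avg_close; [exact: (@th_bd i)|by rewrite divr_ge0|].
  by move=> l s'; rewrite ffunE distrC; exact: cell_close.
rewrite mulr1 expRD -mulrA -[leLHS]mul1r ler_pM// ?ler01//.
  by rewrite -[leLHS]expR0 ler_expR cell_err_ge0.
have /andP[h1 _] := cavity_avg_bd (@th_bd i) x s.
apply: (@le_trans _ _ (expR kap * expR (- kap))); first by rewrite -expRD subrr expR0.
by rewrite ler_wpM2l ?expR_ge0.
Qed.

Lemma integrand_ge x :
  expR (- (m * err)) * Phi0 [ffun u => cell_of nx (x u)] <= vertex_integrand x.
Proof.
rewrite /Phi0 esum1 /mass /vertex_integrand -mulrN -powR_expR -powRM ?expR_ge0//; last first.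
  apply: sumr_ge0 => s _; rewrite mulr_ge0 ?expR_ge0//.
  by apply: prodr_ge0 => i _; exact/ltW/phi_gt0.
have S0 : 0 <= \sum_s expR (h s) * \prod_(i < k) @phi i [ffun l => [ffun u => cell_of nx (x u)]
    (Tagged (fun i : 'I_k => 'I_(tp i).-1) l)] s.
  apply: sumr_ge0 => s _; rewrite mulr_ge0 ?expR_ge0//.
  by apply: prodr_ge0 => i _; exact/ltW/phi_gt0.
apply: ge0_ler_powR; rewrite ?nnegrE ?(ltW m_gt0)//.
- by rewrite mulr_ge0 ?expR_ge0.
- by apply: sumr_ge0 => s _; exact: expR_ge0.
rewrite mulr_sumr; apply: ler_sum => s _.
rewrite expRN ler_pdivrMl ?expR_gt0// [expR (_ + h s)]expRD (mulrC (expR (h s))).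
rewrite mulrA ler_wpM2r ?expR_ge0//.
have -> : expR err * expR (\sum_(i < k) U (th i)
     (fun l => x (Tagged (fun i : 'I_k => 'I_(tp i).-1) l)) s) =
  \prod_(i < k) (expR (cell_err + kap * (~~ good i)%:R) * expR (U (th i)
     (fun l => x (Tagged (fun i : 'I_k => 'I_(tp i).-1) l)) s)).
  rewrite big_split /= -!expR_sum; congr (expR _ * _).
  by rewrite big_split /= sumr_const card_ord -[cell_err *+ k]mulr_natl -mulr_sumr -natr_sum.
apply: ler_prod => i _; rewrite (ltW (phi_gt0 _ _))/=.
have -> : [ffun l : 'I_(tp i).-1 => [ffun u => cell_of nx (x u)] (Tagged (fun i : 'I_k => 'I_(tp i).-1) l)] =
  [ffun l : 'I_(tp i).-1 => cell_of nx (x (Tagged (fun i : 'I_k => 'I_(tp i).-1) l))].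
  by apply/ffunP => l; rewrite !ffunE.
exact: phi_le.
Qed.

Lemma integrand_le x : vertex_integrand x <= (\sum_s expR (k%:R * kap + h s)) `^ m.
Proof.
apply: ge0_ler_powR; rewrite ?nnegrE ?(ltW m_gt0)//.
- by apply: sumr_ge0 => s _; exact: expR_ge0.
- by apply: sumr_ge0 => s _; exact: expR_ge0.
apply: ler_sum => s _; rewrite ler_expR lerD2r mulr_natl -[X in _ *+ X](card_ord k) -sumr_const.
apply: ler_sum => i _; rewrite -ler_expR U_expR.
by have /andP[] := cavity_avg_bd (@th_bd i) (fun l => x (Tagged (fun i : 'I_k => 'I_(tp i).-1) l)) s.
Qed.

Lemma e_true_pos : pos_ens e_true.
Proof.
rewrite /e_true; apply: pos_ens_addfields; first by apply: pos_ens1 => s; exact: expR_gt0.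
by elim: (enum 'I_k) => [|i s IH]; constructor => //; exact: true_field_pos.
Qed.

Lemma Eprime_ge : expR (- (m * err)) * esum e_true (@mass R m _) <=
  Eprime (fun u : {i : 'I_k & 'I_(tp i).-1} => zt _ (tagged u)) vertex_integrand.
Proof.
have := @Eprime_between R G (@cell_of R nx) (@measurable_cell R nx) _
  (fun u : {i : 'I_k & 'I_(tp i).-1} => zt _ (tagged u)) vertex_integrand
  (fun g => expR (- (m * err)) * Phi0 g)
  (fun=> (\sum_s expR (k%:R * kap + h s)) `^ m)
  (fun x => introT andP (conj (integrand_ge x) (integrand_le x))).
move=> /andP[+ _]; apply: le_trans.
rewrite /e_true -(addfields_sum W phi) /cell_mean mulr_sumr.
by rewrite le_eqVlt; apply/orP; left; apply/eqP; apply: eq_bigr => g _; rewrite mulrCA.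
Qed.

Lemma vertex_pointwise :
  ens_val m (addfields [:: (1, fun s => expR (fcode_fun kap (fcode_of nz kap h) s))]
    [seq field_at i | i <- iota 0 k]) <=
  m^-1 * ln (Eprime (fun u : {i : 'I_k & 'I_(tp i).-1} => zt _ (tagged u)) vertex_integrand) +
  (k%:R * (cell_err + code_err) + 2 * kap / nz%:R + kap * bad_count%:R).
Proof.
have Z0 : 0 < esum e_true (@mass R m _) by exact: (esum_mass_gt0 m true e_true_pos).
have E0 : 0 < expR (- (m * err)) * esum e_true (@mass R m _) by rewrite mulr_gt0 ?expR_gt0.
have low : ens_val m e_true - err <=
    m^-1 * ln (Eprime (fun u : {i : 'I_k & 'I_(tp i).-1} => zt _ (tagged u)) vertex_integrand).
  have -> : ens_val m e_true - err =
      m^-1 * ln (expR (- (m * err)) * esum e_true (@mass R m _)).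
    rewrite lnM ?posrE ?expR_gt0// expRK mulrDr /ens_val addrC; congr (_ + _).
    by rewrite mulrN mulrA mulVf ?mul1r// gt_eqF.
  rewrite ler_wpM2l ?invr_ge0 ?(ltW m_gt0)// ler_ln ?posrE//; first exact: Eprime_ge.
  exact: lt_le_trans Eprime_ge.
have e1pos (h' : bool -> R) : pos_ens [:: (1, fun s => expR (h' s))].
  by apply: pos_ens1 => s; exact: expR_gt0.
have dom : dominated m (2 * kap / nz%:R + (size (enum 'I_k))%:R * code_err)
    (addfields [:: (1, fun s => expR (fcode_fun kap (fcode_of nz kap h) s))]
       [seq field_at (val i) | i <- enum 'I_k])
    e_true.
  apply: dominated_addfields => //.
  - by move=> i; exact: field_at_pos.
  - by move=> i; exact: true_field_pos.
  - move=> F [F0 Fm]; rewrite !esum1; apply: Fm => [s|s|s]; try exact: expR_gt0.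
    rewrite -expRD ler_expR; have := fcode_close nz_gt0 kap_gt0 s h_bd.
    by rewrite ler_norml => /andP[]; lra.
  - exact: field_at_dominated.
have codepos : pos_ens (addfields [:: (1, fun s => expR (fcode_fun kap (fcode_of nz kap h) s))]
       [seq field_at (val i) | i <- enum 'I_k]).
  apply: pos_ens_addfields; first exact: e1pos.
  by elim: (enum 'I_k) => [|i s IH]; constructor => //; exact: field_at_pos.
have := dominated_val m_gt0 true codepos e_true_pos dom.
have -> : [seq field_at (val i) | i <- enum 'I_k] = [seq field_at i | i <- iota 0 k].
  by rewrite -[in RHS]val_enum_ord -[in RHS]map_comp.
rewrite -cardE card_ord; move: low; rewrite /err.
move: (ens_val m e_true) (ens_val m _) (m^-1 * ln _) => u v x.
move: (k%:R : R) (bad_count%:R : R) cell_err code_err => k' b' c d; lra.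
Qed.

End vertex_pointwise.

(** * Lower bound of the vertex term *)

Section finite_reads.
Context (R : realType) (dd : measure_display) (Omega : measurableType dd)
  (P : probability Omega R).
Variables (S : eqType) (D : set S) (F : S -> set (set Omega)) (J : finType).
Notation tree := (@tree R dd Omega S).

Fixpoint reads n : ('I_n -> S) -> ('I_n -> Omega -> J) -> ({ffun 'I_n -> J} -> tree) -> tree :=
  match n return ('I_n -> S) -> ('I_n -> Omega -> J) -> ({ffun 'I_n -> J} -> tree) -> tree with
  | 0 => fun _ _ k => k (ffun0 (card_ord 0))
  | n'.+1 => fun src r k => Node (src ord0) (r ord0) (fun x =>
      reads (fun l => src (lift ord0 l)) (fun l => r (lift ord0 l))
        (fun g => k (cons_ffun x g)))
  end.

Lemma reads_eval n (src : 'I_n -> S) r k w :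
  tree_eval (reads src r k) w = tree_eval (k [ffun l => r l w]) w.
Proof.
elim: n src r k => [|n IH] src r k /=.
  by congr (tree_eval (k _) w); apply/ffunP => -[].
rewrite IH; congr (tree_eval (k _) w); apply/ffunP => l; rewrite !ffunE.
by case: unliftP => [l' ->|->]; rewrite ?ffunE.
Qed.

Lemma reads_mean n (src : 'I_n -> S) r k (pr : J -> R) :
  (forall l x, fine (P (r l @^-1` [set x])) = pr x) ->
  tree_mean P (reads src r k) =
  \sum_(g : {ffun 'I_n -> J}) (\prod_l pr (g l)) * tree_mean P (k g).
Proof.
elim: n src r k => [|n IH] src r k prE /=.
  by rewrite (sum_ffun0 _ (ffun0 (card_ord 0))) big_ord0 mul1r.
rewrite sum_cons; apply: eq_bigr => x _; rewrite prE IH; last by move=> l y; exact: prE.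
rewrite mulr_sumr; apply: eq_bigr => g _.
by rewrite (prod_cons_ffun x g (fun _ => pr)) mulrA.
Qed.

Lemma reads_wf n (src : 'I_n -> S) r k used : injective src ->
  (forall l, D (src l)) -> (forall l x, F (src l) (r l @^-1` [set x])) ->
  (forall l, src l \notin used) ->
  (forall g used', (forall s, s \in used' -> s \in used \/ exists l, s = src l) ->
     tree_wf D F used' (k g)) ->
  tree_wf D F used (reads src r k).
Proof.
elim: n src r k used => [|n IH] src r k used isrc Dsrc Fsrc su kwf /=.
  by apply: kwf => s; left.
split => // x; apply: IH => //.
- by move=> l l' /isrc /lift_inj.
- move=> l; rewrite inE negb_or su andbT; apply/eqP => /isrc /eqP.
  by rewrite eq_sym (negbTE (neq_lift _ _)).
- move=> g used' hu; apply: kwf => s /hu[|[l ->]]; last by right; exists (lift ord0 l).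
  by rewrite inE => /orP[/eqP ->|]; [right; exists ord0|left].
Qed.

End finite_reads.

Section vertex_lower_bound.
Context (R : realType) (dd : measure_display) (Omega : measurableType dd)
  (P : probability Omega R).
Variables (PP : set nat)
  (theta : forall p : nat, {RV P >-> funspace R (config p)})
  (thetac : forall p : nat, nat -> {RV P >-> funspace R (config p)})
  (thetac_law : forall p i, PP p -> same_law (thetac p i) (theta p))
  (h : {RV P >-> funspace R spin})
  (hc : nat -> {RV P >-> funspace R spin}).
Variables (mu : probability nat R) (zeta2 : L2 R) (rho : nat -> R)
  (dg : {RV P >-> nat}) (dg_law : has_law dg mu)
  (pp : nat -> {RV P >-> nat})
  (pp_law : forall i p, PP p -> distribution P (pp i) [set p] = (rho p)%:E)
  (pp_PP : forall i, {ae P, forall w, PP (pp i w)})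
  (zetae : nat -> nat -> nat -> {RV P >-> L1 R})
  (zetae_law : forall p i l, PP p -> has_law (zetae p i l) zeta2)
  (zeta : nat -> {RV P >-> L1 R}).
Hypothesis indep : mutually_independent P (source_dom PP)
  (source_sigma theta thetac h hc dg pp zetae zeta).
Variables (m kap : R).
Hypotheses (m_gt0 : 0 < m) (kap_gt0 : 0 < kap)
  (theta_bd : forall p, PP p -> {ae P, forall w, forall s : config p, `|theta p w s| <= kap})
  (h_bd : {ae P, forall w, forall s : spin, `|h w s| <= kap}).
Variables (nx nz K k0 : nat).
Hypotheses (nx_gt0 : (0 < nx)%N) (nz_gt0 : (0 < nz)%N).

Notation tree := (@tree R dd Omega source).
Notation sigma_of := (source_sigma theta thetac h hc dg pp zetae zeta).
Notation pt := (@cell_pt R nx).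
Notation zmass := (@zcode_mass R nx nz).

(** None stands for the sizes that exceed K, whose field is trivial; the other
    types carry the codes of the function and of the p-1 random measures. *)
Definition field_type : finType :=
  option {p : 'I_K.+1 & (theta_code nz p * {ffun 'I_p.-1 -> zcode nx nz})%type}.

Definition zeta_prob (c : zcode nx nz) : R :=
  fine ((zeta2 : probability (L1 R) R) (zcode_of nx nz @^-1` [set c])).

Definition type_prob (p : nat) : R := if `[< PP p >] then rho p else 0.

Definition no_type_prob : R := 1 - \sum_(p < K.+1) type_prob p.

Definition field_type_prob (y : field_type) : R :=
  if y is Some u then
    type_prob (tag u) * (theta_prob theta kap (tagged u).1 * \prod_l zeta_prob ((tagged u).2 l))
  else no_type_prob.

Definition field_of_type (y : field_type) : ens R bool :=
  if y is Some u then cavity_field pt zmass (theta_val kap (tagged u).1) (tagged u).2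
  else trivial_ens R bool.

Definition type_ok (p : nat) : bool := (p <= K)%N && `[< PP p >].

Definition type_round i (w : Omega) : option 'I_K.+1 :=
  if type_ok (pp i w) then Some (inord (pp i w)) else None.

(** The tree reads the size of the i-th edge, then its function and its random
    measures, before the next edge. Sizes that do not occur are treated as
    sizes above K. *)
Fixpoint vertex_fields_tree (i k : nat) (e : ens R bool) : tree :=
  if k is k'.+1 then
    Node (SrcEdgeSize i) (type_round i) (fun t : option 'I_K.+1 =>
      if t is Some p then
        if `[< PP p >] then
          Node (SrcThetaCopy p i) (fun w => fcode_of nz kap (thetac p i w))
            (fun x : theta_code nz p =>
             reads (fun l : 'I_p.-1 => SrcZetaEdge p i l)
               (fun l w => zcode_of nx nz (zetae p i l w))
               (fun z => vertex_fields_tree i.+1 k' (addfield e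
                  (field_of_type (Some (Tagged (fun p : 'I_K.+1 =>
                     (theta_code nz p * {ffun 'I_p.-1 -> zcode nx nz})%type) (x, z)))) id)))
        else vertex_fields_tree i.+1 k' (addfield e (trivial_ens R bool) id)
      else vertex_fields_tree i.+1 k' (addfield e (trivial_ens R bool) id))
  else @Leaf R dd Omega source (ens_val m e).

(** The sources with index below i may have been read; the others are still
    available. *)
Definition source_before i (s : source) : Prop :=
  match s with
  | SrcThetaCopy _ j | SrcEdgeSize j | SrcZetaEdge _ j _ => (j < i)%N
  | _ => True
  end.

Lemma before_notin i s (used : seq source) :
  (forall s, s \in used -> source_before i s) -> ~ source_before i s -> s \notin used.
Proof. by move=> hu ns; apply/negP => /hu. Qed.

Lemma beforeS i s : source_before i s -> source_before i.+1 s.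
Proof. by case: s => //= *; lia. Qed.

Lemma measurable_type_round i t : g_sigma_algebra_preimage (pp i) (type_round i @^-1` [set t]).
Proof.
exists ((fun p => if type_ok p then Some (inord p) else None) @^-1` [set t]) => //.
by rewrite setTI.
Qed.

Lemma vertex_fields_tree_wf i k e used :
  (forall s, s \in used -> source_before i s) ->
  tree_wf (source_dom PP) sigma_of used (vertex_fields_tree i k e).
Proof.
elim: k i e used => [//|k IH] i e used hu /=.
have nb s : source_before i.+1 s -> ~ source_before i s -> s \notin used.
  by move=> _; exact: before_notin.
have hu1 s : s \in SrcEdgeSize i :: used -> source_before i.+1 s.
  by rewrite inE => /orP[/eqP -> /=|/hu /beforeS]; rewrite ?ltnSn.
split => //.
- by apply: nb => /=; rewrite ?ltnn.
- by move=> t; exact: measurable_type_round.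
move=> [p|]; last exact: IH.
case: asboolP => PPp; last exact: IH.
split => //.
- rewrite inE negb_or; apply/andP; split; first exact/eqP.
  by apply: nb => /=; rewrite ?ltnn.
- by move=> x; exact: (preimage_sigma (thetac _ _) (measurable_fcode _ x)).
move=> x; apply: reads_wf => //.
- by move=> l l' [/val_inj].
- by move=> l c; apply: (preimage_sigma (zetae p i l) (A := zcode_of nx nz @^-1` [set c])); exact: measurable_zcode.
- move=> l; rewrite inE negb_or; apply/andP; split; first exact/eqP.
  rewrite inE negb_or; apply/andP; split; first exact/eqP.
  by apply: nb => /=; rewrite ?ltnn.
- move=> g used' hu'; apply: IH => s /hu'[|[l -> /=]]; last exact: ltnSn.
  by rewrite inE => /orP[/eqP -> /=|/hu1 //]; exact: ltnSn.
Qed.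

Lemma prob_type_round i (p : 'I_K.+1) :
  fine (P (type_round i @^-1` [set Some p])) = type_prob p.
Proof.
rewrite /type_prob; case: asboolP => PPp; last first.
  rewrite (_ : _ @^-1` _ = set0) ?measure0// -subset0 => w /=.
  rewrite /type_round; case: ifP => // /andP[pK /asboolP PPw] [] pE; apply: PPp.
  by rewrite -pE inordK.
rewrite (_ : _ @^-1` _ = pp i @^-1` [set (p : nat)]).
  by have := pp_law i PPp; rewrite /distribution /pushforward => ->.
apply/seteqP; split => w /=; rewrite /type_round.
  by case: ifP => // /andP[pK _] [] <-; rewrite inordK.
move=> wp; rewrite /type_ok wp -ltnS ltn_ord /=; case: asboolP => // _.
by congr Some; apply: val_inj; rewrite /= inordK.
Qed.

Lemma sum_option (A : finType) (f : option A -> R) :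
  \sum_t f t = f None + \sum_a f (Some a).
Proof.
rewrite (bigD1 None)//=; congr (_ + _).
rewrite (reindex_omap (@Some A) id) => [|[a|]//].
by apply: eq_bigl => a; rewrite /= eqxx.
Qed.

Lemma sum_tagged (I : finType) (T : I -> finType) (f : {i : I & T i} -> R) :
  \sum_u f u = \sum_i \sum_(x : T i) f (Tagged T x).
Proof. by rewrite (sig_big_dep _ (fun _ _ => true) (fun i x => f (Tagged T x))) /=; apply: eq_bigr => -[]. Qed.

Lemma sum_pair (A B : finType) (f : A * B -> R) : \sum_u f u = \sum_a \sum_b f (a, b).
Proof. by rewrite pair_bigA /=; apply: eq_bigr => -[]. Qed.

Lemma type_round_meas i t : measurable (type_round i @^-1` [set t]).
Proof. exact: (sigma_measurable (measurable_type_round i t)). Qed.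

Lemma prob_no_type i : fine (P (type_round i @^-1` [set None])) = no_type_prob.
Proof.
have := sum_cells P (type_round_meas i); rewrite sum_option.
by under eq_bigr do rewrite prob_type_round; rewrite /no_type_prob => <-; rewrite addrK.
Qed.

Lemma vertex_fields_tree_mean i k e :
  tree_mean P (vertex_fields_tree i k e) = field_mean m field_type_prob field_of_type k e.
Proof.
elim: k i e => [//|k IH] i e /=.
rewrite !sum_option prob_no_type IH; congr (_ + _).
rewrite (sum_tagged (fun u => field_type_prob (Some u) * field_mean m field_type_prob
  field_of_type k (addfield e (field_of_type (Some u)) id))).
apply: eq_bigr => p _; rewrite prob_type_round /type_prob.
case: asboolP => PPp; last first.
  rewrite mul0r big1// => u _.
  by rewrite /field_type_prob /= /type_prob; case: asboolP => // _; rewrite !mul0r.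
rewrite (sum_pair (fun u : theta_code nz p * {ffun 'I_p.-1 -> zcode nx nz} =>
  field_type_prob (Some (Tagged (fun p : 'I_K.+1 =>
      (theta_code nz p * {ffun 'I_p.-1 -> zcode nx nz})%type) u)) *
    field_mean m field_type_prob field_of_type k (addfield e (field_of_type (Some (Tagged
      (fun p : 'I_K.+1 => (theta_code nz p * {ffun 'I_p.-1 -> zcode nx nz})%type) u))) id))).
rewrite /= mulr_sumr.
apply: eq_bigr => x _.
have -> : fine (P ((fun w => fcode_of nz kap (thetac p i w)) @^-1` [set x])) =
    theta_prob theta kap x.
  exact: (same_law_cell (thetac_law i PPp) (measurable_fcode kap x)).
rewrite (reads_mean _ _ (pr := zeta_prob)); last first.
  move=> l c; have := zetae_law i l PPp (measurable_zcode c).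
  by rewrite /distribution /pushforward /zeta_prob => <-.
rewrite mulr_sumr mulr_sumr; apply: eq_bigr => z _; rewrite IH /=.
by rewrite /type_prob asboolT// !mulrA.
Qed.

Definition round_field j (w : Omega) : ens R bool :=
  if type_ok (pp j w) then
    coded_field kap nx nz (thetac (pp j w) j w) (fun l => zetae (pp j w) j l w)
  else trivial_ens R bool.

Lemma vertex_fields_tree_eval i k e w : tree_eval (vertex_fields_tree i k e) w =
  ens_val m (addfields e [seq round_field j w | j <- iota i k]).
Proof.
elim: k i e => [//|k IH] i e /=; set tl := [seq round_field j w | j <- iota i.+1 k].
rewrite /type_round /round_field.
case: ifP => [/andP[pK PPw]|_]; last by rewrite IH.
have PPi : PP (inord (pp i w) : 'I_K.+1) by rewrite inordK//; exact/asboolP.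
case: asboolP => // _ /=; rewrite reads_eval IH -/tl; congr (ens_val m (addfields (addfield e _ id) _)).
pose fld q := coded_field kap nx nz (thetac q i w) (fun l => zetae q i l w).
transitivity (fld (inord (pp i w) : 'I_K.+1)); last by rewrite inordK.
rewrite /fld /coded_field /cavity_field; congr weighted_field.
by apply/funext => l; rewrite ffunE.
Qed.

Definition degree_round (w : Omega) : 'I_k0.+2 := inord (minn (dg w) k0.+1).

Definition vertex_start (x : field_code nz) : ens R bool :=
  [:: (1, fun s => expR (field_val kap x s))].

(** Degrees above k0 are treated as 0; the difference is controlled by the
    tail of the degree. *)
Definition vertex_tree : tree :=
  Node SrcDegree degree_round (fun k => Node SrcH (fun w => fcode_of nz kap (h w))
    (fun x => vertex_fields_tree 0 (if (k <= k0)%N then val k else 0%N) (vertex_start x))).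

Definition vertex_value k : R :=
  \sum_x field_prob h kap x * field_mean m field_type_prob field_of_type k (vertex_start x).

Lemma measurable_degree_round k : g_sigma_algebra_preimage dg (degree_round @^-1` [set k]).
Proof.
by exists ((fun d => inord (minn d k0.+1) : 'I_k0.+2) @^-1` [set k]) => //; rewrite setTI.
Qed.

Lemma vertex_tree_wf : tree_wf (source_dom PP) sigma_of [::] vertex_tree.
Proof.
split => // [k|k]; first exact: measurable_degree_round.
split => // [|x|x]; first by rewrite inE; apply/eqP.
  exact: (preimage_sigma h (measurable_fcode _ x)).
apply: vertex_fields_tree_wf => s; rewrite !inE => /orP[/eqP ->|/eqP ->] //.
Qed.

Lemma vertex_tree_mean : tree_mean P vertex_tree =
  vertex_value 0 + \sum_(k < k0.+1) fine (mu [set (k : nat)]) * (vertex_value k - vertex_value 0).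
Proof.
rewrite /=; transitivity (\sum_(k < k0.+2) fine (P (degree_round @^-1` [set k])) *
   vertex_value (if (k <= k0)%N then val k else 0%N)).
  apply: eq_bigr => k _; congr (_ * _); apply: eq_bigr => x _.
  by rewrite vertex_fields_tree_mean.
have mD k : measurable (degree_round @^-1` [set k]).
  exact: (sigma_measurable (measurable_degree_round k)).
have S1 := sum_cells P mD.
have E (k : 'I_k0.+2) : vertex_value (if (k <= k0)%N then val k else 0%N) =
   vertex_value 0 + (if (k <= k0)%N then vertex_value k - vertex_value 0 else 0).
  by case: ifP => _; rewrite ?addr0// addrC subrK.
rewrite (eq_bigr (fun k : 'I_k0.+2 => fine (P (degree_round @^-1` [set k])) * vertex_value 0 +
   fine (P (degree_round @^-1` [set k])) *
     (if (k <= k0)%N then vertex_value k - vertex_value 0 else 0))) => [|k _]; last first.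
  by rewrite -mulrDr; congr (_ * _); exact: E.
rewrite big_split /= -mulr_suml S1 mul1r; congr (_ + _).
rewrite big_ord_recr /= ltnn mulr0 addr0; apply: eq_bigr => k _.
rewrite -ltnS ltn_ord; congr (_ * _).
have := dg_law (A := [set (k : nat)]); rewrite /distribution /pushforward => <-//.
congr (fine (P _)); apply/seteqP; split => w /=; rewrite /degree_round.
  move=> /(congr1 val) /=; rewrite inordK ?ltnS ?geq_minr// => E1.
  by move: E1; have := ltn_ord k; lia.
move=> ->; apply: val_inj; rewrite /= inordK ?ltnS ?geq_minr//.
by apply/minn_idPl; rewrite ltnW// ltnS ltnW.
Qed.

Definition vertex_err : R := cell_err kap nx K + code_err m kap nx nz K.

Lemma theta_copies_bd :
  {ae P, forall w, forall p i, PP p -> forall c, `|thetac p i w c| <= kap}.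
Proof.
apply: ae_foralln => p; apply: ae_foralln => i.
have [PPp|nPPp] := pselect (PP p); last by apply: aeW => w.
have := same_law_ae (thetac_law i PPp) (bounded_functions_measurable kap) (theta_bd PPp).
by apply: filterS => w.
Qed.

Lemma vertex_err_ge0 : 0 <= vertex_err.
Proof. by rewrite addr_ge0// ?cell_err_ge0 ?code_err_ge0. Qed.

(** bad_count is the number of the first k0 edges that are larger than K; for
    degrees above k0 the whole vertex is compared with the one without edges. *)
Lemma vertex_pointwise_ae : {ae P, forall w,
  tree_eval vertex_tree w <=
  m^-1 * ln (Eprime (@cavity_zeta R dd Omega P dg pp zetae w)
    (fun x => vertex_weight thetac h x `^ m)) +
  (k0%:R * vertex_err + 2 * kap / nz%:R +
   kap * (\sum_(i < k0) \1_(type_round i @^-1` [set None]) w) +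
   (kap + vertex_err) * ((dg w)%:R * (k0 < dg w)%N%:R))}.
Proof.
have ppP : {ae P, forall w, forall i, PP (pp i w)} by exact: ae_foralln.
apply: filterS3 theta_copies_bd ppP h_bd => w tw pw hw.
have ve0 := vertex_err_ge0.
have key (good : nat -> bool) : (forall i, good i -> type_ok (pp i w)) ->
  ens_val m (addfields (vertex_start (fcode_of nz kap (h w)))
    [seq (if good i then coded_field kap nx nz (thetac (pp i w) i w)
        (fun l => zetae (pp i w) i l w) else trivial_ens R bool) | i <- iota 0 (dg w)]) <=
  m^-1 * ln (Eprime (@cavity_zeta R dd Omega P dg pp zetae w)
    (fun x => vertex_weight thetac h x `^ m)) +
  ((dg w)%:R * vertex_err + 2 * kap / nz%:R + kap * (bad_count (dg w) good)%:R).
  move=> gok.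
  apply: (@vertex_pointwise R m kap m_gt0 kap_gt0 nx nz K nx_gt0 nz_gt0 (fun i => pp i w)
    (fun i => thetac (pp i w) i w) (fun i l => zetae (pp i w) i l w) (h w) (dg w) good).
  - by move=> i c; exact: tw.
  - exact: hw.
  - by move=> i /gok /andP[].
rewrite /vertex_tree /= vertex_fields_tree_eval.
have dr : (degree_round w : nat) = minn (dg w) k0.+1 by rewrite inordK// ltnS geq_minr.
have [dk|dk] := leqP (dg w) k0.
  have -> : (degree_round w : nat) = dg w by rewrite dr; apply/minn_idPl; rewrite ltnW.
  rewrite dk; apply: (le_trans (key (fun i => type_ok (pp i w)) (fun i => id))).
  rewrite lerD2l mulr0 mulr0 addr0 lerD//.
    by rewrite lerD2r ler_wpM2r// ler_nat.
  rewrite ler_wpM2l ?(ltW kap_gt0)// /bad_count natr_sum.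
  rewrite (big_ord_widen k0 (fun i => ((~~ type_ok (pp i w))%:R : R)) dk) big_mkcond.
  apply: ler_sum => i _; rewrite indicE; case: ifP => _; last by rewrite ler0n.
  case: (boolP (type_ok (pp i w))) => ok /=; first by rewrite ler0n.
  by rewrite mem_set//= /type_round (negbTE ok).
have -> : (degree_round w : nat) = k0.+1 by rewrite dr; apply/minn_idPr.
rewrite ltnn /=.
have := key xpred0 (fun i => False_ind _ \o notF).
have -> : forall (e : ens R bool) (s : seq nat),
    addfields e [seq (if xpred0 i then coded_field kap nx nz (thetac (pp i w) i w)
        (fun l => zetae (pp i w) i l w) else trivial_ens R bool) | i <- s] = e.
  move=> e s; elim: s e => [//|i s IH] e; rewrite /= in IH *.
  by rewrite addfield_trivial IH.
move=> hkey; apply: (le_trans hkey); rewrite lerD2l mulr1.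
have -> : (bad_count (dg w) xpred0)%:R = (dg w)%:R :> R.
  by rewrite /bad_count sum_nat_const card_ord muln1.
have s0 : 0 <= kap * (\sum_(i < k0) \1_(type_round i @^-1` [set None]) w) :> R.
  rewrite mulr_ge0 ?(ltW kap_gt0)//; apply: sumr_ge0 => i _; rewrite indicE ler0n//.
have k00 : 0 <= k0%:R * vertex_err by rewrite mulr_ge0.
move: s0 k00; move: (kap * _) (k0%:R * _) => u v u0 v0.
move: (2 * kap / _) (dg w)%:R vertex_err => x y z; lra.
Qed.

Variable tau : R.
Hypothesis degree_tail :
  (\int[P]_w ((dg w)%:R * (k0 < dg w)%N%:R)%:E = tau%:E)%E.

(** The mean of the tree is the finite sum; the errors are those of the
    rounding, of the edges larger than K, and of the degrees above k0, whose
    mean is tau. *)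
Lemma vertex_term_ge :
  ((vertex_value 0 + \sum_(k < k0.+1) fine (mu [set (k : nat)]) * (vertex_value k - vertex_value 0)
   - (k0%:R * vertex_err + 2 * kap / nz%:R + kap * (k0%:R * no_type_prob) +
      (kap + vertex_err) * tau))%:E <= vertex_term thetac h dg pp zetae m)%E.
Proof.
have tm : mean P (tree_eval vertex_tree) = tree_mean P vertex_tree.
  by apply: (mean_tree _ indep vertex_tree_wf) => s A; exact: source_sigma_measurable.
have bt : bounded_meas (tree_eval vertex_tree).
  apply: (tree_bounded_meas _ vertex_tree_wf) => s A; exact: source_sigma_measurable.
have bI i : bounded_meas (\1_(type_round i @^-1` [set None]) : Omega -> R).
  by apply: bounded_meas_indic; exact: type_round_meas.
pose g1 w := m * tree_eval vertex_tree w +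
  (- m * (k0%:R * vertex_err + 2 * kap / nz%:R) +
   - (m * kap) * (\sum_(i < k0) \1_(type_round i @^-1` [set None]) w)).
have bS : bounded_meas (fun w => \sum_(i < k0) (\1_(type_round i @^-1` [set None]) w : R)).
  by apply: bounded_meas_sum.
have b1 : bounded_meas (fun w => m * tree_eval vertex_tree w) by exact: bounded_measZ.
have b2 : bounded_meas (fun _ : Omega => - m * (k0%:R * vertex_err + 2 * kap / nz%:R)).
  exact: bounded_meas_cst.
have b3 : bounded_meas (fun w => - (m * kap) *
   (\sum_(i < k0) \1_(type_round i @^-1` [set None]) w)) by exact: bounded_measZ.
have b23 := bounded_measD b2 b3.
have bg1 : bounded_meas g1 by exact: bounded_measD.
have mg1 : mean P g1 = m * (vertex_value 0 + \sum_(k < k0.+1) fine (mu [set (k : nat)]) *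
    (vertex_value k - vertex_value 0) -
    (k0%:R * vertex_err + 2 * kap / nz%:R + kap * (k0%:R * no_type_prob))).
  rewrite /g1 (meanD P b1 b23) (meanD P b2 b3) mean_cst meanZ// meanZ// tm vertex_tree_mean.
  rewrite mean_sum//; under [X in - (m * kap) * X]eq_bigr => i _.
    rewrite mean_indic; last exact: type_round_meas.
    rewrite prob_no_type; over.
  by rewrite sumr_const card_ord -[no_type_prob *+ k0]mulr_natl; ring.
pose c := m * (kap + vertex_err).
pose g2 w : R := (dg w)%:R * (k0 < dg w)%N%:R.
have mg2 : measurable_fun [set: Omega] g2.
  by apply: (measurableT_comp (f := fun d : nat => d%:R * (k0 < d)%N%:R : R)) => //.
have g20 w : 0 <= g2 w by rewrite mulr_ge0.
have ig2 : P.-integrable [set: Omega] (EFin \o g2).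
  apply/integrableP; split; first exact/measurable_EFinP.
  rewrite (eq_integral (fun w => (g2 w)%:E)) ?degree_tail ?ltry// => w _.
  by rewrite /= ger0_norm.
have ig1 := bounded_meas_integrable P bg1.
have icg2 : P.-integrable [set: Omega] (EFin \o (fun w => c * g2 w)).
  have := integrableZl measurableT c ig2; congr (integrable _ _ _).
have int : (\int[P]_w (g1 w - c * g2 w)%:E = (mean P g1 - c * tau)%:E)%E.
  under eq_integral do rewrite EFinB.
  rewrite (integralB_EFin measurableT ig1 icg2) (mean_EFin P bg1) EFinB; congr (_ - _)%E.
  under eq_integral do rewrite EFinM.
  by rewrite (integralZl measurableT ig2) degree_tail EFinM.
have low : ((mean P g1 - c * tau)%:E <= \int[P]_w (ln (Eprime (@cavity_zeta R dd Omega P dg pp zetae w)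
    (fun x => vertex_weight thetac h x `^ m)))%:E)%E.
  rewrite -int; apply: integral_ae_ge.
    apply: measurable_funB; first by case: bg1.
    by apply: measurable_funM => //; exact: measurable_cst.
  apply: filterS vertex_pointwise_ae => w; set L := ln _; rewrite /g1 /c -/(g2 w).
  move=> hw; have := hw; rewrite -(ler_pM2l m_gt0) mulrDr mulrA mulfV ?gt_eqF// mul1r.
  by move: (\sum_(i < k0) _) (g2 w) (tree_eval _ _) => x y z; lra.
rewrite /vertex_term expectation.unlock; apply: (@le_trans _ _ ((m^-1)%:E * (mean P g1 - c * tau)%:E)%E).
  rewrite -EFinM lee_fin mg1 /c le_eqVlt; apply/orP; left; apply/eqP.
  move: (\sum_(k < k0.+1) fine (mu [set (k : nat)]) * (vertex_value k - vertex_value 0)) (vertex_value 0) vertex_err no_type_prob (2 * kap / _) => s v e t z.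
  have mn0 : m != 0 by rewrite gt_eqF.
  by field.
by apply: lee_wpmul2l => //; rewrite lee_fin invr_ge0 ltW.
Qed.

End vertex_lower_bound.

(** * Upper bound of the edge term *)

Section edge_upper_bound.
Context (R : realType) (dd : measure_display) (Omega : measurableType dd)
  (P : probability Omega R).
Variables (m kap : R).
Hypotheses (m_gt0 : 0 < m) (kap_gt0 : 0 < kap).
Variables (nx nz K : nat).
Hypotheses (nx_gt0 : (0 < nx)%N) (nz_gt0 : (0 < nz)%N).

Notation G := (cell nx).
Notation pt := (@cell_pt R nx).
Notation zmass := (@zcode_mass R nx nz).

Definition edge_err : R := \sum_(p < K.+1)
  (avg_err kap p (2 / nx%:R) + (2 * kap / nz%:R + weight_err kap m G p (2 / nz%:R))).

Lemma powR_bd x : expR (- kap) <= x <= expR kap -> expR (- (m * kap)) <= x `^ m <= expR (m * kap).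
Proof.
move=> /andP[h1 h2]; have x0 : 0 <= x by apply: le_trans h1; exact: expR_ge0.
by rewrite -mulrN -!powR_expR; apply/andP; split; apply: ge0_ler_powR;
  rewrite ?nnegrE ?expR_ge0 ?(ltW m_gt0).
Qed.

Lemma ln_le_expR (c x y : R) : 0 < x -> 0 < y -> x <= expR c * y -> ln x <= c + ln y.
Proof.
move=> x0 y0 xy; rewrite -[X in _ <= X + _](expRK c) -lnM ?posrE ?expR_gt0//.
by rewrite ler_ln ?posrE// mulr_gt0 ?expR_gt0.
Qed.

Section pointwise.
Variables (p : nat) (th : config p -> R) (zt : 'I_p -> L1 R).
Hypothesis th_bd : forall c, `|th c| <= kap.

Let integrand (x : 'I_p -> R) : R := gibbs_avg (exp_theta th) x `^ m.

Let gibbs_gt0 x : 0 < gibbs_avg (exp_theta th) x.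
Proof. by have /andP[h1 _] := gibbs_avg_bd th_bd x; apply: lt_le_trans h1; exact: expR_gt0. Qed.

Let integrand_bd x : expR (- (m * kap)) <= integrand x <= expR (m * kap).
Proof. by apply: powR_bd; exact: gibbs_avg_bd. Qed.

Lemma edge_Eprime_bd : expR (- (m * kap)) <= Eprime zt integrand <= expR (m * kap).
Proof.
have := Eprime_between (@measurable_cell R nx) zt
  (F := fun=> expR (- (m * kap))) (F' := fun=> expR (m * kap)) integrand_bd.
by rewrite /cell_mean -!mulr_suml -(bigA_distr_bigA (fun l => cell_mass (@cell_of R nx) (zt l)))
  big1 ?mul1r// => l _; apply: cell_mass_sum => g; exact: measurable_cell.
Qed.

Lemma ln_edge_Eprime_le : ln (Eprime zt integrand) <= m * kap.
Proof.
have /andP[lo up] := edge_Eprime_bd; rewrite -[leRHS]expRK ler_ln//.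
  by rewrite posrE; apply: lt_le_trans lo; exact: expR_gt0.
by rewrite posrE expR_gt0.
Qed.

(** As for a vertex, the cavity variables are rounded first, then the function
    and the random measures. *)
Lemma edge_pointwise : (p <= K)%N -> ln (Eprime zt integrand) <=
  m * (edge_value m pt zmass (fcode_fun kap (fcode_of nz kap th) : config p -> R)
         [ffun l => zcode_of nx nz (zt l)] + edge_err).
Proof.
move=> pK; set th' := fcode_fun _ _; set z := [ffun l => _].
set S := \sum_(g : {ffun 'I_p -> G}) (\prod_l zmass (z l) (g l)) *
    gibbs_avg (exp_theta (th' : config p -> R)) (fun l => pt (g l)) `^ m.
have th'b c : `|th' c| <= kap by exact: fcode_fun_bd.
have S0 : 0 < S.
  have gb (g : {ffun 'I_p -> G}) : expR (- (m * kap)) <=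
      gibbs_avg (exp_theta (th' : config p -> R)) (fun l => pt (g l)) `^ m <= expR (m * kap).
    by apply: powR_bd; exact: gibbs_avg_bd.
  have p0 (g : {ffun 'I_p -> G}) : 0 <= \prod_l zmass (z l) (g l).
    by apply: prodr_ge0 => l _; exact: zcode_mass_ge0.
  have p1 : \sum_(g : {ffun 'I_p -> G}) \prod_l zmass (z l) (g l) = 1.
    by rewrite -(bigA_distr_bigA (fun l => zmass (z l))) big1// => l _; exact: zcode_mass_sum.
  have /andP[+ _] := avg_between p0 p1 gb.
  by apply: lt_le_trans; exact: expR_gt0.
have h0 : 0 <= 2 / nx%:R :> R by rewrite divr_ge0.
have step1 : Eprime zt integrand <= expR (m * avg_err kap p (2 / nx%:R)) *
    \sum_(g : {ffun 'I_p -> G}) (\prod_l cell_mass (@cell_of R nx) (zt l) (g l)) *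
       gibbs_avg (exp_theta th) (fun l => pt (g l)) `^ m.
  have := Eprime_between (@measurable_cell R nx) zt (X := integrand) (F := fun=> expR (- (m * kap)))
   (F' := fun g => expR (m * avg_err kap p (2 / nx%:R)) *
      gibbs_avg (exp_theta th) (fun l => pt (g l)) `^ m).
  move=> h; have /andP[_ +] : expR (- (m * kap)) <= Eprime zt integrand <= cell_mean (@cell_of R nx) zt
     (fun g => expR (m * avg_err kap p (2 / nx%:R)) *
      gibbs_avg (exp_theta th) (fun l => pt (g l)) `^ m).
    have /andP[-> _] := edge_Eprime_bd.
    suff /h /andP[_ ->] : forall x : 'I_p -> R, expR (- (m * kap)) <= integrand x <=
       expR (m * avg_err kap p (2 / nx%:R)) *
      gibbs_avg (exp_theta th) (fun l => pt ([ffun i => cell_of nx (x i)] l)) `^ m by [].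
    move=> x; have /andP[-> _] /= := integrand_bd x.
    rewrite /integrand -powR_expR -powRM ?expR_ge0 ?(ltW (gibbs_gt0 _))//.
    apply: ge0_ler_powR; rewrite ?nnegrE ?(ltW m_gt0) ?(ltW (gibbs_gt0 _))//.
      by rewrite mulr_ge0 ?expR_ge0 ?(ltW (gibbs_gt0 _)).
    apply: (gibbs_avg_close th_bd h0) => l s; rewrite ffunE; exact: cell_close.
  move=> /le_trans; apply; rewrite /cell_mean mulr_sumr le_eqVlt; apply/orP; left; apply/eqP.
  by apply: eq_bigr => g _; rewrite mulrCA.
have step2 := @edge_value_dominated R kap m m_gt0 G pt p th th'
  (fun l => cell_mass (@cell_of R nx) (zt l)) (fun l => zmass (z l)) (2 / nz%:R) (2 * kap / nz%:R).
have {}step2 : Eprime zt integrand <= expR (m * (avg_err kap p (2 / nx%:R) +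
    (2 * kap / nz%:R + weight_err kap m G p (2 / nz%:R)))) * S.
  apply: (le_trans step1); rewrite [m * (_ + (_ + _))]mulrDr expRD -[leRHS]mulrA.
  apply: ler_wpM2l; first exact: expR_ge0.
  apply: step2.
  - by rewrite divr_ge0.
  - exact: th_bd.
  - exact: th'b.
  - by move=> c; exact: (fcode_close nz_gt0 kap_gt0 c th_bd).
  - by move=> l g; exact: cell_mass_ge0.
  - by move=> l; apply: cell_mass_sum => g; exact: measurable_cell.
  - by move=> l g; exact: zcode_mass_ge0.
  - by move=> l; exact: zcode_mass_sum.
  - by move=> l g; rewrite ffunE; exact: zcode_close.
have E0 : 0 < Eprime zt integrand.
  by have /andP[h1 _] := edge_Eprime_bd; apply: lt_le_trans h1; exact: expR_gt0.
have : ln (Eprime zt integrand) <= m * (avg_err kap p (2 / nx%:R) +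
    (2 * kap / nz%:R + weight_err kap m G p (2 / nz%:R))) + ln S.
  exact: ln_le_expR.
move=> /le_trans; apply; rewrite /edge_value -/S [m * (_ + edge_err)]mulrDr [m * (m^-1 * _)]mulrA.
rewrite divff ?gt_eqF// mul1r addrC lerD2l.
rewrite ler_pM2l//.
have pK' : (p < K.+1)%N by [].
rewrite /edge_err (bigD1 (Ordinal pK'))//= lerDl sumr_ge0// => q _.
rewrite addr_ge0//; last by rewrite addr_ge0 ?weight_err_ge0// divr_ge0// mulr_ge0// ltW.
by rewrite mulr_ge0 ?divr_ge0 ?expR_ge0// tv_bound_ge0.
Qed.

End pointwise.

Variables (PP : set nat) (PP_gt0 : forall p, PP p -> (0 < p)%N)
  (theta : forall p : nat, {RV P >-> funspace R (config p)})
  (thetac : forall p : nat, nat -> {RV P >-> funspace R (config p)})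
  (h : {RV P >-> funspace R spin})
  (hc : nat -> {RV P >-> funspace R spin}).
Variables (zeta2 : L2 R) (rho : nat -> R)
  (dg : {RV P >-> nat})
  (pp : nat -> {RV P >-> nat})
  (pp_law : forall i p, PP p -> distribution P (pp i) [set p] = (rho p)%:E)
  (pp_PP : forall i, {ae P, forall w, PP (pp i w)})
  (zetae : nat -> nat -> nat -> {RV P >-> L1 R})
  (zeta : nat -> {RV P >-> L1 R})
  (zeta_law : forall l, has_law (zeta l) zeta2).
Hypothesis indep : mutually_independent P (source_dom PP)
  (source_sigma theta thetac h hc dg pp zetae zeta).
Hypothesis theta_bd :
  forall p, PP p -> {ae P, forall w, forall s : config p, `|theta p w s| <= kap}.

Notation sigma_of := (source_sigma theta thetac h hc dg pp zetae zeta).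

(** This is also the compensating term of the comparison of an edge with its
    cavity fields, which is how the second term of the bound arises. *)
Definition edge_const (p : nat) : R :=
  \sum_(x : theta_code nz p) \sum_(z : {ffun 'I_p -> zcode nx nz})
    theta_prob theta kap x * (\prod_l zeta_prob zeta2 (z l)) *
    edge_value m pt zmass (theta_val kap x) z.

Definition edge_const_mean : R :=
  \sum_(p < K.+1) type_prob PP rho p * ((p%:R - 1) / p%:R * edge_const p).

Definition edge_tree : @tree R dd Omega source :=
  Node (SrcEdgeSize 0) (type_round PP pp K 0) (fun t : option 'I_K.+1 =>
    if t is Some p then
      if `[< PP p >] then
        Node (SrcTheta p) (fun w => fcode_of nz kap (theta p w)) (fun x : theta_code nz p =>
          reads (fun l : 'I_p => SrcZeta l) (fun l w => zcode_of nx nz (zeta l w))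
            (fun z => @Leaf R dd Omega source
               ((p%:R - 1) / p%:R * edge_value m pt zmass (theta_val kap x) z)))
      else @Leaf R dd Omega source 0
    else @Leaf R dd Omega source 0).

Lemma edge_tree_wf : tree_wf (source_dom PP) sigma_of [::] edge_tree.
Proof.
split => // [t|]; first exact: measurable_type_round.
move=> [p|] //; case: asboolP => PPp //; split => //.
- by rewrite inE; apply/eqP.
- by move=> x; exact: (preimage_sigma (theta p) (measurable_fcode _ x)).
move=> x; apply: reads_wf => //.
- by move=> l l' [/val_inj].
- move=> l c; apply: (preimage_sigma (zeta l) (A := zcode_of nx nz @^-1` [set c])).
  exact: measurable_zcode.
- move=> l; rewrite inE negb_or; apply/andP; split; first exact/eqP.
  by rewrite inE; apply/eqP.
Qed.

Lemma edge_tree_mean : tree_mean P edge_tree = edge_const_mean.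
Proof.
rewrite /= sum_option mulr0 add0r; apply: eq_bigr => p _.
rewrite (prob_type_round pp_law).
rewrite /type_prob; case: asboolP => PPp; last by rewrite !mul0r.
congr (_ * _); rewrite /= /edge_const mulr_sumr; apply: eq_bigr => x _.
rewrite (reads_mean _ _ (pr := @zeta_prob R zeta2 nx nz)); last first.
  move=> l c; have := zeta_law l (measurable_zcode c).
  by rewrite /distribution /pushforward /zeta_prob => <-.
rewrite !mulr_sumr; apply: eq_bigr => z _ /=.
by rewrite -/(theta_prob theta kap x); ring.
Qed.

(** For sizes above K the tree has the value 0 and the logarithm is at most m
    kap. *)
Lemma edge_pointwise_ae : {ae P, forall w,
  (((pp 0%N w)%:R - 1) / (pp 0%N w)%:R *
     ln (Eprime (fun l : 'I_(pp 0%N w) => zeta l w) (fun x => edge_weight theta x `^ m)))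
  <= m * (tree_eval edge_tree w + edge_err) +
     m * kap * \1_(type_round PP pp K 0 @^-1` [set None]) w}.
Proof.
have tb : {ae P, forall w, forall p, PP p -> forall c, `|theta p w c| <= kap}.
  apply: ae_foralln => p; have [PPp|nPPp] := pselect (PP p); last by apply: aeW => w.
  by apply: filterS (theta_bd PPp) => w.
have err0 : 0 <= edge_err.
  apply: sumr_ge0 => q _.
  rewrite addr_ge0//; last by rewrite addr_ge0 ?weight_err_ge0// divr_ge0// mulr_ge0// ltW.
  by rewrite mulr_ge0 ?divr_ge0 ?expR_ge0// tv_bound_ge0// divr_ge0.
apply: filterS2 tb (pp_PP 0) => w tw PPw.
have p0 := PP_gt0 PPw.
have c01 : 0 <= (((pp 0%N w)%:R - 1) / (pp 0%N w)%:R : R) <= 1.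
  rewrite divr_ge0 ?subr_ge0 ?ler1n//= ler_pdivrMr ?ltr0n// mul1r.
  by rewrite gerBl.
have [c0 c1] := andP c01.
rewrite indicE; have [ok|bad] := boolP (type_ok PP K (pp 0%N w)); last first.
  rewrite mem_set /= ?mulr1; last by rewrite /type_round (negbTE bad).
  rewrite /type_round (negbTE bad) /= add0r -mulrDr.
  apply: (@le_trans _ _ (((pp 0%N w)%:R - 1) / (pp 0%N w)%:R * (m * kap))).
    by rewrite ler_wpM2l// ln_edge_Eprime_le// => c; exact: tw.
  apply: (@le_trans _ _ (1 * (m * kap))); first by rewrite ler_wpM2r// mulr_ge0// ltW.
  by rewrite mul1r ler_wpM2l ?(ltW m_gt0)// lerDr.
rewrite memNset /= ?mulr0 ?addr0; last by rewrite /type_round ok.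
have [pK _] := andP ok.
have -> : tree_eval (if type_round PP pp K 0 w is Some p then
      if `[< PP p >] then
        Node (SrcTheta p) (fun w => fcode_of nz kap (theta p w)) (fun x : theta_code nz p =>
          reads (fun l : 'I_p => SrcZeta l) (fun l w => zcode_of nx nz (zeta l w))
            (fun z => @Leaf R dd Omega source
               ((p%:R - 1) / p%:R * edge_value m pt zmass (theta_val kap x) z)))
      else @Leaf R dd Omega source 0
    else @Leaf R dd Omega source 0) w =
   ((pp 0%N w)%:R - 1) / (pp 0%N w)%:R * edge_value m pt zmass
     (fcode_fun kap (fcode_of nz kap (theta (pp 0%N w) w)) : config (pp 0%N w) -> R)
     [ffun l : 'I_(pp 0%N w) => zcode_of nx nz (zeta l w)].
  rewrite /type_round ok.
  have PPi : PP (inord (pp 0%N w) : 'I_K.+1) by rewrite inordK.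
  case: asboolP => // _ /=; rewrite reads_eval /=.
  pose val q := (q%:R - 1) / q%:R * edge_value m pt zmass
     (fcode_fun kap (fcode_of nz kap (theta q w)) : config q -> R)
     [ffun l : 'I_q => zcode_of nx nz (zeta l w)].
  by rewrite -/(val _) -/(val (pp 0%N w)) inordK.
set ev := edge_value _ _ _ _ _.
apply: (@le_trans _ _ (((pp 0%N w)%:R - 1) / (pp 0%N w)%:R * (m * (ev + edge_err)))).
  by rewrite ler_wpM2l//; apply: edge_pointwise => // c; exact: tw.
rewrite [leLHS]mulrCA ler_wpM2l ?(ltW m_gt0)// mulrDr lerD2l.
by rewrite -[leRHS]mul1r ler_wpM2r.
Qed.

Variable dbar : R.
Hypotheses (dbar_ge0 : 0 <= dbar) (mean_degree : expectation P (fun w => (dg w)%:R) = dbar%:E).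

Lemma edge_term_le :
  (edge_term theta dg pp zeta m <=
    (dbar * (edge_const_mean + edge_err + kap * no_type_prob PP rho K))%:E)%E.
Proof.
have tm : mean P (tree_eval edge_tree) = tree_mean P edge_tree.
  by apply: (mean_tree _ indep edge_tree_wf) => s A; exact: source_sigma_measurable.
have bt : bounded_meas (tree_eval edge_tree).
  apply: (tree_bounded_meas _ edge_tree_wf) => s A; exact: source_sigma_measurable.
have mN := type_round_meas PP pp (K := K) 0 None.
have bI : bounded_meas (\1_(type_round PP pp K 0 @^-1` [set None]) : Omega -> R).
  by apply: bounded_meas_indic.
have bc : bounded_meas (fun _ : Omega => edge_err) by exact: bounded_meas_cst.
have b0 := bounded_measD bt bc.
have b1 := bounded_measZ m b0.
have b2 := bounded_measZ (m * kap) bI.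
have := expectation_ae_le (bounded_measD b1 b2) edge_pointwise_ae.
rewrite (meanD P b1 b2) (meanZ P _ b0) (meanZ P _ bI) (meanD P bt bc) mean_cst mean_indic//.
rewrite (prob_no_type pp_law) tm edge_tree_mean => hE.
rewrite /edge_term mean_degree -EFinM.
have dm0 : 0 <= dbar * m^-1 by rewrite mulr_ge0// invr_ge0 ltW.
apply: (@le_trans _ _ ((dbar / m)%:E * (m * (edge_const_mean + edge_err) +
    m * kap * no_type_prob PP rho K)%:E)%E); first exact: lee_wpmul2l.
rewrite -EFinM lee_fin le_eqVlt; apply/orP; left; apply/eqP.
have mn0 : m != 0 by rewrite gt_eqF.
by move: edge_const_mean edge_err no_type_prob => u v t; field.
Qed.

End edge_upper_bound.

(** * Series and the degree law *)

Section series.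
Context (R : realType).

Lemma partial_sumE (u : nat -> R) (Q : pred nat) n :
  (\sum_(0 <= k < n | Q k) (u k)%:E = (\sum_(k < n | Q k) u k)%:E)%E.
Proof. by rewrite sumEFin big_mkord. Qed.

Lemma partial_le_series (u : nat -> R) (Q : pred nat) n : (forall k, 0 <= u k) ->
  ((\sum_(k < n | Q k) u k)%:E <= \sum_(0 <= k <oo | Q k) (u k)%:E)%E.
Proof.
move=> u0; rewrite -partial_sumE; apply: nneseries_lim_ge => k _ _.
by rewrite lee_fin.
Qed.

Lemma finite_series (u : nat -> R) (Q : pred nat) n : (forall k, (n <= k)%N -> u k = 0) ->
  (\sum_(0 <= k <oo | Q k) (u k)%:E = (\sum_(k < n | Q k) u k)%:E)%E.
Proof.
move=> u0; rewrite -partial_sumE; apply: lim_near_cst => //.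
exists n => // n' /= nn'; rewrite !partial_sumE; congr EFin.
rewrite (big_ord_widen_cond n' Q u nn') [RHS]big_mkcond [LHS]big_mkcond; apply: eq_bigr => k _.
by case: ltnP => [|nk]; rewrite ?andbT// andbF; case: ifP => // _; exact: u0.
Qed.

Lemma fin_series (u : nat -> R) (Q : pred nat) (s := fine (\sum_(0 <= k <oo | Q k) (u k)%:E)%E) :
  (forall k, 0 <= u k) -> (\sum_(0 <= k <oo | Q k) (u k)%:E < +oo)%E ->
  (forall n, \sum_(k < n | Q k) u k <= s) /\
  (forall eps, 0 < eps -> exists n0, forall n, (n0 <= n)%N -> s - eps <= \sum_(k < n | Q k) u k).
Proof.
move=> u0 fin; have s0 : (0 <= \sum_(0 <= k <oo | Q k) (u k)%:E)%E.
  by apply: nneseries_ge0 => k _ _; rewrite lee_fin.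
have sE : (\sum_(0 <= k <oo | Q k) (u k)%:E = s%:E)%E by rewrite /s fineK// ge0_fin_numE.
split => [n|eps eps0]; first by rewrite -lee_fin -sE; exact: partial_le_series.
have cv : (fun n => \sum_(0 <= k < n | Q k) (u k)%:E)%E @ \oo --> s%:E.
  by rewrite -sE; apply: is_cvg_nneseries => k _ _; rewrite lee_fin.
have {}cv : (fun n => \sum_(k < n | Q k) u k) @ \oo --> s.
  rewrite (_ : (fun n => \sum_(k < n | Q k) u k) =
     fine \o (fun n => \sum_(0 <= k < n | Q k) (u k)%:E)%E); first exact: fine_cvg.
  by apply/funext => n /=; rewrite partial_sumE.
move/cvgrPdist_le : cv => /(_ eps eps0)[n0 _ hn0]; exists n0 => n n0n.
by have := hn0 n n0n; rewrite /= ler_norml => /andP[_]; lra.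
Qed.

Lemma vanishing_series (u : nat -> nat -> R) (Q : pred nat) : (forall N k, 0 <= u N k) ->
  (fun N => \sum_(0 <= k <oo | Q k) (u N k)%:E)%E @ \oo --> 0%E ->
  forall eps, 0 < eps -> exists N0, forall N, (N0 <= N)%N ->
    forall n, \sum_(k < n | Q k) u N k <= eps.
Proof.
move=> u0 /fine_cvgP[[N1 _ fin] /cvgrPdist_le cv] eps eps0.
have [N2 _ h2] := cv eps eps0.
exists (maxn N1 N2) => N; rewrite geq_max => /andP[N1N N2N] n.
have := h2 N N2N; rewrite /= sub0r normrN; apply: le_trans.
apply: (@le_trans _ _ (fine (\sum_(0 <= k <oo | Q k) (u N k)%:E)%E)); last exact: ler_norm.
rewrite -lee_fin fineK; last exact: fin.
exact: partial_le_series.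
Qed.

Lemma nat_measure_series (mu : probability nat R) (A : set nat) :
  (\sum_(0 <= k <oo | k \in A) mu [set k] = mu A)%E.
Proof.
have AE : A = \bigcup_k (if k \in A then [set k] else set0).
  apply/seteqP; split => k /=.
  - by move=> Ak; exists k => //; rewrite mem_set.
  - by move=> [i _]; case: ifPn => // /set_mem Ai ->.
rewrite [in RHS]AE measure_bigcup//; last first.
  move=> i j _ _ [k []]; case: ifP => // _ ->; by case: ifP => // _ ->.
rewrite eseries_mkcond [RHS]eseries_mkcond; apply: eq_eseriesr => k _.
by rewrite in_setT; case: ifP => // _; rewrite measure0.
Qed.

Lemma fine_measure (mu : probability nat R) k : (fine (mu [set k]))%:E = mu [set k].
Proof. by rewrite fineK// fin_num_measure. Qed.

End series.

Section mean_degree.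
Context (R : realType) (dd : measure_display) (Omega : measurableType dd)
  (P : probability Omega R) (mu : probability nat R) (dg : {RV P >-> nat}).
Hypothesis dg_law : has_law dg mu.
Hypothesis mu_second_moment : (\sum_(0 <= n <oo) (n ^ 2)%N%:R%:E * mu [set n] < +oo)%E.

Notation w k := (fine (mu [set k])).

Let truncated n (x : Omega) : R := (dg x)%:R * (dg x <= n)%N%:R.

Lemma mean_truncated n :
  bounded_meas (truncated n) /\ mean P (truncated n) = \sum_(k < n.+1) k%:R * w (k : nat).
Proof.
have mk (k : nat) : measurable (dg @^-1` [set k]).
  by rewrite -[_ @^-1` _]setTI; exact: measurable_funPT.
have E : truncated n = fun x => \sum_(k < n.+1) k%:R * \1_(dg @^-1` [set (k : nat)]) x.
  apply/funext => x; rewrite /truncated; case: leqP => dn; rewrite ?mulr1 ?mulr0.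
    have dn' : (dg x < n.+1)%N by [].
    rewrite (bigD1 (Ordinal dn'))//= big1 ?addr0 ?indicE ?mem_set ?mulr1// => k kd.
    rewrite indicE memNset ?mulr0//= => dk; move/eqP: kd; apply; exact: val_inj.
  apply/esym/big1 => k _; rewrite indicE memNset ?mulr0//= => dk.
  by have := ltn_ord k; rewrite -dk ltnS leqNgt dn.
have bk (k : 'I_n.+1) : bounded_meas (fun x => k%:R * \1_(dg @^-1` [set (k : nat)]) x : R).
  by apply: bounded_measZ; exact: bounded_meas_indic.
rewrite E; split; first exact: bounded_meas_sum.
rewrite mean_sum//; apply: eq_bigr => k _; rewrite meanZ; last exact: bounded_meas_indic.
by rewrite mean_indic//; congr (_ * fine _); exact: (dg_law (A := [set (k : nat)])).
Qed.

(** Monotone convergence for the degree truncated at n, whose mean is a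
    partial sum of the series. *)
Lemma mean_degree_tail : exists dbar, [/\ 0 <= dbar, expectation P (fun x => (dg x)%:R) = dbar%:E,
  (forall n, \int[P]_x ((dg x)%:R * (n < dg x)%N%:R)%:E =
    (dbar - \sum_(k < n.+1) k%:R * w (k : nat))%:E)%E,
  (forall n, \sum_(k < n) k%:R * w (k : nat) <= dbar) &
  (forall eps, 0 < eps -> exists n0, forall n, (n0 <= n)%N ->
     dbar - eps <= \sum_(k < n) k%:R * w (k : nat))].
Proof.
pose u k := k%:R * w k.
have u0 k : 0 <= u k by rewrite mulr_ge0// fine_ge0.
have fin : (\sum_(0 <= k <oo) (u k)%:E < +oo)%E.
  apply: le_lt_trans mu_second_moment; apply: lee_nneseries => k _; first by rewrite lee_fin.
  rewrite /u EFinM fine_measure lee_wpmul2r// lee_fin ler_nat.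
  by case: k => // k; rewrite -[leqLHS]expn1 leq_pexp2l.
have [le_s cv_s] := fin_series u0 fin.
set dbar := fine _ in le_s cv_s.
have dbar0 : 0 <= dbar by have := le_s 0%N; rewrite big_ord0.
have mdg : measurable_fun [set: Omega] (fun x => (dg x)%:R : R).
  by apply: (measurableT_comp (f := fun d : nat => d%:R : R)).
have mtr n : measurable_fun [set: Omega] (truncated n) by have [[]] := mean_truncated n.
have mta n : measurable_fun [set: Omega] (fun x => (dg x)%:R * (n < dg x)%N%:R : R).
  by apply: (measurableT_comp (f := fun d : nat => d%:R * (n < d)%N%:R : R)).
have itr n : (\int[P]_x (truncated n x)%:E = (\sum_(k < n.+1) u k)%:E)%E.
  by have [b <-] := mean_truncated n; rewrite mean_EFin.
have idg : (\int[P]_x ((dg x)%:R)%:E = dbar%:E)%E.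
  have cv : (fun n => \int[P]_x (truncated n x)%:E)%E @ \oo --> (\int[P]_x ((dg x)%:R)%:E)%E.
    have -> : (\int[P]_x ((dg x)%:R)%:E = \int[P]_x (limn (fun n => (truncated n x)%:E)))%E.
      apply: eq_integral => x _; apply/esym/lim_near_cst => //; exists (dg x) => // n /= dn.
      by rewrite /truncated dn mulr1.
    apply: cvg_monotone_convergence => //.
    - by move=> n; exact/measurable_EFinP.
    - by move=> n x _; rewrite lee_fin mulr_ge0.
    - move=> x _ a b ab; rewrite lee_fin ler_wpM2l// ler_nat.
      by case: (leqP (dg x) a) => // /leq_trans -> .
  apply: (cvg_unique _ cv) => //.
  rewrite (_ : (fun n => \int[P]_x (truncated n x)%:E)%E = fun n => (\sum_(k < n.+1) u k)%:E);
    last exact/funext.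
  apply: cvg_EFin; first by apply: nearW.
  apply/cvgrPdist_le => eps eps0 /=; have [n0 hn0] := cv_s eps eps0.
  exists n0 => // n /= n0n; have := hn0 n.+1 (leqW n0n); have := le_s n.+1.
  by move=> h1 h2; rewrite ger0_norm; lra.
exists dbar; split => //.
- by rewrite expectation.unlock.
- move=> n; have : (\int[P]_x ((dg x)%:R)%:E = \int[P]_x (truncated n x)%:E +
      \int[P]_x ((dg x)%:R * (n < dg x)%N%:R)%:E)%E.
    rewrite -ge0_integralD//.
    - by apply: eq_integral => x _; rewrite -EFinD /truncated -mulrDr; case: leqP => _;
        rewrite ?addr0 ?add0r mulr1.
    - by move=> x _; rewrite lee_fin mulr_ge0.
    - exact/measurable_EFinP.
    - exact/measurable_EFinP.
  rewrite idg itr EFinB => ->; by rewrite addeAC subee// add0e.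
Qed.

End mean_degree.

(** * The bound at finite size *)

Section finite_size.
Context (R : realType) (dd : measure_display) (Omega : measurableType dd)
  (P : probability Omega R).
Variables (PP : set nat) (PP_ge2 : forall p, PP p -> (2 <= p)%N)
  (theta : forall p : nat, {RV P >-> funspace R (config p)})
  (thetac : forall p : nat, nat -> {RV P >-> funspace R (config p)})
  (thetac_law : forall p i, PP p -> same_law (thetac p i) (theta p))
  (h : {RV P >-> funspace R spin})
  (hc : nat -> {RV P >-> funspace R spin})
  (hc_law : forall i, same_law (hc i) h)
  (f : nat -> {RV P >-> funspace R spin})
  (fc : forall p : nat, 'I_p -> {RV P >-> funspace R spin})
  (a b : nat -> {RV P >-> measurableTypeR R})
  (fc_law : forall p (j : 'I_p), PP p -> same_law (fc j) (f p))
  (fab_indep : forall p, PP p ->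
    mutually_independent P [set: option 'I_p] (fun o =>
      if o is Some j then g_sigma_algebra_preimage (fc j)
      else g_sigma_algebra_preimage (fun w => (a p w, b p w))))
  (theta_fact : forall p, PP p -> {ae P, forall w, forall sigma : config p,
    expR (theta p w sigma)
      = a p w * (1 + b p w * \prod_(j < p) fc j w (sigma j)) /\
    `|b p w * \prod_(j < p) fc j w (sigma j)| < 1})
  (b_moments : forall p n, PP p -> (1 <= n)%N ->
    (0 <= 'E_P[fun w => ((- b p w) ^+ n)%R])%E)
  (even_or_nonneg : forall p, PP p ->
    ~~ odd p \/ {ae P, forall w, forall s : spin, 0 <= f p w s}).
Variables (kap : R) (kap_gt0 : 0 < kap)
  (theta_bd : forall p, PP p ->
    {ae P, forall w, forall sigma : config p, `|theta p w sigma| <= kap})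
  (h_bd : {ae P, forall w, forall s : spin, `|h w s| <= kap}).
Variables (m : R) (m_gt0 : 0 < m) (m_lt1 : m < 1) (zeta2 : L2 R)
  (dg : {RV P >-> nat}) (pp : nat -> {RV P >-> nat})
  (zetae : nat -> nat -> nat -> {RV P >-> L1 R})
  (zeta : nat -> {RV P >-> L1 R})
  (indep : mutually_independent P (source_dom PP)
     (source_sigma theta thetac h hc dg pp zetae zeta)).
Variables (q rho : nat -> R).
Hypotheses (q_ge0 : forall p, 0 <= q p) (rho_q : forall p, rho p = p%:R * q p)
  (rho_le1 : forall K, \sum_(p < K.+1) type_prob PP rho p <= 1).
Variables (nx nz K : nat).
Hypotheses (nx_gt0 : (0 < nx)%N) (nz_gt0 : (0 < nz)%N) (K_gt0 : (0 < K)%N).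

Notation pt := (@cell_pt R nx).
Notation zmass := (@zcode_mass R nx nz).
Notation Y := (field_type nx nz K).
Notation pY := (@field_type_prob R dd Omega P PP theta zeta2 rho kap nx nz K).
Notation mk := (@field_of_type R kap nx nz K).
Notation pI := (@theta_prob R dd Omega P theta kap nz).
Notation th := (@theta_val R kap nz).
Notation pZ := (@zeta_prob R zeta2 nx nz).
Notation c := (edge_const m kap nx nz theta zeta2).
Notation V := (vertex_value PP theta h zeta2 rho m kap nx nz K).

Definition edge_types : seq nat := [seq p <- iota 0 K.+1 | `[< PP p >]].

Lemma mem_edge_types p : p \in edge_types -> PP p /\ (p <= K)%N.
Proof. by rewrite mem_filter mem_iota => /andP[/asboolP ? /andP[_]]; rewrite add0n ltnS. Qed.

Lemma sum_edge_types (F : nat -> R) : \sum_(p <- edge_types) F p =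
  \sum_(p < K.+1) if `[< PP p >] then F p else 0.
Proof.
rewrite /edge_types big_filter -[iota _ _]/(index_iota 0 K.+1) big_mkord big_mkcond.
by [].
Qed.

Lemma theta_prob_ge0 p (x : theta_code nz p) : 0 <= pI x.
Proof. exact: fine_ge0. Qed.

Lemma theta_prob_sum p : \sum_(x : theta_code nz p) pI x = 1.
Proof.
apply: (@sum_cells R dd Omega P _ (fun w => fcode_of nz kap (theta p w))) => x.
have := measurable_funPT (theta p) measurableT (fcode_of nz kap @^-1` [set x]) (measurable_fcode kap x).
by rewrite setTI.
Qed.

Lemma zeta_prob_ge0 z : 0 <= pZ z.
Proof. exact: fine_ge0. Qed.

Lemma zeta_prob_sum : \sum_z pZ z = 1.
Proof. by apply: (@sum_cells R _ _ zeta2 _ (@zcode_of R nx nz)) => z; exact: measurable_zcode. Qed.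

Lemma no_type_prob_ge0 : 0 <= no_type_prob PP rho K.
Proof. by rewrite subr_ge0. Qed.

(** A field is of type p with probability rho p = p q(p), and then has the law
    of the field of a p-edge. *)
Lemma fields_by_type (F : ens R bool -> R) :
  \sum_y pY y * F (mk y) =
  \sum_(p <- edge_types) p%:R * q p *
    \sum_(y : (theta_code nz p * {ffun 'I_p.-1 -> zcode nx nz})%type)
      (pI y.1 * \prod_l pZ (y.2 l)) * F (cavity_field pt zmass (th y.1) y.2) +
  (1 - \sum_(p <- edge_types) p%:R * q p) * F (trivial_ens R bool).
Proof.
rewrite sum_option addrC; congr (_ + _).
  rewrite (sum_tagged (fun u => pY (Some u) * F (mk (Some u)))) sum_edge_types.
  apply: eq_bigr => p _; rewrite /type_prob /=; case: asboolP => PPp.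
    rewrite mulr_sumr; apply: eq_bigr => y _.
    by rewrite /field_type_prob /= /type_prob asboolT// rho_q !mulrA.
  by apply: big1 => y _; rewrite /field_type_prob /= /type_prob asboolF// !mul0r.
congr (_ * _); rewrite /= /no_type_prob sum_edge_types; congr (_ - _).
by apply: eq_bigr => p _; rewrite /type_prob rho_q.
Qed.

Lemma sum_prod_zeta n : \sum_(z : {ffun 'I_n -> zcode nx nz}) \prod_l pZ (z l) = 1.
Proof. by rewrite -(bigA_distr_bigA (fun _ : 'I_n => pZ)) big1// => _ _; exact: zeta_prob_sum. Qed.

Lemma field_type_prob_ge0 y : 0 <= pY y.
Proof.
case: y => [u|]; last exact: no_type_prob_ge0.
rewrite /field_type_prob mulr_ge0//; first by rewrite /type_prob; case: ifP => // _; rewrite rho_q mulr_ge0.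
by rewrite mulr_ge0 ?theta_prob_ge0// prodr_ge0// => l _; exact: zeta_prob_ge0.
Qed.

Lemma field_type_prob_sum : \sum_y pY y = 1.
Proof.
have := fields_by_type (fun=> 1); under eq_bigr do rewrite mulr1; move=> ->.
rewrite mulr1 (eq_bigr (fun p => p%:R * q p)) => [|p _]; first by rewrite addrC subrK.
under eq_bigr do rewrite mulr1.
rewrite (sum_pair (fun y : theta_code nz p * {ffun 'I_p.-1 -> zcode nx nz} =>
  pI y.1 * \prod_l pZ (y.2 l))) /=.
under eq_bigr => x _ do rewrite -mulr_sumr sum_prod_zeta mulr1.
by rewrite theta_prob_sum mulr1.
Qed.

Lemma theta_val_bd p (x : theta_code nz p) e : `|th x e| <= kap.
Proof. exact: fcode_fun_bd. Qed.

Lemma field_of_type_bounded y : bounded_field kap (mk y).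
Proof.
case: y => [u|] /=.
  apply: (@weighted_field_bounded R kap (cell nx) pt (tag u)) => [e|l g|l].
  - exact: theta_val_bd.
  - exact: zcode_mass_ge0.
  - exact: zcode_mass_sum.
split; first exact: pos_ens_trivial.
move=> x; rewrite inE => /eqP -> s /=.
by rewrite -expR0 !ler_expR oppr_le0 ltW.
Qed.

Lemma field_of_type_pos y : pos_ens (mk y).
Proof. by have [] := field_of_type_bounded y. Qed.

Lemma edge_value_bd p (x : theta_code nz p) z : `|edge_value m pt zmass (th x) z| <= kap.
Proof.
have gb (g : {ffun 'I_p -> cell nx}) : expR (- (m * kap)) <=
    gibbs_avg (exp_theta (th x)) (fun l => pt (g l)) `^ m <= expR (m * kap).
  by apply: (powR_bd m_gt0); apply: gibbs_avg_bd => e; exact: theta_val_bd.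
have p0 (g : {ffun 'I_p -> cell nx}) : 0 <= \prod_l zmass (z l) (g l).
  by apply: prodr_ge0 => l _; exact: zcode_mass_ge0.
have p1 : \sum_(g : {ffun 'I_p -> cell nx}) \prod_l zmass (z l) (g l) = 1.
  by rewrite -(bigA_distr_bigA (fun l => zmass (z l))) big1// => l _; exact: zcode_mass_sum.
have /andP[lo up] := avg_between p0 p1 gb; rewrite /edge_value.
set S := \sum_g _ in lo up *.
have S0 : 0 < S by apply: lt_le_trans lo; exact: expR_gt0.
rewrite -ler_ln ?posrE ?expR_gt0// expRK in lo; rewrite -ler_ln ?posrE ?expR_gt0// expRK in up.
rewrite ler_norml ler_pdivlMl// ler_pdivrMl// mulrN lo; exact: up.
Qed.

Lemma edge_const_bd p : `|c p| <= kap.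
Proof.
rewrite /edge_const; apply: (le_trans (ler_norm_sum _ _ _)).
apply: (@le_trans _ _ (\sum_(x : theta_code nz p) pI x * kap)); last first.
  by rewrite -mulr_suml theta_prob_sum mul1r.
apply: ler_sum => x _; apply: (le_trans (ler_norm_sum _ _ _)).
apply: (@le_trans _ _ (\sum_(z : {ffun 'I_p -> zcode nx nz}) pI x * (\prod_l pZ (z l)) * kap)).
  apply: ler_sum => z _.
  have w0 : 0 <= pI x * \prod_l pZ (z l).
    by rewrite mulr_ge0 ?theta_prob_ge0// prodr_ge0// => l _; exact: zeta_prob_ge0.
  by rewrite normrM (ger0_norm w0) ler_wpM2l// edge_value_bd.
by rewrite -mulr_suml -mulr_sumr sum_prod_zeta mulr1.
Qed.

Definition edge_step_err : R := 2 * K%:R * (2 * kap / nz%:R).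

Lemma round_step_ge0 : 0 <= 2 * kap / nz%:R.
Proof. by rewrite divr_ge0// mulr_ge0// ltW. Qed.

Lemma edge_step_err_ge0 : 0 <= edge_step_err.
Proof. by rewrite mulr_ge0// round_step_ge0. Qed.

Section one_size.
Variables (T H : finType) (t0 : T) (sp : H -> T -> bool).

Lemma coded_edge_vs_fields p (e : ens R T) (U : {set H}) :
  p \in edge_types -> pos_ens e -> (#|U| < #|H|)%N ->
  iid p (fun vs => \sum_(x : theta_code nz p) pI x *
      ens_val m (addfac e (edge_factor sp th x vs))) U
    - ens_val m e
  - p%:R * (pick_mean U (fun v =>
      \sum_(y : (theta_code nz p * {ffun 'I_p.-1 -> zcode nx nz})%type)
        (pI y.1 * \prod_l pZ (y.2 l)) *
        ens_val m (addfield e (cavity_field pt zmass (th y.1) y.2) (sp v)))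
    - ens_val m e) + (p%:R - 1) * c p <= edge_step_err.
Proof.
move=> /mem_edge_types[PPp pK] epos UH.
have p0 : (0 < p)%N by apply: leq_trans (PP_ge2 PPp).
apply: (@edge_vs_cavity_fields R m m_gt0 (cell nx) (zcode nx nz) pt zmass pZ _ _ _ T H t0
  sp (theta_code nz) (fun p => pI (p := p)) (fun p => th (p := p)) p U e edge_step_err) => //.
- by move=> *; exact: zcode_mass_ge0.
- by move=> *; exact: zcode_mass_sum.
- exact: zeta_prob_sum.
- exact: theta_prob_sum.
move=> e' e'1 e'0 e'pos e'prob.
apply: (@le_trans _ _ (2 * p%:R * (m * (2 * kap / nz%:R)))); last first.
  rewrite /edge_step_err mulrCA ler_wpM2l ?(ltW m_gt0)// ler_wpM2r ?round_step_ge0//.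
  by rewrite ler_wpM2l// ler_nat.
apply: (@edge_step R dd Omega P m m_gt0 m_lt1 p p0 T H (zcode nx nz) (cell nx) sp zmass pt _ _
  (pick_weight R U) pZ _ _ _ _ e' e'1 e'0 e'pos e'prob (theta p) (fc (p := p)) (f p) (a p) (b p)
  _ _ _ _ _ kap kap_gt0 _ (theta_code nz p) (fun w => fcode_of nz kap (theta p w))
  (fun x => exp_theta (th x)) (2 * kap / nz%:R)).
- by move=> *; exact: zcode_mass_ge0.
- by move=> *; exact: zcode_mass_sum.
- by move=> j; exact: pick_weight_ge0.
- exact: sum_pick_weight.
- exact: zeta_prob_ge0.
- exact: zeta_prob_sum.
- by move=> j; exact: fc_law.
- exact: fab_indep.
- exact: theta_fact.
- by move=> n; exact: b_moments.
- exact: even_or_nonneg.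
- exact: theta_bd.
- move=> x; have := measurable_funPT (theta p) measurableT (fcode_of nz kap @^-1` [set x])
    (measurable_fcode kap x).
  by rewrite setTI.
- by move=> x e0; exact: expR_gt0.
apply: filterS (theta_bd PPp) => w tw e0; rewrite /exp_theta -!expRD !ler_expR.
have := fcode_close nz_gt0 kap_gt0 e0 tw; rewrite ler_norml /theta_val => /andP[].
by lra.
Qed.

End one_size.

Lemma edge_correction_mean : edge_correction edge_types q c =
  edge_const_mean m kap nx nz K PP theta zeta2 rho.
Proof.
rewrite /edge_correction /edge_const_mean sum_edge_types; apply: eq_bigr => p _.
rewrite /type_prob; case: asboolP => PPp; last by rewrite mul0r.
have p0 : p%:R != 0 :> R by rewrite pnatr_eq0 -lt0n; apply: leq_trans (PP_ge2 PPp).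
by rewrite rho_q; field.
Qed.

Lemma vertex_value0_bd k : `|V k - V 0| <= k%:R * kap.
Proof.
rewrite /vertex_value -sumrB; apply: (le_trans (ler_norm_sum _ _ _)).
apply: (@le_trans _ _ (\sum_x field_prob h kap (nz := nz) x * (k%:R * kap))); last first.
  by rewrite -mulr_suml field_prob_sum mul1r.
apply: ler_sum => x _; rewrite -mulrBr normrM ger0_norm ?field_prob_ge0// ler_wpM2l ?field_prob_ge0//.
apply: (field_mean_bd m_gt0 field_type_prob_sum field_of_type_pos field_type_prob_ge0
  field_of_type_bounded).
by apply: pos_ens1 => s; exact: expR_gt0.
Qed.

Variables (N : nat) (deg : 'I_N -> nat) (E : nat -> nat).
Hypotheses (E_dom : forall p, ~ PP p -> E p = 0%N)
  (edge_count : (\sum_(p < (total_degree deg).+1) p * E p)%N = total_degree deg).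
Notation EDGE := {p : 'I_(total_degree deg).+1 & 'I_(E p)}.
Notation H := {i : 'I_N & 'I_(deg i)}.
Notation D := (total_degree deg).
Notation T := (config N).

Definition edge_sizes : seq nat := [seq edge_size e | e <- enum {: EDGE}].

Lemma card_half_edges : #|{: H}| = D.
Proof. by rewrite card_tagged sumnE big_map big_enum /=; apply: eq_bigr => i _; rewrite card_ord. Qed.

Lemma sum_edges (F : nat -> nat) : (\sum_(e : EDGE) F (edge_size e))%N = (\sum_(p < D.+1) F p * E p)%N.
Proof.
apply/esym; transitivity (\sum_(p < D.+1) \sum_(j < E p) F p)%N.
  by apply: eq_bigr => p _; rewrite sum_nat_const card_ord mulnC.
by rewrite (sig_big_dep _ (fun _ _ => true) (fun (p : 'I_D.+1) (_ : 'I_(E p)) => F p)).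
Qed.

Lemma sumn_edge_sizes : sumn edge_sizes = #|{: H}|.
Proof. by rewrite sumnE big_map big_enum /= (sum_edges id) edge_count card_half_edges. Qed.

Lemma card_edge_half_edges : #|{: {e : EDGE & 'I_(edge_size e)}}| = #|{: H}|.
Proof.
rewrite card_tagged -sumn_edge_sizes !sumnE !big_map; apply: eq_bigr => e _; exact: card_ord.
Qed.

Lemma count_edge_sizes (Q : pred nat) : count Q edge_sizes = (\sum_(p < D.+1) Q p * E p)%N.
Proof. by rewrite /edge_sizes count_map -sum1_count big_mkcond big_enum /= (sum_edges (fun p => Q p : nat)). Qed.

Lemma edge_sizes_gt0 p : p \in edge_sizes -> (0 < p)%N.
Proof. by move=> /mapP[e _ ->]; apply: leq_trans (PP_ge2 (edge_PP E_dom e)). Qed.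

Lemma size_edge_sizes : (size edge_sizes <= D)%N.
Proof.
rewrite -card_half_edges -sumn_edge_sizes; apply: size_le_sumn; exact: edge_sizes_gt0.
Qed.

Notation only_edges := (objects_op (@vertex_spin N deg) pY mk (I := theta_code nz)
  (fun p => pI (p := p)) (fun p => th (p := p)) 0 edge_sizes (@Phi R m _ T)).
Notation only_fields := (objects_op (@vertex_spin N deg) pY mk (I := theta_code nz)
  (fun p => pI (p := p)) (fun p => th (p := p)) #|{: H}| [::] (@Phi R m _ T)).

Lemma fields_mean_addC l acc (F : ('I_N -> field_code nz) -> R) k :
  fields_mean h kap l acc (fun hh => F hh + k) = fields_mean h kap l acc F + k.
Proof.
elim: l acc => [//|i l IH] acc /=; under eq_bigr do rewrite IH mulrDr.
by rewrite big_split /= -mulr_suml field_prob_sum mul1r.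
Qed.

(** A comparison of the two saturations for every initial system becomes one
    of the free energy with the mean over the vertices, after averaging over
    the external fields. *)
Lemma free_energy_comparison k :
  (forall e0, pos_ens e0 -> only_edges e0 finset.set0 <= only_fields e0 finset.set0 + k) ->
  (free_energy deg E thetac hc <=
    (N%:R^-1 * (\sum_i V (deg i) + k + round_err kap nz deg E))%:E)%E.
Proof.
move=> comp; have acc : 'I_N -> field_code nz by move=> _; exact: (fcode_of nz kap (fun=> 0)).
apply: (le_trans (free_energy_le thetac_law hc_law indep kap_gt0 theta_bd h_bd nz_gt0 deg E_dom acc)).
rewrite lee_fin ler_wpM2l ?invr_ge0// lerD2r.
apply: (@le_trans _ _ (fields_mean h kap (enum 'I_N) acc (fun hh =>
   \sum_(i <- enum 'I_N) field_mean m pY mk (deg i) (vertex_start kap (hh i)) + k))).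
  apply: fields_mean_le => hh.
  rewrite -(edges_only _ _ m_gt0 _ card_edge_half_edges) -/edge_sizes.
  have e0pos : pos_ens [:: (1, field_weights kap hh)].
    by apply: pos_ens1 => s; rewrite prodr_gt0// => i _; exact: expR_gt0.
  apply: (le_trans (comp _ e0pos)); rewrite lerD2r le_eqVlt; apply/orP; left; apply/eqP.
  rewrite [LHS](fields_only m deg field_type_prob_sum field_of_type_pos (fun i => field_val kap (hh i))).
  by rewrite big_enum.
rewrite fields_mean_addC lerD2r (fields_mean_local h kap (enum 'I_N) acc (enum 'I_N)
  (fun i x => field_mean m pY mk (deg i) (vertex_start kap x))) big_enum /=.
by apply: ler_sum => i _; rewrite mem_enum.
Qed.

Notation C := (edge_correction edge_types q c).

Lemma edge_types_le1 : \sum_(p <- edge_types) p%:R * q p <= 1.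
Proof.
apply: le_trans (rho_le1 K); rewrite sum_edge_types; apply: ler_sum => p _.
by rewrite /type_prob rho_q.
Qed.

Lemma edge_types_K p : p \in edge_types -> (0 < p <= K)%N.
Proof. by move=> /mem_edge_types[/PP_ge2 p2 ->]; rewrite andbT; apply: leq_trans p2. Qed.

(** Every edge and every field costs at most kap, and there are at most as
    many of them as half-edges; this is used for graphs with few of them. *)
Lemma free_energy_trivial : (free_energy deg E thetac hc <=
  (N%:R^-1 * (\sum_i V (deg i) + (3 * D%:R * kap - D%:R * C) + round_err kap nz deg E))%:E)%E.
Proof.
apply: free_energy_comparison => e0 e0pos.
have t0 : T := [ffun=> true].
have sH : (0 + 0 + sumn edge_sizes <= #|{: H}|)%N by rewrite !add0n sumn_edge_sizes.
have fH : (0 + #|{: H}| + sumn [::] <= #|{: H}|)%N by rewrite add0n addn0.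
have [e1 _] := le_at_objects_Phi m_gt0 t0 (@vertex_spin N deg) field_type_prob_ge0
  field_type_prob_sum field_of_type_bounded theta_prob_ge0 theta_prob_sum theta_val_bd sH.
have [_ e2] := le_at_objects_Phi m_gt0 t0 (@vertex_spin N deg) field_type_prob_ge0
  field_type_prob_sum field_of_type_bounded theta_prob_ge0 theta_prob_sum theta_val_bd fH.
have {}e1 := e1 e0 finset.set0 e0pos (cards0 _).
have {}e2 := e2 e0 finset.set0 e0pos (cards0 _).
have cb : C <= kap.
  apply: (le_trans (ler_norm _)).
  apply: edge_correction_bd edge_types_K q_ge0 edge_types_le1 _; first exact: ltW.
  by move=> p _; exact: edge_const_bd.
have s1 : (0 + size edge_sizes)%:R * kap <= D%:R * kap.
  by rewrite add0n ler_wpM2r ?(ltW kap_gt0)// ler_nat size_edge_sizes.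
rewrite addn0 card_half_edges in e2.
have := ler_wpM2l (ler0n R D) cb; rewrite card_half_edges -(mulrA 3).
move: e1 e2 s1; move: (objects_op _ _ _ _ _ _ _ _ _ _) => x.
move: (objects_op _ _ _ _ _ _ _ _ _ _) (Phi _ _ _) => y z.
by move: (D%:R * kap) ((0 + size edge_sizes)%:R * kap) (D%:R * C) => u v t; lra.
Qed.

Lemma free_energy_interpolation (M n0 : nat) (delta lam : R) :
  0 < delta -> (K <= n0)%N -> (0 < n0)%N -> (M + n0 <= D)%N -> 0 <= lam ->
  3 * D%:R <= lam * (D - M - n0)%:R / K%:R - (size edge_types)%:R * (lam ^+ 2 * delta / 2) ->
  (free_energy deg E thetac hc <=
   (N%:R^-1 * (\sum_i V (deg i) +
      (- (D%:R * C) + M%:R * step_err kap K edge_step_err n0 + 2 * kap * (D - M)%:R +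
       kap * (count_err edge_sizes edge_types q M + (size edge_types)%:R * (delta / 2)
              + M%:R / (2 * delta))) + round_err kap nz deg E))%:E)%E.
Proof.
move=> d0 Kn0 n00 MD lam0 gap; apply: free_energy_comparison => e0 e0pos.
have t0 : T := [ffun=> true].
have := @interpolation_bound R m kap m_gt0 (ltW kap_gt0) _ T t0 (@vertex_spin N deg) _ _ _
  field_type_prob_ge0 field_type_prob_sum field_of_type_bounded (theta_code nz)
  (fun p => pI (p := p)) (fun p => th (p := p)) theta_prob_ge0 theta_prob_sum theta_val_bd
  e0 edge_sizes edge_types K q c e0pos sumn_edge_sizes edge_sizes_gt0 (filter_uniq _ (iota_uniq _ _))
  edge_types_K q_ge0 edge_types_le1 (fun p _ => edge_const_bd p) _ _ _ edge_step_err fields_by_type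
  (fun p e U => @coded_edge_vs_fields _ _ t0 _ p e U) edge_step_err_ge0 M n0 delta lam d0 Kn0 n00.
rewrite card_half_edges => /(_ MD lam0 K_gt0 gap).
by rewrite -!addrA.
Qed.

End finite_size.

(** * Choice of the parameters, degree averages *)

Section rounding_parameters.
Context (R : realType).

Lemma small_inv (c e : R) : 0 < e ->
  exists n0, (0 < n0)%N /\ forall n, (n0 <= n)%N -> c / n%:R <= e.
Proof.
move=> e0; exists (Num.truncn (c / e)).+1; split => // n n0n.
have n0 : 0 < n%:R :> R by rewrite ltr0n; apply: leq_trans n0n.
rewrite ler_pdivrMr// mulrC -ler_pdivrMr//.
have := @Num.Theory.truncnS_gt R (c / e); move/ltW/le_trans; apply.
by rewrite ler_nat.
Qed.

Variables (m kap : R).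
Hypotheses (m_gt0 : 0 < m) (kap_gt0 : 0 < kap).

Lemma avg_err_scale k (n : nat) : avg_err kap k (2 / n%:R) = avg_err kap k 2 / n%:R.
Proof. by rewrite /avg_err /tv_bound !mulrA. Qed.

Lemma weight_err_scale (G : finType) k (n : nat) :
  weight_err kap m G k (2 / n%:R) = weight_err kap m G k 2 / n%:R.
Proof. by rewrite /weight_err /tv_bound !mulrA. Qed.

(** nx is chosen first, because the errors due to nz depend on the number of
    cells. *)
Lemma fine_rounding K e : 0 < e -> exists nx nz,
  [/\ (0 < nx)%N, (0 < nz)%N, vertex_err m kap nx nz K <= e, edge_err m kap nx nz K <= e &
      2 * kap / nz%:R <= e /\ edge_step_err kap nz K <= e].
Proof.
move=> e0; have e20 : 0 < e / 2 by rewrite divr_gt0.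
have A0 k : 0 <= avg_err kap k 2 by rewrite mulr_ge0 ?divr_ge0 ?expR_ge0// tv_bound_ge0.
pose cx := \sum_(p < K.+1) avg_err kap p.-1 2 + \sum_(p < K.+1) avg_err kap p 2.
have [nx [nx0 /(_ nx (leqnn _)) hx]] := small_inv cx e20.
have W0 k : 0 <= weight_err kap m (cell nx) k 2.
  by rewrite mulr_ge0 ?invr_ge0 ?(ltW m_gt0)// mulr_ge0 ?divr_ge0 ?expR_ge0// tv_bound_ge0.
pose wv := \sum_(p < K.+1) weight_err kap m (cell nx) p.-1 2.
pose we := \sum_(p < K.+1) weight_err kap m (cell nx) p 2.
pose cz := 2 * kap + wv + (K.+1%:R * (2 * kap) + we) + 2 * K%:R * (2 * kap).
have [nz [nz0 /(_ nz (leqnn _)) hz]] := small_inv cz e20.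
exists nx, nz; split => //.
- rewrite /vertex_err /cell_err /code_err.
  under eq_bigr do rewrite avg_err_scale; rewrite -mulr_suml.
  under [X in _ + (_ + X)]eq_bigr do rewrite weight_err_scale; rewrite -mulr_suml -mulrDl.
  rewrite [e]splitr; apply: lerD.
    apply: le_trans hx; rewrite ler_wpM2r ?invr_ge0// lerDl; exact: sumr_ge0.
  apply: le_trans hz; rewrite ler_wpM2r ?invr_ge0// /cz -/wv -addrA lerDl.
  by rewrite !addr_ge0// ?mulr_ge0 ?(ltW kap_gt0)// ?sumr_ge0.
- have -> : edge_err m kap nx nz K = (\sum_(p < K.+1) avg_err kap p 2) / nx%:R +
      (K.+1%:R * (2 * kap) + we) / nz%:R.
    rewrite /edge_err !big_split /= [X in _ = _ + X]mulrDl; congr (_ + (_ + _)).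
    - by rewrite mulr_suml; apply: eq_bigr => p _; exact: avg_err_scale.
    - by rewrite sumr_const card_ord -[_ *+ K.+1]mulr_natl mulrA.
    - by rewrite mulr_suml; apply: eq_bigr => p _; exact: weight_err_scale.
  rewrite [e]splitr; apply: lerD.
    apply: le_trans hx; rewrite ler_wpM2r ?invr_ge0// lerDr; exact: sumr_ge0.
  apply: le_trans hz; rewrite ler_wpM2r ?invr_ge0// /cz -/we.
  have : 0 <= 2 * kap + wv + 2 * K%:R * (2 * kap).
    by rewrite !addr_ge0// ?mulr_ge0 ?(ltW kap_gt0)// ?sumr_ge0.
  by move: (2 * K%:R * _) (K.+1%:R * _) => u v; lra.
- have wv0 : 0 <= wv by exact: sumr_ge0.
  have we0 : 0 <= we by exact: sumr_ge0.
  have k0 : 0 <= 2 * kap by rewrite mulr_ge0// ltW.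
  have a0 : 0 <= K.+1%:R * (2 * kap) by rewrite mulr_ge0.
  have b0 : 0 <= 2 * K%:R * (2 * kap) by rewrite mulr_ge0// mulr_ge0.
  have e2 : e / 2 <= e by lra.
  split; first (apply: le_trans e2; apply: le_trans hz; rewrite ler_wpM2r ?invr_ge0// /cz).
    by move: a0 b0 wv0 we0; move: (K.+1%:R * _) (2 * K%:R * _) => u v; lra.
  rewrite /edge_step_err mulrA; apply: le_trans e2; apply: le_trans hz; rewrite ler_wpM2r ?invr_ge0// /cz.
  by rewrite lerDr !addr_ge0.
Qed.

(** A fraction eps of the half-edges is left out. The gap between what fits
    and what is expected is then of order eps D, hence lam of order K/eps
    makes the linear term beat 3 D, and delta of order D/lam^2 keeps the
    quadratic one below it. *)
Lemma walk_parameters K n0 s (eps : R) : (0 < K)%N -> (s <= K.+1)%N -> 0 < eps -> eps <= 2^-1 ->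
  exists (c1 : R) (D1 : nat), forall D : nat, (D1 <= D)%N -> exists (M : nat) (delta lam : R),
    [/\ 0 < delta, (M + n0 <= D)%N, 0 <= lam,
      3 * D%:R <= lam * (D - M - n0)%:R / K%:R - s%:R * (lam ^+ 2 * delta / 2) &
      [/\ (D - M)%:R <= eps * D%:R + n0.+1%:R, s%:R * (delta / 2) <= eps * D%:R &
          M%:R / (2 * delta) <= c1]].
Proof.
move=> K0 sK eps0 eps1; have k0 : 0 < K%:R :> R by rewrite ltr0n.
have k1 : 1 <= K%:R :> R by rewrite ler1n.
pose lam : R := 6 * K%:R / eps.
have lam0 : 0 < lam by rewrite divr_gt0// mulr_gt0.
pose c : R := 6 / (K.+1%:R * lam ^+ 2).
have c0 : 0 < c by rewrite divr_gt0// mulr_gt0// exprn_gt0.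
exists (2 * c)^-1, (n0.+1 * 2)%N => D D1D.
have D0 : 0 < D%:R :> R by rewrite ltr0n; apply: leq_trans D1D; rewrite muln_gt0.
pose L := (Num.truncn (eps * D%:R)).+1.
have L1 : eps * D%:R <= L%:R by apply/ltW/truncnS_gt.
have L2 : L%:R <= eps * D%:R + 1.
  by rewrite /L -natr1 lerD2r Num.Theory.truncn_le// mulr_ge0 ?(ltW eps0)// ltW.
have fit : (n0 + L <= D)%N.
  rewrite -(ler_nat R) natrD; have : (n0.+1 * 2)%:R <= D%:R :> R by rewrite ler_nat.
  rewrite natrM -natr1; have : eps * D%:R <= 2^-1 * D%:R by rewrite ler_wpM2r// ltW.
  by move: L2; lra.
have [n1 n2 n3] : [/\ (D - n0 - L + n0 <= D)%N, (D - (D - n0 - L))%N = (n0 + L)%N & (D - n0 - L <= D)%N].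
  by move: fit; clear; move: L => L fit; split; lia.
have n4 : (D - (D - n0 - L) - n0)%N = L by rewrite n2 addKn.
clearbody L.
have cs : s%:R * (lam ^+ 2 * (c * D%:R) / 2) <= 3 * D%:R.
  apply: (@le_trans _ _ (K.+1%:R * (lam ^+ 2 * (c * D%:R) / 2))).
    rewrite ler_wpM2r ?ler_nat// divr_ge0// mulr_ge0 ?exprn_ge0 ?(ltW lam0)//.
    by rewrite mulr_ge0 ?(ltW c0) ?(ltW D0).
  rewrite le_eqVlt; apply/orP; left; apply/eqP; rewrite /c; move: lam lam0 {c c0} => l l0.
  by field; rewrite ?pnatr_eq0 ?gt_eqF.
clearbody c.
exists (D - n0 - L)%N, (c * D%:R), lam; split => //.
- by rewrite mulr_gt0.
- exact: ltW.
- rewrite n4; apply: (@le_trans _ _ (6 * D%:R - 3 * D%:R)); first by lra.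
  apply: lerB => //; apply: (@le_trans _ _ (lam * (eps * D%:R) / K%:R)); last first.
    by rewrite ler_wpM2r ?invr_ge0 ?(ltW k0)// ler_wpM2l// ltW.
  rewrite le_eqVlt; apply/orP; left; apply/eqP; rewrite /lam.
  by field; rewrite ?gt_eqF.
split.
- by rewrite n2 natrD -natr1; move: L2; move: (eps * _) => u; lra.
- apply: (@le_trans _ _ (3 * D%:R / lam ^+ 2)).
    rewrite ler_pdivlMr ?exprn_gt0//; apply: le_trans cs; rewrite le_eqVlt; apply/orP; left.
    by apply/eqP; ring.
  rewrite ler_pdivrMr ?exprn_gt0// /lam mulrAC ler_wpM2r ?(ltW D0)//.
  have -> : eps * (6 * K%:R / eps) ^+ 2 = 36 * K%:R ^+ 2 / eps.
    by field; rewrite ?gt_eqF.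
  rewrite ler_pdivlMr//; have : 1 <= K%:R ^+ 2 :> R by rewrite exprn_ege1.
  by move: (K%:R ^+ 2 : R) => x; lra.
- rewrite ler_pdivrMr ?mulr_gt0//.
  have -> : (2 * c)^-1 * (2 * (c * D%:R)) = D%:R by field; rewrite ?gt_eqF.
  by rewrite ler_nat.
Qed.

End rounding_parameters.

Section degree_averages.
Context (R : realType).
Variables (N : nat) (deg : 'I_N -> nat) (w : nat -> R) (a dbar : R).
Hypotheses (N_gt0 : (0 < N)%N) (w_ge0 : forall k, 0 <= w k).
Hypothesis deg_close : forall n, \sum_(k < n) k%:R * `|degree_freq R deg k - w k| <= a.
Hypotheses (dbar_ge : forall n, \sum_(k < n) k%:R * w k <= dbar)
  (dbar_lim : forall eps, 0 < eps -> exists n0, forall n, (n0 <= n)%N ->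
     dbar - eps <= \sum_(k < n) k%:R * w k).

Lemma degree_avg (F : nat -> R) n : (total_degree deg < n)%N ->
  N%:R^-1 * \sum_i F (deg i) = \sum_(k < n) degree_freq R deg k * F k.
Proof.
move=> Dn; under [RHS]eq_bigr do rewrite /degree_freq -mulrA mulr_suml.
rewrite -mulr_sumr exchange_big /=; congr (_ * _); apply: eq_bigr => i _.
have di : (deg i < n)%N.
  by apply: leq_ltn_trans Dn; rewrite /total_degree (bigD1 i)//= leq_addr.
rewrite (bigD1 (Ordinal di))//= eqxx mul1r big1 ?addr0// => k ki.
rewrite (_ : deg i == k = false) ?mul0r//; apply/negbTE; apply: contra ki => /eqP dk.
by apply/eqP/val_inj; rewrite /= dk.
Qed.

Lemma degree_mean_close : `|(total_degree deg)%:R / N%:R - dbar| <= a.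
Proof.
apply/ler_addgt0Pr => eps eps0; have [n0 hn0] := dbar_lim eps0.
pose n := maxn n0 (total_degree deg).+1.
have Dn : (total_degree deg < n)%N by rewrite leq_max ltnSn orbT.
have E : (total_degree deg)%:R / N%:R = \sum_(k < n) degree_freq R deg k * k%:R.
  by rewrite -(degree_avg (fun k => k%:R) Dn) mulrC natr_sum.
have h1 : dbar - eps <= \sum_(k < n) k%:R * w k by apply: hn0; rewrite leq_maxl.
have h2 := dbar_ge n.
have h3 : `|(total_degree deg)%:R / N%:R - \sum_(k < n) k%:R * w k| <= a.
  apply: le_trans (deg_close n); rewrite E -sumrB; apply: (le_trans (ler_norm_sum _ _ _)).
  by apply: ler_sum => k _; rewrite mulrC -mulrBr normrM ger0_norm.
move: h3; rewrite !ler_norml => /andP[u v]; move: u v h1 h2.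
by move: (_ / _) (\sum_(k < n) k%:R * w k) => x y; lra.
Qed.

(** The degrees up to k0 are compared one by one, the others contribute at
    most kap times their mean. *)
Lemma degree_avg_le (W : nat -> R) kap k0 : (forall k, `|W k| <= k%:R * kap) -> 0 <= kap ->
  N%:R^-1 * \sum_i W (deg i) <= \sum_(k < k0.+1) w k * W k +
    kap * (a + (dbar - \sum_(k < k0.+1) k%:R * w k)).
Proof.
move=> Wk kap0; pose n := (k0.+1 + (total_degree deg).+1)%N.
have Dn : (total_degree deg < n)%N by rewrite leq_addl.
rewrite (degree_avg W Dn).
have s1 : \sum_(k < n) degree_freq R deg k * W k <= \sum_(k < n) w k * W k + kap * a.
  rewrite -lerBlDl -sumrB; apply: (@le_trans _ _ (kap * \sum_(k < n) k%:R * `|degree_freq R deg k - w k|)).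
    rewrite mulr_sumr; apply: ler_sum => k _; rewrite -mulrBl.
    apply: (le_trans (ler_norm _)); rewrite normrM mulrC mulrA.
    by rewrite ler_wpM2r// mulrC.
  by rewrite ler_wpM2l.
have split_n (F : nat -> R) : \sum_(k < n) F k = \sum_(k < k0.+1) F k +
    \sum_(k < (total_degree deg).+1) F (k0.+1 + k)%N.
  by rewrite big_split_ord.
have s2 : \sum_(k < n) w k * W k <= \sum_(k < k0.+1) w k * W k +
    kap * (dbar - \sum_(k < k0.+1) k%:R * w k).
  rewrite (split_n (fun k => w k * W k)) lerD2l.
  apply: (@le_trans _ _ (kap * \sum_(k < (total_degree deg).+1) (k0.+1 + k)%N%:R * w (k0.+1 + k)%N)).
    rewrite mulr_sumr; apply: ler_sum => k _; rewrite mulrA [leRHS]mulrC ler_wpM2l//.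
    by apply: (le_trans (ler_norm _)); rewrite mulrC.
  rewrite ler_wpM2l// lerBrDl.
  by rewrite -(split_n (fun k => k%:R * w k)).
by rewrite mulrDr; move: s1 s2; move: (kap * a) (kap * (_ - _)) => x y; lra.
Qed.

End degree_averages.

(** * Counts of edges *)

Section edge_counts.
Context (R : realType).
Variables (PP : set nat) (PP_gt0 : forall p, PP p -> (0 < p)%N).
Variables (N : nat) (deg : 'I_N -> nat) (E : nat -> nat).
Hypotheses (E_dom : forall p, ~ PP p -> E p = 0%N)
  (edge_count : (\sum_(p < (total_degree deg).+1) p * E p)%N = total_degree deg)
  (E_large : forall p, (total_degree deg < p)%N -> E p = 0%N)
  (D_gt0 : (0 < total_degree deg)%N).
Notation D := (total_degree deg).
Variables (v : nat -> R) (nb a : R).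
Hypotheses (v_ge0 : forall p, 0 <= v p) (nb_ge1 : 1 <= nb)
  (v_le1 : forall n, \sum_(p < n | (p : nat) \in PP) v p <= 1)
  (nb_ge : forall n, \sum_(p < n | (p : nat) \in PP) p%:R * v p <= nb)
  (nb_lim : forall eps, 0 < eps -> exists n0, forall n, (n0 <= n)%N ->
     nb - eps <= \sum_(p < n | (p : nat) \in PP) p%:R * v p)
  (E_close : forall n, \sum_(p < n | (p : nat) \in PP) p%:R * `|edge_freq R PP E p - v p| <= a).

Let edge_total : R := \sum_(p < D.+1) (E p)%:R.

Lemma edge_freqE p : edge_freq R PP E p = (E p)%:R / edge_total.
Proof.
rewrite /edge_freq; congr (_ / _); rewrite (@finite_series R (fun p => (E p)%:R) _ D.+1) /=.
  rewrite /edge_total big_mkcond; apply: eq_bigr => q _; case: ifPn => // /negP qPP.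
  by rewrite E_dom// => /mem_set.
by move=> q Dq; rewrite E_large.
Qed.

Lemma sum_pE : \sum_(p < D.+1) p%:R * (E p)%:R = D%:R :> R.
Proof. by rewrite -[in RHS]edge_count natr_sum; apply: eq_bigr => p _; rewrite natrM. Qed.

Lemma no_edge_size0 : E 0%N = 0%N.
Proof. by apply: E_dom => /PP_gt0. Qed.

Lemma edge_total_le : edge_total <= D%:R.
Proof.
rewrite -sum_pE; apply: ler_sum => -[[|p] pD] _ /=; first by rewrite no_edge_size0 mulr0.
by rewrite -[leLHS]mul1r ler_wpM2r// ler1n.
Qed.

Lemma edge_total_gt0 : 0 < edge_total.
Proof.
rewrite lt_neqAle sumr_ge0// andbT; apply/eqP => /esym/psumr_eq0P e0.
have : D%:R = 0 :> R.
  by rewrite -sum_pE big1// => p _; rewrite e0 ?mulr0.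
by move/eqP; rewrite pnatr_eq0 -leqn0 leqNgt D_gt0.
Qed.

Lemma mean_size_close : `|D%:R / edge_total - nb| <= a.
Proof.
apply/ler_addgt0Pr => eps eps0; have [n0 hn0] := nb_lim eps0.
pose n := maxn n0 D.+1.
have h1 : nb - eps <= \sum_(p < n | (p : nat) \in PP) p%:R * v p by apply: hn0; rewrite leq_maxl.
have h2 := nb_ge n.
have Dn : (D.+1 <= n)%N by rewrite leq_maxr.
have sE : D%:R / edge_total = \sum_(p < n | (p : nat) \in PP) p%:R * edge_freq R PP E p.
  rewrite -sum_pE mulr_suml (big_ord_widen n (fun p => p%:R * (E p)%:R / edge_total) Dn).
  rewrite big_mkcond [RHS]big_mkcond; apply: eq_bigr => p _; rewrite edge_freqE mulrA.
  case: ltnP => pD; case: ifPn => // pPP.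
    by rewrite E_dom ?mulr0 ?mul0r// => /mem_set; apply/negP.
  by rewrite E_large ?mulr0 ?mul0r.
have h3 : `|D%:R / edge_total - \sum_(p < n | (p : nat) \in PP) p%:R * v p| <= a.
  apply: le_trans (E_close n); rewrite sE -sumrB; apply: (le_trans (ler_norm_sum _ _ _)).
  by apply: ler_sum => k _; rewrite -mulrBr normrM ger0_norm.
move: h3; rewrite !ler_norml => /andP[s t]; move: s t h1 h2.
by move: (_ / edge_total) (\sum_(k < n | _) _) => x y; lra.
Qed.

Lemma freq_err_ge0 : 0 <= a.
Proof. by apply: le_trans (E_close 0); rewrite big_ord0. Qed.

(** The number of edges is D divided by the mean size, which is close to its
    limit nb; the counts then follow from the frequencies. *)
Lemma edge_count_close n :
  \sum_(p < n | (p : nat) \in PP) `|D%:R * (v p / nb) - (E p)%:R| <= 2 * D%:R * a.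
Proof.
have a0 := freq_err_ge0; have e0 := edge_total_gt0; have nb0 : 0 < nb by apply: lt_le_trans nb_ge1.
have step (p : nat) : p \in PP -> `|D%:R * (v p / nb) - (E p)%:R| <=
    edge_total * (a * v p + p%:R * `|edge_freq R PP E p - v p|).
  move=> /set_mem PPp.
  have -> : D%:R * (v p / nb) - (E p)%:R =
     edge_total * ((D%:R / edge_total - nb) * v p / nb + (v p - edge_freq R PP E p)).
    by rewrite edge_freqE; field; rewrite ?gt_eqF.
  rewrite normrM (gtr0_norm e0) ler_wpM2l ?(ltW e0)//.
  apply: (le_trans (ler_normD _ _)); apply: lerD.
    rewrite !normrM (ger0_norm (v_ge0 p)) normfV (gtr0_norm nb0) ler_pdivrMr//.
    rewrite -[leLHS]mulr1 ler_pM ?mulr_ge0//.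
    by rewrite ler_wpM2r// mean_size_close.
  rewrite distrC -[leLHS]mul1r ler_wpM2r// ler1n; exact: PP_gt0.
apply: (@le_trans _ _ (\sum_(p < n | (p : nat) \in PP)
    edge_total * (a * v p + p%:R * `|edge_freq R PP E p - v p|))).
  by apply: ler_sum => p; exact: step.
rewrite -mulr_sumr big_split /= -mulr_sumr.
apply: (@le_trans _ _ (edge_total * (a * 1 + a))).
  by apply: ler_wpM2l; [exact: ltW|apply: lerD; [apply: ler_wpM2l; [exact: a0|exact: v_le1]|exact: E_close]].
have -> : edge_total * (a * 1 + a) = 2 * edge_total * a by ring.
by rewrite ler_wpM2r// ler_wpM2l// edge_total_le.
Qed.

Lemma large_edges K : (0 < K)%N ->
  (\sum_(p < D.+1) (K < p)%N * E p)%N%:R <= D%:R / K%:R :> R.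
Proof.
move=> K0; rewrite ler_pdivlMr ?ltr0n// -natrM ler_nat -[leqRHS]edge_count big_distrl /=.
apply: leq_sum => p _; case: ltnP => Kp; last by rewrite mul0n.
by rewrite mul1n mulnC leq_mul// ltnW.
Qed.

(** The sizes above K are rare because each of their edges uses more than K
    half-edges. *)
Lemma count_err_le K M : (0 < K)%N -> (M <= D)%N ->
  count_err (edge_sizes deg E) (edge_types PP K) (fun p => v p / nb) M <=
  (D - M)%:R + 2 * D%:R * a + D%:R / K%:R.
Proof.
move=> K0 MD; rewrite /count_err; apply: lerD.
  have cp p : p \in edge_types PP K -> (count_mem p (edge_sizes deg E)) = E p.
    move=> /mem_edge_types[PPp pK]; rewrite count_edge_sizes.
    have [pD|Dp] := ltnP p D.+1; last first.
      rewrite E_large// big1// => q _; rewrite /=; have [qp|] := eqVneq (q : nat) p; last by rewrite mul0n.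
      by have := ltn_ord q; rewrite qp ltnNge Dp.
    rewrite (bigD1 (Ordinal pD))//= eqxx mul1n big1 ?addn0// => q qp.
    rewrite /=; have [qp'|] := eqVneq (q : nat) p; last by rewrite mul0n.
    by move/eqP: qp; case; exact: val_inj.
  have nb0 : 0 < nb by apply: lt_le_trans nb_ge1.
  apply: (@le_trans _ _ (\sum_(p <- edge_types PP K)
     ((D - M)%:R * v p + `|D%:R * (v p / nb) - (E p)%:R|))).
    rewrite big_seq [leRHS]big_seq; apply: ler_sum => p pts; rewrite cp//.
    have -> : M%:R * (v p / nb) - (E p)%:R = - ((D - M)%:R * (v p / nb)) +
        (D%:R * (v p / nb) - (E p)%:R) by rewrite natrB//; ring.
    apply: (le_trans (ler_normD _ _)); rewrite lerD2r normrN ger0_norm ?mulr_ge0 ?invr_ge0 ?(ltW nb0)//.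
    by rewrite ler_wpM2l// ler_pdivrMr// ler_peMr.
  have conv (F : nat -> R) : \sum_(p <- edge_types PP K) F p = \sum_(p < K.+1 | (p : nat) \in PP) F p.
    by rewrite sum_edge_types [RHS]big_mkcond.
  rewrite big_split /= -mulr_sumr; apply: lerD.
    by rewrite -[leRHS]mulr1 ler_wpM2l// conv.
  by rewrite conv edge_count_close.
apply: le_trans (large_edges K0); rewrite count_edge_sizes ler_nat; apply: leq_sum => p _.
have [pE|] := boolP ((p : nat) \in edge_types PP K).
  by rewrite /= pE.
rewrite /= => pE; rewrite pE mul1n; case: ltnP => Kp; first by rewrite mul1n.
rewrite mul0n leqn0; apply/eqP/E_dom => PPp; move/negP: pE; apply.
rewrite mem_filter mem_iota add0n ltnS Kp; apply/andP; split => //; exact/asboolP.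
Qed.

End edge_counts.

(** * Size law and vanishing errors *)

Section limiting_laws.
Context (R : realType).

(** An edge of size p uses p half-edges, so that no edge is larger than the
    total degree. *)
Lemma half_edges_finite (PP : set nat) N (deg : 'I_N -> nat) (E : nat -> nat) :
  (forall p, ~ PP p -> E p = 0%N) ->
  (\sum_(0 <= p <oo | p \in PP) ((p * E p)%N%:R : R)%:E = ((total_degree deg)%:R : R)%:E)%E ->
  (\sum_(p < (total_degree deg).+1) p * E p)%N = total_degree deg /\
  forall p, (total_degree deg < p)%N -> E p = 0%N.
Proof.
move=> E_dom half; set D := total_degree deg in half *.
have large p : (D < p)%N -> E p = 0%N.
  move=> Dp; have [PPp|nPPp] := pselect (PP p); last exact: E_dom.
  have := @partial_le_series R (fun p => (p * E p)%N%:R) (fun p => p \in PP) p.+1 (fun k => ler0n R _).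
  rewrite half lee_fin (bigD1 (Ordinal (ltnSn p)))/=; last by rewrite mem_set.
  move=> le1; have : (p * E p)%:R <= D%:R :> R by apply: le_trans le1; rewrite lerDl sumr_ge0.
  rewrite ler_nat => le2; apply/eqP; rewrite -leqn0 leqNgt; apply/negP => E0.
  by have := leq_ltn_trans le2 Dp; rewrite ltnNge leq_pmulr.
split => //; apply/eqP; rewrite -(eqr_nat R); apply/eqP.
move: half; rewrite (@finite_series R (fun p => (p * E p)%N%:R) _ D.+1); last first.
  by move=> k Dk; rewrite large// muln0.
move=> [<-]; rewrite natr_sum [RHS]big_mkcond; apply: eq_bigr => p _.
case: ifPn => // /negP pPP; rewrite E_dom ?muln0// => PPp; apply: pPP; exact: mem_set.
Qed.

Section edge_law.
Variables (PP : set nat) (PP_ge2 : forall p, PP p -> (2 <= p)%N) (nu : probability nat R).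
Hypotheses (nu_dom : nu PP = 1%E)
  (nu_first_moment : (\sum_(0 <= n <oo | n \in PP) n%:R%:E * nu [set n] < +oo)%E).

Notation v p := (fine (nu [set (p : nat)])).

Definition mean_size : R := fine (\sum_(0 <= q <oo | q \in PP) q%:R%:E * nu [set q])%E.

Lemma mean_size_series : ((\sum_(0 <= q <oo | q \in PP) q%:R%:E * nu [set q]) =
  \sum_(0 <= q <oo | q \in PP) (q%:R * v q)%:E)%E.
Proof. by apply: eq_eseriesr => q _; rewrite EFinM fine_measure. Qed.

Lemma nu_weight_ge0 p : 0 <= v p. Proof. exact: fine_ge0. Qed.

Lemma nu_series : (\sum_(0 <= q <oo | q \in PP) (v q)%:E = 1)%E.
Proof.
by rewrite -nu_dom -[RHS]nat_measure_series; apply: eq_eseriesr => q _; rewrite fine_measure.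
Qed.

Lemma mean_size_partial :
  (forall n, \sum_(p < n | (p : nat) \in PP) p%:R * v p <= mean_size) /\
  (forall eps, 0 < eps -> exists n0, forall n, (n0 <= n)%N ->
     mean_size - eps <= \sum_(p < n | (p : nat) \in PP) p%:R * v p).
Proof.
have := @fin_series R (fun q => q%:R * v q) (fun q => q \in PP).
rewrite -mean_size_series; apply => // k; exact: mulr_ge0 (ler0n _ _) (nu_weight_ge0 _).
Qed.

Lemma mean_size_EFin : (\sum_(0 <= q <oo | q \in PP) (q%:R * v q)%:E = mean_size%:E)%E.
Proof.
rewrite /mean_size mean_size_series fineK// ge0_fin_numE; first by rewrite -mean_size_series.
by apply: nneseries_ge0 => k _ _; rewrite lee_fin mulr_ge0 ?nu_weight_ge0.
Qed.

Lemma nu_partial n : \sum_(p < n | (p : nat) \in PP) v p <= 1.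
Proof. by rewrite -lee_fin -nu_series; apply: partial_le_series => k; exact: nu_weight_ge0. Qed.

Lemma mean_size_ge1 : 1 <= mean_size.
Proof.
rewrite -lee_fin -mean_size_EFin -nu_series; apply: lee_nneseries => q.
  by move=> _; rewrite lee_fin nu_weight_ge0.
move=> /set_mem /PP_ge2 q2; rewrite lee_fin ler_peMl ?nu_weight_ge0// ler1n.
exact: leq_trans q2.
Qed.

Lemma size_biased_q p : size_biased PP nu p = p%:R * (v p / mean_size).
Proof. by rewrite /size_biased mulrA. Qed.

Lemma sum_type_prob n : \sum_(p < n) type_prob PP (size_biased PP nu) p =
  (\sum_(p < n | (p : nat) \in PP) p%:R * v p) / mean_size.
Proof.
rewrite mulr_suml [RHS]big_mkcond; apply: eq_bigr => p _.
by rewrite /type_prob size_biased_q mulrA.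
Qed.

Lemma mean_size_gt0 : 0 < mean_size.
Proof. exact: lt_le_trans mean_size_ge1. Qed.

Lemma type_prob_le1 K : \sum_(p < K.+1) type_prob PP (size_biased PP nu) p <= 1.
Proof.
rewrite sum_type_prob ler_pdivrMr ?mean_size_gt0// mul1r.
by have [-> _] := mean_size_partial.
Qed.

Lemma no_type_prob_small eps : 0 < eps -> exists K0, forall K, (K0 <= K)%N ->
  no_type_prob PP (size_biased PP nu) K <= eps.
Proof.
move=> eps0; have [_ /(_ _ eps0)[K0 hK0]] := mean_size_partial; exists K0 => K K0K.
rewrite /no_type_prob sum_type_prob lerBlDl -lerBlDr.
rewrite ler_pdivlMr ?mean_size_gt0// mulrBl mul1r; apply: le_trans (hK0 K.+1 (leqW K0K)).
by rewrite lerB// ler_peMr ?mean_size_ge1// ltW.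
Qed.

(** The size-biased weights of the admissible sizes sum to 1. *)
Lemma size_law_on_types (dd : measure_display) (Omega : measurableType dd)
    (P : probability Omega R) (X : {RV P >-> nat}) :
  (forall p, PP p -> distribution P X [set p] = (size_biased PP nu p)%:E) ->
  {ae P, forall w, PP (X w)}.
Proof.
move=> lawX.
have PX : P (X @^-1` PP) = 1%E.
  rewrite -[LHS]/(distribution P X PP) -(nat_measure_series (distribution P X)).
  rewrite (@eq_eseriesr _ _ (fun p => ((mean_size^-1)%:E * (p%:R * v p)%:E)%E)); last first.
    move=> p /set_mem PPp; rewrite -[LHS]/(distribution P X [set p]) lawX//.
    by rewrite size_biased_q -EFinM; congr EFin; ring.
  rewrite nneseriesZl; last by move=> p _; rewrite lee_fin mulr_ge0 ?nu_weight_ge0.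
  by rewrite mean_size_EFin -EFinM mulVf// gt_eqF// mean_size_gt0.
have mX (A : set nat) : measurable (X @^-1` A).
  by rewrite -[_ @^-1` _]setTI; exact: measurable_funPT.
exists (X @^-1` (~` PP)); split => //.
have := probability_setC P (mX PP); rewrite [P (X @^-1` PP)]PX subee// => <-.

Qed.

End edge_law.

(** The error is taken to be 0 where the bound holds without it; elsewhere
    both sides are finite and it is their difference. *)
Lemma vanishing_error (F : nat -> \bar R) (X : \bar R) :
  (forall N, (0 < N)%N -> (F N < +oo)%E) -> (-oo < X)%E ->
  (forall eps, 0 < eps -> exists N0, forall N, (N0 <= N)%N -> (0 < N)%N ->
     (F N <= X + eps%:E)%E) ->
  exists o : nat -> R, o @ \oo --> 0 /\ forall N, (0 < N)%N -> (F N <= X + (o N)%:E)%E.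
Proof.
move=> Ffin Xfin ev.
exists (fun N => if (0 < N)%N && ~~ (F N <= X)%E then fine (F N) - fine X else 0).
have finite N : (0 < N)%N -> ~~ (F N <= X)%E -> F N = (fine (F N))%:E /\ X = (fine X)%:E.
  rewrite -ltNge => N0 XF; have FN := Ffin N N0; split; rewrite fineK// fin_real//.
    by rewrite (lt_trans Xfin XF).
  by rewrite Xfin (lt_trans XF FN).
split; last first.
  move=> N N0; rewrite N0 /=; case: ifPn => [nle|/negPn le]; last by rewrite adde0.
  have [-> ->] := finite N N0 nle; rewrite -EFinD lee_fin /=.
  by rewrite addrC subrK.
apply/cvgrPdist_le => eps eps0; have [N0 hN0] := ev eps eps0.
exists N0 => // N /= N0N; rewrite sub0r normrN; case: ifPn => [/andP[Npos nle]|_]; last by rewrite normr0 ltW.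
 have [FE XE] := finite N Npos nle.
have := hN0 N N0N Npos; move: nle; rewrite FE XE /= -EFinD !lee_fin -ltNge => lt1 le1.
by rewrite ger0_norm; lra.
Qed.

(** n is the number of vertices and D the number of half-edges; each parameter
    contributes an error of order e per vertex. *)
Lemma scaled_errors (n D M dm ce s1 s2 ed kap e B se x : R) :
  0 < n -> 0 <= D -> D <= B * n -> 0 < e -> 0 <= kap -> 0 <= M <= D -> 0 <= se <= 2 * e ->
  dm <= e * D + e * n -> ce <= dm + 2 * D * e + D * e -> s1 <= e * D -> s2 <= e * n ->
  0 <= ed <= D -> 0 <= x <= e ->
  n^-1 * (M * se + 2 * kap * dm + kap * (ce + s1 + s2) + (ed + n) * x) <=
  e * (2 * B + kap * (7 * B + 4) + (B + 1)).
Proof.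
move=> n0 D0 DB e0 k0 /andP[M0 MD] /andP[se0 se1] hdm hce hs1 hs2 /andP[ed0 edD] /andP[x0 x1].
rewrite ler_pdivrMl//.
have h1 : M * se <= B * n * (2 * e) by apply: ler_pM => //; exact: le_trans DB.
have eD : e * D <= e * (B * n) by rewrite ler_wpM2l// ltW.
have h2 : kap * dm <= kap * (e * (B * n) + e * n) by rewrite ler_wpM2l//; lra.
have h3 : kap * (ce + s1 + s2) <= kap * (5 * (e * (B * n)) + 2 * (e * n)).
  by rewrite ler_wpM2l//; lra.
have h4 : (ed + n) * x <= (B * n + n) * e.
  apply: ler_pM => //; first by rewrite addr_ge0// ltW.
  by rewrite lerD2r; apply: le_trans DB.
have -> : n * (e * (2 * B + kap * (7 * B + 4) + (B + 1))) =
  B * n * (2 * e) + 2 * (kap * (e * (B * n) + e * n)) +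
  kap * (5 * (e * (B * n)) + 2 * (e * n)) + (B * n + n) * e by ring.
have -> : 2 * kap * dm = 2 * (kap * dm) by ring.
by lra.
Qed.

End limiting_laws.

(** * The limit *)

Theorem theorem2 (R : realType) (dd : measure_display)
    (Omega : measurableType dd) (P : probability Omega R)
    (PP : set nat)
    (PP_ge2 : forall p, PP p -> (2 <= p)%N)
    (* the random functions and the copies of them *)
    (theta : forall p : nat, {RV P >-> funspace R (config p)})
    (thetac : forall p : nat, nat -> {RV P >-> funspace R (config p)})
    (thetac_law : forall p i, PP p -> same_law (thetac p i) (theta p))
    (h : {RV P >-> funspace R spin})
    (hc : nat -> {RV P >-> funspace R spin})
    (hc_law : forall i, same_law (hc i) h)
    (* (i) *)
    (f : nat -> {RV P >-> funspace R spin})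
    (fc : forall p : nat, 'I_p -> {RV P >-> funspace R spin})
    (a b : nat -> {RV P >-> measurableTypeR R})
    (fc_law : forall p (j : 'I_p), PP p -> same_law (fc p j) (f p))
    (fab_indep : forall p, PP p ->
      mutually_independent P [set: option 'I_p] (fun o =>
        if o is Some j then g_sigma_algebra_preimage (fc p j)
        else g_sigma_algebra_preimage (fun w => (a p w, b p w))))
    (theta_fact : forall p, PP p -> {ae P, forall w, forall sigma : config p,
      expR (theta p w sigma)
        = a p w * (1 + b p w * \prod_(j < p) fc p j w (sigma j)) /\
      `|b p w * \prod_(j < p) fc p j w (sigma j)| < 1})
    (b_moments : forall p n, PP p -> (1 <= n)%N ->
      (0 <= 'E_P[fun w => ((- b p w) ^+ n)%R])%E)
    (* (ii) *)
    (kappa : R) (kappa_gt0 : 0 < kappa)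
    (theta_bd : forall p, PP p ->
      {ae P, forall w, forall sigma : config p, `|theta p w sigma| <= kappa})
    (h_bd : {ae P, forall w, forall s : spin, `|h w s| <= kappa})
    (* (iii) *)
    (even_or_nonneg : forall p, PP p ->
      ~~ odd p \/ {ae P, forall w, forall s : spin, 0 <= f p w s})
    (* (iv) *)
    (deg : forall N : nat, 'I_N -> nat) (E : nat -> nat -> nat)
    (E_dom : forall N p, ~ PP p -> E N p = 0%N)
    (half_edges : forall N, (0 < N)%N ->
      (\sum_(0 <= p <oo | p \in PP) ((p * E N p)%N%:R : R)%:E
        = ((\sum_(i < N) deg N i)%N%:R : R)%:E)%E)
    (mu nu : probability nat R)
    (nu_dom : nu PP = 1%E)
    (mu_lim : (fun N => \sum_(0 <= k <oo)
        (k%:R * `|degree_freq R (deg N) k - fine (mu [set k])|)%:E)%E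
      @ \oo --> 0%E)
    (nu_lim : (fun N => \sum_(0 <= p <oo | p \in PP)
        (p%:R * `|edge_freq R PP (E N) p - fine (nu [set p])|)%:E)%E
      @ \oo --> 0%E)
    (* (v) *)
    (deg_second_moment :
      (ereal_sup [set ((N%:R^-1 * \sum_(i < N) (deg N i)%:R ^+ 2) : R)%:E
                 | N in [set N : nat | (1 <= N)%N]] < +oo)%E)
    (mu_second_moment :
      (\sum_(0 <= n <oo) (n ^ 2)%N%:R%:E * mu [set n] < +oo)%E)
    (nu_first_moment :
      (\sum_(0 <= n <oo | n \in PP) n%:R%:E * nu [set n] < +oo)%E)
    (* d, (p_i), and the random measures *)
    (m : R) (m_gt0 : 0 < m) (m_lt1 : m < 1)
    (zeta2 : L2 R)
    (dg : {RV P >-> nat}) (dg_law : has_law dg mu)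
    (pp : nat -> {RV P >-> nat})
    (pp_law : forall i p, PP p ->
      distribution P (pp i) [set p] = (size_biased PP nu p)%:E)
    (zetae : nat -> nat -> nat -> {RV P >-> L1 R})
    (zetae_law : forall p i l, PP p -> has_law (zetae p i l) zeta2)
    (zeta : nat -> {RV P >-> L1 R})
    (zeta_law : forall l, has_law (zeta l) zeta2)
    (indep : mutually_independent P (source_dom PP)
       (source_sigma theta thetac h hc dg pp zetae zeta)) :
  exists o : nat -> R,
    o @ \oo --> 0 /\
    forall N, (0 < N)%N ->
      (free_energy (deg N) (E N) thetac hc
        <= vertex_term thetac h dg pp zetae m - edge_term theta dg pp zeta m
           + (o N)%:E)%E.
Proof.
pose q p := fine (nu [set p]) / mean_size PP nu.
have nb0 := mean_size_gt0 PP_ge2 nu_dom nu_first_moment.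
have q_ge0 p : 0 <= q p by rewrite divr_ge0 ?(ltW nb0)// fine_ge0.
have rho_q p : size_biased PP nu p = p%:R * q p by exact: size_biased_q.
have rho_le1 := type_prob_le1 PP_ge2 nu_dom nu_first_moment.
have PP_gt0 p : PP p -> (0 < p)%N by move=> /PP_ge2; exact: leq_trans.
have pp_PP i : {ae P, forall w, PP (pp i w)}.
  by apply: (size_law_on_types PP_ge2 nu_dom nu_first_moment) => p; exact: pp_law.
have [dbar [dbar0 mean_dg tail_dg dbar_ge dbar_lim]] := mean_degree_tail dg_law mu_second_moment.
have halves N (N0 : (0 < N)%N) := half_edges_finite (E_dom N) (half_edges N N0).
have [nb_ge nb_lim] := mean_size_partial nu_first_moment.
pose W kX nx nz := vertex_value PP theta h zeta2 (size_biased PP nu) m kappa nx nz kX.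
have kap0 := ltW kappa_gt0.
have mu0 k : 0 <= fine (mu [set k]) by exact: fine_ge0.

(* The parameters of the rounding are still free in these two bounds of the
   limit. *)
have lower K nx nz k0 (nx0 : (0 < nx)%N) (nz0 : (0 < nz)%N) :=
  vertex_term_ge thetac_law dg_law pp_law pp_PP zetae_law indep m_gt0 kappa_gt0
    theta_bd h_bd K nx0 nz0 (tail_dg k0).
have upper K nx nz (nx0 : (0 < nx)%N) (nz0 : (0 < nz)%N) :=
  edge_term_le m_gt0 kappa_gt0 K nx0 nz0 PP_gt0 pp_law pp_PP zeta_law indep theta_bd
    dbar0 mean_dg.
apply: vanishing_error.
- move=> N N0; have [ec El] := halves N N0.
  apply: le_lt_trans (free_energy_trivial PP_ge2 thetac_law hc_law kappa_gt0 theta_bd h_bd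
    m_gt0 zeta2 indep q_ge0 rho_q rho_le1 1 1 (ltn0Sn 0) (E_dom N) ec) _.
  exact: ltry.
- have lo := lower 1%N 1%N 1%N 1%N isT isT; have up := upper 1%N 1%N 1%N isT isT.
  apply: lt_le_trans (leeB lo up); exact: ltNyr.
move=> eps eps0.
pose B := dbar + 1.
pose cst := 2 * B + kappa * (7 * B + 4) + (B + 1) + 3 * kappa + 5 * kappa + 3 + dbar * (1 + kappa).
have B0 : 0 <= B by rewrite addr_ge0.
have cst0 : 0 < cst.
  have : 0 <= kappa * (7 * B + 4) by rewrite mulr_ge0// addr_ge0// mulr_ge0.
  have : 0 <= dbar * (1 + kappa) by rewrite mulr_ge0// addr_ge0.
  by rewrite /cst; move: (kappa * _) (dbar * _) => u v; lra.
(* All the errors below are at most e, and their sum is at most cst e. *)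
pose e := Num.min (eps / cst) 2^-1.
have e0 : 0 < e by rewrite lt_min divr_gt0//= invr_gt0 ltr0n.
have e12 : e <= 2^-1 by rewrite ge_min lexx orbT.
have e_eps : cst * e <= eps.
  by rewrite mulrC -ler_pdivlMr// ge_min lexx.
have [k0 /(_ k0.+1 (leqnSn _)) hk0] := dbar_lim _ e0.
pose tau := dbar - \sum_(k < k0.+1) k%:R * fine (mu [set (k : nat)]).
have tau_e : tau <= e by rewrite /tau lerBlDr -lerBlDl.
have tau0 : 0 <= tau by rewrite subr_ge0.
have k1 : 0 < k0.+1%:R :> R by [].
have ek0 : 0 < e / k0.+1%:R by rewrite divr_gt0.
have small_k0 x : 0 <= x -> x <= e / k0.+1%:R -> k0%:R * x <= e /\ x <= e.
  move=> x0; rewrite ler_pdivlMr// => xe; split; apply: le_trans xe; rewrite mulrC.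
    by rewrite ler_wpM2l// ler_nat.
  by rewrite ler_peMl// ler1n.
have [K1 hK1] := no_type_prob_small PP_ge2 nu_dom nu_first_moment ek0.
have [K2 [K20 hK2]] := small_inv 1 e0.
pose K := maxn K1 K2.
have K0 : (0 < K)%N by rewrite leq_max K20 orbT.
have Ke : 1 / K%:R <= e by apply: hK2; rewrite leq_maxr.
have nt0 := no_type_prob_ge0 rho_le1 K.
have [nt1 nt2] := small_k0 _ nt0 (hK1 K (leq_maxl _ _)).
have [nx [nz [nx0 nz0 ve' ee' [xe' eta_e']]]] := fine_rounding m_gt0 kappa_gt0 K ek0.
have ve0 := vertex_err_ge0 m_gt0 kappa_gt0 nx nz K.
have x0 := round_step_ge0 kappa_gt0 nz.
have [ve1 ve2] := small_k0 _ ve0 ve'.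
have ek0e : e / k0.+1%:R <= e.
  by rewrite ler_pdivrMr// ler_peMr ?(ltW e0)// ler1n.
have ee := le_trans ee' ek0e; have xe := le_trans xe' ek0e.
have eta_e := le_trans eta_e' ek0e.
have eta0 := edge_step_err_ge0 kappa_gt0 nz K.
have [n1 [n10 hn1]] := small_inv (2 * kappa * (K ^ 2)%:R) e0.
pose n0 := maxn n1 K.
have n00 : (0 < n0)%N by rewrite leq_max n10.
have Kn0 : (K <= n0)%N by rewrite leq_maxr.
pose se := step_err kappa K (edge_step_err kappa nz K) n0.
have se1 : se <= 2 * e.
  have := hn1 n0 (leq_maxl _ _); rewrite /se /step_err; move: eta_e.
  by move: (edge_step_err _ _ _) (_ / n0%:R) => u v; lra.
have se0 : 0 <= se.
  by rewrite addr_ge0// divr_ge0// mulr_ge0// mulr_ge0.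
have sK : (size (edge_types PP K) <= K.+1)%N.
  by rewrite /edge_types size_filter -[leqRHS](size_iota 0) count_size.
have [c1 [D1 walk]] := walk_parameters n0 K0 sK e0 e12.
have [N1 hN1] := vanishing_series (fun N k => mulr_ge0 (ler0n R k) (normr_ge0 _)) mu_lim e0.
have [N2 hN2] := vanishing_series (fun N k => mulr_ge0 (ler0n R k) (normr_ge0 _)) nu_lim e0.
have [N3 [_ hN3]] := small_inv n0.+1%:R e0.
have [N4 [_ hN4]] := small_inv c1 e0.
have [N5 [_ hN5]] := small_inv D1%:R e0.
exists (maxn (maxn N1 N2) (maxn N3 (maxn N4 N5))) => N.
rewrite !geq_max => /andP[/andP[/hN1 mu_close /hN2 nu_close] /and3P[/hN3 n0N /hN4 c1N /hN5 D1N]] N_gt0.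
have [ec El] := halves N N_gt0.
have NR : 0 < N%:R :> R by rewrite ltr0n.
set D := total_degree (deg N).
have D0 : 0 <= D%:R :> R by [].
have rd := @degree_mean_close R N (deg N) (fun k => fine (mu [set k])) e dbar mu_close dbar_ge dbar_lim; rewrite -/D in rd.
have DB : D%:R <= B * N%:R.
  rewrite -ler_pdivrMr//; move: rd; rewrite ler_norml => /andP[_].
  by rewrite /B; lra.
pose V k := vertex_value PP theta h zeta2 (size_biased PP nu) m kappa nx nz K k.
pose C := edge_const_mean m kappa nx nz K PP theta zeta2 (size_biased PP nu).
have CE : edge_correction (edge_types PP K) q (edge_const m kappa nx nz theta zeta2) = C.
  exact: edge_correction_mean.
have Cb : `|C| <= kappa.
  rewrite -CE; apply: edge_correction_bd => //.
  - exact: edge_types_K.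
  - exact: edge_types_le1 rho_q rho_le1 K.
  - by move=> p _; exact: edge_const_bd.
have VW : N%:R^-1 * \sum_i V (deg N i) <= V 0 +
    \sum_(k < k0.+1) fine (mu [set (k : nat)]) * (V k - V 0) + kappa * (e + tau).
  have -> : N%:R^-1 * \sum_i V (deg N i) = V 0 + N%:R^-1 * \sum_i (V (deg N i) - V 0).
    rewrite sumrB mulrBr sumr_const card_ord -[V 0 *+ N]mulr_natl mulrA mulVf ?gt_eqF// mul1r.
    by rewrite addrC subrK.
  rewrite -addrA lerD2l.
  apply: (@degree_avg_le R N (deg N) (fun k => fine (mu [set k])) e dbar mu0 mu_close dbar_ge
    (fun k => V k - V 0) kappa k0) => // k.
  exact: (vertex_value0_bd theta h kappa_gt0 m_gt0 zeta2 q_ge0 rho_q rho_le1 nx nz K k).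
have edD : #|{: {p : 'I_D.+1 & 'I_(E N p)}}|%:R <= D%:R :> R.
  rewrite ler_nat; have := size_edge_sizes PP_ge2 (E_dom N) ec.
  by rewrite /edge_sizes size_map -cardE.
have free : (free_energy (deg N) (E N) thetac hc <= (N%:R^-1 * (\sum_i V (deg N i)) -
    D%:R / N%:R * C + e * (2 * B + kappa * (7 * B + 4) + (B + 1) + 3 * kappa))%:E)%E.
  (* With fewer than D1 half-edges, trivially comparing the two systems costs a
     bounded amount, which vanishes after division by N. *)
  have [DD1|D1D] := ltnP D D1.
    apply: (le_trans (free_energy_trivial PP_ge2 thetac_law hc_law kappa_gt0 theta_bd h_bd
      m_gt0 zeta2 indep q_ge0 rho_q rho_le1 nx K nz0 (E_dom N) ec)).
    rewrite lee_fin CE -/D -/V /round_err -/D.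
    have DN : D%:R / N%:R <= e.
      by apply: le_trans D1N; rewrite ler_wpM2r ?invr_ge0 ?(ltW NR)// ler_nat ltnW.
    have r1 : N%:R^-1 * ((#|{: {p : 'I_D.+1 & 'I_(E N p)}}| + N)%:R * (2 * kappa / nz%:R)) <= e * (B + 1).
      rewrite natrD ler_pdivrMl//.
      have -> : N%:R * (e * (B + 1)) = (B * N%:R + N%:R) * e by ring.
      by apply: ler_pM => //; rewrite lerD2r; apply: le_trans DB.
    have r2 : D%:R / N%:R * kappa <= e * kappa by rewrite ler_wpM2r.
    have r3 : 0 <= e * (2 * B + kappa * (7 * B + 4)).
      rewrite mulr_ge0 ?(ltW e0)// addr_ge0 ?mulr_ge0// addr_ge0// mulr_ge0//.
    move: r1 r3; rewrite ![N%:R^-1 * _]mulrC.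
    move: (#|_| + N)%:R (2 * kappa / _) => u v r1 r3.
    have -> : (\sum_i V (deg N i) + (3 * D%:R * kappa - D%:R * C) + u * v) / N%:R =
      \sum_i V (deg N i) / N%:R - D%:R / N%:R * C + 3 * (D%:R / N%:R * kappa) + u * v / N%:R.
      by rewrite -mulr_suml; ring.
    by rewrite -mulr_suml; move: (_ / _ * C) => t; lra.
  have [M [delta [lam [d0 MD lam0 gap [dm s1 s2]]]]] := walk D D1D.
  apply: (le_trans (free_energy_interpolation PP_ge2 thetac_law hc_law fc_law fab_indep theta_fact
    b_moments even_or_nonneg kappa_gt0 theta_bd h_bd m_gt0 m_lt1 zeta2 indep q_ge0 rho_q rho_le1 nx
    nz0 K0 (E_dom N) ec d0 Kn0 n00 MD lam0 gap)).
  rewrite lee_fin CE -/D -/V /round_err -/D -/se.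
  have D_gt0 : (0 < D)%N by apply: leq_trans MD; rewrite addn_gt0 n00 orbT.
  have MD' : (M <= D)%N by apply: leq_trans MD; rewrite leq_addr.
  have ce := count_err_le PP_gt0 (E_dom N) ec El D_gt0 (fun p => nu_weight_ge0 nu p)
    (mean_size_ge1 PP_ge2 nu_dom nu_first_moment) (nu_partial nu_dom) nb_ge nb_lim nu_close K0 MD'.
  rewrite -/D -/q in ce.
  have n0e : n0.+1%:R <= e * N%:R by rewrite -ler_pdivrMr.
  have c1e : c1 <= e * N%:R by rewrite -ler_pdivrMr.
  have DK : D%:R / K%:R <= D%:R * e.
    by rewrite ler_wpM2l//; move: Ke; rewrite mul1r.
  have hM : 0 <= (M%:R : R) <= D%:R by apply/andP; split; [exact: ler0n|rewrite ler_nat].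
  have hdm : (D - M)%:R <= e * D%:R + e * N%:R by apply: (le_trans dm); rewrite lerD2l.
  have hce : count_err (edge_sizes (deg N) (E N)) (edge_types PP K) q M <=
      (D - M)%:R + 2 * D%:R * e + D%:R * e by apply: (le_trans ce); rewrite lerD2l.
  have err := @scaled_errors R N%:R D%:R M%:R (D - M)%:R
    (count_err (edge_sizes (deg N) (E N)) (edge_types PP K) q M)
    ((size (edge_types PP K))%:R * (delta / 2)) (M%:R / (2 * delta))
    #|{: {p : 'I_D.+1 & 'I_(E N p)}}|%:R kappa e B se (2 * kappa / nz%:R) NR D0 DB e0 kap0 hM
    (introT andP (conj se0 se1)) hdm hce s1 (le_trans s2 c1e)
    (introT andP (conj (ler0n _ _) edD)) (introT andP (conj x0 xe)).
  have r3 : 0 <= e * (3 * kappa) by rewrite mulr_ge0 ?(ltW e0)// mulr_ge0.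
  move: err; rewrite natrD; move: (count_err _ _ _ _ + _ + _) => ce'.
  move: #|_|%:R (2 * kappa / _) => u v err.
  have -> : N%:R^-1 * (\sum_i V (deg N i) + (- (D%:R * C) + M%:R * se + 2 * kappa * (D - M)%:R +
      kappa * ce') + (u + N%:R) * v) =
     N%:R^-1 * (\sum_i V (deg N i)) - D%:R / N%:R * C +
     N%:R^-1 * (M%:R * se + 2 * kappa * (D - M)%:R + kappa * ce' + (u + N%:R) * v) by ring.
  have -> : e * (2 * B + kappa * (7 * B + 4) + (B + 1) + 3 * kappa) =
    e * (2 * B + kappa * (7 * B + 4) + (B + 1)) + e * (3 * kappa) by ring.
  rewrite lerD2l; apply: (le_trans err).
  by rewrite lerDl.
apply: (le_trans free).
apply: (@le_trans _ _ (((V 0 + \sum_(k < k0.+1) fine (mu [set (k : nat)]) * (V k - V 0)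
   - (k0%:R * vertex_err m kappa nx nz K + 2 * kappa / nz%:R +
      kappa * (k0%:R * no_type_prob PP (size_biased PP nu) K) +
      (kappa + vertex_err m kappa nx nz K) * tau))%:E -
   (dbar * (C + edge_err m kappa nx nz K + kappa * no_type_prob PP (size_biased PP nu) K))%:E +
   eps%:E)%E)); last first.
  by rewrite leeD2r// leeB//; [exact: lower|exact: upper].
rewrite -EFinB -EFinD lee_fin.
move: VW nt0 nt1 nt2 ve0 ve1 ve2 ee; set nt := no_type_prob _ _ _; set ve := vertex_err _ _ _ _ _.
set edge_e := edge_err _ _ _ _ _; set S := \sum_(k < k0.+1) _; set X := N%:R^-1 * _.
move=> VW nt0 nt1 nt2 ve0 ve1 ve2 ee.
have t1 : - (D%:R / N%:R * C) <= - (dbar * C) + e * kappa.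
  rewrite -lerBlDl -opprD -mulNr -mulrDl; apply: (le_trans (ler_norm _)).
  by rewrite normrN normrM ler_pM.
have t2 : kappa * (e + tau) <= kappa * (2 * e) by rewrite ler_wpM2l//; lra.
have t3 : kappa * (k0%:R * nt) <= kappa * e by rewrite ler_wpM2l.
have t4 : (kappa + ve) * tau <= (kappa + 1) * e.
  by apply: ler_pM => //; [rewrite addr_ge0|rewrite lerD2l; lra].
have t5 : dbar * (edge_e + kappa * nt) <= dbar * (e + kappa * e).
  by rewrite ler_wpM2l// lerD// ler_wpM2l.
move: VW t1 t2 t3 t4 t5 xe ve1 e_eps; rewrite /cst; move: (2 * kappa / _) (D%:R / _ * C) => x y.
by lra.
Qed.
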